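(* Let $M$ be a compact connected smooth manifold without boundary, let $H$ be a Tonelli Hamiltonian on $T^*M$ and let $F_1,F_2:T^*M\to\mathbb{R}$ be two $C^2$ integrals of motion of $H$. Let $\pi:T^*M\to M$ be the canonical projection. For each $c\in H^1(M;\mathbb{R})$ let $\mathcal{A}_c(H)=\pi(\mathcal{A}^*_c(H))$ and let $\hat\pi_c=\pi|_{\mathcal{A}^*_c(H)}:\mathcal{A}^*_c(H)\to\mathcal{A}_c(H)$ (a bijection). Then for each $c\in H^1(M;\mathbb{R})$ $$\{F_1,F_2\}\big(\hat\pi_c^{-1}(x)\big)=0\qquad\text{for all }x\in\overline{\mathrm{Int}\big(\mathcal{A}_c(H)\big)}.$$
   Context: $T^*M$ carries its canonical symplectic form $\omega$; $X_f$ denotes the Hamiltonian vector field of $f$ (so $df=\omega(X_f,\cdot)$), and $\{f,g\}=\omega(X_f,X_g)$. A Tonelli Hamiltonian is a $C^2$ function $H:T^*M\to\mathbb{R}$ that is strictly convex in each fiber ($\partial^2H/\partial p^2$ positive definite) and uniformly superlinear in each fiber. An integral of motion of $H$ is a function $F$ with $\{H,F\}\equiv0$. The Lagrangian associated to $H$ is $L(x,v)=\sup_{p\in T^*_xM}(\langle p,v\rangle-H(x,p))$ on $TM$. For $c\in H^1(M;\mathbb{R})$, fix a smooth closed 1-form $\eta$ with $[\eta]=c$ and set $-\alpha_H(c)=\min_\mu\int_{TM}(L(x,v)-\langle\eta(x),v\rangle)\,d\mu$, the minimum being over Borel probability measures on $TM$ invariant under the Euler–Lagrange flow of $L$. The Aubry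 set is $\mathcal{A}^*_c(H)=\bigcap_u\{(x,\eta_x+d_xu):x\in M\}\subset T^*M$, the intersection over all $u\in C^{1,1}(M)$ with $H(x,\eta_x+d_xu)\le\alpha_H(c)$ for all $x\in M$ (independent of the choice of $\eta$ in $c$). $\mathrm{Int}$ and the bar denote interior and closure in $M$. *)

(* Defs.v *)
From HB Require Import structures.
From mathcomp Require Import all_boot all_order all_algebra.
From mathcomp Require Import all_classical all_reals all_analysis.
Import Order.TTheory GRing.Theory Num.Theory.
Import numFieldNormedType.Exports.

Set Implicit Arguments.
Unset Strict Implicit.
Unset Printing Implicit Defensive.

Local Open Scope classical_set_scope.
Local Open Scope ring_scope.

(** * Calculus *)

(* Functions of class C^k on an open subset [A] of a finite-dimensional normed
   space [V]; the values of [f] outside [A] are irrelevant. *)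
Fixpoint Ck (R : realType) (V W : normedModType R) (k : nat) (A : set V)
    (f : V -> W) : Prop :=
  match k with
  | 0%N => forall x, A x -> {for x, continuous f}
  | k'.+1 => (forall x, A x -> differentiable f x) /\
             (forall v : V, Ck k' A (fun x => 'd f x v))
  end.

Definition Cinfty (R : realType) (V W : normedModType R) (A : set V)
    (f : V -> W) : Prop := forall k, Ck k A f.

Definition pairing (R : realType) (n : nat) (p v : 'rV[R]_n) : R :=
  (p *m v^T) 0 0.

Definition grad (R : realType) (n : nat) (f : 'rV[R]_n -> R) (y : 'rV[R]_n) :
    'rV[R]_n :=
  \row_k 'd f y (delta_mx 0 k).

(** * Smooth manifolds *)

(* A smooth atlas modelled on R^n (without boundary).  The chart [chart i] is
   only meaningful on [dom i], and [param i] is its inverse, only meaningful on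
   the image of [dom i].  [chart_at x] is a selected chart around [x]; it serves
   to represent (co)tangent vectors at [x] by their coordinates. *)
Record smooth_manifold (R : realType) (n : nat) (M : topologicalType) := {
  hausdorffM : hausdorff_space M;
  second_countableM : @second_countable M;
  chart_index : Type;
  dom : chart_index -> set M;
  chart : chart_index -> M -> 'rV[R]_n;
  param : chart_index -> 'rV[R]_n -> M;
  open_dom : forall i, open (dom i);
  open_cod : forall i, open (chart i @` dom i);
  chartK : forall i x, dom i x -> param i (chart i x) = x;
  chart_continuous : forall i x, dom i x -> {for x, continuous (chart i)};
  param_continuous : forall i y, (chart i @` dom i) y ->
    {for y, continuous (param i)};
  transition_smooth : forall i j,
    Cinfty (chart i @` (dom i `&` dom j)) (chart j \o param i);
  chart_at : M -> chart_index;
  dom_chart_at : forall x, dom (chart_at x) x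
}.

(* The pair [(x, v)] of [TM] (resp. [(x, p)] of [T^*M]) stands for the tangent
   vector (resp. covector) at [x] of coordinates [v] (resp. [p]) in the chart
   [chart_at S x].  As [chart_at] is not continuous in general, the topology and the C^k
   structure of the bundles are not those of the product: they are read through
   [TM_coord], [TM_param] and [TsM_param] below. *)
Definition TM (R : realType) (n : nat) (M : ptopologicalType)
  (S : smooth_manifold R n M) : Type := (M * 'rV[R]_n)%type.
Definition TsM (R : realType) (n : nat) (M : ptopologicalType)
  (S : smooth_manifold R n M) : Type := (M * 'rV[R]_n)%type.

Section Manifold.
Context {R : realType} {n : nat} {M : ptopologicalType}.
Variable S : smooth_manifold R n M.

Definition cod (i : chart_index S) : set 'rV[R]_n := chart i @` dom i.

(* Jacobian at [x] of the change of coordinates from chart [i] to chart [j].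
   It acts on row vectors: a tangent vector at [x] with coordinates [v] in the
   chart [i] has coordinates [v *m trans i j x] in the chart [j], and hence a
   covector with coordinates [p] in the chart [j] has coordinates
   [p *m (trans i j x)^T] in the chart [i]. *)
Definition trans (i j : chart_index S) (x : M) : 'M[R]_n :=
  jacobian (chart j \o param i) (chart i x).

Definition TsM_proj (z : TsM S) : M := z.1.

Definition TM_coord (i : chart_index S) (z : TM S) : 'rV[R]_n * 'rV[R]_n :=
  (chart i z.1, z.2 *m trans (chart_at S z.1) i z.1).

Definition TM_param (i : chart_index S) (y : 'rV[R]_n * 'rV[R]_n) : TM S :=
  let x := param i y.1 in (x, y.2 *m trans i (chart_at S x) x).

Definition TsM_param (i : chart_index S) (y : 'rV[R]_n * 'rV[R]_n) : TsM S :=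
  let x := param i y.1 in (x, y.2 *m (trans (chart_at S x) i x)^T).

Definition smooth_fun (f : M -> R) : Prop :=
  forall i, Cinfty (cod i) (f \o param i).

Definition C11_fun (u : M -> R) : Prop :=
  forall i, Ck 1 (cod i) (u \o param i) /\
    forall y, cod i y -> exists k : R, exists2 U : set 'rV[R]_n, nbhs y U &
      k.-lipschitz_U (grad (u \o param i)).

(* d_x u *)
Definition dfun (u : M -> R) (x : M) : 'rV[R]_n :=
  grad (u \o param (chart_at S x)) (chart (chart_at S x) x).

(** * 1-forms and the first de Rham cohomology group *)

(* [eta x] is the list of the coordinates of the covector [eta_x] in the chart
   [chart_at S x]; [form_loc eta i] is the expression of [eta] in the chart
   [i]. *)
Definition form_loc (eta : M -> 'rV[R]_n) (i : chart_index S)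
    (y : 'rV[R]_n) : 'rV[R]_n :=
  let x := param i y in eta x *m (trans i (chart_at S x) x)^T.

Definition closed_form (eta : M -> 'rV[R]_n) : Prop :=
  forall i, Cinfty (cod i) (form_loc eta i) /\
    forall y, cod i y -> forall v w : 'rV[R]_n,
      pairing ('d (form_loc eta i) y v) w = pairing ('d (form_loc eta i) y w) v.

(* The elements of H^1(M; R), as classes of smooth closed 1-forms modulo the
   differentials of smooth functions. *)
Record H1 := {
  H1_class : set (M -> 'rV[R]_n);
  H1_classP : exists2 eta0, closed_form eta0 &
    H1_class = [set eta | closed_form eta /\
      exists2 f, smooth_fun f & forall x, eta x = eta0 x + dfun f x]
}.

(** * Hamiltonians *)

Definition TsM_loc (f : TsM S -> R) (i : chart_index S) :
    'rV[R]_n * 'rV[R]_n -> R := f \o TsM_param i.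

Definition TsM_C2 (f : TsM S -> R) : Prop :=
  forall i, Ck 2 (cod i `*` setT) (TsM_loc f i).

(* The canonical symplectic form dx /\ dp, in coordinates. *)
Definition omega (a b : 'rV[R]_n * 'rV[R]_n) : R :=
  pairing b.2 a.1 - pairing a.2 b.1.

(* The Hamiltonian vector field at [z], in the coordinates of T^*M induced by
   [chart_at S z.1]: it is the vector X such that df = omega(X, .). *)
Definition hamiltonian_vf (f : TsM S -> R) (z : TsM S) : 'rV[R]_n * 'rV[R]_n :=
  let i := chart_at S z.1 in
  get [set X | forall w, 'd (TsM_loc f i) (chart i z.1, z.2) w = omega X w].

Lemma hamiltonian_vfE (f : TsM S -> R) (z : TsM S) :
  let df := 'd (TsM_loc f (chart_at S z.1)) (chart (chart_at S z.1) z.1, z.2) in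
  hamiltonian_vf f z =
    (\row_k df (0, delta_mx 0 k), - \row_k df (delta_mx 0 k, 0)).
Proof.
move=> df; rewrite /hamiltonian_vf -/df.
have pair_delta k (p : 'rV[R]_n) : pairing p (delta_mx 0 k) = p 0 k.
  by rewrite /pairing mxE (bigD1 k)//= !mxE !eqxx mulr1 big1 ?addr0// => j jk;
     rewrite !mxE (negbTE jk) mulr0.
have pairC (p v : 'rV[R]_n) : pairing p v = pairing v p.
  by rewrite /pairing !mxE; apply: eq_bigr => k _; rewrite !mxE mulrC.
have pairN (p v : 'rV[R]_n) : pairing (- p) v = - pairing p v.
  by rewrite /pairing mulNmx mxE.
have pair0 (p : 'rV[R]_n) : pairing p 0 = 0.
  by rewrite /pairing trmx0 mulmx0 mxE.
have expand w : df w = \sum_k w.1 0 k * df (delta_mx 0 k, 0) +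
    \sum_k w.2 0 k * df (0, delta_mx 0 k).
  pose a (v : 'rV[R]_n) : 'rV[R]_n * 'rV[R]_n := (v, 0).
  pose b (v : 'rV[R]_n) : 'rV[R]_n * 'rV[R]_n := (0, v).
  have Ew : w = \sum_k w.1 0 k *: a (delta_mx 0 k) +
                \sum_k w.2 0 k *: b (delta_mx 0 k).
    apply/eqP; rewrite -pair_eqE /=; apply/andP; split; apply/eqP.
      rewrite !raddf_sum /= [X in _ + X]big1 ?addr0 => [|k _]; last exact: scaler0.
      exact: row_sum_delta.
    rewrite !raddf_sum /= [X in X + _]big1 ?add0r => [|k _]; last exact: scaler0.
    exact: row_sum_delta.
  rewrite [in LHS]Ew linearD !linear_sum /=.
  by congr (_ + _); apply: eq_bigr => k _; rewrite linearZ.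
have omegaE : forall w, df w =
    omega (\row_k df (0, delta_mx 0 k), - \row_k df (delta_mx 0 k, 0)) w.
  move=> w; rewrite expand /omega /= pairN opprK addrC; congr (_ + _).
    by rewrite /pairing mxE; apply: eq_bigr => k _; rewrite !mxE.
  by rewrite pairC /pairing mxE; apply: eq_bigr => k _; rewrite !mxE.
have HX X : (forall w, df w = omega X w) ->
    X = (\row_k df (0, delta_mx 0 k), - \row_k df (delta_mx 0 k, 0)).
  case: X => X1 X2 HX; congr pair; apply/rowP => k; rewrite !mxE HX /omega /=.
    by rewrite pairC pair_delta [X in _ - X]pair0 subr0.
  by rewrite pairC pair0 sub0r opprK pair_delta.
set P := [set X | _]; have : P (get P) by apply: getPex; exists (\row_k df (0, delta_mx 0 k), - \row_k df (delta_mx 0 k, 0)); exact: omegaE.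
exact: HX.
Qed.

Definition poisson (f g : TsM S -> R) (z : TsM S) : R :=
  omega (hamiltonian_vf f z) (hamiltonian_vf g z).

Definition riemannian_metric (g : M -> 'M[R]_n) : Prop :=
  [/\ forall x, (g x)^T = g x,
      forall x v, v != 0 -> 0 < pairing (v *m g x) v &
      forall i, Cinfty (cod i) (fun y => let x := param i y in
        let J := trans i (chart_at S x) x in J *m g x *m J^T)].

(* The norm on T_x^*M dual to the norm given by [g] on T_xM. *)
Definition conorm (g : M -> 'M[R]_n) (x : M) (p : 'rV[R]_n) : R :=
  sup [set pairing p v | v in [set v | pairing (v *m g x) v <= 1]].

Definition tonelli (H : TsM S -> R) : Prop :=
  [/\ TsM_C2 H,
      (forall x (p w : 'rV[R]_n), w != 0 ->
        0 < 'D_w ('D_w (fun q => H (x, q))) p) &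
      exists2 g, riemannian_metric g &
        forall A : R, exists B : R, forall x p,
          A * conorm g x p - B <= H (x, p)].

Definition integral_of_motion (H F : TsM S -> R) : Prop :=
  forall z, poisson H F z = 0.

(** * Lagrangians and Euler-Lagrange flows *)

Definition lagrangian (H : TsM S -> R) (z : TM S) : R :=
  sup [set pairing p z.2 - H (z.1, p) | p in setT].

(* [gamma] is the lift to TM of a solution x of the Euler-Lagrange equation
   d/dt (dL/dv) (x, x') = dL/dx (x, x'), in every chart. *)
Definition EL_curve (L : TM S -> R) (gamma : R -> TM S) : Prop :=
  continuous (fun t => (gamma t).1 : M) /\
  forall i t, dom i (gamma t).1 ->
    let c s := TM_coord i (gamma s) in
    is_derive t 1 (fun s => (c s).1) (c t).2 /\
    forall e : 'rV[R]_n,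
      is_derive t 1 (fun s => 'D_(0, e) (L \o TM_param i) (c s))
        ('D_(e, 0) (L \o TM_param i) (c t)).

Definition EL_flow (L : TM S -> R) (Phi : R -> TM S -> TM S) : Prop :=
  forall z, Phi 0 z = z /\ EL_curve L (Phi ^~ z).

Definition TM_open (W : set (TM S)) : Prop :=
  forall i, open [set y | cod i y.1 /\ W (TM_param i y)].

Definition borelTM := g_sigma_algebraType TM_open.

Definition EL_invariant (L : TM S -> R) (mu : probability borelTM R) : Prop :=
  exists2 Phi, EL_flow L Phi &
    forall t (B : set borelTM), measurable B -> mu (Phi t @^-1` B) = mu B.

(** * Mather's alpha function and the Aubry set *)

Definition action (L : TM S -> R) (eta : M -> 'rV[R]_n)
    (mu : probability borelTM R) : \bar R :=
  (\int[mu]_z (L z - pairing (eta z.1) z.2)%:E)%E.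

(* alpha_H([eta]): the number whose opposite is the minimum of the actions. *)
Definition mather_alpha (H : TsM S -> R) (eta : M -> 'rV[R]_n) : R :=
  let L := lagrangian H in
  get [set a : R | exists2 mu, EL_invariant L mu &
    action L eta mu = (- a)%:E /\
    forall nu, EL_invariant L nu -> (action L eta mu <= action L eta nu)%E].

Definition critical_subsolution (H : TsM S -> R) (eta : M -> 'rV[R]_n) :
    set (M -> R) :=
  [set u | C11_fun u /\ forall x, H (x, eta x + dfun u x) <= mather_alpha H eta].

(* A^*_[eta](H), a subset of T^*M *)
Definition aubry (H : TsM S -> R) (eta : M -> 'rV[R]_n) : set (TsM S) :=
  \bigcap_(u in critical_subsolution H eta)
    [set ((x, eta x + dfun u x) : TsM S) | x in [set: M]].

(* A_[eta](H), a subset of M *)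
Definition proj_aubry (H : TsM S -> R) (eta : M -> 'rV[R]_n) : set M :=
  TsM_proj @` aubry H eta.

End Manifold.

(* Main.v *)
(* Let K(x, p) = H(x, eta_x + p), let phi be its Hamiltonian flow and A_t(z) the action of the orbit
   of z over [0, t].

   Existence of a C^{1,1} critical subsolution.  Let T_t be the Lax-Oleinik operators of K, used for
   short times only.  For one constant c the functions T_(Nh) 0 + c N h are uniformly bounded; an
   infimum v of them satisfies v (pi (phi_t z)) <= v (pi z) + A_t(z) + c t.  Applying T_h and then
   the operator of the reversed Hamiltonian K(x, - p) (Bernard) turns v into a function u of class
   C^{1,1} with K(x, d_x u) <= c.

   Moreover c = alpha_H([eta]).  Integrating the inequality of u against an invariant measure bounds
   its action below by - c.  The orbits realizing T_(Nh) 0 start on the zero section, hence stay in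
   a compact set; an ultralimit of their occupation frequencies is a finitely additive content,
   whose inner regularization is an invariant probability measure of action at most - c.

   Vanishing of the bracket.  For small times the flow of an integral F maps the graph of du, with u
   a critical subsolution, to the graph of another one.  Over the interior of the projected Aubry
   set these graphs agree, so that the graph of du is invariant, and comparing the subsolutions
   shows that F is locally constant on it.  Hence F_2 is constant along the flow of F_1 there. *)
From HB Require Import structures.
Require Import Defs.
From mathcomp Require Import all_boot all_order all_algebra.
From mathcomp Require Import all_classical all_reals all_analysis.
From mathcomp Require Import measurable_realfun ring lra.
Import Order.TTheory GRing.Theory Num.Theory.
Import numFieldNormedType.Exports.

Set Implicit Arguments.
Unset Strict Implicit.

Local Open Scope classical_set_scope.
Local Open Scope ring_scope.

Section Pairing.
Context {R : realType} {n : nat}.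
Implicit Types p v w : 'rV[R]_n.

Lemma pairingE p v : pairing p v = \sum_k p 0 k * v 0 k.
Proof. by rewrite /pairing mxE; apply: eq_bigr => k _; rewrite !mxE. Qed.

Lemma pairingC p v : pairing p v = pairing v p.
Proof. by rewrite !pairingE; apply: eq_bigr => k _; rewrite mulrC. Qed.

Lemma pairingDl p q v : pairing (p + q) v = pairing p v + pairing q v.
Proof. by rewrite /pairing mulmxDl mxE. Qed.

Lemma pairingNl p v : pairing (- p) v = - pairing p v.
Proof. by rewrite /pairing mulNmx mxE. Qed.

Lemma pairingZl a p v : pairing (a *: p) v = a * pairing p v.
Proof. by rewrite /pairing -scalemxAl mxE. Qed.

Lemma pairingBl p q v : pairing (p - q) v = pairing p v - pairing q v.
Proof. by rewrite pairingDl pairingNl. Qed.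

Lemma pairing0l v : pairing 0 v = 0.
Proof. by rewrite /pairing mul0mx mxE. Qed.

Lemma pairingDr p v w : pairing p (v + w) = pairing p v + pairing p w.
Proof. by rewrite !(pairingC p) pairingDl. Qed.

Lemma pairingNr p v : pairing p (- v) = - pairing p v.
Proof. by rewrite !(pairingC p) pairingNl. Qed.

Lemma pairingZr a p v : pairing p (a *: v) = a * pairing p v.
Proof. by rewrite !(pairingC p) pairingZl. Qed.

Lemma pairingBr p v w : pairing p (v - w) = pairing p v - pairing p w.
Proof. by rewrite pairingDr pairingNr. Qed.

Lemma pairing0r p : pairing p 0 = 0.
Proof. by rewrite pairingC pairing0l. Qed.

Lemma pairing_delta p k : pairing p (delta_mx 0 k) = p 0 k.
Proof.
rewrite pairingE (bigD1 k) //= !mxE !eqxx mulr1 big1 ?addr0 // => j jk.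
by rewrite !mxE (negbTE jk) mulr0.
Qed.

Lemma pairing_mulmx p v (A : 'M[R]_n) : pairing p (v *m A) = pairing (p *m A^T) v.
Proof. by rewrite /pairing trmx_mul mulmxA. Qed.

Lemma pairing_ext p q : (forall v, pairing p v = pairing q v) -> p = q.
Proof. by move=> pq; apply/rowP => k; rewrite -!pairing_delta pq. Qed.

Lemma norm_coord v k : `|v 0 k| <= `|v|.
Proof.
by have := le_bigmax 0 (fun i : 'I_1 * 'I_n => `|v i.1 i.2|) (0, k);
  rewrite -mx_normrE.
Qed.

Lemma norm_rV_le v B : 0 <= B -> (forall k, `|v 0 k| <= B) -> `|v| <= B.
Proof.
move=> B0 vB; rewrite [leLHS]mx_normrE; apply/bigmax_leP; split=> //= -[i k] _.
by rewrite (ord1 i).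
Qed.

Lemma pairing_norm p v : `|pairing p v| <= n%:R * (`|p| * `|v|).
Proof.
rewrite pairingE (le_trans (ler_norm_sum _ _ _)) //.
have -> : n%:R * (`|p| * `|v|) = \sum_(k < n) `|p| * `|v|.
  by rewrite sumr_const card_ord mulr_natl.
apply: ler_sum => k _.
by rewrite normrM ler_pM ?norm_coord.
Qed.

Lemma sqr_norm_pairing v : `|v| ^+ 2 <= pairing v v.
Proof.
have vv : 0 <= pairing v v.
  by rewrite pairingE sumr_ge0 // => k _; rewrite -expr2 sqr_ge0.
rewrite -(sqr_sqrtr vv) ler_pXn2r ?nnegrE ?sqrtr_ge0 //.
apply: norm_rV_le; rewrite ?sqrtr_ge0 // => k.
rewrite -ler_sqr ?nnegrE ?sqrtr_ge0 // sqr_sqrtr // real_normK ?num_real //.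
rewrite pairingE (bigD1 k) //= expr2 lerDl sumr_ge0 // => j _.
by rewrite -expr2 sqr_ge0.
Qed.

Lemma pairing_ge0 v : 0 <= pairing v v.
Proof. by rewrite (le_trans _ (sqr_norm_pairing v)) ?sqr_ge0. Qed.

Lemma pairing_le_sqr v : pairing v v <= n%:R * `|v| ^+ 2.
Proof. by rewrite expr2 (le_trans (ler_norm _)) ?pairing_norm. Qed.

Lemma pairing_dual v : exists2 w : 'rV[R]_n, `|w| <= 1 & pairing w v = `|v|.
Proof.
have [->|v0] := eqVneq v 0.
  by exists 0; rewrite ?normr0 ?ler01 // pairing0r.
have [[i k] vk] : exists i, `|v| = `|v i.1 i.2|.
  by apply: mx_norm_neq0; apply: contra_neq v0 => /mx_norm_eq0.
rewrite (ord1 i) /= in vk.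
exists (Num.sg (v 0 k) *: delta_mx 0 k).
  apply: norm_rV_le => // j; rewrite !mxE /= normrM normr_sg.
  by rewrite -[leRHS]mulr1 ler_pM // ?ler0n //;
    [case: (_ != 0) | case: (j == k); rewrite ?normr1 ?normr0].
by rewrite pairingZl pairingC pairing_delta vk mulrC normrEsg mulrC.
Qed.

End Pairing.

Section CurveCalculus.
Context {R : realType}.

Lemma MVT_sym (f f' : R -> R) (t : R) :
  (forall s : R, `|s| <= `|t| -> is_derive s 1 f (f' s)) ->
  exists2 s : R, `|s| <= `|t| & f t - f 0 = f' s * t.
Proof.
move=> df; have cf s : `|s| <= `|t| -> {for s, continuous f}.
  by move=> /df [dfs _]; apply/differentiable_continuous/derivable1_diffP.
have [t0|t0|->] := ltgtP t 0.
- have [s] : exists2 s, s \in `]t, 0[ & f 0 - f t = f' s * (0 - t).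
    apply: MVT => // [s|].
      by rewrite in_itv /= => /andP[s1 s2]; apply: df; rewrite !ler0_norm; lra.
    apply: continuous_in_subspaceT => s; rewrite inE /= in_itv /= => /andP[s1 s2].
    by apply: cf; rewrite !ler0_norm; lra.
  rewrite in_itv /= => /andP[s1 s2] E.
  by exists s; [rewrite !ler0_norm; lra|move: E; lra].
- have [s] : exists2 s, s \in `]0, t[ & f t - f 0 = f' s * (t - 0).
    apply: MVT => // [s|].
      by rewrite in_itv /= => /andP[s1 s2]; apply: df; rewrite !ger0_norm; lra.
    apply: continuous_in_subspaceT => s; rewrite inE /= in_itv /= => /andP[s1 s2].
    by apply: cf; rewrite !ger0_norm; lra.
  rewrite in_itv /= => /andP[s1 s2] E.
  by exists s; [rewrite !ger0_norm; lra|move: E; lra].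
- by exists 0; rewrite ?subrr ?mulr0.
Qed.

Lemma MVT_norm (f f' : R -> R) (t B : R) :
  (forall s : R, `|s| <= `|t| -> is_derive s 1 f (f' s)) ->
  (forall s : R, `|s| <= `|t| -> `|f' s| <= B) -> `|f t - f 0| <= B * `|t|.
Proof.
move=> df fB; have [s st ->] := MVT_sym df.
by rewrite normrM ler_wpM2r ?fB.
Qed.

Context {n : nat}.
Local Notation V := 'rV[R]_n.

Lemma is_derive_rVP (x : R -> V) (t : R) (v : V) :
  is_derive t 1 x v <-> forall k, is_derive t 1 (fun s => x s 0 k) (v 0 k).
Proof.
split=> [[dx <-] k|xk].
  have dxk : derivable (fun s => x s 0 k) t 1 by move/derivable_mxP: dx.
  by split=> //; rewrite derive_mx // mxE.
have dx : derivable x t 1.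
  by apply/derivable_mxP => i k; rewrite (ord1 i); case: (xk k).
split=> //; apply/rowP => k; rewrite derive_mx // mxE.
by case: (xk k).
Qed.

Lemma is_derive_pairing (p v : R -> V) (t : R) p' v' :
  is_derive t 1 p p' -> is_derive t 1 v v' ->
  is_derive t 1 (fun s => pairing (p s) (v s)) (pairing p' (v t) + pairing (p t) v').
Proof.
move=> /is_derive_rVP dp /is_derive_rVP dv.
rewrite (_ : (fun s => _) = \sum_k (fun s => p s 0 k * v s 0 k)); last first.
  by apply/funext => s; rewrite pairingE fct_sumE.
rewrite !pairingE -big_split /=; apply: is_derive_sum => k.
have dpk := dp k; have dvk := dv k.
have := @is_deriveM _ _ (fun s => p s 0 k) (fun s => v s 0 k) t 1 _ _ dpk dvk.
by rewrite /GRing.scale /= addrC (mulrC (v t 0 k)).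
Qed.

Lemma is_derive_pairingl (p : R -> V) (t : R) p' (v : V) :
  is_derive t 1 p p' -> is_derive t 1 (fun s => pairing (p s) v) (pairing p' v).
Proof.
move=> dp; have dv : is_derive t 1 (fun=> v) (0 : V) by exact: is_derive_cst.
by have := is_derive_pairing dp dv; rewrite pairing0r addr0.
Qed.

Lemma MVT_norm_rV (x x' : R -> V) (t B : R) : 0 <= B ->
  (forall s : R, `|s| <= `|t| -> is_derive s 1 x (x' s)) ->
  (forall s : R, `|s| <= `|t| -> `|x' s| <= B) -> `|x t - x 0| <= B * `|t|.
Proof.
move=> B0 dx xB; apply: norm_rV_le => [|k]; first by rewrite mulr_ge0.
rewrite !mxE; apply: (@MVT_norm (fun s => x s 0 k) (fun s => x' s 0 k)) => s st.
  by have /is_derive_rVP := dx s st.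
by rewrite (le_trans (norm_coord _ _)) ?xB.
Qed.

Lemma is_derive_continuous (W : normedModType R) (x : R -> W) (t : R) v :
  is_derive t 1 x v -> {for t, continuous x}.
Proof. by case=> /derivable1_diffP /differentiable_continuous. Qed.

End CurveCalculus.

Section Primitives.
Context {R : realType}.
Local Notation mu := (@lebesgue_measure R).

Lemma primitive_bounded (g : R -> R) (N : R) : continuous g ->
  exists G : R -> R, forall t : R, `|t| < N -> is_derive t 1 G (g t).
Proof.
move=> cg; exists (fun x => \int[mu]_(t in [set` `[- N, x]]) (g t))%R => t.
rewrite ltr_norml => /andP[t1 t2].
have ig : mu.-integrable `[- N, N] (EFin \o g).
  apply: continuous_compact_integrable; first exact: segment_compact.
  exact: continuous_subspaceT.
have [d1 d2] := continuous_FTC1_closed t2 ig t1 (cg t).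
by split; [exact: d1|rewrite -derive1E; exact: d2].
Qed.

Lemma constant_of_derive0 (f : R -> R) (N : R) :
  (forall t : R, `|t| < N -> is_derive t 1 f 0) ->
  forall t : R, `|t| < N -> f t = f 0.
Proof.
move=> df t tN; have [s st] := @MVT_sym _ f (fun=> 0) t
  (fun s st => df s (le_lt_trans st tN)).
by rewrite mul0r => /eqP; rewrite subr_eq0 => /eqP.
Qed.

Lemma primitive (g : R -> R) : continuous g ->
  exists2 G : R -> R, G 0 = 0 & forall t : R, is_derive t 1 G (g t).
Proof.
move=> cg; have /choice[F HF] : forall N : nat, exists G : R -> R,
    forall t : R, `|t| < N%:R -> is_derive t 1 G (g t).
  by move=> N; exact: primitive_bounded.
pose b (t : R) : nat := (Num.trunc `|t|).+1.
have bP t : `|t| < (b t)%:R by rewrite truncnS_gt.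
have FE N t : `|t| < N%:R -> F N t - F N 0 = F (b t) t - F (b t) 0.
  move=> tN; pose m := Num.min N%:R (b t)%:R : R.
  have tm : `|t| < m by rewrite lt_min tN bP.
  have H0 (s : R) : `|s| < m -> is_derive s 1 (F N - F (b t)) 0.
    rewrite lt_min => /andP[s1 s2].
    have d1 := HF _ _ s1; have d2 := HF _ _ s2.
    by apply: is_derive_eq; rewrite subrr.
  by have := constant_of_derive0 H0 tm; rewrite /= !fctE; lra.
exists (fun t => F (b t) t - F (b t) 0) => [|t]; first by rewrite subrr.
have tN := bP t; have d := HF _ _ tN.
have dD : is_derive t 1 (fun s => F (b t) s - F (b t) 0) (g t).
  by apply: is_derive_eq; rewrite subr0.
apply: near_eq_is_derive dD.
near=> s; apply/FE.
near: s; have : {for t, continuous (fun s : R => `|s|)} by apply: norm_continuous.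
by move=> /cvgr_lt; apply.
Unshelve. all: by end_near. Qed.

End Primitives.

Section PairCurves.
Context {R : realType}.

Lemma is_deriveP (V W : normedModType R) (f : V -> W) (a v : V) (l : W) :
  is_derive a v f l <-> h^-1 *: (f (h *: v + a) - f a) @[h --> 0^'] --> l.
Proof.
split=> [[df <-]|fl]; first exact: df.
by split; [apply/cvg_ex; exists l | exact/cvg_lim].
Qed.

Context {n : nat}.
Local Notation V := 'rV[R]_n.

Lemma is_derive_pairP (x : R -> V * V) (t : R) (v : V * V) :
  is_derive t 1 x v <->
  is_derive t 1 (fun s => (x s).1) v.1 /\ is_derive t 1 (fun s => (x s).2) v.2.
Proof.
rewrite !is_deriveP; split=> [dx|[d1 d2]].
  by split; [apply: (cvg_comp _ _ dx cvg_fst)|apply: (cvg_comp _ _ dx cvg_snd)].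
by case: v d1 d2 => v1 v2 d1 d2; exact: (cvg_pair d1 d2).
Qed.

Lemma norm_pairE (z : V * V) : `|z| = Num.max `|z.1| `|z.2|.
Proof. by []. Qed.

Lemma norm_pair1 (z : V * V) : `|z.1| <= `|z|.
Proof. by rewrite norm_pairE le_max lexx. Qed.

Lemma norm_pair2 (z : V * V) : `|z.2| <= `|z|.
Proof. by rewrite norm_pairE le_max lexx orbT. Qed.

Lemma norm_pair_le (z : V * V) B : `|z.1| <= B -> `|z.2| <= B -> `|z| <= B.
Proof. by rewrite norm_pairE ge_max => -> ->. Qed.

Lemma MVT_norm_pair (x x' : R -> V * V) (t B : R) : 0 <= B ->
  (forall s : R, `|s| <= `|t| -> is_derive s 1 x (x' s)) ->
  (forall s : R, `|s| <= `|t| -> `|x' s| <= B) -> `|x t - x 0| <= B * `|t|.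
Proof.
move=> B0 dx xB; apply: norm_pair_le.
  apply: (@MVT_norm_rV _ _ (fun s => (x s).1) (fun s => (x' s).1)) => // s st.
    by have /is_derive_pairP[] := dx s st.
  exact: le_trans (norm_pair1 _) (xB _ st).
apply: (@MVT_norm_rV _ _ (fun s => (x s).2) (fun s => (x' s).2)) => // s st.
  by have /is_derive_pairP[] := dx s st.
exact: le_trans (norm_pair2 _) (xB _ st).
Qed.

Lemma primitive_pair (g : R -> V * V) : continuous g ->
  exists2 G : R -> V * V, G 0 = 0 & forall t : R, is_derive t 1 G (g t).
Proof.
move=> cg.
have c1 k : continuous (fun s : R => (g s).1 0 k).
  move=> s; have h := @coord_continuous R 1 n 0 k (g s).1.
  exact: (cvg_comp _ _ (cvg_comp _ _ (cg s) cvg_fst) h).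
have c2 k : continuous (fun s : R => (g s).2 0 k).
  move=> s; have h := @coord_continuous R 1 n 0 k (g s).2.
  exact: (cvg_comp _ _ (cvg_comp _ _ (cg s) cvg_snd) h).
exists (fun s => (\row_k sval (cid2 (primitive (c1 k))) s, \row_k sval (cid2 (primitive (c2 k))) s)).
  by congr pair; apply/rowP => k; rewrite !mxE; case: cid2.
move=> t; apply/is_derive_pairP; split; apply/is_derive_rVP => k /=.
  under eq_fun do rewrite mxE.
  by case: cid2.
under eq_fun do rewrite mxE.
by case: cid2.
Qed.

End PairCurves.

Section CurveShift.
Context {R : realType}.

Lemma is_derive_shiftl (W : normedModType R) (f : R -> W) (a t : R) (l : W) :
  is_derive (a + t) 1 f l -> is_derive t 1 (fun s => f (a + s)) l.
Proof.
rewrite !is_deriveP; under [X in _ -> X @ _ --> _]eq_fun do rewrite addrCA.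
by [].
Qed.

Lemma lip_continuous (V W : normedModType R) (L : R) (x : V -> W) (t : V) :
  (\forall s \near t, `|x s - x t| <= L * `|s - t|) -> {for t, continuous x}.
Proof.
move=> xL; apply/cvgrPdist_le => e e0; near=> s.
have L1 : 0 < `|L| + 1 by rewrite ltr_wpDl.
apply: (@le_trans _ _ ((`|L| + 1) * `|t - s|)).
  rewrite distrC (distrC t); apply: (@le_trans _ _ (L * `|s - t|)); first by near: s.
  by rewrite ler_wpM2r // (le_trans (ler_norm _)) // lerDl.
rewrite mulrC -ler_pdivlMr //; near: s.
by apply: cvgr_dist_le; [exact: cvg_id | rewrite divr_gt0].
Unshelve. all: by end_near. Qed.

Lemma lipT_continuous (V W : normedModType R) (L : R) (x : V -> W) :
  (forall s t, `|x s - x t| <= L * `|s - t|) -> continuous x.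
Proof. by move=> xL t; apply: (@lip_continuous _ _ L); near=> s; exact: xL.
Unshelve. all: by end_near. Qed.

End CurveShift.

Section CauchyLipschitz.
Context {R : realType} {n : nat}.
Local Notation E := ('rV[R]_n * 'rV[R]_n)%type.
Implicit Types (f : E -> E) (K h : R).

Definition clamp h (t : R) : R := Num.max (- h) (Num.min h t).

Lemma clampP h t : 0 <= h -> `|clamp h t| <= h.
Proof.
move=> h0; rewrite /clamp ler_norml.
by case: (lerP h t) => ht; [case: (lerP (- h) h)|case: (lerP (- h) t)] => ?; lra.
Qed.

Lemma clamp_id h t : `|t| <= h -> clamp h t = t.
Proof. by rewrite ler_norml /clamp => /andP[t1 t2]; rewrite min_r // max_r. Qed.

Lemma clamp_lip h s t : 0 <= h -> `|clamp h s - clamp h t| <= `|s - t|.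
Proof.
move=> h0; rewrite /clamp ler_norml.
have := ler_norm (s - t); have := lerNnormlW (lexx `|s - t|).
case: (lerP h s) => hs; case: (lerP h t) => ht.
- by case: (lerP (- h) h) => ?; lra.
- by case: (lerP (- h) h) => ?; case: (lerP (- h) t) => ?; lra.
- by case: (lerP (- h) h) => ?; case: (lerP (- h) s) => ?; lra.
- by case: (lerP (- h) t) => ?; case: (lerP (- h) s) => ?; lra.
Qed.

Lemma pair_cauchy (u : nat -> E) :
  (forall r : R, 0 < r -> exists N, forall k, (N <= k)%N -> `|u k - u N| < r) ->
  exists l : E, u @ \oo --> l.
Proof.
move=> H.
have c1 : cvg ((fun k => (u k).1) @ \oo).
  apply/cauchy_cvgP/cauchy_exP => r r0; have [N NP] := H r r0.
  exists (u N).1; exists N => // k /= Nk; rewrite -ball_normE /= distrC.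
  exact: le_lt_trans (norm_pair1 (u k - u N)) (NP k Nk).
have c2 : cvg ((fun k => (u k).2) @ \oo).
  apply/cauchy_cvgP/cauchy_exP => r r0; have [N NP] := H r r0.
  exists (u N).2; exists N => // k /= Nk; rewrite -ball_normE /= distrC.
  exact: le_lt_trans (norm_pair2 (u k - u N)) (NP k Nk).
exists (lim ((fun k => (u k).1) @ \oo), lim ((fun k => (u k).2) @ \oo)).
rewrite (_ : u = fun k => ((u k).1, (u k).2)); first exact: (cvg_pair c1 c2).
by apply/funext => k; rewrite -surjective_pairing.
Qed.

Lemma pair_lip_of_derive (y y' : R -> E) B : 0 <= B ->
  (forall t : R, is_derive t 1 y (y' t)) -> (forall t, `|y' t| <= B) ->
  forall s t, `|y s - y t| <= B * `|s - t|.
Proof.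
move=> B0 dy yB s t.
have := @MVT_norm_pair _ _ (fun u => y (t + u)) (fun u => y' (t + u)) (s - t) B B0
  (fun u _ => is_derive_shiftl (dy _)) (fun u _ => yB _).
by rewrite addr0 addrCA subrr addr0.
Qed.

Lemma ode_local f K (z : E) : 0 < K ->
  (forall z z', `|f z - f z'| <= K * `|z - z'|) ->
  exists2 x : R -> E, x 0 = z &
  forall t : R, `|t| < (2 * K)^-1 -> is_derive t 1 x (f (x t)).
Proof.
move=> K0 fK; set h := (2 * K)^-1.
have h0 : 0 < h by rewrite invr_gt0; lra.
have hK : h * K = 2^-1 by rewrite /h invfM mulfVK // gt_eqF.
pose B := `|f z|; pose L := 2 * B.
have B0 : 0 <= B by exact: normr_ge0.
pose ok (x : R -> E) := x 0 = z /\
  forall s t, `|s| <= h -> `|t| <= h -> `|x s - x t| <= L * `|s - t|.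
have okB x t : ok x -> `|f (x (clamp h t))| <= L.
  move=> [x0 xL]; have th := clampP t (ltW h0).
  rewrite -[X in `|X|](subrK (f z)) (le_trans (ler_normD _ _)) //.
  have := fK (x (clamp h t)) z; have := xL (clamp h t) 0 th.
  rewrite normr0 (ltW h0) x0 subr0 => /(_ isT) x1 f1.
  have : K * `|x (clamp h t) - z| <= K * (L * h).
    by rewrite ler_wpM2l ?(ltW K0) // (le_trans x1) // ler_wpM2l // /L; lra.
  rewrite (_ : K * (L * h) = L * (h * K)); last by ring.
  rewrite hK /L -/B; lra.
have step (x : {x : R -> E | ok x}) : exists y : {x : R -> E | ok x},
    forall t : R, is_derive t 1 (sval y) (f (sval x (clamp h t))).
  case: x => x okx /=; have [x0 xL] := okx.
  have cx : continuous (fun t => f (x (clamp h t))).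
    apply: (@lipT_continuous _ _ _ (K * L)) => s t; apply: le_trans (fK _ _) _.
    rewrite -mulrA ler_wpM2l ?(ltW K0) //.
    apply: le_trans (xL _ _ (clampP _ (ltW h0)) (clampP _ (ltW h0))) _.
    by rewrite ler_wpM2l ?clamp_lip ?(ltW h0) // /L; lra.
  have [G G0 dG] := primitive_pair cx.
  have dy (t : R) : is_derive t 1 (fun s => z + G s) (f (x (clamp h t))).
    have d2 := dG t.
    by apply: is_derive_eq; rewrite add0r.
  have oky : ok (fun s => z + G s).
    split=> [|s t _ _]; first by rewrite G0 addr0.
    apply: (pair_lip_of_derive _ dy) => [|u]; first by rewrite /L; lra.
    exact: okB.
  by exists (exist _ _ oky).
have [nxt nxtP] := choice step.
have ok0 : ok (fun=> z).
  by split=> // s t _ _; rewrite subrr normr0 mulr_ge0 // /L; lra.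
pose X k := iter k nxt (exist _ _ ok0).
have dX k (t : R) : is_derive t 1 (sval (X k.+1)) (f (sval (X k) (clamp h t))).
  exact: nxtP.
have okX k : ok (sval (X k)) by case: (X k).
pose e k := L * h * (2^-1) ^+ k.
have close k t : `|t| <= h -> `|sval (X k.+1) t - sval (X k) t| <= e k.
  elim: k t => [|k IH] t th.
    have [y0 yL] := okX 1%N; have := yL t 0 th; rewrite normr0 (ltW h0) y0 subr0.
    move=> /(_ isT) H; rewrite /e expr0 mulr1 (le_trans H) // ler_wpM2l // /L; lra.
  have H (s : R) : `|s| <= `|t| -> is_derive s 1 (sval (X k.+2) - sval (X k.+1))
      (f (sval (X k.+1) (clamp h s)) - f (sval (X k) (clamp h s))).
    by move=> _; have d1 := dX k.+1 s; have d2 := dX k s; apply: is_derive_eq.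
  have e0 : 0 <= K * e k.
    by rewrite mulr_ge0 ?(ltW K0) // /e mulr_ge0 ?exprn_ge0 // mulr_ge0 // ?(ltW h0) // /L; lra.
  have := MVT_norm_pair e0 H; rewrite /= !fctE.
  have [-> _] := okX k.+2; have [-> _] := okX k.+1; rewrite subrr subr0.
  move=> /(_ (fun s _ => le_trans (fK _ _) (ler_wpM2l (ltW K0) (IH _ (clampP s (ltW h0)))))).
  move=> /le_trans; apply; apply: (@le_trans _ _ (K * e k * h)).
    by rewrite ler_wpM2l.
  by rewrite mulrAC (mulrC K) hK /e exprS; lra.
have eP k m t : `|t| <= h -> `|sval (X (k + m)%N) t - sval (X k) t| <= 2 * e k - 2 * e (k + m)%N.
  move=> th; elim: m => [|m IH]; first by rewrite addn0 !subrr normr0.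
  rewrite addnS -(subrKA (sval (X (k + m)%N) t)) (le_trans (ler_normD _ _)) //.
  have := close (k + m)%N t th; move: IH; rewrite /e exprS; lra.
have e0 : e @ \oo --> (0 : R).
  rewrite -[0 : R](mulr0 (L * h)); apply: cvgMl_tmp; apply: cvg_expr.
  by rewrite ger0_norm // invf_lt1 // ltr1n.
have ege0 k : 0 <= e k.
  by rewrite /e mulr_ge0 ?exprn_ge0 // mulr_ge0 // ?(ltW h0) // /L; lra.
have cvgX t : exists l : E, `|t| <= h -> (fun k => sval (X k) t) @ \oo --> l.
  have [th|?] := pselect (`|t| <= h); last by exists z.
  suff [l lP] : exists l : E, (fun k => sval (X k) t) @ \oo --> l by exists l.
  apply: pair_cauchy => r r0.
  have [N _ NP] : \forall N \near \oo, 2 * e N < r.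
    near=> N; have : e N < r / 2 by near: N; apply: (cvgr_lt _ e0); rewrite divr_gt0.
    by rewrite ltr_pdivlMr // mulrC.
  exists N => k Nk; rewrite -(subnKC Nk) (le_lt_trans (eP _ _ _ th)) //.
  have := NP N (leqnn _); have := ege0 (N + (k - N))%N => /=; lra.
have [x xP] := choice cvgX.
have xX k t : `|t| <= h -> `|x t - sval (X k) t| <= 2 * e k.
  move=> th; have H : `|sval (X m) t - sval (X k) t| @[m --> \oo] --> `|x t - sval (X k) t|.
    by apply: cvg_norm; apply: cvgB; [exact: xP | exact: cvg_cst].
  apply: (cvgr_to_le H); near=> m.
  have km : (k <= m)%N by near: m; exact: nbhs_infty_ge.
  have := eP k (m - k)%N t th; rewrite subnKC // => /le_trans; apply.
  by have := ege0 m; lra.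
have okx : ok x.
  split=> [|s t sh th].
    have h00 : `|0 : R| <= h by rewrite normr0 ltW.
    apply: (cvg_unique _ (xP 0 h00)) => //; rewrite (_ : (fun k => _) = fun=> z); first exact: cvg_cst.
    by apply/funext => k; case: (okX k).
  have H : `|sval (X m) s - sval (X m) t| @[m --> \oo] --> `|x s - x t|.
    by apply: cvg_norm; apply: cvgB; exact: xP.
  apply: (cvgr_to_le H); near=> m.
  by have [_ ->] := okX m.
have [[y oky] /= dy] := step (exist _ _ okx).
have xy t : `|t| <= h -> y t = x t.
  move=> th; apply/eqP; rewrite -subr_eq0 -normr_le0; apply/ler_addgt0Pr => r r0.
  have [N _ NP] : \forall N \near \oo, 3 * e N < r.
    near=> N; have : e N < r / 3 by near: N; apply: (cvgr_lt _ e0); rewrite divr_gt0.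
    by rewrite ltr_pdivlMr // mulrC.
  have := NP N (leqnn _); rewrite /= add0r => /ltW; apply: le_trans.
  have H (s : R) : `|s| <= `|t| -> is_derive s 1 (y - sval (X N.+1))
      (f (x (clamp h s)) - f (sval (X N) (clamp h s))).
    by move=> _; have d1 := dy s; have d2 := dX N s; apply: is_derive_eq.
  have Ke : 0 <= K * (2 * e N) by rewrite mulr_ge0 ?(ltW K0) // mulr_ge0.
  have := MVT_norm_pair Ke H; rewrite /= !fctE.
  have [-> _] := okX N.+1; have [-> _] := oky; rewrite subrr subr0.
  move=> /(_ (fun s _ => le_trans (fK _ _) (ler_wpM2l (ltW K0) (xX N _ (clampP s (ltW h0)))))).
  move=> yX; rewrite -(subrKA (sval (X N.+1) t)) (le_trans (ler_normD _ _)) //.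
  have : K * (2 * e N) * `|t| <= K * (2 * e N) * h by rewrite ler_wpM2l.
  have -> : K * (2 * e N) * h = 2 * e N * (h * K) by ring.
  have eS : e N.+1 = e N / 2 by rewrite /e exprS; ring.
  have {}yX : `|y t - sval (X N.+1) t| <= K * (2 * e N) * `|t| := yX.
  by move: yX (xX N.+1 t th) (ege0 N); rewrite (distrC (x t)) eS hK; lra.
exists y => [|t th]; first by case: oky.
by have := dy t; rewrite clamp_id ?(ltW th) // xy ?(ltW th).
Unshelve. all: by end_near. Qed.

End CauchyLipschitz.

Section QuadAbsorb.
Context {R : realType}.

Lemma quad_absorb (k C : R) : 0 < k -> 0 <= C -> exists2 th0 : R, 0 < th0 & exists2 D : R, 0 < D &
  forall th d e x p : R, 0 <= th -> th <= th0 -> 0 <= d -> 0 <= e -> 0 <= x -> 0 <= p ->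
  `|p - d| <= th * (d + e) -> `|x - e| <= th * (d + e) ->
  k / 2 * d ^+ 2 - D * e ^+ 2 <=
    k * p ^+ 2 - C * (x ^+ 2 + x * p) - C * th * (d + e) ^+ 2.
Proof.
move=> k0 C0; pose A := 2 * k + 6 * C.
have A0 : 0 < A by rewrite /A; lra.
exists (k / (8 * A)); first by rewrite divr_gt0 // mulr_gt0.
exists (2 * C + 2 * C ^+ 2 / k + k / 4).
  have : 0 <= C ^+ 2 / k by rewrite divr_ge0 ?sqr_ge0 ?ltW.
  by lra.
move=> th d e x p th0 thA d0 e0 x0 p0; set E := d + e.
rewrite !ler_norml => /andP[p1 p2] /andP[x1 x2].
have th8 : th * (8 * A) <= k by rewrite -ler_pdivlMr // mulr_gt0.
have th1 : th <= 1.
  rewrite (le_trans thA) // ler_pdivrMr ?mulr_gt0 // mul1r /A; lra.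
have E0 : 0 <= E by rewrite addr_ge0.
have dE : d <= E by rewrite /E; lra.
have eE : e <= E by rewrite /E; lra.
have thE : 0 <= th * E by rewrite mulr_ge0.
have thE1 : th * E <= E by rewrite ler_piMl.
pose Q := th * E ^+ 2.
have Q0 : 0 <= Q by rewrite mulr_ge0 ?sqr_ge0.
have dQ : d * (th * E) <= Q by rewrite /Q expr2 mulrCA ler_wpM2l // ler_wpM2r.
have eQ : e * (th * E) <= Q by rewrite /Q expr2 mulrCA ler_wpM2l // ler_wpM2r.
have ttQ : (th * E) * (th * E) <= Q.
  by rewrite /Q expr2 (_ : th * (E * E) = E * (th * E)) ?ler_wpM2r //; ring.
have H1 : d ^+ 2 - 2 * Q <= p ^+ 2.
  have [pd|pd] := lerP d p.
    have : d ^+ 2 <= p ^+ 2 by rewrite ler_sqr ?nnegrE.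
    by lra.
  have : (d - p) * d <= th * E * d by rewrite ler_wpM2r //; lra.
  have : (d - p) * p <= th * E * d.
    by apply: (@le_trans _ _ (th * E * p)); rewrite ?ler_wpM2r ?ler_wpM2l //; lra.
  by nra.
have xe : x <= e + th * E by lra.
have H2 : x ^+ 2 <= 2 * e ^+ 2 + 2 * Q.
  have : x ^+ 2 <= (e + th * E) ^+ 2 by rewrite ler_sqr ?nnegrE; lra.
  have : 0 <= (e - th * E) ^+ 2 by rewrite sqr_ge0.
  by nra.
have H3 : x * p <= e * d + 3 * Q.
  have : x * p <= (e + th * E) * (d + th * E) by rewrite ler_pM //; lra.
  by nra.
have H4 : C * (e * d) <= k / 8 * d ^+ 2 + 2 * C ^+ 2 / k * e ^+ 2.
  have : 0 <= (k * d - 4 * C * e) ^+ 2 / (8 * k) by rewrite divr_ge0 ?sqr_ge0; lra.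
  suff -> : (k * d - 4 * C * e) ^+ 2 / (8 * k) =
    k / 8 * d ^+ 2 + 2 * C ^+ 2 / k * e ^+ 2 - C * (e * d) by lra.
  by field; rewrite gt_eqF.
have H5 : A * Q <= k / 4 * (d ^+ 2 + e ^+ 2).
  have : E ^+ 2 <= 2 * (d ^+ 2 + e ^+ 2).
    have : 0 <= (d - e) ^+ 2 by rewrite sqr_ge0.
    by rewrite /E; nra.
  move=> E2; have : th * (8 * A) * E ^+ 2 <= k * (2 * (d ^+ 2 + e ^+ 2)).
    have t8 : 0 <= th * (8 * A) by rewrite mulr_ge0 // mulr_ge0 // ltW.
  by apply: ler_pM => //; rewrite sqr_ge0.
  by rewrite /Q; lra.
have G1 : k * (d ^+ 2 - 2 * Q) <= k * p ^+ 2 by rewrite ler_wpM2l // ltW.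
have G2 : C * (x ^+ 2 + x * p) <= C * (2 * e ^+ 2 + 2 * Q + (e * d + 3 * Q)).
  by rewrite ler_wpM2l //; lra.
have d2 : 0 <= d ^+ 2 by rewrite sqr_ge0.
have e2 : 0 <= e ^+ 2 by rewrite sqr_ge0.
have kd : 0 <= k * d ^+ 2 by rewrite mulr_ge0 // ltW.
move: H5; rewrite /A -/Q => H5.
have -> : C * th * E ^+ 2 = C * Q by rewrite /Q mulrA.
lra.
Qed.

End QuadAbsorb.

Section Taylor.
Context {R : realType} {n : nat}.
Local Notation V := 'rV[R]_n.
Implicit Types (g : V * V -> R) (gy gq : V * V -> V) (C k : R).

(* [gy] and [gq] are the two halves of the gradient of [g]. *)
Definition grad_at g gy gq (z : V * V) : Prop :=
  differentiable g z /\
  forall w, 'd g z w = pairing (gy z) w.1 + pairing (gq z) w.2.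

Definition box (a : V) (r b : R) : set (V * V) :=
  [set z | `|z.1 - a| <= r /\ `|z.2| <= b].

Definition reg_on (A : set (V * V)) C k g gy gq : Prop :=
  [/\ forall z, A z -> grad_at g gy gq z,
      forall z z', A z -> A z' -> `|gy z' - gy z| <= C * `|z' - z|,
      forall z z', A z -> A z' -> `|gq z' - gq z| <= C * `|z' - z|,
      forall z, A z -> `|gy z| <= C /\ `|gq z| <= C &
      forall z z', A z -> A z' -> z.1 = z'.1 ->
        k * `|z'.2 - z.2| ^+ 2 <= pairing (gq z' - gq z) (z'.2 - z.2)].

Lemma box_segment a r b z w (s : R) : box a r b z -> box a r b w -> 0 <= s <= 1 ->
  box a r b (z + s *: (w - z)).
Proof.
move=> [z1 z2] [w1 w2] /andP[s0 s1]; split=> /=.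
  rewrite (_ : _ - a = (1 - s) *: (z.1 - a) + s *: (w.1 - a)).
    rewrite (le_trans (ler_normD _ _)) // !normrZ !ger0_norm ?subr_ge0 //.
    have : (1 - s) * `|z.1 - a| <= (1 - s) * r by rewrite ler_wpM2l ?subr_ge0.
    have : s * `|w.1 - a| <= s * r by rewrite ler_wpM2l.
    by lra.
  by apply/rowP => k; rewrite !mxE; ring.
rewrite (_ : _ + _ = (1 - s) *: z.2 + s *: w.2).
  rewrite (le_trans (ler_normD _ _)) // !normrZ !ger0_norm ?subr_ge0 //.
  have : (1 - s) * `|z.2| <= (1 - s) * b by rewrite ler_wpM2l ?subr_ge0.
  have : s * `|w.2| <= s * b by rewrite ler_wpM2l.
  by lra.
by apply/rowP => k; rewrite !mxE; ring.
Qed.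

Lemma is_derive_comp_grad g gy gq (c : R -> V * V) (t : R) (c' : V * V) :
  grad_at g gy gq (c t) -> is_derive t 1 c c' ->
  is_derive t 1 (g \o c) (pairing (gy (c t)) c'.1 + pairing (gq (c t)) c'.2).
Proof.
move=> [dg gE] [dc <-].
have dc' : differentiable c t by exact/derivable1_diffP.
have dgc : differentiable (g \o c) t by exact: differentiable_comp.
split; first exact/derivable1_diffP.
by rewrite deriveE // diff_comp //= gE -deriveE.
Qed.

Lemma is_derive_line (W : normedModType R) (z w : W) (t : R) :
  is_derive t 1 (fun s : R => z + s *: w) w.
Proof.
have d1 : is_derive t 1 (fun s : R => s *: w) w.
  rewrite is_deriveP; apply: cvg_near_cst; near=> h.
  rewrite -scalerBl addrK scalerA [h *: 1]mulr1 mulVf ?scale1r //.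
  by near: h; exact: nbhs_dnbhs_neq.
by apply: is_derive_eq; rewrite add0r.
Unshelve. all: by end_near. Qed.

Lemma is_derive_mulr (m t : R) : is_derive t 1 (fun s : R => s * m) m.
Proof. by have := is_derive_line (0 : R) m t; under eq_fun do rewrite add0r. Qed.

Lemma MVT01 (f f' : R -> R) :
  (forall s : R, 0 <= s <= 1 -> is_derive s 1 f (f' s)) ->
  exists2 s : R, 0 <= s <= 1 & f 1 - f 0 = f' s.
Proof.
move=> df; have [u||u] := @MVT_segment R f f' 0 1 ler01.
- by rewrite in_itv /= => /andP[s0 s1]; apply: df; rewrite !ltW.
- apply: continuous_in_subspaceT => s; rewrite inE /= in_itv /= => s01.
  by have := df s s01; exact: is_derive_continuous.
by rewrite in_itv /= => s01; rewrite subr0 mulr1 => E; exists u.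
Qed.

Lemma taylor_bound a r b C k g gy gq z z' :
  reg_on (box a r b) C k g gy gq -> box a r b z -> box a r b z' ->
  `|g z' - g z - pairing (gy z) (z'.1 - z.1) - pairing (gq z) (z'.2 - z.2)| <=
    2 * n%:R * C * `|z' - z| ^+ 2.
Proof.
move=> [gG Ly Lq Cb _] zA zA'; pose w := z' - z.
have C0 : 0 <= C by have [c1 _] := Cb z zA; exact: le_trans c1.
have seg (s : R) : 0 <= s <= 1 -> box a r b (z + s *: w) by move=> s01; exact: box_segment.
pose m := pairing (gy z) w.1 + pairing (gq z) w.2.
have [s s01] := @MVT01 (fun s => g (z + s *: w) - s * m)
  (fun s => (pairing (gy (z + s *: w)) w.1 + pairing (gq (z + s *: w)) w.2) - m)
  (fun s s01 => is_deriveB (is_derive_comp_grad (gG _ (seg s s01)) (is_derive_line z w s))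
    (is_derive_mulr m s)).
have zw1 : z + w = z' by rewrite addrC subrK.
rewrite scale1r scale0r addr0 mul1r mul0r subr0 zw1 => E.
rewrite (_ : _ - _ = g z' - m - g z); last by rewrite /m; ring.
rewrite E /m; have /andP[s0 s1] := s01.
have zw : `|z + s *: w - z| <= `|w|.
  by rewrite addrC addKr normrZ ger0_norm // ler_piMl.
have b1 : `|pairing (gy (z + s *: w) - gy z) w.1| <= n%:R * C * `|w| ^+ 2.
  rewrite (le_trans (pairing_norm _ _)) // -mulrA ler_wpM2l // expr2 mulrA.
  rewrite ler_pM ?norm_pair1 // (le_trans (Ly _ _ zA (seg s s01))) //.
  by rewrite ler_wpM2l.
have b2 : `|pairing (gq (z + s *: w) - gq z) w.2| <= n%:R * C * `|w| ^+ 2.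
  rewrite (le_trans (pairing_norm _ _)) // -mulrA ler_wpM2l // expr2 mulrA.
  rewrite ler_pM ?norm_pair2 // (le_trans (Lq _ _ zA (seg s s01))) //.
  by rewrite ler_wpM2l.
move: b1 b2; rewrite !pairingBl -/w.
set A1 := pairing _ _; set A2 := pairing _ _; set A3 := pairing _ _; set A4 := pairing _ _.
move=> b1 b2; rewrite (_ : _ - _ = (A1 - A2) + (A3 - A4)); last by ring.
by rewrite (le_trans (ler_normD _ _)) //; lra.
Qed.

Lemma convex_bound a r b C k g gy gq z z' :
  reg_on (box a r b) C k g gy gq -> box a r b z -> box a r b z' -> z.1 = z'.1 ->
  k / 2 * `|z'.2 - z.2| ^+ 2 <= g z' - g z - pairing (gq z) (z'.2 - z.2).
Proof.
move=> [gG _ _ _ kc] zA zA' zz'; pose w := z' - z.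
have w1 : w.1 = 0 by rewrite /w /= zz' subrr.
have seg (s : R) : 0 <= s <= 1 -> box a r b (z + s *: w) by move=> s01; exact: box_segment.
pose m := pairing (gq z) w.2; pose c := k / 2 * `|w.2| ^+ 2.
have dsq (s : R) : is_derive s 1 (fun s : R => s * (s * c)) (s * (2 * c)).
  have d1 := is_derive_mulr c s; have d2 : is_derive s 1 (@id R) 1 by exact: is_derive_id.
  by apply: is_derive_eq; rewrite /GRing.scale /=; ring.
have [s s01] := @MVT01 (fun s => g (z + s *: w) - s * m - s * (s * c))
  (fun s => (pairing (gy (z + s *: w)) w.1 + pairing (gq (z + s *: w)) w.2) - m - s * (2 * c))
  (fun s s01 => is_deriveB (is_deriveB
     (is_derive_comp_grad (gG _ (seg s s01)) (is_derive_line z w s))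
     (is_derive_mulr m s)) (dsq s)).
rewrite scale1r scale0r addr0 !mul1r !mul0r !subr0 w1 pairing0r add0r.
rewrite (_ : z + w = z'); last by rewrite /w addrC subrK.
rewrite -/(w.2) => E; rewrite -/m -/c.
suff : 0 <= pairing (gq (z + s *: w)) w.2 - m - s * (2 * c) by rewrite -E; lra.
have /andP[s0 s1] := s01.
have [->|sn] := eqVneq s 0; first by rewrite scale0r addr0 mul0r /m subrr subr0.
have sp : 0 < s by rewrite lt_neqAle eq_sym sn.
have e1 : z.1 = (z + s *: w).1 by rewrite -[RHS]/(z.1 + s *: w.1) w1 scaler0 addr0.
have e2 : (z + s *: w).2 - z.2 = s *: w.2.
  by rewrite -[(z + s *: w).2]/(z.2 + s *: w.2) addrC addKr.
have := kc _ _ zA (seg s s01) e1.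
rewrite e2 normrZ pairingZr pairingBl -/m ger0_norm // exprMn.
rewrite (_ : k * _ = s * (k * s * `|w.2| ^+ 2)); last by ring.
by rewrite ler_pM2l // /c; lra.
Qed.

Definition ham_field gy gq (z : V * V) : V * V := (gq z, - gy z).

Lemma ham_field_lip A C k g gy gq z z' : reg_on A C k g gy gq -> A z -> A z' ->
  `|ham_field gy gq z' - ham_field gy gq z| <= C * `|z' - z|.
Proof.
move=> [_ Ly Lq _ _] zA zA'; apply: norm_pair_le => /=; first exact: Lq.
by rewrite -opprD normrN; exact: Ly.
Qed.

Lemma flow_close A C k g gy gq (c c' : R -> V * V) (t : R) :
  0 <= C -> C * `|t| <= 2^-1 -> reg_on A C k g gy gq ->
  (forall s : R, `|s| <= `|t| -> A (c s) /\ is_derive s 1 c (ham_field gy gq (c s))) ->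
  (forall s : R, `|s| <= `|t| -> A (c' s) /\ is_derive s 1 c' (ham_field gy gq (c' s))) ->
  (forall s : R, `|s| <= `|t| -> `|c' s - c s| <= 2 * `|c' 0 - c 0|) /\
  (forall s : R, `|s| <= `|t| ->
    `|c' s - c s - (c' 0 - c 0)| <= 2 * C * `|s| * `|c' 0 - c 0|).
Proof.
move=> C0 Ct rg Hc Hc'; pose d := c' - c.
have dd (s : R) : `|s| <= `|t| ->
    is_derive s 1 d (ham_field gy gq (c' s) - ham_field gy gq (c s)).
  by move=> st; have [_ d1] := Hc s st; have [_ d2] := Hc' s st; apply: is_derive_eq.
have cd : {within `[- `|t|, `|t|], continuous (fun s => `|d s|)}.
  apply: continuous_in_subspaceT => s; rewrite inE /= in_itv /= -ler_norml => st.
  by apply: cvg_norm; apply: is_derive_continuous (dd s st).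
have [|s0] := EVT_max _ cd; first by have := normr_ge0 t; lra.
rewrite in_itv /= -ler_norml => s0t smax.
have E0 (s : R) : `|s| <= `|t| -> `|d s - d 0| <= C * `|d s0| * `|s|.
  move=> st; apply: (@MVT_norm_pair _ _ d
      (fun s => ham_field gy gq (c' s) - ham_field gy gq (c s))).
  - by rewrite mulr_ge0.
  - by move=> u us; apply: dd; exact: le_trans us st.
  - move=> u us; have ut := le_trans us st.
    have [cA _] := Hc u ut; have [cA' _] := Hc' u ut.
    apply: le_trans (ham_field_lip rg cA cA') _; rewrite ler_wpM2l //.
    by apply: smax; rewrite in_itv /= -ler_norml.
have S2 : `|d s0| <= 2 * `|d 0|.
  have := E0 s0 s0t; have := ler_normD (d s0 - d 0) (d 0); rewrite subrK.
  have : C * `|d s0| * `|s0| <= 2^-1 * `|d s0|.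
    rewrite mulrAC ler_wpM2r // (le_trans _ Ct) // ler_wpM2l //.
  lra.
split=> s st.
  by apply: le_trans S2; apply: smax; rewrite in_itv /= -ler_norml.
apply: le_trans (E0 s st) _.
have : C * `|d s0| * `|s| <= C * (2 * `|d 0|) * `|s| by rewrite ler_wpM2r // ler_wpM2l.
by rewrite /d !fctE; lra.
Qed.

Lemma flow_twist (C k : R) : 0 < k -> 0 <= C -> exists2 tau : R, 0 < tau & exists2 D : R, 0 < D &
  forall (a : V) r b g gy gq (c c' : R -> V * V) (t : R),
  reg_on (box a r b) C k g gy gq -> `|t| <= tau ->
  (forall s : R, `|s| <= `|t| -> box a r b (c s) /\ is_derive s 1 c (ham_field gy gq (c s))) ->
  (forall s : R, `|s| <= `|t| -> box a r b (c' s) /\ is_derive s 1 c' (ham_field gy gq (c' s))) ->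
  t ^+ 2 * (k / 2 * `|(c' 0).2 - (c 0).2| ^+ 2 - D * `|(c' 0).1 - (c 0).1| ^+ 2) <=
    t * pairing ((c' 0).2 - (c 0).2) ((c' t).1 - (c t).1 - ((c' 0).1 - (c 0).1)).
Proof.
move=> k0 C0; pose C' := 4 * n%:R * (C + 1).
have C'0 : 0 <= C' by rewrite /C' mulr_ge0 ?mulr_ge0 //; lra.
have [th0 th00 [D D0 absorb]] := quad_absorb k0 C'0.
pose tau := Num.min (th0 / (2 * (C + 1))) ((2 * (C + 1))^-1).
have C1 : 0 < 2 * (C + 1) by lra.
exists tau; first by rewrite lt_min divr_gt0 // invr_gt0.
exists D => // a r b g gy gq c c' t rg.
rewrite le_min => /andP[t1' t2'] Hc Hc'.
pose xi s := (c' s).1 - (c s).1; pose pi s := (c' s).2 - (c s).2.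
rewrite -/(pi 0) -/(xi 0) -/(xi t).
have t1 : `|t| * (2 * (C + 1)) <= th0 by rewrite -ler_pdivlMr.
have t2 : `|t| * (2 * (C + 1)) <= 1 by rewrite -ler_pdivlMr // mul1r.
have Ct : C * `|t| <= 2^-1 by have := normr_ge0 t; nra.
have [F1 F2] := flow_close C0 Ct rg Hc Hc'.
pose d := `|pi 0|; pose e := `|xi 0|; pose m := `|c' 0 - c 0|.
have me : m <= d + e.
  by apply: norm_pair_le => /=; rewrite -/(pi 0) -/(xi 0) -/d -/e /d /e ?lerDr ?lerDl.
have [s st E] : exists2 s : R, `|s| <= `|t| &
    pairing (pi 0) (xi t) - pairing (pi 0) (xi 0) = pairing (pi 0) (gq (c' s) - gq (c s)) * t.
  apply: (@MVT_sym _ (fun s => pairing (pi 0) (xi s))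
    (fun s => pairing (pi 0) (gq (c' s) - gq (c s)))) => s st.
  have [_ /is_derive_pairP[d1 _]] := Hc s st; have [_ /is_derive_pairP[d2 _]] := Hc' s st.
  have dx : is_derive s 1 xi (gq (c' s) - gq (c s)) by apply: is_derive_eq.
  have := is_derive_pairingl (pi 0) dx.
  by under eq_fun do rewrite pairingC; rewrite pairingC.
rewrite pairingBr E (_ : t * _ = t ^+ 2 * pairing (pi 0) (gq (c' s) - gq (c s))); last by ring.
rewrite ler_wpM2l ?sqr_ge0 //.
have [cA _] := Hc s st; have [cA' _] := Hc' s st.
pose th := 2 * (C + 1) * `|t|.
have bnd u : `|u| <= `|t| -> `|pi u - pi 0| <= th * (d + e) /\ `|xi u - xi 0| <= th * (d + e).
  move=> ut; have := F2 u ut; rewrite -/m => H.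
  have : 2 * C * `|u| * m <= th * (d + e).
    have h1 : 2 * C * `|u| <= 2 * (C + 1) * `|t|.
      by apply: ler_pM => //; [rewrite mulr_ge0|lra].
    exact: (ler_pM (mulr_ge0 (mulr_ge0 (ler0n _ 2) C0) (normr_ge0 _)) (normr_ge0 _) h1 me).
  move=> H'; split; apply: le_trans H'; apply: le_trans H.
    exact: (norm_pair2 (c' u - c u - (c' 0 - c 0))).
  exact: (norm_pair1 (c' u - c u - (c' 0 - c 0))).
have [ps xs] := bnd s st.
have := absorb th d e `|xi s| `|pi s|.
have th0' : 0 <= th by rewrite mulr_ge0 // ltW.
rewrite th0' (_ : th <= th0); last by rewrite /th mulrC.
rewrite !normr_ge0 => /(_ isT isT isT isT isT isT).
move=> /(_ (le_trans (ler_dist_dist _ _) ps) (le_trans (ler_dist_dist _ _) xs)).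
move=> /le_trans; apply.
pose w : V * V := ((c' s).1, (c s).2).
have wA : box a r b w by case: cA => [_ ?]; case: cA' => [? _].
have [_ _ Lq _ kc] := rg.
have K1 := kc w (c' s) wA cA' erefl; rewrite /= -/(pi s) in K1.
have K2 : `|gq w - gq (c s)| <= C * `|xi s|.
  apply: le_trans (Lq _ _ cA wA) _; rewrite ler_wpM2l //.
  by apply: norm_pair_le; rewrite /= ?subrr ?normr0.
have K3 : `|gq (c' s) - gq (c s)| <= C * (2 * m).
  by apply: le_trans (Lq _ _ cA cA') _; rewrite ler_wpM2l // F1.
have K4 := le_trans (pairing_norm (pi 0 - pi s) (gq (c' s) - gq (c s))) (lexx _).
have K5 := le_trans (pairing_norm (gq w - gq (c s)) (pi s)) (lexx _).
have E1 : pairing (pi 0) (gq (c' s) - gq (c s)) =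
  pairing (gq (c' s) - gq w) (pi s) + pairing (gq w - gq (c s)) (pi s)
  + pairing (pi 0 - pi s) (gq (c' s) - gq (c s)).
  move: (gq (c' s)) (gq (c s)) (gq w) (pi s) (pi 0) => G1 G2 G3 P1 P0.
  by rewrite !(pairingBr, pairingBl) !(pairingC _ P1); ring.
rewrite E1.
have n0 : 0 <= n%:R :> R by [].
have B5 : `|pairing (gq w - gq (c s)) (pi s)| <= C' * (`|xi s| * `|pi s|).
  apply: le_trans K5 _.
  have : n%:R * (`|gq w - gq (c s)| * `|pi s|) <= n%:R * (C * `|xi s| * `|pi s|).
    by rewrite ler_wpM2l // ler_wpM2r.
  move=> /le_trans; apply.
  have : 0 <= n%:R * (`|xi s| * `|pi s|) * (3 * C + 4) by rewrite !mulr_ge0 //; lra.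
  rewrite /C'; lra.
have B4 : `|pairing (pi 0 - pi s) (gq (c' s) - gq (c s))| <= C' * th * (d + e) ^+ 2.
  apply: le_trans K4 _; rewrite distrC.
  have de0 : 0 <= d + e by apply: addr_ge0; exact: normr_ge0.
  have : `|pi s - pi 0| * `|gq (c' s) - gq (c s)| <= th * (d + e) * (C * (2 * (d + e))).
    apply: ler_pM => //; apply: le_trans K3 _; rewrite ler_wpM2l //; lra.
  move=> /(ler_wpM2l n0) /le_trans; apply.
  have : 0 <= n%:R * (th * (d + e) ^+ 2) * (2 * C + 4) by rewrite !mulr_ge0 ?sqr_ge0 //; lra.
  rewrite /C'; lra.
have : 0 <= C' * `|xi s| ^+ 2 by rewrite mulr_ge0 ?sqr_ge0.
move: B5 B4; rewrite !ler_norml => /andP[B5 _] /andP[B4 _]; lra.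
Qed.

Definition ham_lagr g gq (z : V * V) : R := pairing z.2 (gq z) - g z.

(* Second variation of the action between two neighbouring orbits: the boundary terms are those
   of the generating function. *)
Lemma flow_action (C k : R) : 0 <= C -> exists2 tau : R, 0 < tau & exists2 D : R, 0 < D &
  forall (a : V) r b g gy gq (c c' : R -> V * V) (A A' : R -> R) (t : R),
  reg_on (box a r b) C k g gy gq -> `|t| <= tau ->
  (forall s : R, `|s| <= `|t| -> [/\ box a r b (c s),
     is_derive s 1 c (ham_field gy gq (c s)) & is_derive s 1 A (ham_lagr g gq (c s))]) ->
  (forall s : R, `|s| <= `|t| -> [/\ box a r b (c' s),
     is_derive s 1 c' (ham_field gy gq (c' s)) & is_derive s 1 A' (ham_lagr g gq (c' s))]) ->
  let xi s := (c' s).1 - (c s).1 in let pi s := (c' s).2 - (c s).2 in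
  let Th s := A' s - A s - pairing (c s).2 (xi s) in
  (0 < k -> t ^+ 2 * (k / 4 * `|pi 0| ^+ 2 - D * `|xi 0| ^+ 2) <= t * (Th t - Th 0)) /\
  `|Th t - Th 0| <= D * `|t| * `|c' 0 - c 0| ^+ 2.
Proof.
move=> C0; pose C' := 8 * n%:R * (C + 1).
pose k' := if 0 < k then k else 1.
have k'0 : 0 < k' by rewrite /k'; case: ifP.
have C'0 : 0 <= C' by rewrite /C' mulr_ge0 ?mulr_ge0 //; lra.
have k20 : 0 < k' / 2 by lra.
have [th0 th00 [D D0 absorb]] := quad_absorb k20 C'0.
pose tau := Num.min (th0 / (2 * (C + 1))) ((2 * (C + 1))^-1).
have C1 : 0 < 2 * (C + 1) by lra.
exists tau; first by rewrite lt_min divr_gt0 // invr_gt0.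
exists (D + 4 * C') => [|a r b g gy gq c c' A A' t rg]; first by lra.
rewrite le_min => /andP[t1' t2'] Hc Hc' xi pi Th.
have t1 : `|t| * (2 * (C + 1)) <= th0 by rewrite -ler_pdivlMr.
have t2 : `|t| * (2 * (C + 1)) <= 1 by rewrite -ler_pdivlMr // mul1r.
have Ct : C * `|t| <= 2^-1 by have := normr_ge0 t; nra.
have Hc2 s : `|s| <= `|t| -> box a r b (c s) /\ is_derive s 1 c (ham_field gy gq (c s)).
  by case/Hc.
have Hc2' s : `|s| <= `|t| -> box a r b (c' s) /\ is_derive s 1 c' (ham_field gy gq (c' s)).
  by case/Hc'.
have [F1 F2] := flow_close C0 Ct rg Hc2 Hc2'.
pose d := `|pi 0|; pose e := `|xi 0|; pose m := `|c' 0 - c 0|.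
have me : m <= d + e.
  by apply: norm_pair_le => /=; rewrite -/(pi 0) -/(xi 0) -/d -/e /d /e ?lerDr ?lerDl.
pose rem s := pairing (pi s) (gq (c' s)) - g (c' s) + g (c s) + pairing (gy (c s)) (xi s).
have [s st E] : exists2 s : R, `|s| <= `|t| & Th t - Th 0 = rem s * t.
  apply: (@MVT_sym _ Th rem) => s st.
  have [_ dc dA] := Hc s st; have [_ dc' dA'] := Hc' s st.
  have /is_derive_pairP[/= d1 d2] := dc; have /is_derive_pairP[/= d1' _] := dc'.
  have dx : is_derive s 1 xi (gq (c' s) - gq (c s)) by apply: is_derive_eq.
  have dp := is_derive_pairing d2 dx.
  rewrite /Th; apply: is_derive_eq; rewrite /ham_lagr /rem pairingNl !pairingBr.
  by rewrite /pi pairingBl /=; ring.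
have [cA _] := Hc2 s st; have [cA' _] := Hc2' s st.
have n0 : 0 <= n%:R :> R by [].
pose w : V * V := ((c' s).1, (c s).2).
have wA : box a r b w by case: cA => [_ ?]; case: cA' => [? _].
have [_ _ Lq _ _] := rg.
have T1 := taylor_bound rg cA wA.
rewrite /= -/(xi s) subrr pairing0r subr0 in T1.
have ws : `|w - c s| <= `|xi s| by apply: norm_pair_le; rewrite /= ?subrr ?normr0.
have T2 : `|g w - g (c s) - pairing (gy (c s)) (xi s)| <= 2 * n%:R * C * `|xi s| ^+ 2.
  apply: le_trans T1 _; rewrite ler_wpM2l ?mulr_ge0 //.
  by rewrite ler_sqr ?nnegrE.
have K2 : `|gq (c' s) - gq w| <= C * `|pi s|.
  apply: le_trans (Lq _ _ wA cA') _; rewrite ler_wpM2l //.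
  by apply: norm_pair_le; rewrite /= ?subrr ?normr0.
split.
- move=> k0; have Ek : k' = k by rewrite /k' k0.
  rewrite Ek in absorb; rewrite E (_ : t * (rem s * t) = t ^+ 2 * rem s); last by ring.
  rewrite ler_wpM2l ?sqr_ge0 //.
  have convw := convex_bound rg cA' wA erefl.
  rewrite /= -opprB -/(pi s) normrN pairingNr opprK in convw.
  pose th := 2 * (C + 1) * `|t|.
  have bnd u : `|u| <= `|t| -> `|pi u - pi 0| <= th * (d + e) /\ `|xi u - xi 0| <= th * (d + e).
    move=> ut; have := F2 u ut; rewrite -/m => H.
    have : 2 * C * `|u| * m <= th * (d + e).
      have h1 : 2 * C * `|u| <= 2 * (C + 1) * `|t|.
        by apply: ler_pM => //; [rewrite mulr_ge0|lra].
      exact: (ler_pM (mulr_ge0 (mulr_ge0 (ler0n _ 2) C0) (normr_ge0 _)) (normr_ge0 _) h1 me).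
    move=> H'; split; apply: le_trans H'; apply: le_trans H.
      exact: (norm_pair2 (c' u - c u - (c' 0 - c 0))).
    exact: (norm_pair1 (c' u - c u - (c' 0 - c 0))).
  have [ps xs] := bnd s st.
  have := absorb th d e `|xi s| `|pi s|.
  have th0' : 0 <= th by rewrite mulr_ge0 // ltW.
  rewrite th0' (_ : th <= th0); last by rewrite /th mulrC.
  rewrite !normr_ge0 => /(_ isT isT isT isT isT isT).
  move=> /(_ (le_trans (ler_dist_dist _ _) ps) (le_trans (ler_dist_dist _ _) xs)).
  have := mulr_ge0 (mulr_ge0 C'0 th0') (sqr_ge0 (d + e)).
  have := mulr_ge0 (mulr_ge0 C'0 (normr_ge0 (xi s))) (normr_ge0 (pi s)).
  have : 2 * n%:R * C * `|xi s| ^+ 2 <= C' * `|xi s| ^+ 2.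
    rewrite ler_wpM2r ?sqr_ge0 // /C'.
    have : 0 <= n%:R * (6 * C + 8) by rewrite mulr_ge0 //; lra.
    lra.
  have : 0 <= (D + 4 * C' - D) * e ^+ 2.
    by rewrite addrAC subrr add0r; apply: mulr_ge0; [apply: mulr_ge0|exact: sqr_ge0].
  move: T2; rewrite ler_norml /rem -/d -/e => /andP[T2 T2'] h1 h2 h3 h4 h5.
  rewrite pairingC; nra.
- rewrite E normrM mulrAC ler_wpM2r //.
  have dm : `|c' s - c s| <= 2 * m by exact: F1.
  have pm : `|pi s| <= 2 * m by apply: le_trans dm; exact: (norm_pair2 (c' s - c s)).
  have xm : `|xi s| <= 2 * m by apply: le_trans dm; exact: (norm_pair1 (c' s - c s)).
  have m0 : 0 <= m by exact: normr_ge0.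
  have T3 := taylor_bound rg cA' cA.
  have [_ Ly _ _ _] := rg.
  have xN : (c s).1 - (c' s).1 = - xi s by rewrite /xi opprB.
  have pN : (c s).2 - (c' s).2 = - pi s by rewrite /pi opprB.
  rewrite xN pN !pairingNr !opprK (distrC (c s)) in T3.
  have Q : rem s = (g (c s) - g (c' s) + pairing (gy (c' s)) (xi s) + pairing (gq (c' s)) (pi s))
      - pairing (gy (c' s) - gy (c s)) (xi s).
    by rewrite /rem pairingBl (pairingC (pi s)); ring.
  rewrite Q (le_trans (ler_normB _ _)) //.
  have T4 : `|pairing (gy (c' s) - gy (c s)) (xi s)| <= n%:R * (C * (2 * m) * (2 * m)).
    apply: le_trans (pairing_norm _ _) _; rewrite ler_wpM2l // ler_pM //.
    by apply: le_trans (Ly _ _ cA cA') _; rewrite ler_wpM2l.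
  have T5 : 2 * n%:R * C * `|c' s - c s| ^+ 2 <= 2 * n%:R * C * (4 * m ^+ 2).
    rewrite ler_wpM2l ?mulr_ge0 // (_ : 4 * m ^+ 2 = (2 * m) ^+ 2); last by ring.
    by rewrite ler_sqr ?nnegrE // mulr_ge0.
  have : 0 <= D * m ^+ 2 by rewrite mulr_ge0 ?sqr_ge0 // ltW.
  have : 0 <= n%:R * m ^+ 2 * (20 * C + 32) by rewrite !mulr_ge0 ?sqr_ge0 //; lra.
  have := le_trans T3 T5.
  rewrite -/m /C'; move: T4; lra.
Qed.

End Taylor.

Section DiffEps.
Context {R : realType} {V W : normedModType R}.
Implicit Types (f g : V -> W) (x : V).

Lemma diff_eps f x : differentiable f x -> forall e : R, 0 < e ->
  \forall h \near (0 : V), `|f (h + x) - f x - 'd f x h| <= e * `|h|.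
Proof.
move=> /diff_locallyP[_ /eqaddoP fE] e e0; apply: filterS (fE e e0) => h.
by rewrite /= opprD addrA.
Qed.

Lemma diff_intro f x (L : {linear V -> W}) : continuous L ->
  (forall e : R, 0 < e -> \forall h \near (0 : V), `|f (h + x) - f x - L h| <= e * `|h|) ->
  differentiable f x /\ 'd f x = L :> (V -> W).
Proof.
move=> cL H.
have E : f \o shift x = cst (f x) + L +o_ (0 : V) id.
  apply/eqaddoP => e e0; apply: filterS (H e e0) => h.
  by rewrite /= opprD addrA.
have dL := diff_unique cL E; split => //.
by apply/diff_locallyP; rewrite dL.
Qed.

Lemma diff_near_eq f g x : (\forall y \near x, f y = g y) -> differentiable f x ->
  differentiable g x /\ 'd g x = 'd f x :> (V -> W).
Proof.
move=> fg df; apply: diff_intro; first exact: diff_continuous.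
move=> e e0; have fgx := nbhs_singleton fg.
have fg0 : \forall h \near (0 : V), f (h + x) = g (h + x).
  have cs : h + x @[h --> (0 : V)] --> x.
    by rewrite -[X in _ --> X]add0r; apply: cvgD; [exact: cvg_id|exact: cvg_cst].
  exact: cs _ fg.
apply: filterS2 (diff_eps df e0) fg0 => h H1 H2.
by rewrite -H2 -fgx.
Qed.

Lemma diff_open_eq (O : set V) f g x : open O -> (forall y, O y -> f y = g y) -> O x ->
  differentiable f x -> differentiable g x /\ 'd g x = 'd f x :> (V -> W).
Proof.
move=> oO fg Ox; apply: diff_near_eq; near=> y; apply: fg; near: y.
exact: open_nbhs_nbhs.
Unshelve. all: by end_near. Qed.

End DiffEps.

(* The gradients are sealed: unifying two of them would unfold differentials. *)
HB.lock Definition gradY (R : realType) (n : nat) (f : 'rV[R]_n * 'rV[R]_n -> R)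
  (z : 'rV[R]_n * 'rV[R]_n) : 'rV[R]_n := \row_k 'd f z (delta_mx 0 k, 0).
HB.lock Definition gradQ (R : realType) (n : nat) (f : 'rV[R]_n * 'rV[R]_n -> R)
  (z : 'rV[R]_n * 'rV[R]_n) : 'rV[R]_n := \row_k 'd f z (0, delta_mx 0 k).

Section CkTheory.
Context {R : realType}.
Implicit Types (V W X : normedModType R).

Lemma Ck_ext V W k (O : set V) (f g : V -> W) : open O -> (forall y, O y -> f y = g y) ->
  Ck k O f -> Ck k O g.
Proof.
move=> oO; elim: k f g => [|k IH] f g fg /=.
  move=> cf x Ox; have gE := fg x Ox.
  have H : g @ x --> f @ x.
    by apply: near_eq_cvg; near=> y; apply: fg; near: y; exact: open_nbhs_nbhs.
  by have := cvg_trans H (cf x Ox); rewrite gE.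
move=> [df Cf]; split=> [x Ox|v]; first by have [] := diff_open_eq oO fg Ox (df x Ox).
by apply: IH (Cf v) => x Ox; have [_ ->] := diff_open_eq oO fg Ox (df x Ox).
Unshelve. all: by end_near. Qed.

Lemma Ck_pred V W k (O : set V) (f : V -> W) : Ck k.+1 O f -> Ck k O f.
Proof.
elim: k f => [|k IH] f [df Cf]; first by move=> x Ox; apply: differentiable_continuous; exact: df.
by split=> // v; exact: IH.
Qed.

Lemma Ck_cst V W k (O : set V) (w : W) : Ck k O (fun=> w).
Proof.
elim: k w => [|k IH] w /=; first by move=> x _; exact: cvg_cst.
split=> [x _|v]; first exact: differentiable_cst.
rewrite (_ : (fun x => _) = fun=> 0); first exact: IH.
by apply/funext => x; rewrite diff_cst.
Qed.

Lemma Ck_add V W k (O : set V) (f g : V -> W) : open O -> Ck k O f -> Ck k O g ->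
  Ck k O (fun x => f x + g x).
Proof.
move=> oO; elim: k f g => [|k IH] f g /=.
  by move=> cf cg x Ox; apply: cvgD; [exact: cf|exact: cg].
move=> [df Cf] [dg Cg]; split=> [x Ox|v].
  by apply: differentiableD; [exact: df|exact: dg].
apply: (Ck_ext oO _ (IH _ _ (Cf v) (Cg v))) => x Ox.
have E : 'd (f + g) x = 'd f x \+ 'd g x :> (V -> W) := diffD (df x Ox) (dg x Ox).
by change ('d f x v + 'd g x v = 'd (f + g) x v); rewrite E.
Qed.

Lemma Ck_sum V W k (O : set V) m (f : 'I_m -> V -> W) : open O ->
  (forall i, Ck k O (f i)) -> Ck k O (fun x => \sum_i f i x).
Proof.
move=> oO; elim: m f => [|m IH] f Cf.
  by apply: (Ck_ext oO _ (Ck_cst k O 0)) => x _; rewrite big_ord0.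
have := Ck_add oO (Cf ord0) (IH _ (fun i => Cf (lift ord0 i))).
by apply: Ck_ext => // x _; rewrite big_ord_recl.
Qed.

Lemma Ck_lin V W X k (O : set V) (f : V -> W) (L : {linear W -> X}) : open O ->
  continuous L -> Ck k O f -> Ck k O (L \o f).
Proof.
move=> oO cL; elim: k f => [|k IH] f /=.
  by move=> cf x Ox; apply: continuous_comp; [exact: cf|exact: cL].
move=> [df Cf]; have dL y : differentiable L y by exact: linear_differentiable.
split=> [x Ox|v]; first by apply: differentiable_comp => //; exact: df.
apply: (Ck_ext oO _ (IH _ (Cf v))) => x Ox /=.
by rewrite (diff_comp (df x Ox) (dL _)) /= diff_lin.
Qed.

Lemma Ck_mul V k (O : set V) (f g : V -> R) : open O -> Ck k O f -> Ck k O g ->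
  Ck k O (fun x => f x * g x).
Proof.
move=> oO; elim: k f g => [|k IH] f g.
  by move=> cf cg x Ox; apply: cvgM; [exact: cf|exact: cg].
move=> Cf1 Cg1; have Cf0 := Ck_pred Cf1; have Cg0 := Ck_pred Cg1.
have [df Cf] := Cf1; have [dg Cg] := Cg1; split=> [x Ox|v].
  by apply: differentiableM; [exact: df|exact: dg].
apply: (Ck_ext oO _ (Ck_add oO (IH _ _ Cf0 (Cg v)) (IH _ _ Cg0 (Cf v)))) => x Ox.
have E := diffM (df x Ox) (dg x Ox).
have {}E : 'd (f * g) x v = (f x \*: 'd g x + g x \*: 'd f x) v by rewrite E.
move: E; rewrite mulrfctE => ->; rewrite addrfctE; reflexivity.
Qed.

Lemma Ck_scale V k (O : set V) (a : R) (f : V -> R) : open O -> Ck k O f ->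
  Ck k O (fun x => a * f x).
Proof. by move=> oO; apply: Ck_mul => //; exact: Ck_cst. Qed.

Lemma Ck_pair V W X k (O : set V) (f : V -> W) (g : V -> X) : open O ->
  Ck k O f -> Ck k O g -> Ck k O (fun x => (f x, g x)).
Proof.
move=> oO; elim: k f g => [|k IH] f g /=.
  by move=> cf cg x Ox; apply: cvg_pair; [exact: cf|exact: cg].
move=> [df Cf] [dg Cg]; split=> [x Ox|v].
  by apply: differentiable_pair; [exact: df|exact: dg].
apply: (Ck_ext oO _ (IH _ _ (Cf v) (Cg v))) => x Ox.
by rewrite (diff_pair (df x Ox) (dg x Ox)).
Qed.

Context {n : nat}.
Local Notation Y := 'rV[R]_n.

Lemma linear_pair_basis (L : {linear (Y * Y)%type -> R}) w :
  L w = pairing (\row_k L (delta_mx 0 k, 0)) w.1 + pairing (\row_k L (0, delta_mx 0 k)) w.2.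
Proof.
pose a (v : Y) : Y * Y := (v, 0); pose b (v : Y) : Y * Y := (0, v).
have Ew : w = \sum_k w.1 0 k *: a (delta_mx 0 k) + \sum_k w.2 0 k *: b (delta_mx 0 k).
  apply/eqP; rewrite -pair_eqE /=; apply/andP; split; apply/eqP.
    rewrite !raddf_sum /= [X in _ + X]big1 ?addr0 => [|k _]; last exact: scaler0.
    exact: row_sum_delta.
  rewrite !raddf_sum /= [X in X + _]big1 ?add0r => [|k _]; last exact: scaler0.
  exact: row_sum_delta.
rewrite [in LHS]Ew linearD !linear_sum /= !pairingE.
by congr (_ + _); apply: eq_bigr => k _; rewrite linearZ !mxE /= mulrC.
Qed.

Lemma diff_grad (f : Y * Y -> R) z w :
  'd f z w = pairing (gradY f z) w.1 + pairing (gradQ f z) w.2.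
Proof. by rewrite gradY.unlock gradQ.unlock; exact: linear_pair_basis. Qed.

Lemma gradYE f (z : Y * Y) k : gradY f z 0 k = 'd f z (delta_mx 0 k, 0).
Proof. by rewrite gradY.unlock mxE. Qed.

Lemma gradQE f (z : Y * Y) k : gradQ f z 0 k = 'd f z (0, delta_mx 0 k).
Proof. by rewrite gradQ.unlock mxE. Qed.

Lemma continuous_coordl k : continuous (fun z : Y * Y => z.1 0 k).
Proof. apply: (@lipT_continuous _ _ _ 1) => z w; rewrite mul1r.
have -> : z.1 0 k - w.1 0 k = (z - w).1 0 k by rewrite !mxE.
by apply: le_trans (norm_coord _ _) _; exact: norm_pair1.
Qed.

Lemma continuous_coordr k : continuous (fun z : Y * Y => z.2 0 k).
Proof. apply: (@lipT_continuous _ _ _ 1) => z w; rewrite mul1r.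
have -> : z.2 0 k - w.2 0 k = (z - w).2 0 k by rewrite !mxE.
by apply: le_trans (norm_coord _ _) _; exact: norm_pair2.
Qed.

Lemma coordl_is_linear k : linear (fun z : Y * Y => z.1 0 k : R).
Proof. by move=> a u v /=; rewrite !mxE. Qed.
Lemma coordr_is_linear k : linear (fun z : Y * Y => z.2 0 k : R).
Proof. by move=> a u v /=; rewrite !mxE. Qed.

Definition lin_of (V W : normedModType R) (f : V -> W) (lf : linear f) : {linear V -> W} :=
  HB.pack f (GRing.isLinear.Build _ _ _ _ f lf).

Lemma Ck_coordl V k (O : set V) (f : V -> Y * Y) j : open O -> Ck k O f ->
  Ck k O (fun x => (f x).1 0 j).
Proof. move=> oO; apply: (Ck_lin (L := lin_of (coordl_is_linear j))) => //; exact: continuous_coordl. Qed.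

Lemma Ck_coordr V k (O : set V) (f : V -> Y * Y) j : open O -> Ck k O f ->
  Ck k O (fun x => (f x).2 0 j).
Proof. move=> oO; apply: (Ck_lin (L := lin_of (coordr_is_linear j))) => //; exact: continuous_coordr. Qed.

Lemma Ck_comp V k (O : set V) (O' : set (Y * Y)) (f : Y * Y -> R) (g : V -> Y * Y) :
  open O -> (forall x, O x -> O' (g x)) -> Ck k O' f -> Ck k O g -> Ck k O (f \o g).
Proof.
move=> oO gO; elim: k f => [|k IH] f.
  by move=> cf cg x Ox; apply: continuous_comp; [exact: cg|exact: cf (gO x Ox)].
move=> [df Cf] Cg1; have Cg0 := Ck_pred Cg1; have [dg Cg] := Cg1.
split=> [x Ox|v]; first by apply: differentiable_comp; [exact: dg|exact: df (gO x Ox)].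
have H : Ck k O (fun x => \sum_j 'd f (g x) (delta_mx 0 j, 0) * ('d g x v).1 0 j
    + \sum_j 'd f (g x) (0, delta_mx 0 j) * ('d g x v).2 0 j).
  apply: Ck_add => //; apply: Ck_sum => // j; apply: Ck_mul => //.
  - exact: IH (Cf _) Cg0.
  - exact: (Ck_coordl j oO (Cg v)).
  - exact: IH (Cf _) Cg0.
  - exact: (Ck_coordr j oO (Cg v)).
apply: (Ck_ext oO _ H) => x Ox.
rewrite (diff_comp (dg x Ox) (df _ (gO x Ox))) /= diff_grad !pairingE.
by congr (_ + _); apply: eq_bigr => j _; rewrite ?gradYE ?gradQE.
Qed.

Lemma compact_ball (a : Y) (r : R) : compact [set y : Y | `|y - a| <= r].
Proof.
apply: bounded_closed_compact.
  exists (r + `|a|); split; first by rewrite num_real.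
  move=> M rM y /= ya; rewrite -(subrK a y) (le_trans (ler_normD _ _)) //.
  by apply: le_trans (ltW rM); rewrite lerD2r.
have cf : continuous (fun y : Y => `|y - a|).
  apply: (@lipT_continuous _ _ _ 1) => y z; rewrite mul1r.
  by apply: le_trans (ler_dist_dist _ _) _; rewrite opprB addrA subrK.
exact: (closed_comp (fun y _ => cf y) (@closed_le R r)).
Qed.

Lemma compact_box (a : Y) (r b : R) : compact (box a r b).
Proof.
have -> : box a r b = [set y | `|y - a| <= r] `*` [set q | `|q - 0| <= b].
  by apply/seteqP; split=> -[y q] /=; rewrite /box /= subr0.
exact: (@compact_setX _ _ _ _ (@compact_ball a r) (@compact_ball 0 b)).
Qed.

Lemma compact_bound (T : topologicalType) (A : set T) (f : T -> R) :
  compact A -> (forall x, A x -> {for x, continuous f}) ->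
  exists2 B : R, 0 <= B & forall x, A x -> `|f x| <= B.
Proof.
move=> cA cf; have [A0|/set0P/negP/negPn/eqP ->] := pselect (A !=set0); last by exists 0.
have cf' : {within A, continuous (fun x => `|f x|)}.
  apply: continuous_in_subspaceT => x; rewrite inE => Ax.
  by apply: cvg_norm; exact: cf.
have [c cA' H] := compact_EVT_max A0 cA cf'.
by exists `|f c| => // x Ax; apply: H; rewrite inE.
Qed.

Lemma box_bound (O : set (Y * Y)) (f : Y * Y -> R) a r b : Ck 0 O f -> box a r b `<=` O ->
  exists2 B : R, 0 <= B & forall z, box a r b z -> `|f z| <= B.
Proof. by move=> cf AO; apply: (@compact_bound _ (box a r b) f (@compact_box a r b)) => z /AO; exact: cf. Qed.

Lemma fin_bound m (P : 'I_m -> R -> Prop) : (forall i, exists2 B, 0 <= B & P i B) ->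
  (forall i B B', B <= B' -> P i B -> P i B') -> exists2 B, 0 <= B & forall i, P i B.
Proof.
move=> H mono.
have [B BP] := choice (fun i => let: ex_intro2 B B0 PB := H i in ex_intro _ B (conj B0 PB)).
have B0 i : 0 <= B i by case: (BP i).
exists (\sum_i B i) => [|i]; first by apply: sumr_ge0.
by apply: mono (proj2 (BP i)); rewrite (bigD1 i) //= lerDl sumr_ge0.
Qed.

Lemma Ck1_box_lip (O : set (Y * Y)) (f : Y * Y -> R) a r b : Ck 1 O f -> box a r b `<=` O ->
  exists2 B : R, 0 <= B & forall z z', box a r b z -> box a r b z' ->
    `|f z' - f z| <= B * `|z' - z|.
Proof.
move=> [df Cf] AO.
have [B1 B10 H1] := fin_bound
  (P := fun k B => forall z, box a r b z -> `|'d f z (delta_mx 0 k, 0)| <= B)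
  (fun k => box_bound (Cf _) AO) (fun i B B' BB H z Az => le_trans (H z Az) BB).
have [B2 B20 H2] := fin_bound
  (P := fun k B => forall z, box a r b z -> `|'d f z (0, delta_mx 0 k)| <= B)
  (fun k => box_bound (Cf _) AO) (fun i B B' BB H z Az => le_trans (H z Az) BB).
exists (n%:R * (B1 + B2)) => [|z z' Az Az']; first by rewrite mulr_ge0 ?addr_ge0.
pose w := z' - z.
have seg (s : R) : 0 <= s <= 1 -> box a r b (z + s *: w) by move=> s01; exact: box_segment.
have gr (s : R) : 0 <= s <= 1 -> grad_at f (gradY f) (gradQ f) (z + s *: w).
  by move=> s01; split; [exact: df _ (AO _ (seg s s01))|move=> u; exact: diff_grad].
have [s s01] := MVT01 (fun s s01 => is_derive_comp_grad (gr s s01) (is_derive_line z w s)).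
have zw : z + w = z' by rewrite addrC subrK.
rewrite /= scale1r scale0r addr0 zw => ->.
have b1 : `|gradY f (z + s *: w)| <= B1.
  by apply: norm_rV_le => // k; rewrite gradYE; apply: H1; exact: seg.
have b2 : `|gradQ f (z + s *: w)| <= B2.
  by apply: norm_rV_le => // k; rewrite gradQE; apply: H2; exact: seg.
rewrite (le_trans (ler_normD _ _)) // mulrDr mulrDl lerD //.
  rewrite (le_trans (pairing_norm _ _)) // -mulrA ler_wpM2l // ler_pM //.
  exact: (norm_pair1 (z' - z)).
rewrite (le_trans (pairing_norm _ _)) // -mulrA ler_wpM2l // ler_pM //.
exact: (norm_pair2 (z' - z)).
Qed.

Lemma Ck2_box_reg (O : set (Y * Y)) (f : Y * Y -> R) a r b : Ck 2 O f -> box a r b `<=` O ->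
  exists2 C : R, 0 <= C & [/\ forall z, box a r b z -> grad_at f (gradY f) (gradQ f) z,
      forall z z', box a r b z -> box a r b z' -> `|gradY f z' - gradY f z| <= C * `|z' - z|,
      forall z z', box a r b z -> box a r b z' -> `|gradQ f z' - gradQ f z| <= C * `|z' - z| &
      forall z, box a r b z -> `|gradY f z| <= C /\ `|gradQ f z| <= C].
Proof.
move=> [df Cf] AO.
have [B1 B10 H1] := fin_bound (P := fun k B => forall z z', box a r b z -> box a r b z' ->
    `|'d f z' (delta_mx 0 k, 0) - 'd f z (delta_mx 0 k, 0)| <= B * `|z' - z|)
  (fun k => Ck1_box_lip (Cf _) AO)
  (fun i B B' BB H z z' Az Az' => le_trans (H z z' Az Az') (ler_wpM2r (normr_ge0 _) BB)).
have [B2 B20 H2] := fin_bound (P := fun k B => forall z z', box a r b z -> box a r b z' ->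
    `|'d f z' (0, delta_mx 0 k) - 'd f z (0, delta_mx 0 k)| <= B * `|z' - z|)
  (fun k => Ck1_box_lip (Cf _) AO)
  (fun i B B' BB H z z' Az Az' => le_trans (H z z' Az Az') (ler_wpM2r (normr_ge0 _) BB)).
have [B3 B30 H3] := fin_bound
  (P := fun k B => forall z, box a r b z -> `|'d f z (delta_mx 0 k, 0)| <= B)
  (fun k => box_bound (Ck_pred (k := 0) (Cf _)) AO) (fun i B B' BB H z Az => le_trans (H z Az) BB).
have [B4 B40 H4] := fin_bound
  (P := fun k B => forall z, box a r b z -> `|'d f z (0, delta_mx 0 k)| <= B)
  (fun k => box_bound (Ck_pred (k := 0) (Cf _)) AO) (fun i B B' BB H z Az => le_trans (H z Az) BB).
pose B := B1 + B2 + B3 + B4; have B0 : 0 <= B by rewrite !addr_ge0.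
exists B => //; split.
- by move=> z Az; split; [exact: df _ (AO _ Az)|move=> w; exact: diff_grad].
- move=> z z' Az Az'; apply: norm_rV_le => [|k]; first by rewrite mulr_ge0.
  rewrite !mxE !gradYE (le_trans (H1 k _ _ Az Az')) // ler_wpM2r // /B; lra.
- move=> z z' Az Az'; apply: norm_rV_le => [|k]; first by rewrite mulr_ge0.
  rewrite !mxE !gradQE (le_trans (H2 k _ _ Az Az')) // ler_wpM2r // /B; lra.
- move=> z Az; split; apply: norm_rV_le => // k; rewrite ?gradYE ?gradQE.
    by rewrite (le_trans (H3 k _ Az)) // /B; lra.
  by rewrite (le_trans (H4 k _ Az)) // /B; lra.
Qed.

End CkTheory.

(* Sealed copies of differentials and of frozen definitions: unifying two
   instances of the originals unfolds them and does not terminate in practice. *)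
HB.lock Definition dr (R : realType) (V W : normedModType R) (f : V -> W) (x v : V) : W :=
  'd f x v.
HB.lock Definition Jac (R : realType) (n : nat) (M : ptopologicalType) (S : smooth_manifold R n M)
  (i j : chart_index S) (x : M) : 'M[R]_n := trans i j x.
HB.lock Definition tprm (R : realType) (n : nat) (M : ptopologicalType)
  (S : smooth_manifold R n M) (i : chart_index S) (y : 'rV[R]_n * 'rV[R]_n) : TsM S :=
  TsM_param i y.
HB.lock Definition tloc (R : realType) (n : nat) (M : ptopologicalType)
  (S : smooth_manifold R n M) (f : TsM S -> R) (i : chart_index S) : 'rV[R]_n * 'rV[R]_n -> R :=
  TsM_loc f i.

Section SealedDiff.
Context {R : realType}.
Implicit Types (V W X : normedModType R).

Lemma drE V W (f : V -> W) x v : dr f x v = 'd f x v.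
Proof. by rewrite dr.unlock. Qed.

Lemma dr_fun V W (f : V -> W) v : (fun x => 'd f x v) = (fun x => dr f x v).
Proof. by apply/funext => x; rewrite drE. Qed.

Lemma drZ V W (f : V -> W) x a v : dr f x (a *: v) = a *: dr f x v.
Proof. by rewrite !drE linearZ. Qed.

Lemma dr_sum V W (f : V -> W) x m (v : 'I_m -> V) :
  dr f x (\sum_k v k) = \sum_k dr f x (v k).
Proof. by rewrite !drE linear_sum; apply: eq_bigr => k _; rewrite drE. Qed.

Lemma dr_comp V W X (f : V -> W) (g : W -> X) x v :
  differentiable f x -> differentiable g (f x) ->
  dr (g \o f) x v = dr g (f x) (dr f x v).
Proof. by move=> df dg; rewrite !drE diff_comp. Qed.

Lemma dr_open_eq V W (O : set V) (f g : V -> W) x v : open O -> (forall y, O y -> f y = g y) ->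
  O x -> differentiable f x -> differentiable g x /\ dr g x v = dr f x v.
Proof.
by move=> oO fg Ox df; have [dg E] := diff_open_eq oO fg Ox df; rewrite !drE E.
Qed.

Lemma dr_lin V W (L : {linear V -> W}) x v : continuous L -> dr L x v = L v.
Proof. by move=> cL; rewrite drE diff_lin. Qed.

Lemma is_derive_dr V W (f : V -> W) (c : R -> V) (t : R) (c' : V) :
  differentiable f (c t) -> is_derive t 1 c c' -> is_derive t 1 (fun s => f (c s)) (dr f (c t) c').
Proof.
move=> df [dc <-].
have dc' : differentiable c t by exact/derivable1_diffP.
have dgc : differentiable (f \o c) t by exact: differentiable_comp.
split; first exact/derivable1_diffP.
by rewrite drE deriveE // [in RHS]deriveE // diff_comp.
Qed.

Lemma dr_grad n (f : 'rV[R]_n * 'rV[R]_n -> R) z w :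
  dr f z w = pairing (gradY f z) w.1 + pairing (gradQ f z) w.2.
Proof. by rewrite drE diff_grad. Qed.

Lemma near_plane V (y v w : V) (O : set V) : nbhs y O ->
  exists2 d : R, 0 < d & forall a b : R, `|a| <= d -> `|b| <= d -> O (y + a *: v + b *: w).
Proof.
move=> /nbhs_ballP[r /= r0 rO]; pose m := `|v| + `|w| + 1.
have m0 : 0 < m by have := normr_ge0 v; have := normr_ge0 w; rewrite /m; lra.
exists (r / (2 * m)) => [|a b ad bd]; first by rewrite divr_gt0 // mulr_gt0.
apply: rO; rewrite -ball_normE /= -addrA opprD addrA subrr sub0r normrN.
apply: (@le_lt_trans _ _ (r / (2 * m) * m)).
  rewrite (le_trans (ler_normD _ _)) // !normrZ.
  have : `|a| * `|v| <= r / (2 * m) * `|v| by rewrite ler_wpM2r.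
  have : `|b| * `|w| <= r / (2 * m) * `|w| by rewrite ler_wpM2r.
  have : 0 <= r / (2 * m) by rewrite divr_ge0 ?mulr_ge0 ?ltW.
  rewrite /m; lra.
have -> : r / (2 * m) * m = r / 2 by field; rewrite gt_eqF.
lra.
Qed.

Lemma Schwarz V (O : set V) (f : V -> R) (y v w : V) : open O -> Ck 2 O f -> O y ->
  dr (fun x => dr f x v) y w = dr (fun x => dr f x w) y v.
Proof.
move=> oO C2 Oy; have [df Cf] := C2.
suff H (v' w' : V) : forall e : R, 0 < e -> \forall s \near (0 : R)^'+,
    `|(f (y + s *: v' + s *: w') - f (y + s *: w') - f (y + s *: v') + f y) / s ^+ 2
      - dr (fun x => dr f x v') y w'| <= e.
  apply/eqP; rewrite -subr_eq0 -normr_le0; apply/ler_addgt0Pr => e e0; rewrite add0r.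
  have e2 : 0 < e / 2 by lra.
  have [s [H1 H2]] := @filter_ex _ _ _ _ (filterI (H v w _ e2) (H w v _ e2)).
  move: H1 H2; rewrite (addrAC y).
  rewrite (_ : f _ - f (y + s *: w) - f (y + s *: v) + f y =
    f (y + s *: w + s *: v) - f (y + s *: v) - f (y + s *: w) + f y); last by ring.
  move: (_ / _) (dr _ y w) (dr _ y v) => A B C H1 H2.
  have := ler_normB (A - C) (A - B).
  rewrite (_ : A - C - (A - B) = B - C); last by ring.
  lra.
move: v' w' => {v w} v w e e0; have [dfv Cfv] := Cf v.
rewrite dr_fun in dfv; have cD := Cfv w y Oy; rewrite (dr_fun f) dr_fun in cD.
have [d d0 dP] : exists2 d : R, 0 < d & forall a b : R, `|a| <= d -> `|b| <= d ->
    O (y + a *: v + b *: w) /\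
    `|dr (fun x => dr f x v) (y + a *: v + b *: w) w - dr (fun x => dr f x v) y w| <= e.
  have N : nbhs y (fun x => O x /\
     `|dr (fun x => dr f x v) x w - dr (fun x => dr f x v) y w| <= e).
    apply: filterI; first exact: open_nbhs_nbhs.
    by move/cvgrPdist_le: cD => /(_ e e0); apply: filterS => x; rewrite distrC.
  by have [d d0 dP] := near_plane v w N; exists d.
near=> s.
have s0 : 0 < s by near: s; exact: nbhs_right_gt.
have sd : s <= d by near: s; exact: nbhs_right_le.
have line (x u : V) (a : R) : is_derive a 1 (fun a : R => x + a *: u) u by exact: is_derive_line.
have in01 (a : R) : 0 <= a <= 1 -> `|s * a| <= d.
  move=> /andP[a0 a1]; rewrite ger0_norm; last by rewrite mulr_ge0 // ltW.
  by apply: le_trans sd; rewrite ler_piMr // ltW.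
pose p (a b : R) := y + (s * a) *: v + (s * b) *: w.
have dpa (a b : R) : is_derive a 1 (fun a => p a b) (s *: v).
  have := line (y + (s * b) *: w) (s *: v) a; congr is_derive; apply/funext => c.
  by rewrite /p scalerA (mulrC c) addrAC.
have dpb (a b : R) : is_derive b 1 (fun b => p a b) (s *: w).
  have := line (y + (s * a) *: v) (s *: w) b; congr is_derive; apply/funext => c.
  by rewrite /p scalerA (mulrC c).
have z01 : 0 <= (0 : R) <= 1 by rewrite lexx ler01.
have o01 : 0 <= (1 : R) <= 1 by rewrite lexx ler01.
have Op a b : 0 <= a <= 1 -> 0 <= b <= 1 -> O (p a b).
  by move=> a01 b01; have [] := dP _ _ (in01 a a01) (in01 b b01).
have [a a01 Ea] := @MVT01 _ (fun a => f (p a 1) - f (p a 0))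
   (fun a => dr f (p a 1) (s *: v) - dr f (p a 0) (s *: v))
   (fun a a01 => is_deriveB
     (is_derive_dr (c := fun a => p a 1) (df _ (Op a 1 a01 o01)) (dpa a 1))
     (is_derive_dr (c := fun a => p a 0) (df _ (Op a 0 a01 z01)) (dpa a 0))).
have [b b01 Eb] := @MVT01 _ (fun b => dr f (p a b) v)
   (fun b => dr (fun x => dr f x v) (p a b) (s *: w))
   (fun b b01 => is_derive_dr (c := fun b => p a b) (dfv _ (Op a b a01 b01)) (dpb a b)).
have E : f (p 1 1) - f (p 1 0) - (f (p 0 1) - f (p 0 0)) =
    s ^+ 2 * dr (fun x => dr f x v) (p a b) w.
  have sv z : dr f z (s *: v) = s * dr f z v by exact: drZ.
  have sw z : dr (fun x => dr f x v) z (s *: w) = s * dr (fun x => dr f x v) z w.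
    exact: drZ.
  by rewrite Ea !sv -mulrBr Eb sw; ring.
have p11 : p 1 1 = y + s *: v + s *: w by rewrite /p mulr1.
have p10 : p 1 0 = y + s *: v by rewrite /p mulr1 mulr0 scale0r addr0.
have p01 : p 0 1 = y + s *: w by rewrite /p mulr1 mulr0 scale0r addr0.
have p00 : p 0 0 = y by rewrite /p mulr0 !scale0r !addr0.
move: E; rewrite p11 p10 p01 p00 => E.
rewrite (_ : f _ - _ - _ + _ = s ^+ 2 * dr (fun x => dr f x v) (p a b) w); last first.
  by rewrite -E; ring.
rewrite mulrC mulKf ?expf_neq0 ?gt_eqF //.
by have [_] := dP _ _ (in01 a a01) (in01 b b01).
Unshelve. all: by end_near. Qed.

End SealedDiff.

Section Charts.
Context {R : realType} {n : nat} {M : ptopologicalType}.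
Variable S : smooth_manifold R n M.
Local Notation V := 'rV[R]_n.
Implicit Types (i j k : chart_index S) (x : M) (y q v : V).

Lemma cod_chart i x : dom i x -> cod i (chart i x).
Proof. by move=> dx; exists x. Qed.

Lemma dom_param i y : cod i y -> dom i (param i y).
Proof. by move=> [x dx <-]; rewrite chartK. Qed.

Lemma paramK i y : cod i y -> chart i (param i y) = y.
Proof. by move=> [x dx <-]; rewrite chartK. Qed.

Definition overlap i j : set V := chart i @` (dom i `&` dom j).

Lemma overlapP i j y : overlap i j y <-> cod i y /\ dom j (param i y).
Proof.
split=> [[x [dx dx'] <-]|[cy dy]]; first by rewrite chartK //; split; first exists x.
by exists (param i y); [split => //; exact: dom_param|exact: paramK].
Qed.

Lemma overlap_chart i j x : dom i x -> dom j x -> overlap i j (chart i x).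
Proof. by move=> dx dx'; exists x. Qed.

Lemma open_overlap i j : open (overlap i j).
Proof.
rewrite openE => y /overlapP[cy dy]; suff : nbhs y (overlap i j) by [].
have N1 : nbhs y (cod i) by apply: open_nbhs_nbhs; split => //; exact: open_cod.
have N2 : nbhs y (fun y => dom j (param i y)).
  have := @param_continuous _ _ _ S i y cy; apply.
  by apply: open_nbhs_nbhs; split => //; exact: open_dom.
by apply: filterS (filterI N1 N2) => u [H1 H2]; apply/overlapP.
Qed.

Lemma near_dom i x : dom i x -> \forall x' \near x, dom i x'.
Proof. by move=> dx; apply: open_nbhs_nbhs; split => //; exact: open_dom. Qed.

Lemma transition_Ck i j m : Ck m (overlap i j) (chart j \o param i).
Proof. exact: transition_smooth. Qed.

Lemma transition_diff i j y : overlap i j y -> differentiable (chart j \o param i) y.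
Proof. by move=> oy; have [H _] := @transition_Ck i j 1; exact: H. Qed.

Lemma transE i j x v : v *m Jac i j x = dr (chart j \o param i) (chart i x) v.
Proof. by rewrite drE Jac.unlock /trans /jacobian mul_rV_lin1. Qed.

Lemma JacE i j x : trans i j x = Jac i j x.
Proof. by rewrite Jac.unlock. Qed.

Lemma trans_id i x : dom i x -> Jac i i x = 1%:M.
Proof.
move=> dx; apply/row_matrixP => k; rewrite !rowE transE mulmx1.
have did : differentiable (@id V) (chart i x) by exact: ex_diff.
have [_ ->] := @dr_open_eq _ _ _ _ (@id V) (chart i \o param i) (chart i x) (delta_mx 0 k)
  (@open_cod _ _ _ S i) (fun y cy => esym (paramK cy)) (cod_chart dx) did.
by rewrite drE diff_val.
Qed.

Lemma trans_comp i j k x : dom i x -> dom j x -> dom k x ->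
  Jac i j x *m Jac j k x = Jac i k x.
Proof.
move=> di dj dk; apply/row_matrixP => l; rewrite !rowE mulmxA (transE j k) (transE i j) (transE i k).
pose O := overlap i j `&` overlap i k.
have oO : open O by apply: openI; exact: open_overlap.
have Ox : O (chart i x) by split; exact: overlap_chart.
have d1 : differentiable (chart j \o param i) (chart i x) by exact/transition_diff/overlap_chart.
have E1 : (chart j \o param i) (chart i x) = chart j x by rewrite /= chartK.
have d2 : differentiable (chart k \o param j) ((chart j \o param i) (chart i x)).
  by rewrite E1; exact/transition_diff/overlap_chart.
have d3 := differentiable_comp d1 d2.
have HO y : O y -> ((chart k \o param j) \o (chart j \o param i)) y = (chart k \o param i) y.
  by move=> [/overlapP[cy dy] _] /=; rewrite chartK.
have [_ ->] := dr_open_eq (delta_mx 0 l) oO HO Ox d3.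
by rewrite (dr_comp _ d1 d2) /= (chartK di).
Qed.

Lemma trans_inv i j x : dom i x -> dom j x -> Jac i j x *m Jac j i x = 1%:M.
Proof. by move=> di dj; rewrite trans_comp // trans_id. Qed.

Local Notation ca := (chart_at S).
Let dca x : dom (ca x) x := @dom_chart_at _ _ _ S x.

Definition TsM_coord i (z : TsM S) : V * V :=
  (chart i z.1, z.2 *m (Jac i (ca z.1) z.1)^T).

Lemma tprmE i z : tprm i z =
  (param i z.1, z.2 *m (Jac (ca (param i z.1)) i (param i z.1))^T) :> TsM S.
Proof. by rewrite tprm.unlock Jac.unlock. Qed.

Lemma tlocE (G : TsM S -> R) i z : tloc G i z = G (tprm i z).
Proof. by rewrite tloc.unlock tprm.unlock. Qed.

Lemma coordK i z : dom i z.1 -> tprm i (TsM_coord i z) = z.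
Proof.
case: z => x p /= dx; rewrite ?tprmE /TsM_coord ?tprmE /= chartK //.
by rewrite -mulmxA -trmx_mul trans_inv // trmx1 mulmx1.
Qed.

Lemma tprmK i z : cod i z.1 -> TsM_coord i (tprm i z) = z.
Proof.
case: z => y q /= cy; rewrite ?tprmE /TsM_coord ?tprmE /= paramK //.
by rewrite -mulmxA -trmx_mul trans_inv ?trmx1 ?mulmx1 //; exact: dom_param.
Qed.

Lemma TM_coordK i z : dom i z.1 -> TM_param i (TM_coord i z) = z.
Proof.
case: z => x p /= dx; rewrite /TM_param /TM_coord !JacE /= chartK //.
by rewrite -mulmxA trans_inv // mulmx1.
Qed.

Lemma TM_paramK i z : cod i z.1 -> TM_coord i (TM_param i z) = z.
Proof.
case: z => y q /= cy; rewrite /TM_param /TM_coord !JacE /= paramK //.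
by rewrite -mulmxA trans_inv ?mulmx1 //; exact: dom_param.
Qed.

Lemma coord_change i j z : dom i z.1 -> dom j z.1 ->
  (TsM_coord i z).2 = (TsM_coord j z).2 *m (Jac i j z.1)^T.
Proof. by move=> di dj /=; rewrite -mulmxA -trmx_mul trans_comp. Qed.

Lemma tloc_coord (G : TsM S -> R) i z : dom i z.1 -> tloc G i (TsM_coord i z) = G z.
Proof. by move=> di; rewrite /= !tlocE coordK. Qed.

Lemma pairing_sumr (p : V) m (f : 'I_m -> V) :
  pairing p (\sum_k f k) = \sum_k pairing p (f k).
Proof. by elim/big_rec2: _ => [|k y1 y2 _ <-]; rewrite ?pairing0r ?pairingDr. Qed.

Definition hess i j y q v w : R :=
  pairing q (dr (fun y => dr (chart j \o param i) y v) y w).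

Lemma hess_sym i j y q v w : overlap i j y -> hess i j y q v w = hess i j y q w v.
Proof.
move=> oy; have C2 := @transition_Ck i j 2; have [dp Cp] := C2.
have lin : linear (pairing q : V -> R) by move=> a u u'; rewrite pairingDr pairingZr.
pose L := lin_of lin; have LE u : L u = pairing q u by [].
have cL : continuous L.
  apply: (@lipT_continuous _ _ _ (n%:R * `|q|)) => s t.
  by rewrite !LE -pairingBr (le_trans (pairing_norm _ _)) // mulrA.
have dL u : differentiable L u by exact: linear_differentiable.
have Cf : Ck 2 (overlap i j) (L \o (chart j \o param i)).
  by apply: Ck_lin => //; exact: open_overlap.
have E (u x : V) : overlap i j x ->
    dr (L \o (chart j \o param i)) x u = pairing q (dr (chart j \o param i) x u).
  by move=> ox; rewrite (dr_comp _ (dp x ox) (dL _)) (dr_lin _ _ cL) LE.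
have E2 (u u' : V) : dr (fun x : V => dr (L \o (chart j \o param i)) x u) y u' = hess i j y q u u'.
  have dpu : differentiable (fun x : V => dr (chart j \o param i) x u) y.
    by rewrite -dr_fun; have [H _] := Cp u; exact: H.
  have dc := differentiable_comp dpu (dL _).
  have [_ ->] := @dr_open_eq _ _ _ _ (L \o (fun x : V => dr (chart j \o param i) x u)) _ y u'
    (@open_overlap i j) (fun (x : V) ox => esym (E u x ox)) oy dc.
  by rewrite (dr_comp _ dpu (dL _)) (dr_lin _ _ cL).
by rewrite -!E2; apply: (Schwarz (O := overlap i j)) => //; exact: open_overlap.
Qed.

Lemma tprm_change i j x q : dom i x -> dom j x ->
  tprm i (chart i x, q *m (Jac i j x)^T) = tprm j (chart j x, q).
Proof.
move=> di dj; rewrite !tprmE /= (chartK di) (chartK dj); apply: (f_equal (pair x)).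
by rewrite -mulmxA -trmx_mul (trans_comp (dca x) di dj).
Qed.

Lemma gradQ_change (G : TsM S -> R) i j z : dom i z.1 -> dom j z.1 ->
  differentiable (tloc G i) (TsM_coord i z) ->
  differentiable (tloc G j) (TsM_coord j z) ->
  gradQ (tloc G j) (TsM_coord j z) = gradQ (tloc G i) (TsM_coord i z) *m Jac i j z.1.
Proof.
move=> di dj dG dG'; apply: pairing_ext => w.
rewrite -[X in _ = pairing (_ *m X) _]trmxK -pairing_mulmx.
set y := chart i z.1; set q := (TsM_coord j z).2.
have d1 (s : R) : is_derive s 1 (fun s : R => (chart j z.1, q + s *: w)) (0, w).
  apply/is_derive_pairP; split => /=; first exact: is_derive_cst.
  exact: is_derive_line.
have d2 (s : R) : is_derive s 1 (fun s : R => (y, (q + s *: w) *m (Jac i j z.1)^T))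
    (0, w *m (Jac i j z.1)^T).
  apply/is_derive_pairP; split => /=; first exact: is_derive_cst.
  by under eq_fun do rewrite mulmxDl -scalemxAl; exact: is_derive_line.
have E1 : (chart j z.1, q + 0 *: w) = TsM_coord j z by rewrite scale0r addr0.
have E2 : (y, (q + 0 *: w) *m (Jac i j z.1)^T) = TsM_coord i z.
  by rewrite scale0r addr0 /q -(coord_change di dj).
have H1 := is_derive_dr (f := tloc G j) (t := 0) _ (d1 0).
have H2 := is_derive_dr (f := tloc G i) (t := 0) _ (d2 0).
rewrite E1 in H1; rewrite E2 in H2.
have H2' := H2 dG; have [_ H1'] := H1 dG'.
have : is_derive (0 : R) 1 (fun s : R => tloc G j (chart j z.1, q + s *: w))
    (dr (tloc G i) (TsM_coord i z) (0, w *m (Jac i j z.1)^T)).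
  move: H2'; congr is_derive; apply/funext => s.
  by rewrite !tlocE (tprm_change _ di dj).
by move=> [_]; rewrite H1' !dr_grad !pairing0r !add0r => ->.
Qed.

Lemma gradY_change (G : TsM S -> R) i j z e : dom i z.1 -> dom j z.1 ->
  differentiable (tloc G i) (TsM_coord i z) ->
  differentiable (tloc G j) (TsM_coord j z) ->
  pairing (gradY (tloc G j) (TsM_coord j z)) (e *m Jac i j z.1) =
  pairing (gradY (tloc G i) (TsM_coord i z)) e +
  hess i j (chart i z.1) (TsM_coord j z).2 (gradQ (tloc G i) (TsM_coord i z)) e.
Proof.
move=> di dj dG dG'; set y := chart i z.1; set q := (TsM_coord j z).2.
have oy : overlap i j y by exact: overlap_chart.
pose psi : V -> V := chart j \o param i.
have dpsi u : differentiable (fun y : V => dr psi y u) y.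
  by rewrite -dr_fun; have [_ /(_ u) [H _]] := @transition_Ck i j 2; exact: H.
pose c1 (s : R) := (psi (y + s *: e), q).
pose c2 (s : R) := (y + s *: e, \row_k pairing q (dr psi (y + s *: e) (delta_mx 0 k))).
have E1 : c1 0 = TsM_coord j z by rewrite /c1 scale0r addr0 /psi /= chartK.
have rowE x : dom i x -> (\row_k pairing q (dr psi (chart i x) (delta_mx 0 k))) =
    q *m (Jac i j x)^T.
  move=> dx; apply/rowP => k; rewrite mxE -transE pairing_mulmx.
  by rewrite pairing_delta.
have E2 : c2 0 = TsM_coord i z.
  rewrite /c2 scale0r addr0; congr pair.
  by rewrite /y (rowE _ di) /q -(coord_change di dj).
have dy : is_derive (0 : R) 1 (fun s : R => y + s *: e) e by exact: is_derive_line.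
have y0 : y + (0 : R) *: e = y by rewrite scale0r addr0.
have d1 : is_derive (0 : R) 1 c1 (e *m Jac i j z.1, 0).
  apply/is_derive_pairP; split => /=; last exact: is_derive_cst.
  have := @is_derive_dr _ _ _ psi (fun s : R => y + s *: e) 0 e.
  by rewrite y0 transE; apply => //; exact: transition_diff.
have d2 : is_derive (0 : R) 1 c2
    (e, \row_k pairing q (dr (fun y : V => dr psi y (delta_mx 0 k)) y e)).
  apply/is_derive_pairP; split => //=; apply/is_derive_rVP => k; rewrite mxE.
  under eq_fun do rewrite mxE pairingC; rewrite pairingC.
  apply: is_derive_pairingl.
  have := @is_derive_dr _ _ _ (fun y : V => dr psi y (delta_mx 0 k)) (fun s : R => y + s *: e) 0 e.
  by rewrite y0; apply => //; exact: dpsi.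
have H1 := is_derive_dr (f := tloc G j) (t := 0) _ d1.
have H2 := is_derive_dr (f := tloc G i) (t := 0) _ d2.
rewrite E1 in H1; rewrite E2 in H2.
have H2' := H2 dG; have [_ H1'] := H1 dG'.
have : is_derive (0 : R) 1 (fun s : R => tloc G j (c1 s)) (dr (tloc G i) (TsM_coord i z)
   (e, \row_k pairing q (dr (fun y : V => dr psi y (delta_mx 0 k)) y e))).
  apply: near_eq_is_derive H2'.
  have : \forall s \near (0 : R), overlap i j (y + s *: e).
    have := is_derive_continuous dy; rewrite /prop_for /continuous_at y0; apply.
    by apply: open_nbhs_nbhs; split => //; exact: open_overlap.
  apply: filterS => s /overlapP[cy dyj].
  have di' := dom_param cy.
  rewrite !tlocE /c1 /c2; move: (rowE _ di'); rewrite (paramK cy) => ->.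
  by rewrite -{1}(paramK cy) (tprm_change _ di' dyj).
move=> [_]; rewrite H1' !dr_grad /= pairing0r addr0 => ->; congr (_ + _).
rewrite hess_sym // /hess -/psi {2}(row_sum_delta (gradQ _ _)) dr_sum pairing_sumr pairingE.
apply: eq_bigr => k _; rewrite drZ pairingZr mxE; congr (_ * _).
exact: hess_sym.
Qed.

Definition bracket_loc (F G : TsM S -> R) i (z : V * V) : R :=
  pairing (gradY (tloc F i) z) (gradQ (tloc G i) z) -
  pairing (gradY (tloc G i) z) (gradQ (tloc F i) z).

Lemma bracket_change (F G : TsM S -> R) i j z : dom i z.1 -> dom j z.1 ->
  differentiable (tloc F i) (TsM_coord i z) -> differentiable (tloc F j) (TsM_coord j z) ->
  differentiable (tloc G i) (TsM_coord i z) -> differentiable (tloc G j) (TsM_coord j z) ->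
  bracket_loc F G j (TsM_coord j z) = bracket_loc F G i (TsM_coord i z).
Proof.
move=> di dj dF dF' dG dG'; rewrite /bracket_loc.
rewrite (gradQ_change di dj dF dF') (gradQ_change di dj dG dG').
rewrite (gradY_change _ di dj dF dF') (gradY_change _ di dj dG dG').
by rewrite (hess_sym _ (gradQ (tloc G i) _)); [ring|exact: overlap_chart].
Qed.

Lemma hamiltonian_vf_grad (F : TsM S -> R) z : hamiltonian_vf F z =
  (gradQ (tloc F (ca z.1)) (chart (ca z.1) z.1, z.2),
   - gradY (tloc F (ca z.1)) (chart (ca z.1) z.1, z.2)).
Proof. by rewrite hamiltonian_vfE tloc.unlock gradQ.unlock gradY.unlock. Qed.

Lemma poissonE (F G : TsM S -> R) z :
  poisson F G z = bracket_loc F G (ca z.1) (TsM_coord (ca z.1) z).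
Proof.
rewrite /poisson !hamiltonian_vf_grad /omega /bracket_loc /TsM_coord (trans_id (dca _)).
by rewrite trmx1 mulmx1 !pairingNl opprK addrC.
Qed.

Lemma poisson_chart (F G : TsM S -> R) i z : TsM_C2 F -> TsM_C2 G -> dom i z.1 ->
  poisson F G z = bracket_loc F G i (TsM_coord i z).
Proof.
move=> F2 G2 di; rewrite poissonE; apply: bracket_change => //.
- by rewrite tloc.unlock; have [+ _] := F2 i; apply; split => //; exact: cod_chart.
- by rewrite tloc.unlock; have [+ _] := F2 (ca z.1); apply; split => //; exact: cod_chart.
- by rewrite tloc.unlock; have [+ _] := G2 i; apply; split => //; exact: cod_chart.
- by rewrite tloc.unlock; have [+ _] := G2 (ca z.1); apply; split => //; exact: cod_chart.
Qed.

End Charts.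

Lemma real_ind (R : realType) (P : R -> Prop) (b : R) : 0 <= b -> P 0 ->
  (forall t : R, 0 <= t -> t < b -> (forall s : R, 0 <= s <= t -> P s) ->
     exists2 e : R, 0 < e & forall s : R, t <= s -> s <= t + e -> s <= b -> P s) ->
  (forall t : R, 0 < t -> t <= b -> (forall s : R, 0 <= s -> s < t -> P s) -> P t) ->
  forall t : R, 0 <= t -> t <= b -> P t.
Proof.
move=> b0 P0 Pr Pl; pose A := [set t : R | 0 <= t <= b /\ forall s : R, 0 <= s <= t -> P s].
have A0 : A 0.
  by split=> [|s]; [rewrite lexx|rewrite -eq_le => /eqP <-].
have hA : has_sup A by split; [exists 0|exists b => t [/andP[]]].
set m := sup A.
have m0 : 0 <= m by exact: sup_upper_bound.
have mb : m <= b by apply: ge_sup; [exists 0|move=> t [/andP[]]].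
have Am s : 0 <= s -> s < m -> P s.
  move=> s0 sm; have e0 : 0 < m - s by rewrite subr_gt0.
  have [t [_ At] st] := sup_adherent e0 hA; apply: At.
  by rewrite s0 ltW //; rewrite -/m in st; move: st; lra.
have Pm : P m.
  by have [->|mn0] := eqVneq m 0; [exact: P0|apply: Pl => //; rewrite lt_def mn0 m0].
have AAm s : 0 <= s <= m -> P s.
  by move=> /andP[s0]; rewrite le_eqVlt => /orP[/eqP -> //|]; exact: Am.
have [mb'|bm] := ltP m b; last first.
  by move=> t t0 tb; apply: AAm; rewrite t0 (le_trans tb).
have [e e0 He] := Pr m m0 mb' AAm.
have : A (Num.min (m + e) b).
  split=> [|s /andP[s0]]; first by rewrite le_min ge_min lexx orbT !andbT; apply/andP; split; lra.
  rewrite le_min => /andP[s1 s2].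
  by have [sm|/ltW sm] := lerP s m; [apply: AAm; rewrite s0|exact: He].
move=> /(sup_upper_bound hA); rewrite -/m /Num.min; case: ifP; lra.
Qed.

Record patches (R : realType) (n : nat) (M : ptopologicalType) (S : smooth_manifold R n M) :=
  Patches {
  pcard : nat;
  idx : 'I_pcard -> chart_index S;
  ctr : 'I_pcard -> 'rV[R]_n;
  rad : 'I_pcard -> R;
  rad_gt0 : forall d, 0 < rad d;
  pcover : forall x, exists2 d, dom (idx d) x & `|chart (idx d) x - ctr d| < rad d;
  pcod : forall d y, `|y - ctr d| <= 4 * rad d -> cod (idx d) y }.

Local Notation pchart d := (chart (idx d)).
Local Notation coord := TsM_coord.
Local Notation pcoord d := (TsM_coord (idx d)).
Local Notation ploc K d := (tloc K (idx d)).

Section Ham.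
Context {R : realType} {n : nat} {M : ptopologicalType}.
Variable S : smooth_manifold R n M.
Local Notation V := 'rV[R]_n.
Local Notation ca := (chart_at S).
Let dca x : dom (ca x) x := @dom_chart_at _ _ _ S x.
Implicit Types (i j : chart_index S) (G K : TsM S -> R).

Lemma chart_ball i x : dom i x -> exists2 r : R, 0 < r &
  forall y, `|y - chart i x| <= r -> cod i y.
Proof.
move=> dx; have : nbhs (chart i x) (cod i).
  by apply: open_nbhs_nbhs; split; [exact: open_cod|exact: cod_chart].
move=> /nbhs_ballP[r /= r0 rP]; exists (r / 2) => [|y yr]; first lra.
by apply: rP; rewrite -ball_normE /= distrC; apply: le_lt_trans yr _; lra.
Qed.

Lemma near_chart i x (r : R) : dom i x -> 0 < r ->
  \forall x' \near x, dom i x' /\ `|chart i x' - chart i x| < r.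
Proof.
move=> dx r0; apply: filterI; first exact: near_dom.
have := @chart_continuous _ _ _ S i x dx => /cvgrPdist_lt /(_ r r0).
by apply: filterS => x' ; rewrite distrC.
Qed.

Lemma patches_ex : compact [set: M] -> inhabited (patches S).
Proof.
move=> cM; have /choice[r rP] (x : M) : exists r : R, 0 < r /\
    forall y, `|y - chart (ca x) x| <= 4 * r -> cod (ca x) y.
  have [r r0 rP] := chart_ball (dca x); exists (r / 4); split=> [|y]; first lra.
  by rewrite mulrC divfK ?pnatr_eq0 //; exact: rP.
have cM' : cover_compact [set: M] by rewrite -compact_cover.
pose U x := [set x' | dom (ca x) x' /\ `|chart (ca x) x' - chart (ca x) x| < r x].
have /(_ M setT (fun x => (U x)^°)) [||D _ DU] := cM'.
- by move=> x _; exact: open_interior.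
- move=> x _; exists x => //; have [r0 _] := rP x; exact: near_chart.
pose s := in_tuple (finmap.enum_fset D).
split; apply: (@Patches _ _ _ S (size s) (fun d => ca (tnth s d))
  (fun d => chart (ca (tnth s d)) (tnth s d)) (fun d => r (tnth s d))).
- by move=> d; have [] := rP (tnth s d).
- move=> x; have [x0 Dx0 /interior_subset [dx0 xr]] := DU x I.
  have : x0 \in s by [].
  by move=> /tnthP[d E]; exists d; rewrite -E.
- by move=> d y; have [_] := rP (tnth s d); exact.
Qed.

Lemma tloc_C2 G i : TsM_C2 G -> Ck 2 (cod i `*` setT) (tloc G i).
Proof. by rewrite tloc.unlock. Qed.

Lemma tloc_diff G i z : TsM_C2 G -> cod i z.1 -> differentiable (tloc G i) z.
Proof. by move=> /(tloc_C2 i)[+ _] cz; apply. Qed.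

Lemma tloc_diff_coord G i z : TsM_C2 G -> dom i z.1 ->
  differentiable (tloc G i) (TsM_coord i z).
Proof. by move=> G2 dz; apply: tloc_diff => //; exact: cod_chart. Qed.

Definition hfield G i (z : V * V) : V * V :=
  ham_field (gradY (tloc G i)) (gradQ (tloc G i)) z.

Definition ham_at G (zeta : R -> TsM S) (t : R) : Prop :=
  {for t, continuous (fun s => (zeta s).1 : M)} /\
  forall i, dom i (zeta t).1 ->
    is_derive t 1 (fun s => TsM_coord i (zeta s)) (hfield G i (TsM_coord i (zeta t))).

Lemma near_curve_dom (zeta : R -> TsM S) (t : R) i :
  {for t, continuous (fun s => (zeta s).1 : M)} -> dom i (zeta t).1 ->
  \forall s \near t, dom i (zeta s).1.
Proof. by move=> ct dt; apply: ct; exact: near_dom. Qed.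

Lemma ham_at_chart G (zeta : R -> TsM S) (t : R) i : TsM_C2 G -> dom i (zeta t).1 ->
  {for t, continuous (fun s => (zeta s).1 : M)} ->
  is_derive t 1 (fun s => TsM_coord i (zeta s)) (hfield G i (TsM_coord i (zeta t))) ->
  ham_at G zeta t.
Proof.
move=> G2 di ct dzi; split=> // j dj; move: (dzi) => /is_derive_pairP[/= dy dq].
set z := zeta t in di dj dy dq *.
have oy : overlap i j (chart i z.1) by exact: overlap_chart.
have Ni := near_curve_dom ct di; have Nj := near_curve_dom ct dj.
have dG := tloc_diff_coord G2 di; have dG' := tloc_diff_coord G2 dj.
have gQ := gradQ_change di dj dG dG'.
have dyj : is_derive t 1 (fun s => chart j (zeta s).1) (gradQ (tloc G j) (TsM_coord j z)).
  have := @is_derive_dr _ _ _ (chart j \o param i) _ _ _ (transition_diff oy) dy.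
  rewrite -transE -gQ; apply: near_eq_is_derive.
  by apply: filterS Ni => s ds /=; rewrite chartK.
apply/is_derive_pairP; split=> //=; apply/is_derive_rVP => k; rewrite mxE.
pose psi : V -> V := chart i \o param j.
have oj : overlap j i (chart j z.1) by exact: overlap_chart.
have dpsi : differentiable (fun y : V => dr psi y (delta_mx 0 k)) (chart j z.1).
  rewrite -dr_fun; have [_ /(_ (delta_mx 0 k)) [H _]] := @transition_Ck _ _ _ S j i 2; exact: H.
have dp := is_derive_pairing dq (is_derive_dr dpsi dyj).
rewrite -transE -/(hess j i _ _ _ _) pairingNl in dp.
have gY := gradY_change (delta_mx 0 k) dj di dG' dG.
rewrite -/z gY (hess_sym _ _ _ oj) /= opprD -addrA addNr addr0 pairing_delta in dp.
apply: near_eq_is_derive dp.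
apply: filterS (filterI Ni Nj) => s [ds ds'].
rewrite -/(TsM_coord i _).2 -/(TsM_coord j _).2.
rewrite -transE pairing_mulmx pairing_delta; congr (_ 0 k).
by have := coord_change ds' ds; rewrite /= => ->.
Qed.

Lemma ham_of_coord G i (c : R -> V * V) (t : R) : TsM_C2 G -> cod i (c t).1 ->
  is_derive t 1 c (hfield G i (c t)) -> ham_at G (fun s => tprm i (c s)) t.
Proof.
move=> G2 ct dc; have cc := is_derive_continuous dc.
have c1 : {for t, continuous (fun s => (c s).1)}.
  by have [+ _] := (is_derive_pairP _ _ _).1 dc; exact: is_derive_continuous.
have Nc : \forall s \near t, cod i (c s).1.
  by apply: c1; apply: open_nbhs_nbhs; split => //; exact: open_cod.
apply: (@ham_at_chart _ _ _ i) => //.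
- by rewrite tprmE /=; exact: dom_param.
- rewrite /prop_for /continuous_at.
  have -> : (fun s => (tprm i (c s)).1) = (fun s => param i (c s).1 : M).
    by apply/funext => s; rewrite tprmE.
  rewrite tprmE /=; apply: (@continuous_comp _ _ _ (fun s => (c s).1) (param i)) => //.
  exact: param_continuous.
- rewrite tprmK //; apply: near_eq_is_derive dc.
  by apply: filterS Nc => s cs; rewrite tprmK.
Qed.

Lemma ham_at_near G (z1 z2 : R -> TsM S) (t : R) :
  (\forall s \near t, z1 s = z2 s) -> ham_at G z1 t -> ham_at G z2 t.
Proof.
move=> E [ct dz]; have Et := nbhs_singleton E; split.
  rewrite /prop_for /continuous_at -Et; apply: cvg_trans ct.
  by apply: near_eq_cvg; apply: filterS E => s ->.
rewrite -Et => i di; apply: near_eq_is_derive (dz i di).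
by apply: filterS E => s ->.
Qed.

Lemma ham_at_shift G (zeta : R -> TsM S) (a t : R) :
  ham_at G zeta (a + t) -> ham_at G (fun s => zeta (a + s)) t.
Proof.
move=> [ct dz]; split=> [|i di]; last by apply: (@is_derive_shiftl _ _ (fun s => TsM_coord i (zeta s))); exact: dz.
apply: (@continuous_comp _ _ _ (fun s => a + s) (fun s => (zeta s).1 : M)) => //.
by apply: continuousD; [exact: cvg_cst|exact: cvg_id].
Qed.

Lemma ham_conserve G K (zeta : R -> TsM S) (T : R) : TsM_C2 G -> TsM_C2 K ->
  (forall z, poisson K G z = 0) -> (forall t : R, `|t| < T -> ham_at G zeta t) ->
  forall t : R, `|t| < T -> K (zeta t) = K (zeta 0).
Proof.
move=> G2 K2 KG hz; apply: constant_of_derive0 => t tT.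
have [ct dz] := hz t tT; set i := ca (zeta t).1.
have di : dom i (zeta t).1 by exact: dca.
have := is_derive_dr (tloc_diff_coord K2 di) (dz i di).
rewrite (_ : dr _ _ _ = 0); last first.
  by rewrite dr_grad /= pairingNr -(KG (zeta t)) (poisson_chart K2 G2 di) (pairingC (gradQ (tloc K i) _)).
apply: near_eq_is_derive; apply: filterS (near_curve_dom ct di) => s ds.
by rewrite tloc_coord.
Qed.

End Ham.

Section ClampV.
Context {R : realType} {n : nat}.
Local Notation V := 'rV[R]_n.
Implicit Types (y a : V) (r b : R) (z : V * V).

Definition clampv r y : V := \row_k clamp r (y 0 k).

Lemma clampv_le r y : 0 <= r -> `|clampv r y| <= r.
Proof. by move=> r0; apply: norm_rV_le => // k; rewrite mxE; exact: clampP. Qed.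

Lemma clampv_id r y : `|y| <= r -> clampv r y = y.
Proof.
by move=> yr; apply/rowP => k; rewrite mxE clamp_id // (le_trans (norm_coord _ _)).
Qed.

Lemma clampv_lip r y y' : 0 <= r -> `|clampv r y - clampv r y'| <= `|y - y'|.
Proof.
move=> r0; apply: norm_rV_le => // k; rewrite !mxE (le_trans (clamp_lip _ _ r0)) //.
by have := norm_coord (y - y') k; rewrite !mxE.
Qed.

Definition clamp_box a r b z : V * V := (a + clampv r (z.1 - a), clampv b z.2).

Lemma clamp_boxP a r b z : 0 <= r -> 0 <= b -> box a r b (clamp_box a r b z).
Proof. by move=> r0 b0; split=> /=; [rewrite addrC addKr|]; exact: clampv_le. Qed.

Lemma clamp_box_id a r b z : box a r b z -> clamp_box a r b z = z.
Proof.
by case: z => y q [/= ya qb]; rewrite /clamp_box !clampv_id // addrC subrK.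
Qed.

Lemma clamp_box_lip a r b z z' : 0 <= r -> 0 <= b ->
  `|clamp_box a r b z - clamp_box a r b z'| <= `|z - z'|.
Proof.
move=> r0 b0; apply: norm_pair_le => /=.
  rewrite opprD addrACA subrr add0r (le_trans (clampv_lip _ _ r0)) //.
  by rewrite opprB addrA subrK; exact: (norm_pair1 (z - z')).
by rewrite (le_trans (clampv_lip _ _ b0)) //; exact: (norm_pair2 (z - z')).
Qed.

End ClampV.

Section Flow.
Context {R : realType} {n : nat} {M : ptopologicalType} (S : smooth_manifold R n M) (P : patches S).
Local Notation V := 'rV[R]_n.
Implicit Types (G K : TsM S -> R) (d : 'I_(pcard P)).

Definition pbox d b : set (V * V) := box (ctr d) (4 * rad d) b.

Definition reg_patch G d b C k : Prop :=
  reg_on (pbox d b) C k (ploc G d) (gradY (ploc G d)) (gradQ (ploc G d)).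

Lemma pbox_cod d b z : pbox d b z -> cod (idx d) z.1.
Proof. by move=> [zr _]; exact: pcod. Qed.

Lemma reg_const G b : TsM_C2 G -> 0 <= b ->
  exists2 C : R, 0 <= C & forall d, reg_patch G d b C (- (n%:R * C)).
Proof.
move=> G2 b0.
have [||C C0 HC] := @fin_bound _ _ (fun d C => reg_patch G d b C (- (n%:R * C))); last 1 first.
- by exists C.
- move=> d; have sub : pbox d b `<=` cod (idx d) `*` setT by move=> z /pbox_cod.
  have [C C0 [H1 H2 H3 H4]] := Ck2_box_reg (tloc_C2 (idx d) G2) sub.
  exists C => //; split => // z z' zA zA' E; rewrite mulNr lerNl.
  apply: le_trans (ler_norm _) _; rewrite normrN (le_trans (pairing_norm _ _)) //.
  rewrite expr2 -!mulrA ler_wpM2l // mulrA ler_wpM2r //.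
  apply: le_trans (H3 _ _ zA zA') _; rewrite ler_wpM2l //.
  by apply: norm_pair_le => /=; rewrite ?E ?subrr ?normr0.
- move=> d B B' BB' [H1 H2 H3 H4 H5]; split=> // [z z' zA zA'|z z' zA zA'|z zA|z z' zA zA' E].
  + by apply: le_trans (H2 _ _ zA zA') _; rewrite ler_wpM2r.
  + by apply: le_trans (H3 _ _ zA zA') _; rewrite ler_wpM2r.
  + by have [h1 h2] := H4 z zA; split; [apply: le_trans h1 _|apply: le_trans h2 _].
  + by apply: le_trans (H5 _ _ zA zA' E); rewrite ler_wpM2r ?sqr_ge0 // lerN2 ler_wpM2l.
Qed.

Definition proper_on K (E b : R) : Prop := forall d y q,
  `|y - ctr d| <= 4 * rad d -> ploc K d (y, q) <= E -> `|q| <= b.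

(* Any solution started at energy at most [E] in the middle third of a patch stays in this patch
   for times up to [del]. *)
Definition flow_const K G (E b C del : R) : Prop :=
  [/\ 0 <= b /\ 0 < C /\ 0 < del, proper_on K E b,
      forall d, reg_patch G d (b + 1) C (- (n%:R * C)),
      forall d, C * del <= rad d & C * del <= 2^-1].

Lemma flow_const_ex K G E : TsM_C2 G -> (exists b, proper_on K E b) ->
  exists b C del, flow_const K G E b C del.
Proof.
move=> G2 [b bP]; pose b' := Num.max 0 b.
have b'0 : 0 <= b' by rewrite le_max lexx.
have bP' : proper_on K E b'.
  by move=> d y q yr KE; rewrite le_max (bP d y q yr KE) orbT.
have [|C C0 HC] := @reg_const G (b' + 1) G2; first lra.
pose C' := C + 1.
have C'0 : 0 < C' by rewrite /C'; lra.
have [||B B0 HB] := @fin_bound _ _ (fun d B => C' / rad d <= B).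
- by move=> d; exists (C' / rad d) => //; rewrite divr_ge0 // ltW ?rad_gt0.
- by move=> d B B' BB' /le_trans; exact.
pose del := (2 * C' + B)^-1.
have D0 : 0 < 2 * C' + B by rewrite ltr_wpDr // mulr_gt0.
exists b', C', del; split => //.
- by rewrite b'0 C'0 invr_gt0.
- move=> d; have [H1 H2 H3 H4 H5] := HC d.
  have CC : C <= C' by rewrite /C'; lra.
  split=> // [z z' zA zA'|z z' zA zA'|z zA|z z' zA zA' Ez].
  + by apply: le_trans (H2 _ _ zA zA') _; rewrite ler_wpM2r.
  + by apply: le_trans (H3 _ _ zA zA') _; rewrite ler_wpM2r.
  + by have [h1 h2] := H4 z zA; split; [apply: le_trans h1 _|apply: le_trans h2 _].
  + by apply: le_trans (H5 _ _ zA zA' Ez); rewrite ler_wpM2r ?sqr_ge0 // lerN2 ler_wpM2l.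
- move=> d; have r0 := rad_gt0 d; have := HB d.
  rewrite ler_pdivrMr // => h; rewrite /del ler_pdivrMr // (le_trans h) // mulrC ler_wpM2l ?ltW //.
  by rewrite ltrDr mulr_gt0.
- by rewrite /del ler_pdivrMr //; lra.
Qed.

Section Energy.
Variables (K G : TsM S -> R).
Hypothesis (K2 : TsM_C2 K) (G2 : TsM_C2 G).
Hypothesis KG0 : forall z, poisson K G z = 0.
Variables (E b C del : R).
Hypothesis cst : flow_const K G E b C del.

Lemma energy_pbox d z : dom (idx d) z.1 -> K z <= E ->
  `|pchart d z.1 - ctr d| <= 4 * rad d -> pbox d b (pcoord d z).
Proof.
move=> dz KE zr; split=> //; have [_ bP _ _ _] := cst; apply: (bP d _ _ zr).
by have := tloc_coord K dz; rewrite /coord /= => ->.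
Qed.

Lemma pboxS d z : pbox d b z -> pbox d (b + 1) z.
Proof. by move=> [h1 h2]; split=> //; apply: le_trans h2 _; rewrite lerDl. Qed.

Lemma hfield_le d z : pbox d (b + 1) z -> `|hfield G (idx d) z| <= C.
Proof.
have [_ _ reg _ _] := cst; have [_ _ _ H _] := reg d.
by move=> /H[h1 h2]; apply: norm_pair_le => //=; rewrite normrN.
Qed.

Lemma ham_local d z : dom (idx d) z.1 -> `|pchart d z.1 - ctr d| <= 3 * rad d -> K z <= E ->
  exists2 zeta : R -> TsM S, zeta 0 = z & forall t : R, `|t| < del -> ham_at G zeta t.
Proof.
have [[b0 [C0 del0]] bP reg Cd1 Cd2] := cst.
move=> dz zr KE; have r0 := rad_gt0 d.
have r3 : 0 <= 4 * rad d by lra.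
have b1 : 0 <= b + 1 by lra.
pose cl := clamp_box (ctr d) (4 * rad d) (b + 1).
have clP w : pbox d (b + 1) (cl w) by exact: clamp_boxP.
have fL w w' : `|hfield G (idx d) (cl w) - hfield G (idx d) (cl w')| <= C * `|w - w'|.
  apply: le_trans (ham_field_lip (reg d) (clP _) (clP _)) _.
  by apply: ler_wpM2l; [exact: ltW|exact: clamp_box_lip].
have [x x0 dx] := @ode_local _ _ (hfield G (idx d) \o cl) C (pcoord d z) C0 fL.
have delC : del <= (2 * C)^-1.
  rewrite -(ler_pM2l C0) (le_trans Cd2) // invfM mulrCA divff ?mulr1 // gt_eqF //.
have xin t : `|t| < del -> pbox d (b + 1) (x t).
  move=> tdel; have := @MVT_norm_pair _ _ x (fun s => hfield G (idx d) (cl (x s))) t C (ltW C0).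
  have h1 : `|t| < (2 * C)^-1 by exact: lt_le_trans tdel delC.
  move=> /(_ (fun s st => dx s (le_lt_trans st h1)) (fun s st => hfield_le (clP _))).
  rewrite x0 => H.
  have H' : `|x t - pcoord d z| <= C * del.
    by apply: le_trans H _; rewrite ler_wpM2l // ltW.
  have [zr3 qb] : pbox d b (pcoord d z) by apply: energy_pbox => //; lra.
  have Cd1d := Cd1 d.
  split.
    rewrite -(subrK (pcoord d z).1 (x t).1) -addrA (le_trans (ler_normD _ _)) //.
    have := norm_pair1 (x t - pcoord d z); rewrite /= in zr *; lra.
  rewrite -(subrK (pcoord d z).2 (x t).2) (le_trans (ler_normD _ _)) //.
  have := norm_pair2 (x t - pcoord d z); rewrite /= in qb *; lra.
exists (fun t => tprm (idx d) (x t)); first by rewrite x0 coordK.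
move=> t tdel; have xt := xin t tdel; apply: ham_of_coord => //; first exact: pbox_cod xt.
by have := dx t (lt_le_trans tdel delC); rewrite /= /cl (clamp_box_id xt).
Qed.

Lemma closed_chart_ball d (y0 : V) (r : R) :
  (forall y, `|y - y0| <= r -> cod (idx d) y) ->
  closed [set x | dom (idx d) x /\ `|pchart d x - y0| <= r].
Proof.
move=> sub; rewrite (_ : mkset _ = param (idx d) @` [set y | `|y - y0| <= r]).
  apply: compact_closed; first exact: (hausdorffM S).
  apply: continuous_compact; last exact: compact_ball.
  by apply: continuous_in_subspaceT => y; rewrite inE => /sub; exact: param_continuous.
apply/seteqP; split=> [x [dx xr]|x [y yr <-]].
  by exists (pchart d x) => //; exact: chartK.
by have cy := sub y yr; split; [exact: dom_param|rewrite paramK].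
Qed.

Lemma ham_stay d (zeta : R -> TsM S) (T : R) :
  (forall t : R, `|t| < T -> ham_at G zeta t) -> K (zeta 0) <= E ->
  dom (idx d) (zeta 0).1 -> `|pchart d (zeta 0).1 - ctr d| <= 3 * rad d ->
  forall t : R, `|t| < T -> `|t| <= del ->
    dom (idx d) (zeta t).1 /\ `|pchart d (zeta t).1 - pchart d (zeta 0).1| <= C * `|t|.
Proof.
have [[b0 [C0 del0]] bP reg Cd1 Cd2] := cst.
move=> hz KE d0 y0r t tT tdel; have r0 := rad_gt0 d.
have Cd1d := Cd1 d.
set y0 := pchart d (zeta 0).1 in y0r *.
pose Q s := dom (idx d) (zeta s).1 /\ `|pchart d (zeta s).1 - y0| <= C * `|s|.
have KEs s : `|s| < T -> K (zeta s) <= E by move=> sT; rewrite (ham_conserve G2 K2 KG0 hz).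
have in3 y : `|y - y0| <= rad d -> `|y - ctr d| <= 4 * rad d.
  move=> yr; rewrite -(subrK y0 y) -addrA (le_trans (ler_normD _ _)) //; lra.
suff H : forall s, 0 <= s -> s <= `|t| -> Q s /\ Q (- s).
  have [h1 h2] := H `|t| (normr_ge0 _) (lexx _).
  case: (leP 0 t) => t0.
    by move: h1; rewrite /Q normr_id (ger0_norm t0).
  by move: h2; rewrite /Q normrN normr_id (ltr0_norm t0) opprK.
have step u : `|u| < `|t| -> Q u -> exists2 e : R, 0 < e & forall s, `|s - u| <= e ->
    dom (idx d) (zeta s).1 /\
    `|pchart d (zeta s).1 - pchart d (zeta u).1| <= C * `|s - u|.
  move=> ut [du yu].
  have uT : `|u| < T by exact: lt_trans ut tT.
  have rr : 0 < rad d - C * `|u|.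
    have : C * `|u| < C * del by rewrite ltr_pM2l //; lra.
    lra.
  have [cu _] := hz u uT.
  have := near_chart du rr => /cu; rewrite /= => /nbhs_ballP[e1 /= e10 e1P].
  pose e := Num.min (e1 / 2) ((T - `|u|) / 2).
  have e0 : 0 < e by rewrite /e lt_min; apply/andP; split; lra.
  have e1P' s : `|s - u| <= e -> dom (idx d) (zeta s).1 /\
      `|pchart d (zeta s).1 - pchart d (zeta u).1| < rad d - C * `|u|.
    move=> su; apply: e1P; rewrite -ball_normE /= distrC; apply: le_lt_trans su _.
    by rewrite gt_min; apply/orP; left; lra.
  exists e => // s su; split; first by have [] := e1P' s su.
  have := @MVT_norm_pair _ _ (fun v => pcoord d (zeta (u + v)))
    (fun v => hfield G (idx d) (pcoord d (zeta (u + v)))) (s - u) C (ltW C0).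
  have vP v : `|v| <= `|s - u| -> `|u + v| < T /\ `|u + v - u| <= e.
    move=> vs; have ve := le_trans vs su; rewrite addrAC subrr add0r; split => //.
    apply: le_lt_trans (ler_normD _ _) _.
    have : e <= (T - `|u|) / 2 by rewrite ge_min lexx orbT.
    lra.
  rewrite addr0 (addrC u (s - u)) subrK => /(_ _ _)/(le_trans (norm_pair1 _)); apply.
    move=> v vs; have [vT ve] := vP v vs; have [dv _] := e1P' _ ve.
    have [_ H] := hz _ vT.
    exact: (@is_derive_shiftl _ _ (fun v => pcoord d (zeta v))) (H _ dv).
  move=> v vs; have [vT ve] := vP v vs; have [dv yv] := e1P' _ ve.
  apply: hfield_le; apply: pboxS; apply: energy_pbox => //; first exact: KEs.
  apply: in3; apply: le_trans (ler_distD (pchart d (zeta u).1) _ _) _.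
  by move: yv yu; move: (`|_ - y0|) (`|_ - _|) (C * _) => A B D; lra.
apply: real_ind => //.
- by rewrite oppr0 /Q subrr !normr0 mulr0.
- move=> s s0 st Hs; have [Q1 Q2] := Hs s (introT andP (conj s0 (lexx s))).
  have s1 : `|s| < `|t| by rewrite ger0_norm.
  have s2 : `|- s| < `|t| by rewrite normrN.
  have [e1 e10 H1] := step _ s1 Q1; have [e2 e20 H2] := step _ s2 Q2.
  exists (Num.min e1 e2) => [|v sv ve vt]; first by rewrite lt_min e10.
  have v0 : 0 <= v by lra.
  have ve12 : v - s <= e1 /\ v - s <= e2.
    by move: ve; rewrite -lerBlDl le_min => /andP.
  have [ve1 ve2] := ve12.
  have [|h1 h2] := H1 v; first by rewrite ger0_norm // subr_ge0.
  have vsE : `|- v - - s| = v - s by rewrite -opprD normrN ger0_norm // subr_ge0.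
  have [|h3 h4] := H2 (- v); first by rewrite vsE.
  have [_ Q1'] := Q1; have [_ Q2'] := Q2.
  split; split => //.
    apply: le_trans (ler_distD (pchart d (zeta s).1) _ _) _.
    apply: le_trans (lerD h2 Q1') _.
    by rewrite (ger0_norm s0) (ger0_norm v0) ger0_norm ?subr_ge0 // -mulrDr subrK.
  apply: le_trans (ler_distD (pchart d (zeta (- s)).1) _ _) _.
  apply: le_trans (lerD h4 Q2') _.
  by rewrite vsE !normrN (ger0_norm s0) (ger0_norm v0) -mulrDr subrK.
- move=> s s0 st Hs.
  have lim (sg : bool) : Q (if sg then s else - s).
    set u := if sg then s else - s.
    have us : `|u| = s by rewrite /u; case: (sg); rewrite ?normrN gtr0_norm.
    have uT : `|u| < T by rewrite us (le_lt_trans st).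
    have Cs : C * s <= rad d.
      exact: le_trans (ler_wpM2l (ltW C0) (le_trans st tdel)) (Cd1 d).
    have cl : closed [set x | dom (idx d) x /\ `|pchart d x - y0| <= C * s].
      apply: closed_chart_ball => y ys; apply: pcod; apply: in3; lra.
    rewrite /Q us; have [//|nB] := pselect ([set x | dom (idx d) x /\
      `|pchart d x - y0| <= C * s] (zeta u).1).
    have [cu _] := hz u uT.
    have oB := closed_openC cl.
    have := @open_nbhs_nbhs _ _ _ (conj oB nB) => /cu; rewrite /= => /nbhs_ballP[e /= e0 eP].
    pose v := s - Num.min (e / 2) (s / 2).
    have m0 : 0 < Num.min (e / 2) (s / 2) by rewrite lt_min; apply/andP; split; lra.
    have v0 : 0 <= v.
      have : Num.min (e / 2) (s / 2) <= s / 2 by rewrite ge_min lexx orbT.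
      rewrite /v; lra.
    have vs : v < s by rewrite /v; lra.
    have [Q1 Q2] := Hs v v0 vs.
    have me : Num.min (e / 2) (s / 2) < e.
      have : Num.min (e / 2) (s / 2) <= e / 2 by rewrite ge_min lexx.
      lra.
    have vC : C * v <= C * s by rewrite ler_wpM2l ?ltW.
    case: (sg) @u us uT nB oB cu eP => u us uT nB oB cu eP.
      have : ball u e v.
        by rewrite -ball_normE /= /u /v opprB addrC subrK gtr0_norm.
      move=> /eP; case; have [h1 h2] := Q1; split=> //.
      by move: h2; rewrite ger0_norm //; lra.
    have : ball u e (- v).
      rewrite -ball_normE /= (_ : u - - v = - Num.min (e / 2) (s / 2)).
        by rewrite normrN gtr0_norm.
      by rewrite /u /v; ring.
    move=> /eP; case; have [h1 h2] := Q2; split=> //.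
    by move: h2; rewrite normrN ger0_norm //; lra.
  by split; [exact: (lim true)|exact: (lim false)].
Qed.

End Energy.
End Flow.

Section Flow.
Context {R : realType} {n : nat} {M : ptopologicalType} (S : smooth_manifold R n M) (P : patches S).
Local Notation V := 'rV[R]_n.
Implicit Types (d : 'I_(pcard P)).
Variables (K G : TsM S -> R).
Hypothesis (K2 : TsM_C2 K) (G2 : TsM_C2 G).
Hypothesis KG0 : forall z, poisson K G z = 0.

Lemma pcover2 x : exists2 d : 'I_(pcard P), dom (idx d) x & `|pchart d x - ctr d| <= 3 * rad d.
Proof.
have [d dx xr] := pcover P x; exists d => //; have r0 := rad_gt0 d.
by have := ltW xr; lra.
Qed.

Lemma coord_inj i (z w : TsM S) : dom i z.1 -> dom i w.1 ->
  coord i z = coord i w -> z = w.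
Proof. by move=> dz dw E; rewrite -(coordK dz) E coordK. Qed.

Section Energy.
Variables (E b C del : R).
Hypothesis cst : flow_const P K G E b C del.

Lemma ham_stay_box d (zeta : R -> TsM S) (T : R) :
  (forall t : R, `|t| < T -> ham_at G zeta t) -> K (zeta 0) <= E ->
  dom (idx d) (zeta 0).1 -> `|pchart d (zeta 0).1 - ctr d| <= 3 * rad d ->
  forall t : R, `|t| < T -> `|t| <= del -> [/\ dom (idx d) (zeta t).1,
    pbox d b (pcoord d (zeta t)) &
    is_derive t 1 (fun s => pcoord d (zeta s)) (hfield G (idx d) (pcoord d (zeta t)))].
Proof.
move=> hz KE d0 zr t tT tdel.
have [dt yt] := ham_stay K2 G2 KG0 cst hz KE d0 zr tT tdel.
have [[b0 [C0 del0]] _ _ Cd1 _] := cst.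
split => //; last by have [_] := hz t tT; exact.
apply: (energy_pbox cst) => //; first by rewrite (ham_conserve G2 K2 KG0 hz).
apply: le_trans (ler_distD (pchart d (zeta 0).1) _ _) _.
have := le_trans yt (le_trans (ler_wpM2l (ltW C0) tdel) (Cd1 d)).
by move: zr; lra.
Qed.

Lemma ham_unique_step (z1 z2 : R -> TsM S) (T : R) :
  (forall t : R, `|t| < T -> ham_at G z1 t) -> (forall t : R, `|t| < T -> ham_at G z2 t) ->
  K (z1 0) <= E -> z1 0 = z2 0 -> forall t : R, `|t| < T -> `|t| <= del -> z1 t = z2 t.
Proof.
move=> h1 h2 KE E0 t tT tdel; have [d dx xr] := pcover2 (z1 0).1.
have [[b0 [C0 del0]] _ reg Cd1 Cd2] := cst.
have H1 := ham_stay_box h1 KE dx xr.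
have H2 : forall t : R, `|t| < T -> `|t| <= del -> [/\ dom (idx d) (z2 t).1,
    pbox d b (pcoord d (z2 t)) &
    is_derive t 1 (fun s => pcoord d (z2 s)) (hfield G (idx d) (pcoord d (z2 t)))].
  by apply: ham_stay_box => //; rewrite -E0.
have [d1 _ _] := H1 t tT tdel; have [d2 _ _] := H2 t tT tdel.
apply: (coord_inj d1 d2); apply/esym/eqP; rewrite -subr_eq0 -normr_le0.
have [] := @flow_close _ _ (pbox d (b + 1)) C _ _ _ _ (fun s => pcoord d (z1 s))
  (fun s => pcoord d (z2 s)) t (ltW C0) _ (reg d).
- by apply: le_trans (ler_wpM2l (ltW C0) tdel) Cd2.
- move=> s st; have [_ h3 h4] := H1 s (le_lt_trans st tT) (le_trans st tdel).
  by split=> //; exact: pboxS.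
- move=> s st; have [_ h3 h4] := H2 s (le_lt_trans st tT) (le_trans st tdel).
  by split=> //; exact: pboxS.
by move=> /(_ t (lexx _)); rewrite E0 subrr normr0 mulr0.
Qed.

Lemma ham_unique (z1 z2 : R -> TsM S) (T : R) :
  (forall t : R, `|t| < T -> ham_at G z1 t) -> (forall t : R, `|t| < T -> ham_at G z2 t) ->
  K (z1 0) <= E -> z1 0 = z2 0 -> forall t : R, `|t| < T -> z1 t = z2 t.
Proof.
move=> h1 h2 KE E0 t tT; have [[b0 [C0 del0]] _ _ _ _] := cst.
pose eta := Num.min del (T - `|t|) / 2.
have Tt : 0 < T - `|t| by rewrite subr_gt0.
have eta0 : 0 < eta by rewrite divr_gt0 // lt_min del0.
have eta1 : eta < T - `|t|.
  have : Num.min del (T - `|t|) <= T - `|t| by rewrite ge_min lexx orbT.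
  by rewrite /eta; move: (Num.min _ _) => m; lra.
have eta2 : eta <= del.
  have : Num.min del (T - `|t|) <= del by rewrite ge_min lexx.
  by rewrite /eta; move: (Num.min _ _) eta0; rewrite /eta => m; lra.
suff H (N : nat) (s : R) : `|s| <= `|t| -> `|s| <= N%:R * eta -> z1 s = z2 s.
  apply: (H (Num.truncn (`|t| / eta)).+1) => //.
  by rewrite -ler_pdivrMr // ltW // truncnS_gt.
elim: N s => [|N IH] s st; first by rewrite mul0r normr_le0 => /eqP ->.
move=> sN; pose s0 := N%:R / N.+1%:R * s.
have N1 : (0 : R) < N.+1%:R by rewrite ltr0n.
have q1 : N%:R / N.+1%:R <= 1 :> R by rewrite ler_pdivrMr // mul1r ler_nat.
have q0 : 0 <= N%:R / N.+1%:R :> R by rewrite divr_ge0.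
have s0s : `|s0| <= `|s| by rewrite normrM (ger0_norm q0) ler_piMl.
have s0t := le_trans s0s st.
have s0E : z1 s0 = z2 s0.
  apply: IH => //; rewrite normrM (ger0_norm q0) mulrAC ler_pdivrMr //.
  by rewrite -mulrA ler_wpM2l // mulrC.
have ds : `|s - s0| <= eta.
  have -> : s - s0 = s / N.+1%:R.
    by rewrite /s0 -natr1; field; rewrite natr1 pnatr_eq0.
  by rewrite normrM normfV (ger0_norm (ltW N1)) ler_pdivrMr // mulrC.
have -> : s = s0 + (s - s0) by rewrite addrC subrK.
apply: (@ham_unique_step (fun v => z1 (s0 + v)) (fun v => z2 (s0 + v)) (T - `|t|)).
- move=> v vT; apply: ham_at_shift; apply: h1; apply: le_lt_trans (ler_normD _ _) _; lra.
- move=> v vT; apply: ham_at_shift; apply: h2; apply: le_lt_trans (ler_normD _ _) _; lra.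
- by rewrite addr0 (ham_conserve G2 K2 KG0 h1) //; lra.
- by rewrite addr0.
- exact: le_lt_trans ds eta1.
- exact: le_trans ds eta2.
Qed.

Lemma ham_double (T : R) : 0 < T ->
  (forall z, K z <= E -> exists2 zeta : R -> TsM S, zeta 0 = z &
     forall t : R, `|t| < T -> ham_at G zeta t) ->
  forall z, K z <= E -> exists2 zeta : R -> TsM S, zeta 0 = z &
     forall t : R, `|t| < 3 / 2 * T -> ham_at G zeta t.
Proof.
move=> T0 H z KE; have [zt z0 hz] := H z KE.
have T2 : `|T / 2| < T by rewrite gtr0_norm; lra.
have T2' : `|- (T / 2)| < T by rewrite normrN.
have KT t : `|t| < T -> K (zt t) <= E by move=> tT; rewrite (ham_conserve G2 K2 KG0 hz) // z0.
have [zp zp0 hp] := H _ (KT _ T2); have [zm zm0 hm] := H _ (KT _ T2').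
have Ep s : 0 < s -> s < T -> zt s = zp (s - T / 2).
  move=> s0 sT; have := @ham_unique (fun v => zt (T / 2 + v)) zp (T / 2).
  rewrite addr0 => /(_ _ _ (KT _ T2) (esym zp0) (s - T / 2)).
  rewrite [X in zt X]addrC subrK; apply.
  - move=> v vT; apply: ham_at_shift; apply: hz; apply: le_lt_trans (ler_normD _ _) _.
    by rewrite gtr0_norm; lra.
  - by move=> v vT; apply: hp; lra.
  - by rewrite ltr_norml; apply/andP; split; lra.
have Em s : - T < s -> s < 0 -> zt s = zm (s + T / 2).
  move=> s0 sT; have := @ham_unique (fun v => zt (- (T / 2) + v)) zm (T / 2).
  rewrite addr0 => /(_ _ _ (KT _ T2') (esym zm0) (s + T / 2)).
  rewrite [X in zt X]addrC addrK; apply.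
  - move=> v vT; apply: ham_at_shift; apply: hz; apply: le_lt_trans (ler_normD _ _) _.
    by rewrite normrN gtr0_norm; lra.
  - by move=> v vT; apply: hm; lra.
  - by rewrite ltr_norml; apply/andP; split; lra.
pose w t := if t < T then (if - T < t then zt t else zm (t + T / 2)) else zp (t - T / 2).
exists w => [|t tT]; first by rewrite /w T0 oppr_lt0 T0.
have [tlt|tge] := ltP `|t| T.
  apply: ham_at_near (hz t tlt).
  have op : open [set s : R | - T < s < T].
    rewrite (_ : mkset _ = `]- T, T[%classic); first exact: interval_open.
    by apply/seteqP; split=> s /=; rewrite in_itv.
  have : nbhs t [set s : R | - T < s < T].
    by apply: open_nbhs_nbhs; split => //=; rewrite -ltr_norml.
  by apply: filterS => s /= /andP[s1 s2]; rewrite /w s1 s2.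
have [t0|t0] := lerP 0 t.
  rewrite ger0_norm // in tge tT.
  apply: (@ham_at_near _ _ _ S G (fun s => zp (s - T / 2))).
    have : nbhs t [set s : R | 0 < s].
      by apply: open_nbhs_nbhs; split => /=; [exact: open_gt|lra].
    apply: filterS => s /= s0; rewrite /w; case: ifP => // sT.
    have -> : - T < s by lra.
    by rewrite Ep.
  have := @ham_at_shift _ _ _ S G zp (- (T / 2)) t.
  under eq_fun do rewrite addrC; apply.
  by apply: hp; rewrite ltr_norml; apply/andP; split; lra.
rewrite ltr0_norm // in tge tT.
apply: (@ham_at_near _ _ _ S G (fun s => zm (s + T / 2))).
  have : nbhs t [set s : R | s < 0].
    by apply: open_nbhs_nbhs; split => //=; exact: open_lt.
  apply: filterS => s /= s0; rewrite /w.
  have -> : s < T by lra.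
  by case: ifP => // sT; rewrite Em.
have := @ham_at_shift _ _ _ S G zm (T / 2) t.
under eq_fun do rewrite addrC; apply.
by apply: hm; rewrite ltr_norml; apply/andP; split; lra.
Qed.

Lemma ham_exists (T : R) z : K z <= E -> exists2 zeta : R -> TsM S, zeta 0 = z &
  forall t : R, `|t| < T -> ham_at G zeta t.
Proof.
have [[b0 [C0 del0]] _ _ _ _] := cst.
suff H (N : nat) : forall z, K z <= E -> exists2 zeta : R -> TsM S, zeta 0 = z &
    forall t : R, `|t| < (1 + N%:R / 2) * del -> ham_at G zeta t.
  move=> KE; have [zt z0 hz] := H (Num.truncn (2 * `|T| / del)).+1 z KE.
  exists zt => // t tT; apply: hz; apply: lt_le_trans tT _.
  apply: le_trans (ler_norm T) _; rewrite -ler_pdivrMr //.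
  have := @truncnS_gt R (2 * `|T| / del); rewrite -[2 * _ / _]mulrA.
  by move=> h; lra.
elim: N => [|N IH] {}z KE.
  have [d dx xr] := pcover2 z.1.
  have [zt z0 hz] := ham_local G2 cst dx xr KE.
  by exists zt => // t; rewrite mul0r addr0 mul1r; exact: hz.
have T0 : 0 < (1 + N%:R / 2) * del by rewrite mulr_gt0 // ltr_pwDl // divr_ge0.
have [zt z0 hz] := ham_double T0 IH KE; exists zt => // t tT; apply: hz.
apply: lt_le_trans tT _; rewrite mulrA; apply: ler_wpM2r; first exact: ltW.
rewrite -natr1.
have : (0 : R) <= N%:R by [].
lra.
Qed.

End Energy.
End Flow.

Section Global.
Context {R : realType} {n : nat} {M : ptopologicalType} (S : smooth_manifold R n M) (P : patches S).
Local Notation V := 'rV[R]_n.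
Local Notation ca := (chart_at S).
Let dca x : dom (ca x) x := @dom_chart_at _ _ _ S x.

Definition hflow (G : TsM S -> R) (t : R) (z : TsM S) : TsM S :=
  get [set w | exists T zeta, [/\ `|t| < T, (forall s : R, `|s| < T -> ham_at G zeta s),
    zeta 0 = z & zeta t = w]].

Definition lagr (G : TsM S -> R) (z : TsM S) : R :=
  ham_lagr (tloc G (ca z.1)) (gradQ (tloc G (ca z.1))) (coord (ca z.1) z).

Definition hact (G : TsM S -> R) (z : TsM S) : R -> R :=
  get [set F : R -> R | F 0 = 0 /\ forall t : R, is_derive t 1 F (lagr G (hflow G t z))].

Lemma lagr_chart (G : TsM S -> R) i z : TsM_C2 G -> dom i z.1 ->
  lagr G z = ham_lagr (tloc G i) (gradQ (tloc G i)) (coord i z).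
Proof.
move=> G2 dz; rewrite /lagr /ham_lagr !tloc_coord //; congr (_ - _).
rewrite (gradQ_change dz (dca z.1)); [|exact: tloc_diff_coord..].
by rewrite pairing_mulmx (coord_change dz (dca z.1)).
Qed.

Lemma ham_lagr_continuous (G : TsM S -> R) i (z : V * V) : TsM_C2 G -> cod i z.1 ->
  {for z, continuous (ham_lagr (tloc G i) (gradQ (tloc G i)))}.
Proof.
move=> G2 cz; pose O := cod i `*` [set: V].
have oO : open O.
  rewrite openE => w [cw _]; have : nbhs w (O : set (V * V)); last by [].
  exists (cod i, setT) => [|w' [h1 h2]] //=; split; last exact: filterT.
  by apply: open_nbhs_nbhs; split => //; exact: open_cod.
have C2 := tloc_C2 i G2; have [dG CG] := C2.
suff : Ck 0 O (ham_lagr (tloc G i) (gradQ (tloc G i))) by apply.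
apply: (@Ck_ext _ _ _ 0 O (fun w => \sum_k w.2 0 k * 'd (tloc G i) w (0, delta_mx 0 k)
   + (-1) * tloc G i w)) => // [w _|].
  by rewrite /ham_lagr pairingE mulN1r; congr (_ - _); apply: eq_bigr => k _; rewrite gradQE.
apply: Ck_add => //; last by apply: Ck_scale => //; apply: Ck_pred; exact: Ck_pred.
apply: Ck_sum => // k; apply: Ck_mul => //; last by apply: Ck_pred; exact: CG.
by apply: Ck_coordr => //= w _; exact: cvg_id.
Qed.

Definition good_pair (K G : TsM S -> R) : Prop :=
  [/\ TsM_C2 K, TsM_C2 G, forall z, poisson K G z = 0 &
      forall E, exists b, proper_on P K E b].

Section GlobalFlow.
Variables (K G : TsM S -> R).
Hypothesis KG : good_pair K G.

Lemma hflowP (T : R) (zeta : R -> TsM S) : (forall s : R, `|s| < T -> ham_at G zeta s) ->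
  forall t : R, `|t| < T -> hflow G t (zeta 0) = zeta t.
Proof.
have [K2 G2 KG0 prop] := KG; move=> hz t tT.
rewrite /hflow; set A := [set w | _].
have : A (get A) by apply: getPex; exists (zeta t), T, zeta.
move=> [T' [xi [tT' hx x0 <-]]].
have [b [C [del cst]]] := flow_const_ex G2 (prop (K (zeta 0))).
apply: (ham_unique K2 G2 KG0 cst (T := Num.min T T')); rewrite ?x0 ?lt_min ?tT ?tT' //.
- by move=> s; rewrite lt_min => /andP[_]; exact: hx.
- by move=> s; rewrite lt_min => /andP[+ _]; exact: hz.
Qed.

Lemma hflow_near z (T : R) : exists2 zeta : R -> TsM S,
  forall s : R, `|s| < T -> ham_at G zeta s & forall s : R, `|s| < T -> zeta s = hflow G s z.
Proof.
have [K2 G2 KG0 prop] := KG.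
have [b [C [del cst]]] := flow_const_ex G2 (prop (K z)).
have [zeta z0 hz] := ham_exists K2 G2 KG0 cst T (lexx (K z)).
by exists zeta => // s sT; rewrite -z0 (hflowP hz).
Qed.

Lemma hflow_ham z t : ham_at G (fun s => hflow G s z) t.
Proof.
have [zeta hz Ez] := hflow_near z (`|t| + 1).
apply: ham_at_near (hz t _); last by rewrite ltrDl.
have : nbhs t (fun s : R => `|s| < `|t| + 1).
  apply: open_nbhs_nbhs; split; last by rewrite ltrDl.
  by apply: (@open_comp _ _ (fun s : R => `|s|) [set y | y < `|t| + 1]) => [s _|]; [exact: norm_continuous|exact: open_lt].
by apply: filterS => s; exact: Ez.
Qed.

Lemma hflow0 z : hflow G 0 z = z.
Proof.
have [K2 G2 KG0 prop] := KG.
have [b [C [del cst]]] := flow_const_ex G2 (prop (K z)).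
have [zeta z0 hz] := ham_exists K2 G2 KG0 cst 1 (lexx (K z)).
by rewrite -[in LHS]z0 (hflowP hz) // normr0.
Qed.

Lemma hflowD s t z : hflow G (s + t) z = hflow G t (hflow G s z).
Proof.
have := @hflowP (`|t| + 1) (fun v => hflow G (s + v) z).
rewrite addr0 => -> //; last by rewrite ltrDl.
by move=> v _; apply: (@ham_at_shift _ _ _ S G (fun v => hflow G v z)); exact: hflow_ham.
Qed.

Lemma hflowNK s z : hflow G (- s) (hflow G s z) = z.
Proof. by rewrite -hflowD subrr hflow0. Qed.

Lemma hflowKN s z : hflow G s (hflow G (- s) z) = z.
Proof. by rewrite -hflowD addNr hflow0. Qed.

Lemma hflow_energy t z : K (hflow G t z) = K z.
Proof.
have [K2 G2 KG0 _] := KG.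
rewrite (ham_conserve G2 K2 KG0 (zeta := fun s => hflow G s z) (T := `|t| + 1)).
- by rewrite hflow0.
- by move=> s _; exact: hflow_ham.
- by rewrite ltrDl.
Qed.

Lemma hactP z : hact G z 0 = 0 /\ forall t : R, is_derive t 1 (hact G z) (lagr G (hflow G t z)).
Proof.
have [K2 G2 KG0 _] := KG; rewrite /hact; set A := [set F | _].
suff : A (get A) by [].
apply: getPex; have [|F F0 dF] := @primitive _ (fun t => lagr G (hflow G t z)).
  move=> t; have [ct dt] := hflow_ham z t; set i := ca (hflow G t z).1.
  have di : dom i (hflow G t z).1 by exact: dca.
  have cc := is_derive_continuous (dt i di).
  have cl := ham_lagr_continuous G2 (cod_chart di : cod i (coord i (hflow G t z)).1).
  rewrite /continuous_at (lagr_chart G2 di); have := continuous_comp cc cl.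
  apply: cvg_trans; apply: near_eq_cvg.
  by apply: filterS (near_curve_dom ct di) => s ds /=; rewrite -lagr_chart.
by exists F.
Qed.

Lemma hact0 z : hact G z 0 = 0. Proof. by have [] := hactP z. Qed.

Lemma is_derive_hact z (t : R) : is_derive t 1 (hact G z) (lagr G (hflow G t z)).
Proof. by have [_] := hactP z. Qed.

Lemma hactD s t z : hact G z (s + t) = hact G z s + hact G (hflow G s z) t.
Proof.
have H := @constant_of_derive0 _ (fun v => hact G z (s + v) - hact G (hflow G s z) v) (`|t| + 1).
have E : hact G z (s + t) - hact G (hflow G s z) t = hact G z (s + 0) - hact G (hflow G s z) 0.
  apply: H.
  - move=> v _; have d1 := is_derive_shiftl (is_derive_hact z (s + v)).
    have d2 := is_derive_hact (hflow G s z) v.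
    rewrite hflowD in d1.
    by rewrite -(subrr (lagr G (hflow G v (hflow G s z)))); exact: is_deriveB.
  - by rewrite ltrDl.
by rewrite addr0 hact0 subr0 in E; rewrite -E subrK.
Qed.

End GlobalFlow.
End Global.

Section MonoSurj.
Context {R : realType} {n : nat}.
Local Notation V := 'rV[R]_n.
Implicit Types (x y : V).

Lemma pairing_eq0 x : pairing x x <= 0 -> x = 0.
Proof.
move=> x0; apply/eqP; rewrite -normr_le0 -(@ler_pXn2r _ 2) ?nnegrE // expr0n /=.
exact: le_trans (sqr_norm_pairing x) x0.
Qed.

Lemma norm_le_pairing x y (m : R) : 0 <= m -> m * `|x| ^+ 2 <= pairing x y -> m * `|x| <= n%:R * `|y|.
Proof.
move=> m0 H; have [->|x0] := eqVneq x 0; first by rewrite normr0 mulr0 mulr_ge0.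
have nx : 0 < `|x| by rewrite normr_gt0.
rewrite -(ler_pM2r nx) -mulrA -expr2 (le_trans H) // (le_trans (ler_norm _)) //.
by rewrite (le_trans (pairing_norm _ _)) // -mulrA (mulrC `|y|).
Qed.

Lemma pairing_sqrB (v w : V) :
  pairing (v - w) (v - w) = pairing v v - 2 * pairing v w + pairing w w.
Proof. by rewrite !(pairingBl, pairingBr) (pairingC w v); ring. Qed.

Lemma sqr_dist_continuous y : continuous (fun z : V => pairing (z - y) (z - y)).
Proof.
suff : Ck 0 setT (fun z : V => pairing (z - y) (z - y)) by move=> H x; exact: H.
have oT : open [set: V] by exact: openT.
have -> : (fun z : V => pairing (z - y) (z - y)) =
    (fun z => \sum_k (z 0 k - y 0 k) * (z 0 k - y 0 k)).
  by apply/funext => z; rewrite pairingE; apply: eq_bigr => k _; rewrite !mxE.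
have ck k : Ck 0 setT (fun z : V => z 0 k - y 0 k).
  move=> z _; apply: (@lipT_continuous _ _ _ 1) => z1 z2 /=.
  by rewrite mul1r opprB addrA subrK; have := norm_coord (z1 - z2) k; rewrite !mxE.
by apply: Ck_sum => // k; exact: Ck_mul.
Qed.

Lemma lip_within (W W' : normedModType R) (f : W -> W') (A : set W) (L : R) :
  (forall p p', A p -> A p' -> `|f p' - f p| <= L * `|p' - p|) -> {within A, continuous f}.
Proof.
move=> fL; apply/subspace_continuousP => x Ax; apply/cvgrPdist_le => e e0.
have L1 : 0 < `|L| + 1 by rewrite ltr_wpDl.
have : \forall y \near x, `|x - y| <= e / (`|L| + 1).
  apply/nbhs_ballP; exists (e / (`|L| + 1)) => [|y]; first by rewrite /= divr_gt0.
  by rewrite -ball_normE /= => /ltW.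
rewrite near_withinE; apply: filterS => y xy Ay.
rewrite (le_trans (fL _ _ Ay Ax)) //.
apply: (@le_trans _ _ ((`|L| + 1) * `|x - y|)).
  by rewrite ler_wpM2r // (le_trans (ler_norm L)) // lerDl.
by rewrite mulrC -ler_pdivlMr.
Qed.

(* The Euclidean residual [f p - y] is minimal somewhere on the ball; where it does not vanish,
   a small step along the residual decreases it. *)
Lemma mono_surj (f : V -> V) (p0 y : V) (s m L : R) : 0 < s -> 0 < m -> 0 <= L ->
  (forall p p', `|p - p0| <= s -> `|p' - p0| <= s ->
     m * `|p' - p| ^+ 2 <= pairing (p' - p) (f p' - f p)) ->
  (forall p p', `|p - p0| <= s -> `|p' - p0| <= s -> `|f p' - f p| <= L * `|p' - p|) ->
  n%:R * (n%:R + 1) * `|y - f p0| < m * s ->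
  exists p, [/\ `|p - p0| <= s, f p = y & m * `|p - p0| <= n%:R * `|y - f p0|].
Proof.
move=> s0 m0 L0 fm fL ys; pose r p := pairing (f p - y) (f p - y).
pose B := [set p : V | `|p - p0| <= s].
have p0B : B p0 by rewrite /B /= subrr normr0 ltW.
have [p pB pmin] : exists2 p, B p & forall p', B p' -> r p <= r p'.
  have cr : {within B, continuous r}.
    apply/subspace_continuousP => p pB.
    have /subspace_continuousP/(_ p pB) := @lip_within _ _ f B L (fun p p' h h' => fL p p' h h').
    move=> H; exact: (cvg_comp f (fun z => pairing (z - y) (z - y)) H (@sqr_dist_continuous y (f p))).
  have [||p pB pmin] := compact_EVT_min _ _ cr; [by exists p0|exact: compact_ball|].
  by rewrite inE in pB; exists p => // p' p'B; apply: pmin; rewrite inE.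
have n0 : 0 <= n%:R :> R by [].
have fpy : `|f p - y| <= n%:R * `|y - f p0|.
  have [n1|n1] := posnP n.
    rewrite (_ : f p - y = 0) ?normr0 ?mulr_ge0 //.
    by apply/rowP => -[k kn]; exfalso; rewrite n1 in kn.
  rewrite -(@ler_pXn2r _ 2) ?nnegrE ?mulr_ge0 //.
  apply: le_trans (sqr_norm_pairing _) _; apply: le_trans (pmin _ p0B) _.
  rewrite /r (le_trans (pairing_le_sqr _)) // distrC exprMn ler_wpM2r ?sqr_ge0 //.
  by rewrite expr2 ler_peMr // ler1n.
have mp : m * `|p - p0| <= n%:R * `|f p - f p0| by apply: norm_le_pairing; [exact: ltW|exact: fm].
have ps : `|p - p0| < s.
  rewrite -(ltr_pM2l m0) (le_lt_trans mp) // (le_lt_trans _ ys) // -mulrA ler_wpM2l //.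
  rewrite mulrDl mul1r (le_trans (ler_distD y _ _)) // lerD //.
have fpE : f p = y.
  apply/eqP; rewrite -subr_eq0; apply/eqP/pairing_eq0; rewrite leNgt; apply/negP => rp.
  set v := f p - y in rp.
  have v0 : 0 < `|v|.
    rewrite normr_gt0; apply: contraTneq rp => ->; by rewrite pairing0l ltxx.
  pose de := Num.min ((s - `|p - p0|) / `|v|) (m / (n%:R * L ^+ 2 + 1)).
  have q0 : 0 < n%:R * L ^+ 2 + 1 by rewrite ltr_wpDl // mulr_ge0 // sqr_ge0.
  have de0 : 0 < de by rewrite lt_min !divr_gt0 // subr_gt0.
  have de1 : de * `|v| <= s - `|p - p0| by rewrite -ler_pdivlMr // ge_min lexx.
  have de2 : de * (n%:R * L ^+ 2 + 1) <= m by rewrite -ler_pdivlMr // ge_min lexx orbT.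
  pose p' := p - de *: v.
  have pp' : p' - p = - (de *: v) by rewrite /p' addrC addKr.
  have npp : `|p' - p| = de * `|v| by rewrite pp' normrN normrZ gtr0_norm.
  have p'B : B p'.
    rewrite /B /= (le_trans (ler_distD p _ _)) // npp -lerBrDr; exact: de1.
  have H1 := fm _ _ pB p'B; have H2 := fL _ _ pB p'B.
  rewrite npp in H1 H2.
  set w := f p - f p'.
  have wE : f p' - f p = - w by rewrite opprB.
  rewrite pp' wE pairingNl pairingNr opprK pairingZl exprMn mulrCA expr2 -!mulrA ler_pM2l // in H1.
  rewrite wE normrN in H2.
  have H3 : r p' = pairing v v - 2 * pairing v w + pairing w w.
    rewrite /r (_ : f p' - y = v - w); last by apply/rowP => j; rewrite !mxE; ring.
    exact: pairing_sqrB.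
  have := pmin _ p'B; rewrite H3 {1}/r -/v; apply/negP; rewrite -ltNge.
  have H4 : pairing w w <= n%:R * (L * (de * `|v|)) ^+ 2.
    by rewrite (le_trans (pairing_le_sqr _)) // ler_wpM2l // ler_pXn2r ?nnegrE ?mulr_ge0 // ltW.
  have H5 : n%:R * (L * (de * `|v|)) ^+ 2 <= m * (de * (`|v| * `|v|)) .
    rewrite (_ : _ * _ ^+ 2 = de * (n%:R * L ^+ 2) * (de * (`|v| * `|v|))); last by ring.
    apply: ler_wpM2r; first by rewrite !mulr_ge0 // ltW.
    by apply: le_trans de2; rewrite ler_pM2l // lerDl.
  have H6 : 0 < m * (de * (`|v| * `|v|)) by rewrite !mulr_gt0.
  by clear -H1 H4 H5 H6; lra.
exists p; split => //; last by rewrite -fpE.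
Qed.

Lemma ball_convex (a x y : V) (r l : R) : 0 <= l <= 1 -> `|x - a| <= r -> `|y - a| <= r ->
  `|x + l *: (y - x) - a| <= r.
Proof.
move=> /andP[l0 l1] xa ya.
rewrite (_ : _ - a = (1 - l) *: (x - a) + l *: (y - a)); last first.
  by apply/rowP => j; rewrite !mxE; ring.
rewrite (le_trans (ler_normD _ _)) // !normrZ (ger0_norm l0) ger0_norm ?subr_ge0 //.
have h1 : (1 - l) * `|x - a| <= (1 - l) * r by rewrite ler_wpM2l // subr_ge0.
have h2 : l * `|y - a| <= l * r by rewrite ler_wpM2l.
by clear -h1 h2; lra.
Qed.

(* A function with a supporting paraboloid at each point of a ball is convex up to a square, so
   that each of its subdifferentials gives a supporting paraboloid. *)
Lemma semiconvex_subdiff (u : V -> R) (a : V) (r C : R) (x p : V) :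
  (forall y, `|y - a| <= r -> exists q, forall y', `|y' - a| <= r ->
     u y + pairing q (y' - y) - C * pairing (y' - y) (y' - y) <= u y') ->
  `|x - a| <= r ->
  (forall e : R, 0 < e -> exists2 d : R, 0 < d &
     forall y, `|y - x| <= d -> u x + pairing p (y - x) - e * `|y - x| <= u y) ->
  forall y, `|y - a| <= r -> u x + pairing p (y - x) - C * pairing (y - x) (y - x) <= u y.
Proof.
move=> uC xa px y ya; set v := y - x; set Q := pairing v v.
have Q0 : 0 <= Q by exact: pairing_ge0.
apply/ler_addgt0Pr => e e0.
have v1 : 0 < `|v| + 1 by rewrite ltr_wpDl.
pose e' := e / 2 / (`|v| + 1).
have e'0 : 0 < e' by rewrite !divr_gt0.
have [d d0 dP] := px e' e'0.
have CQ : 0 < 2 * (`|C| * Q + 1) by rewrite mulr_gt0 // ltr_wpDl // mulr_ge0.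
pose l := Num.min (Num.min 1 (d / (`|v| + 1))) (e / (2 * (`|C| * Q + 1))).
have l0 : 0 < l by rewrite !lt_min ltr01 !divr_gt0.
have l1 : l <= 1 by rewrite !ge_min lexx.
have ld : l * (`|v| + 1) <= d by rewrite -ler_pdivlMr // !ge_min lexx orbT.
have le : l * (2 * (`|C| * Q + 1)) <= e by rewrite -ler_pdivlMr // !ge_min lexx orbT.
pose z := x + l *: v.
have zx : z - x = l *: v by rewrite /z addrC addKr.
have za : `|z - a| <= r by rewrite /z /v; apply: ball_convex => //; rewrite l1 ltW.
have [q qP] := uC z za.
have := qP x xa; have := qP y ya.
have -> : x - z = - (l *: v) by rewrite -zx opprB.
have -> : y - z = (1 - l) *: v.
  by rewrite /z /v; apply/rowP => j; rewrite !mxE; ring.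
rewrite !(pairingNr, pairingNl, pairingZr, pairingZl) opprK -/Q => H1 H2.
have H3 : u x + l * pairing p v - e' * (l * `|v|) <= u z.
  have := dP z; rewrite zx normrZ (ger0_norm (ltW l0)) pairingZr; apply.
  by apply: le_trans ld; rewrite ler_wpM2l ?lerDl // ltW.
have ev : e' * `|v| <= e / 2.
  rewrite /e' mulrAC ler_pdivrMr //; apply: ler_wpM2l; last by rewrite lerDl.
  by rewrite divr_ge0 // ltW.
have CC : l * - (C * Q) <= e / 2.
  apply: (@le_trans _ _ (l * (`|C| * Q + 1))); last by clear -le; lra.
  apply: ler_wpM2l; first exact: ltW.
  by rewrite -mulNr (le_trans (ler_wpM2r Q0 (ler_norm (- C)))) // normrN lerDl.
have : l * (u x + pairing p v - C * Q) <= l * (u y + e); last by rewrite ler_pM2l.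
have h1 : l * (e' * `|v|) <= l * (e / 2) by rewrite ler_wpM2l // ltW.
have h2 : l * (l * - (C * Q)) <= l * (e / 2) by rewrite ler_wpM2l // ltW.
have h3 : (1 - l) * (u z - l * pairing q v - C * (l * (l * Q))) <= (1 - l) * u x.
  by rewrite ler_wpM2l ?subr_ge0.
have h4 : l * (u z + (1 - l) * pairing q v - C * ((1 - l) * ((1 - l) * Q))) <= l * u y.
  by rewrite ler_wpM2l // ltW.
by clear -h1 h2 h3 h4 H3; nra.
Qed.

(* Subdividing a segment removes the quadratic term. *)
Lemma lip_of_quad (u : V -> R) (a : V) (r s C k : R) : 0 < s ->
  (forall y y', `|y - a| <= r -> `|y' - a| <= r -> `|y' - y| <= s ->
     u y' - u y <= k * `|y' - y| + C * `|y' - y| ^+ 2) ->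
  forall y y', `|y - a| <= r -> `|y' - a| <= r -> `|u y' - u y| <= k * `|y' - y|.
Proof.
move=> s0 H.
suff H1 y y' : `|y - a| <= r -> `|y' - a| <= r -> u y' - u y <= k * `|y' - y|.
  move=> y y' ya ya'; rewrite ler_norml H1 // andbT lerNl opprB.
  by rewrite distrC; exact: H1.
move=> ya ya'; apply/ler_addgt0Pr => e e0; set v := y' - y.
have v0 : 0 <= `|v| by [].
pose N := (Num.truncn (`|v| / s + `|C| * `|v| ^+ 2 / e)).+1.
have N0 : (0 : R) < N%:R by rewrite ltr0n.
have Nb : `|v| / s + `|C| * `|v| ^+ 2 / e < N%:R by exact: truncnS_gt.
have b1 : 0 <= `|v| / s by rewrite divr_ge0 // ltW.
have b2 : 0 <= `|C| * `|v| ^+ 2 / e by rewrite divr_ge0 ?mulr_ge0 ?sqr_ge0 // ltW.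
have Ns : `|v| / N%:R <= s.
  rewrite ler_pdivrMr // mulrC -ler_pdivrMr //; clear -Nb b1 b2; lra.
have Ne : `|C| * `|v| ^+ 2 <= e * N%:R.
  rewrite [leRHS]mulrC -ler_pdivrMr //; clear -Nb b1 b2; lra.
pose w (j : nat) := y + (j%:R / N%:R) *: v.
have wa j : (j <= N)%N -> `|w j - a| <= r.
  move=> jN; pose l : R := j%:R / N%:R.
  have l0 : 0 <= l by rewrite divr_ge0 // ltW.
  have l1 : l <= 1 by rewrite ler_pdivrMr // mul1r ler_nat.
  by rewrite /w /v; apply: ball_convex => //; rewrite l0.
have step j : (j < N)%N -> u (w j.+1) - u (w j) <= k * (`|v| / N%:R) + e / N%:R.
  move=> jN; have wE : w j.+1 - w j = N%:R^-1 *: v.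
    by rewrite /w; apply/rowP => i; rewrite !mxE -natr1; field; rewrite gt_eqF.
  have nE : `|w j.+1 - w j| = `|v| / N%:R.
    by rewrite wE normrZ normfV (ger0_norm (ltW N0)) mulrC.
  have := H _ _ (wa j (ltnW jN)) (wa _ jN); rewrite nE => /(_ Ns) h.
  apply: le_trans h _; rewrite lerD2l exprMn exprVn mulrA.
  rewrite ler_pdivrMr ?exprn_gt0 // (_ : e / N%:R * N%:R ^+ 2 = e * N%:R); last first.
    by field; rewrite gt_eqF.
  by apply: le_trans Ne; rewrite ler_wpM2r ?sqr_ge0 // ler_norm.
have sum j : (j <= N)%N -> u (w j) - u y <= j%:R * (k * (`|v| / N%:R) + e / N%:R).
  elim: j => [|j IH] jN; first by rewrite /w !mul0r scale0r addr0 subrr.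
  have := IH (ltnW jN); have := step j jN; rewrite -natr1 mulrDl mul1r.
  move=> h1 h2; rewrite (_ : u (w j.+1) - u y = (u (w j) - u y) + (u (w j.+1) - u (w j))).
    exact: lerD.
  by ring.
have := sum N (leqnn _).
have -> : w N = y' by rewrite /w divff ?gt_eqF // scale1r /v addrC subrK.
suff -> : N%:R * (k * (`|v| / N%:R) + e / N%:R) = k * `|v| + e by [].
by field; rewrite gt_eqF.
Qed.

End MonoSurj.

Lemma le12 {R : realType} : (1 : R) <= 2. Proof. by rewrite (ler_nat R 1 2). Qed.
Lemma le13 {R : realType} : (1 : R) <= 3. Proof. by rewrite (ler_nat R 1 3). Qed.
Lemma le23 {R : realType} : (2 : R) <= 3. Proof. by rewrite (ler_nat R 2 3). Qed.

Section Local.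
Context {R : realType} {n : nat} {M : ptopologicalType} (S : smooth_manifold R n M) (P : patches S).
Local Notation V := 'rV[R]_n.
Implicit Types (d : 'I_(pcard P)) (K G : TsM S -> R) (z : TsM S).

Definition inr d (m : R) (x : M) : Prop :=
  dom (idx d) x /\ `|pchart d x - ctr d| <= m * rad d.

Lemma inr_le d m m' x : m <= m' -> inr d m x -> inr d m' x.
Proof.
move=> mm [dx xm]; split=> //; apply: le_trans xm _.
by rewrite ler_wpM2r // ltW // rad_gt0.
Qed.

Definition cdiff d z z' : V * V := pcoord d z' - pcoord d z.

Definition theta G d (t : R) z z' : R :=
  hact G z' t - hact G z t
  - pairing (pcoord d (hflow G t z)).2 (cdiff d (hflow G t z) (hflow G t z')).1
  + pairing (pcoord d z).2 (cdiff d z z').1.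

Record est K G (E b C k tau D : R) : Prop := Est {
  est_pos : [/\ 0 <= b, 0 < C, 0 < tau & 0 < D];
  est_proper : proper_on P K E b;
  est_rad : forall d, C * tau <= rad d;
  est_half : C * tau <= 2^-1;
  est_stay : forall d z t, inr d 3 z.1 -> K z <= E -> `|t| <= tau ->
    dom (idx d) (hflow G t z).1 /\
    `|pchart d (hflow G t z).1 - pchart d z.1| <= C * `|t|;
  est_lip : forall d z z' t, inr d 3 z.1 -> inr d 3 z'.1 -> K z <= E -> K z' <= E ->
    `|t| <= tau ->
    `|cdiff d (hflow G t z) (hflow G t z') - cdiff d z z'| <= C * `|t| * `|cdiff d z z'|;
  est_twist : forall d z z' t, inr d 3 z.1 -> inr d 3 z'.1 -> K z <= E -> K z' <= E ->
    `|t| <= tau -> 0 < k ->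
    t ^+ 2 * (k / 2 * `|(cdiff d z z').2| ^+ 2 - D * `|(cdiff d z z').1| ^+ 2) <=
    t * pairing (cdiff d z z').2
      ((cdiff d (hflow G t z) (hflow G t z')).1 - (cdiff d z z').1);
  est_low : forall d z z' t, inr d 3 z.1 -> inr d 3 z'.1 -> K z <= E -> K z' <= E ->
    `|t| <= tau -> 0 < k ->
    t ^+ 2 * (k / 4 * `|(cdiff d z z').2| ^+ 2 - D * `|(cdiff d z z').1| ^+ 2) <=
    t * theta G d t z z';
  est_act : forall d z z' t, inr d 3 z.1 -> inr d 3 z'.1 -> K z <= E -> K z' <= E ->
    `|t| <= tau -> `|theta G d t z z'| <= D * `|t| * `|cdiff d z z'| ^+ 2 }.

Definition reg_fun G (Q : R -> Prop) : Prop := forall b, 0 <= b ->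
  exists C k, [/\ 0 <= C, Q k & forall d, reg_patch G d b C k].

Lemma est_ex K G E (Q : R -> Prop) : good_pair P K G -> reg_fun G Q ->
  exists b C k tau D, Q k /\ est K G E b C k tau D.
Proof.
move=> KG reg; have [K2 G2 KG0 prop] := KG.
have [b [C [del cst]]] := flow_const_ex G2 (prop E).
have [[b0 [C0 del0]] bP regC Cd1 Cd2] := cst.
have [|C' [k [C'0 Qk regk]]] := reg (b + 1); first by rewrite addr_ge0.
have [tau1 tau10 [D1 D10 A1]] := @flow_action R n C' k C'0.
have [tau2 tau20 [D2 D20 A2]] : exists2 tau2 : R, 0 < tau2 & exists2 D : R, 0 < D &
  0 < k -> forall (a : V) r b g gy gq (c c' : R -> V * V) (t : R),
  reg_on (box a r b) C' k g gy gq -> `|t| <= tau2 ->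
  (forall s : R, `|s| <= `|t| -> box a r b (c s) /\ is_derive s 1 c (ham_field gy gq (c s))) ->
  (forall s : R, `|s| <= `|t| -> box a r b (c' s) /\ is_derive s 1 c' (ham_field gy gq (c' s))) ->
  t ^+ 2 * (k / 2 * `|(c' 0).2 - (c 0).2| ^+ 2 - D * `|(c' 0).1 - (c 0).1| ^+ 2) <=
    t * pairing ((c' 0).2 - (c 0).2) ((c' t).1 - (c t).1 - ((c' 0).1 - (c 0).1)).
  have [k0|k0] := pselect (0 < k); last by exists 1 => //; exists 1.
  have [tau2 tau20 [D2 D20 A2]] := @flow_twist R n C' k k0 C'0.
  by exists tau2 => //; exists D2.
pose tau := Num.min (del / 2) (Num.min tau1 tau2).
have tau0 : 0 < tau by rewrite !lt_min tau10 tau20 divr_gt0.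
have tau_del : tau <= del / 2 by rewrite ge_min lexx.
have tau_t1 : tau <= tau1 by rewrite !ge_min lexx orbT.
have tau_t2 : tau <= tau2 by rewrite !ge_min lexx !orbT.
have C20 : 0 < 2 * C by rewrite mulr_gt0.
have Ctau : 2 * C * tau <= C * del.
  apply: le_trans (ler_wpM2l (ltW C20) tau_del) _.
  by rewrite (_ : 2 * C * (del / 2) = C * del) //; field.
have del2 : del / 2 <= del by rewrite ler_pdivrMr // ler_peMr ?ler1n // ltW.
have orb d z t : inr d 3 z.1 -> K z <= E -> `|t| <= tau ->
  [/\ dom (idx d) (hflow G t z).1, pbox d (b + 1) (pcoord d (hflow G t z)),
    is_derive t 1 (fun s => pcoord d (hflow G s z))
      (hfield G (idx d) (pcoord d (hflow G t z))) &
    is_derive t 1 (hact G z)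
      (ham_lagr (ploc G d) (gradQ (ploc G d)) (pcoord d (hflow G t z)))].
  move=> [dz zr] KE tt.
  have hz s : `|s| < `|t| + 1 -> ham_at G (fun s => hflow G s z) s.
    by move=> _; exact: (hflow_ham KG).
  have := ham_stay_box K2 G2 KG0 cst (d := d) hz.
  rewrite (hflow0 KG) => /(_ KE dz zr t); rewrite ltrDl ltr01 => /(_ isT).
  move=> /(_ (le_trans tt (le_trans tau_del del2))) [h1 h2 h3]; split => //.
    exact: pboxS.
  by rewrite -lagr_chart //; exact: (is_derive_hact KG).
have stC (s t : R) : `|s| <= `|t| -> `|t| <= tau -> `|s| <= tau by exact: le_trans.
have D12 : 0 <= D1 /\ 0 <= D2 by split; exact: ltW.
exists b, (2 * C), k, tau, (D1 + D2); split=> //; split.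
- by split=> //; exact: addr_gt0.
- exact: bP.
- by move=> d; apply: le_trans Ctau _.
- exact: le_trans Ctau _.
- move=> d z t [dz zr] KE tt.
  have hz s : `|s| < `|t| + 1 -> ham_at G (fun s => hflow G s z) s.
    by move=> _; exact: (hflow_ham KG).
  have := ham_stay K2 G2 KG0 cst (d := d) hz.
  rewrite (hflow0 KG) => /(_ KE dz zr t); rewrite ltrDl ltr01 => /(_ isT).
  move=> /(_ (le_trans tt (le_trans tau_del del2))) [h1 h2]; split=> //.
  by apply: le_trans h2 _; apply: ler_wpM2r => //; rewrite ler_peMl ?ler1n // ltW.
- move=> d z z' t iz iz' KE KE' tt.
  have [|s st|s st|_] := flow_close (c := fun s => pcoord d (hflow G s z))
     (c' := fun s => pcoord d (hflow G s z')) (ltW C0) (t := t) _ (regC d).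
  + apply: le_trans _ Cd2; apply: ler_wpM2l; first exact: ltW.
    exact: le_trans tt (le_trans tau_del del2).
  + by have [] := orb d z s iz KE (stC _ _ st tt).
  + by have [] := orb d z' s iz' KE' (stC _ _ st tt).
  by move=> /(_ t (lexx _)); rewrite !(hflow0 KG).
- move=> d z z' t iz iz' KE KE' tt k0.
  have H1 s : `|s| <= `|t| -> pbox d (b + 1) (pcoord d (hflow G s z)) /\
    is_derive s 1 (fun s => pcoord d (hflow G s z))
      (hfield G (idx d) (pcoord d (hflow G s z))).
    by move=> st; have [] := orb d z s iz KE (stC _ _ st tt).
  have H2 s : `|s| <= `|t| -> pbox d (b + 1) (pcoord d (hflow G s z')) /\
    is_derive s 1 (fun s => pcoord d (hflow G s z'))
      (hfield G (idx d) (pcoord d (hflow G s z'))).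
    by move=> st; have [] := orb d z' s iz' KE' (stC _ _ st tt).
  have := A2 k0 _ _ _ _ _ _ _ _ _ (regk d) (le_trans tt tau_t2) H1 H2.
  rewrite !(hflow0 KG) /=; apply: le_trans; apply: ler_wpM2l; first exact: sqr_ge0.
  rewrite lerD2l lerN2; apply: ler_wpM2r; first exact: sqr_ge0.
  by rewrite lerDr; have [] := D12.
- move=> d z z' t iz iz' KE KE' tt k0.
  have [+ _] := A1 _ _ _ _ _ _ _ _ _ _ _ (regk d) (le_trans tt tau_t1)
    (fun s st => let: And4 _ h2 h3 h4 := orb d z s iz KE (stC _ _ st tt) in And3 h2 h3 h4)
    (fun s st => let: And4 _ h2 h3 h4 := orb d z' s iz' KE' (stC _ _ st tt) in And3 h2 h3 h4).
  move=> /(_ k0); rewrite !(hflow0 KG) !(hact0 KG) /=.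
  rewrite (_ : _ - (0 - 0 - _) = theta G d t z z').
    apply: le_trans; apply: ler_wpM2l; first exact: sqr_ge0.
    rewrite lerD2l lerN2; apply: ler_wpM2r; first exact: sqr_ge0.
    by rewrite lerDl; have [] := D12.
  by rewrite /theta /cdiff /= subrr sub0r opprK.
- move=> d z z' t iz iz' KE KE' tt.
  have [_] := A1 _ _ _ _ _ _ _ _ _ _ _ (regk d) (le_trans tt tau_t1)
    (fun s st => let: And4 _ h2 h3 h4 := orb d z s iz KE (stC _ _ st tt) in And3 h2 h3 h4)
    (fun s st => let: And4 _ h2 h3 h4 := orb d z' s iz' KE' (stC _ _ st tt) in And3 h2 h3 h4).
  rewrite !(hflow0 KG) !(hact0 KG) /=.
  rewrite (_ : _ - (0 - 0 - _) = theta G d t z z').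
    move=> h; apply: le_trans h _; apply: ler_wpM2r; first exact: sqr_ge0.
    by apply: ler_wpM2r => //; rewrite lerDl; have [] := D12.
  by rewrite /theta /cdiff /= subrr sub0r opprK.
Qed.

Lemma tloc_lip K b : TsM_C2 K -> exists2 B : R, 0 <= B & forall d w w', pbox d b w -> pbox d b w' ->
  `|ploc K d w' - ploc K d w| <= B * `|w' - w|.
Proof.
move=> K2; apply: (@fin_bound R (pcard P) (fun d B => forall w w', pbox d b w -> pbox d b w' ->
  `|ploc K d w' - ploc K d w| <= B * `|w' - w|)).
- move=> d; have sub : pbox d b `<=` cod (idx d) `*` setT by move=> z /pbox_cod.
  exact: (Ck1_box_lip (Ck_pred (tloc_C2 (idx d) K2)) sub).
- move=> d B B' BB' H w w' hw hw'; apply: le_trans (H _ _ hw hw') _.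
  by apply: ler_wpM2r.
Qed.

Lemma tprm_base (i : chart_index S) (z : TsM S) (p : V) : dom i z.1 -> (tprm i (chart i z.1, p)).1 = z.1.
Proof. by move=> dz; rewrite tprmE /= chartK. Qed.

Lemma tprm_coord (i : chart_index S) (z : TsM S) (p : V) : dom i z.1 ->
  coord i (tprm i (chart i z.1, p)) = (chart i z.1, p).
Proof. by move=> dz; rewrite tprmK //; exact: cod_chart. Qed.

Lemma norm_pair0l (v : V) : `|((0 : V), v)| = `|v|.
Proof.
apply/eqP; rewrite eq_le; apply/andP; split; last exact: (norm_pair2 (0 : V, v)).
by apply: norm_pair_le => //=; rewrite normr0.
Qed.

(* Twist: moving the covector at the starting point moves the endpoint to any prescribed nearby
   point; the variation of the action is then given by the final covector. *)
Lemma push K G (E b C k tau D : R) : good_pair P K G -> est K G E b C k tau D -> 0 < k ->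
  forall t : R, 0 < `|t| -> `|t| <= tau -> exists rho Q, [/\ 0 < rho, 0 < Q &
  forall d z, inr d 3 z.1 -> K z <= E - 1 ->
  forall y', `|y' - pchart d (hflow G t z).1| <= rho ->
  exists z', [/\ z'.1 = z.1, K z' <= E, dom (idx d) (hflow G t z').1,
    pchart d (hflow G t z').1 = y' &
    `|hact G z' t - hact G z t - pairing (pcoord d (hflow G t z)).2
       (y' - pchart d (hflow G t z).1)| <=
    Q * `|y' - pchart d (hflow G t z).1| ^+ 2] ].
Proof.
move=> KG es k0 t t0 tt; have [K2 _ _ _] := KG; have [b0 C0 tau0 D0] := est_pos es.
have [B B0 lipK] := tloc_lip (b + 1) K2.
have B1 : 0 < B + 1 by rewrite ltr_wpDl.
pose sg := (B + 1)^-1.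
have sg0 : 0 < sg by rewrite invr_gt0.
have sg1 : sg <= 1 by rewrite invf_le1 // lerDr.
have Bsg : B * sg <= 1 by rewrite -ler_pdivlMr ?invr_gt0 // invrK mul1r lerDl.
have t2 : 0 < t ^+ 2 by rewrite exprn_even_gt0 //= -normr_gt0.
pose m := t ^+ 2 * (k / 2).
have m0 : 0 < m by rewrite mulr_gt0 // divr_gt0.
pose nn : R := n%:R * (n%:R + 1) + 1.
have nn0 : 0 < nn by rewrite ltr_wpDl // mulr_ge0 // addr_ge0.
pose rho := m * sg / (nn * `|t|).
have rho0 : 0 < rho by apply: divr_gt0; apply: mulr_gt0.
exists rho, (D * `|t| * (n%:R * `|t| / m) ^+ 2 + 1); split.
- exact: rho0.
- by rewrite ltr_wpDl // mulr_ge0 ?sqr_ge0 // mulr_ge0 // ltW.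
move=> d z iz KE y' y'r; have [dz zr] := iz.
set y := pchart d (hflow G t z).1 in y'r *; set q := (pcoord d (hflow G t z)).2.
pose p := (pcoord d z).2; pose Z (p' : V) := tprm (idx d) (pchart d z.1, p').
have Zp : Z p = z by rewrite /Z /p -[RHS](coordK dz).
have Zc p' : pcoord d (Z p') = (pchart d z.1, p') by exact: tprm_coord.
have Z1 p' : (Z p').1 = z.1 by exact: tprm_base.
have zr4 : `|pchart d z.1 - ctr d| <= 4 * rad d.
  by have [_] := inr_le (ler_nat R 3 4 : (3 <= 4 :> R) = true) iz.
have pb : `|p| <= b.
  apply: (est_proper es zr4); have := tloc_coord K dz; rewrite {1}/coord => ->.
  by apply: le_trans KE _; rewrite gerBl.
have ZE p' : `|p' - p| <= sg -> K (Z p') <= E.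
  move=> ps; have h1 : pbox d (b + 1) (pchart d z.1, p).
    by split=> //=; apply: le_trans pb _; rewrite lerDl.
  have h2 : pbox d (b + 1) (pchart d z.1, p').
    split=> //=; rewrite -(subrK p p') addrC (le_trans (ler_normD _ _)) // lerD //.
    exact: le_trans ps sg1.
  have := lipK _ _ _ h1 h2; rewrite !tlocE -/(Z p') -/(Z p) Zp => H.
  have e : `|(pchart d z.1, p') - (pchart d z.1, p)| <= sg.
    by apply: norm_pair_le; rewrite /= ?subrr ?normr0 // ltW.
  have := le_trans H (ler_wpM2l B0 e) => {}H.
  have := le_trans (ler_norm _) (le_trans H Bsg); rewrite lerBlDr => h3.
  by apply: le_trans h3 _; rewrite addrC -lerBrDr.
have Zi p' : inr d 3 (Z p').1 by rewrite Z1.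
have cd p' p'' : cdiff d (Z p') (Z p'') = (0, p'' - p').
  by rewrite /cdiff !Zc; congr pair; exact: subrr.
have ncd p' p'' : `|cdiff d (Z p') (Z p'')| = `|p'' - p'| by rewrite cd norm_pair0l.
pose f (p' : V) := t *: (pcoord d (hflow G t (Z p'))).1.
have fB p' p'' : f p'' - f p' = t *: (cdiff d (hflow G t (Z p')) (hflow G t (Z p''))).1.
  by rewrite /f -scalerBr.
have Lt : 0 <= C * t ^+ 2 by rewrite mulr_ge0 ?sqr_ge0 // ltW.
have fE : f p = t *: y by rewrite /f Zp.
have y'E : `|t *: y' - f p| = `|t| * `|y' - y| by rewrite fE -scalerBr normrZ.
have [p' p''|p' p''||p' [ps fp' mp]] := @mono_surj _ _ f p (t *: y') sg m (C * t ^+ 2) sg0 m0 Lt.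
- move=> h1 h2; have := est_twist es (Zi p') (Zi p'') (ZE _ h1) (ZE _ h2) tt k0.
  rewrite fB pairingZr cd /= normr0 expr0n mulr0 subr0 subr0.
  by rewrite /m -(mulrA (t ^+ 2)).
- move=> h1 h2; have := est_lip es (Zi p') (Zi p'') (ZE _ h1) (ZE _ h2) tt.
  rewrite ncd => /(le_trans (norm_pair1 _)); rewrite /= !Z1 subrr subr0 => h.
  rewrite fB normrZ (_ : C * t ^+ 2 * _ = `|t| * (C * `|t| * `|p'' - p'|)).
    exact: ler_wpM2l.
  by rewrite -(real_normK (num_real t)); ring.
- rewrite y'E; apply: (@lt_le_trans _ _ (nn * (`|t| * rho))).
    apply: (@le_lt_trans _ _ (n%:R * (n%:R + 1) * (`|t| * rho))).
      by apply: ler_wpM2l; [rewrite mulr_ge0 // addr_ge0|apply: ler_wpM2l].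
    by rewrite ltr_pM2r ?ltrDl // mulr_gt0.
  rewrite le_eqVlt; apply/orP; left; apply/eqP; rewrite /rho; field.
  by rewrite !gt_eqF.
rewrite y'E in mp.
have dZ : dom (idx d) (hflow G t (Z p')).1 by have [] := est_stay es (Zi p') (ZE _ ps) tt.
have yZ : pchart d (hflow G t (Z p')).1 = y'.
  move: fp'; rewrite /f => /(congr1 (fun v => t^-1 *: v)); rewrite !scalerA mulVf ?scale1r //.
  by rewrite -normr_gt0.
exists (Z p'); split=> //; first exact: ZE.
have zE : K z <= E by apply: le_trans KE _; rewrite gerBl.
have := est_act es iz (Zi p') zE (ZE _ ps) tt.
have cdz : cdiff d z (Z p') = (0, p' - p) by rewrite -[in LHS]Zp cd.
rewrite /theta cdz norm_pair0l /= pairing0r addr0 -/q yZ -/y => H.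
apply: le_trans H _; rewrite mulrDl mul1r.
have pp : `|p' - p| <= n%:R * `|t| / m * `|y' - y|.
  by rewrite (mulrAC _ m^-1) -(mulrA n%:R) ler_pdivlMr // mulrC.
have h : `|p' - p| ^+ 2 <= (n%:R * `|t| / m * `|y' - y|) ^+ 2.
  by rewrite ler_pXn2r ?nnegrE // (le_trans _ pp).
have Dt : 0 <= D * `|t| by rewrite mulr_ge0 // ltW.
apply: le_trans (ler_wpM2l Dt h) _.
by rewrite exprMn mulrA lerDl sqr_ge0.
Qed.

End Local.

Section Coercive.
Context {R : realType} {n : nat} {M : ptopologicalType} (S : smooth_manifold R n M) (P : patches S).
Local Notation V := 'rV[R]_n.
Implicit Types (d : 'I_(pcard P)) (z : TsM S) (u v : M -> R).

Definition tonelli_in (K : TsM S -> R) : Prop :=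
  [/\ TsM_C2 K, reg_fun P K (fun k => 0 < k) & forall A, exists B, forall d y q,
    `|y - ctr d| <= 4 * rad d -> A * `|q| - B <= ploc K d (y, q)].

Definition zero_cov (x : M) : TsM S := (x, 0).

Variable K : TsM S -> R.
Hypothesis KT : tonelli_in K.

Lemma poisson_self z : poisson K K z = 0.
Proof. by rewrite /poisson /omega pairingC subrr. Qed.

Lemma tonelli_good : good_pair P K K.
Proof.
have [K2 _ sup] := KT; split=> // [|E]; first exact: poisson_self.
have [B HB] := sup 1; exists (E + B) => d y q yr KE.
by have := le_trans (HB d y q yr) KE; rewrite mul1r lerBlDr.
Qed.

Lemma fiber_convex d y (q r : V) : `|y - ctr d| <= 4 * rad d ->
  ploc K d (y, q) + pairing (gradQ (ploc K d) (y, q)) (r - q) <= ploc K d (y, r).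
Proof.
move=> yr; have [_ reg _] := KT.
pose b := Num.max `|q| `|r|.
have b0 : 0 <= b by rewrite le_max normr_ge0.
have [C [k [C0 k0 rg]]] := reg b b0.
have h1 : pbox d b (y, q) by split=> //=; rewrite le_max lexx.
have h2 : pbox d b (y, r) by split=> //=; rewrite le_max lexx orbT.
have H := convex_bound (rg d) h1 h2 erefl.
rewrite addrC -lerBrDr -subr_ge0; apply: le_trans H.
by rewrite mulr_ge0 ?sqr_ge0 // divr_ge0 // ltW.
Qed.

Lemma tloc_bound b : exists2 B : R, 0 <= B &
  forall d (w : V * V), pbox d b w -> `|ploc K d w| <= B.
Proof.
have [K2 _ _] := KT.
apply: (@fin_bound R (pcard P) (fun d B => forall w : V * V, pbox d b w -> `|ploc K d w| <= B)).
- move=> d; have sub : pbox d b `<=` cod (idx d) `*` setT by move=> z /pbox_cod.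
  by apply: (box_bound _ sub); apply: Ck_pred; apply: Ck_pred; exact: tloc_C2.
- by move=> d B B' BB' H w hw; apply: le_trans (H _ hw) _.
Qed.

Lemma coercive (k0 a : R) : 0 <= k0 -> exists2 E1 : R, 0 <= E1 & forall d y q e,
  `|y - ctr d| <= 4 * rad d -> `|e| <= 1 ->
  pairing q (gradQ (ploc K d) (y, q)) - ploc K d (y, q)
    - k0 * pairing e (gradQ (ploc K d) (y, q)) <= a -> ploc K d (y, q) <= E1.
Proof.
move=> k00; have [_ _ sup] := KT.
have [B0 B00 HB0] := tloc_bound (k0 + 1).
pose a2 := B0 + `|a|.
have a20 : 0 <= a2 by rewrite addr_ge0.
have [B HB] := sup (n%:R * a2 + 1).
exists (B0 + n%:R * a2 * `|B0 + B|); first by rewrite addr_ge0 // !mulr_ge0.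
move=> d y q e yr e1 H.
set g := gradQ (ploc K d) (y, q) in H.
have in0 r : `|r| <= k0 + 1 -> ploc K d (y, r) <= B0.
  by move=> rk; apply: le_trans (ler_norm _) (HB0 d _ _).
have [e' e'1 e'g] := pairing_dual g.
have gb : `|g| <= a2.
  have := fiber_convex q (k0 *: e + e') yr; rewrite -/g pairingBr pairingDr pairingZr.
  rewrite (pairingC g e) (pairingC g e') e'g (pairingC g q).
  have : ploc K d (y, k0 *: e + e') <= B0.
    apply: in0; rewrite (le_trans (ler_normD _ _)) // lerD // normrZ ger0_norm //.
    by rewrite ler_piMr.
  have := ler_norm a; move: H; rewrite /a2.
  move: (tloc K _ _) (tloc K _ _) (pairing q g) (pairing e g) `|a| `|g| => t1 t2 t3 t4 t5 t6.
  move: (k0 * t4) => t7 h1 h2 h3 h4; lra.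
have Kq : ploc K d (y, q) <= B0 + n%:R * a2 * `|q|.
  have := fiber_convex q 0 yr; rewrite -/g sub0r pairingNr lerBlDr => h.
  apply: le_trans h _; apply: lerD; first by apply: in0; rewrite normr0 addr_ge0.
  apply: le_trans (ler_norm _) _; apply: le_trans (pairing_norm _ _) _.
  by rewrite -mulrA; apply: ler_wpM2l => //; apply: ler_wpM2r.
have qb : `|q| <= `|B0 + B|.
  have := le_trans (HB d y q yr) Kq; rewrite mulrDl mul1r => h; apply: le_trans (ler_norm _).
  by move: h; move: (n%:R * a2 * `|q|) `|q| => x1 x2; lra.
by apply: le_trans Kq _; rewrite lerD2l; apply: ler_wpM2l => //; rewrite mulr_ge0.
Qed.

Definition Lip (k : R) u : Prop := forall d x x', inr d 2 x -> inr d 2 x' ->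
  `|u x' - u x| <= k * `|pchart d x' - pchart d x|.

Lemma pcover1 x : exists d, inr d 1 x.
Proof. by have [d dx xr] := pcover P x; exists d; split=> //; rewrite mul1r ltW. Qed.

Lemma zero_cov_coord i x : coord i (zero_cov x) = (chart i x, 0).
Proof. by rewrite /coord /= mul0mx. Qed.

Lemma hact_back (t : R) z : hact K z t = - hact K (hflow K t z) (- t).
Proof.
have := hactD tonelli_good t (- t) z; rewrite subrr (hact0 tonelli_good) => /eqP.
by rewrite eq_sym addr_eq0 => /eqP.
Qed.

Lemma chart_deriv d (t : R) z : dom (idx d) (hflow K t z).1 ->
  is_derive t 1 (fun s => pchart d (hflow K s z).1)
    (gradQ (ploc K d) (pcoord d (hflow K t z))).
Proof.
by move=> dz; have [_ /(_ _ dz)/is_derive_pairP[]] := hflow_ham tonelli_good z t.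
Qed.

Section Est.
Variables (E b C k tau D : R).
Hypothesis es : est P K K E b C k tau D.

Lemma stay_inr d (m : R) z t : inr d m z.1 -> m <= 3 -> K z <= E -> `|t| <= tau ->
  inr d (m + 1) (hflow K t z).1.
Proof.
move=> iz m3 KE tt; have [] := est_stay es (inr_le m3 iz) KE tt.
have [b0 C0 tau0 D0] := est_pos es; case: iz => dz zr dt h; split=> //.
apply: le_trans (ler_distD (pchart d z.1) _ _) _; rewrite addrC mulrDl mul1r lerD //.
by apply: le_trans h (le_trans _ (est_rad es d)); apply: ler_wpM2l => //; exact: ltW.
Qed.

Lemma stay_pbox d z t : inr d 3 z.1 -> K z <= E -> `|t| <= tau ->
  [/\ dom (idx d) (hflow K t z).1, `|pchart d (hflow K t z).1 - ctr d| <= 4 * rad d &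
      pbox d b (pcoord d (hflow K t z))].
Proof.
move=> iz KE tt; have [dt yt] := stay_inr iz (lexx _) KE tt.
have y4 : `|pchart d (hflow K t z).1 - ctr d| <= 4 * rad d.
  by apply: le_trans yt _; rewrite natr1.
split=> //; split=> //; apply: (est_proper es y4).
have := tloc_coord K dt; rewrite {1}/coord => ->.
by rewrite (hflow_energy tonelli_good).
Qed.

End Est.

Lemma min_interior (E0 k0 : R) : 0 <= k0 -> (forall x, K (zero_cov x) <= E0) ->
  exists2 E1 : R, E0 <= E1 & forall E b C k tau D, E1 <= E -> est P K K E b C k tau D ->
  forall t z u, 0 < t -> t <= tau -> Lip k0 u -> K z <= E ->
  u z.1 + hact K z t <= u (hflow K (- t) (zero_cov (hflow K t z).1)).1 +
    hact K (hflow K (- t) (zero_cov (hflow K t z).1)) t -> K z <= E1.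
Proof.
move=> k00 K0; have [K2 reg sup] := KT; have gp := tonelli_good.
have [_ _ _ /(_ E0) [b1 prop0]] := gp.
pose b0 := Num.max 0 b1.
have b00 : 0 <= b0 by rewrite le_max lexx.
have prop : proper_on P K E0 b0.
  by move=> d y q h1 h2; rewrite le_max (prop0 d y q h1 h2) orbT.
have [C0 [k' [C00 _ rg]]] := reg b0 b00.
have [B0 HB0] := sup 0.
pose a := k0 * C0 + (n%:R * (b0 * C0) + B0).
have [E1 E10 HE1] := coercive a k00.
exists (Num.max E0 E1) => [|E b C k tau D]; first by rewrite le_max lexx.
rewrite ge_max => /andP[E0E E1E] es t z u t0 tt Lu KE H.
have [b' C' tau0 D0] := est_pos es.
set y := (hflow K t z).1 in H; set w := zero_cov y in H.
have nt (s : R) : `|s| <= `|- t| -> `|s| <= tau.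
  by move=> st; apply: le_trans st _; rewrite normrN gtr0_norm.
have [d iy] := pcover1 y.
have iw : inr d 1 w.1 by [].
have KwE : K w <= E0 by exact: K0.
have KwE' := le_trans KwE E0E.
have iw3 := inr_le le13 iw.
have orbw (s : R) : `|s| <= `|- t| -> dom (idx d) (hflow K s w).1 /\
    pbox d b0 (pcoord d (hflow K s w)).
  move=> st; have [h1 h2 h3] := stay_pbox es iw3 KwE' (nt _ st); split=> //; split=> //.
  apply: (prop d _ _ h2); have := tloc_coord K h1; rewrite {1}/coord => ->.
  by rewrite (hflow_energy gp).
have i11 : (1 + 1 = 2 :> R) by rewrite -[2]natr1.
have H1 : u (hflow K (- t) w).1 <= u y + k0 * (C0 * t).
  have h : `|pchart d (hflow K (- t) w).1 - pchart d y| <= C0 * t.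
    have := @MVT_norm_rV _ _ (fun s => pchart d (hflow K s w).1)
     (fun s => gradQ (ploc K d) (pcoord d (hflow K s w))) (- t) C0 C00.
    rewrite (hflow0 gp) normrN (gtr0_norm t0); apply=> s st.
      by apply: chart_deriv; have [|] := orbw s; first by move: st; rewrite ?normrN ?(gtr0_norm t0).
    have [_ _ _ H' _] := rg d.
    have [|h1 h2] := orbw s; first by move: st; rewrite ?normrN ?(gtr0_norm t0).
    by have [] := H' _ h2.
  rewrite -lerBlDl (le_trans (ler_norm _)) //.
  have iz := stay_inr es iw le13 KwE' (nt _ (lexx _)).
  rewrite i11 in iz.
  by apply: le_trans (Lu d _ _ (inr_le le12 iy) iz) _; apply: ler_wpM2l.
have H2 : hact K (hflow K (- t) w) t <= (n%:R * (b0 * C0) + B0) * t.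
  have := @MVT_sym _ (hact K w) (fun s => lagr K (hflow K s w)) (- t)
     (fun s _ => is_derive_hact gp w s).
  move=> [s st]; rewrite (hact0 gp) subr0 => E'.
  rewrite hact_back (hflowKN gp) E' mulrN opprK; apply: ler_wpM2r; first exact: ltW.
  have [h1 h2] := orbw s st; rewrite (lagr_chart K2 h1) /ham_lagr; apply: lerD.
    apply: le_trans (ler_norm _) _; apply: le_trans (pairing_norm _ _) _.
    have [_ _ _ H' _] := rg d; have [_ h3] := H' _ h2; have [_ h4] := h2.
    by apply: ler_wpM2l => //; apply: ler_pM.
  rewrite lerNl; have [h3 _] := h2; have := HB0 d _ (pcoord d (hflow K s w)).2 h3.
  by rewrite mul0r sub0r -surjective_pairing.
have H3 : u z.1 + hact K z t <= u y + a * t.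
  apply: le_trans H _; rewrite /a mulrDl addrA; apply: lerD => //.
  by rewrite -mulrA.
pose w' := hflow K t z.
have iw' : inr d 1 w'.1 by [].
have Kw' : K w' <= E by rewrite (hflow_energy gp).
have zE : hflow K (- t) w' = z by rewrite (hflowNK gp).
have iz : inr d 2 z.1.
  by have := stay_inr es iw' le13 Kw' (nt _ (lexx _)); rewrite zE i11.
have [e e1 eE] := pairing_dual (pchart d y - pchart d z.1).
pose g s := hact K w' s - k0 * pairing e (pchart d (hflow K s w').1).
pose G s := gradQ (ploc K d) (pcoord d (hflow K s w')).
have orb (s : R) : `|s| <= `|- t| -> dom (idx d) (hflow K s w').1 /\
    pbox d b (pcoord d (hflow K s w')).
  by move=> st; have [] := stay_pbox es (inr_le le13 iw') Kw' (nt _ st).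
have [s st gE] : exists2 s : R, `|s| <= `|- t| &
    g (- t) - g 0 = (lagr K (hflow K s w') - k0 * pairing e (G s)) * - t.
  apply: (@MVT_sym _ g (fun s => lagr K (hflow K s w') - k0 * pairing e (G s)) (- t)) => s st.
  have d1 := is_derive_hact gp w' s.
  have [h1 _] := orb s st.
  have d2 := is_derive_pairingl e (chart_deriv h1).
  rewrite /g; under eq_fun do rewrite (pairingC e); rewrite (pairingC e).
  by apply: is_deriveB; apply: is_deriveZ.
have [h1 h2] := orb s st.
have Ks : K z = K (hflow K s w') by rewrite !(hflow_energy gp).
have [h3 _] := h2.
have KsE : ploc K d (pcoord d (hflow K s w')) = K z.
  by rewrite (tloc_coord K h1) Ks.
rewrite le_max -KsE; apply/orP; right.
rewrite [X in tloc K _ X]surjective_pairing.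
apply: (HE1 d _ _ e) => //; rewrite -surjective_pairing.
have lE := lagr_chart K2 h1; rewrite /ham_lagr in lE; rewrite -lE -/(G s).
rewrite -(ler_pM2r t0).
move: gE; rewrite mulrN => /eqP; rewrite -eqr_oppLR opprB => /eqP gE.
rewrite -gE /g (hact0 gp) (hflow0 gp) zE.
have hz := hact_back t z; rewrite -/w' in hz.
have hz' : hact K w' (- t) = - hact K z t by rewrite hz opprK.
rewrite hz' sub0r opprB opprK.
have -> : - (k0 * pairing e (pchart d w'.1)) + (k0 * pairing e (pchart d z.1) + hact K z t) =
   hact K z t - k0 * `|pchart d y - pchart d z.1|.
  by rewrite -eE pairingBr /w' /y; ring.
have := Lu d _ _ iz (inr_le le12 iy) => /(le_trans (ler_norm _)).
move: H3; rewrite -/y; move: (u y) (u z.1) (hact K z t) (a * t) (k0 * _) => x1 x2 x3 x4 x5 h4 h5.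
rewrite -(lerD2l x2) addrA lerBlDr (le_trans h4) // (addrC x1) -addrA.
by rewrite addrCA lerD2l -lerBlDl.
Qed.

End Coercive.

Section Matching.
Context {R : realType} {n : nat}.
Local Notation V := 'rV[R]_n.

Lemma quad_match (p q : V) (r Q : R) : 0 < r -> 0 <= Q ->
  (forall w : V, `|w| <= r -> pairing p w <= pairing q w + Q * `|w| ^+ 2) -> p = q.
Proof.
move=> r0 Q0 H; suff le0 w : pairing (p - q) w <= 0.
  apply: pairing_ext => w; apply/eqP; rewrite -subr_eq0 -pairingBl eq_le le0 /=.
  by have := le0 (- w); rewrite pairingNr oppr_le0.
apply/ler_addgt0Pr => e e0; rewrite add0r.
have w1 : 0 < `|w| + 1 by rewrite ltr_wpDl.
have q1 : 0 < Q * `|w| ^+ 2 + 1 by rewrite ltr_wpDl // mulr_ge0 // sqr_ge0.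
pose l := Num.min (r / (`|w| + 1)) (e / (Q * `|w| ^+ 2 + 1)).
have l0 : 0 < l by rewrite lt_min !divr_gt0.
have l1 : l * (`|w| + 1) <= r by rewrite -ler_pdivlMr // ge_min lexx.
have l2 : l * (Q * `|w| ^+ 2 + 1) <= e by rewrite -ler_pdivlMr // ge_min lexx orbT.
have lw : l * `|w| <= r.
  by apply: le_trans l1; apply: ler_wpM2l; [exact: ltW|rewrite lerDl].
have := H (l *: w); rewrite normrZ (gtr0_norm l0) !pairingZr => /(_ lw).
rewrite -lerBlDl -mulrBr -pairingBl exprMn mulrCA expr2 -mulrA ler_pM2l // => h.
apply: le_trans h _; apply: le_trans l2; apply: ler_wpM2l; first exact: ltW.
by rewrite lerDl.
Qed.

Lemma derive_sign (h : R -> R) (l r Q : R) (sg : bool) : 0 < r -> 0 <= Q -> is_derive (0 : R) 1 h l ->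
  h 0 = 0 -> (forall s : R, 0 < s -> s <= r ->
    if sg then - (Q * s ^+ 2) <= h s else h (- s) <= Q * s ^+ 2) -> 0 <= l.
Proof.
move=> r0 Q0 dh h0 H; rewrite leNgt; apply/negP => l0.
have [dh1 dhl] := dh; have hd : differentiable h 0 by exact/derivable1_diffP.
have l20 : 0 < - l / 2 by rewrite divr_gt0 // oppr_gt0.
have := diff_eps hd l20 => /nbhs_ballP[e /= e0 eP].
pose s := Num.min (Num.min r (e / 2)) (- l / (4 * (Q + 1))).
have Q1 : 0 < 4 * (Q + 1) by rewrite mulr_gt0 // ltr_wpDl.
have s0 : 0 < s by rewrite !lt_min r0 !divr_gt0 // oppr_gt0.
have sr : s <= r by rewrite !ge_min lexx.
have se : s < e.
  have : s <= e / 2 by rewrite !ge_min lexx orbT.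
  by move=> h1; apply: le_lt_trans h1 _; rewrite ltr_pdivrMr // mulrDr mulr1 ltrDl.
have sl : s * (4 * (Q + 1)) <= - l by rewrite -ler_pdivlMr // !ge_min lexx orbT.
have dE (v : R) : 'd h 0 v = v * l.
  by rewrite -[v in LHS]mulr1 linearZ /= -deriveE // dhl.
have sl2 : s * (s * (4 * (Q + 1))) <= s * - l by rewrite ler_pM2l.
have ps : 0 < s * - l by rewrite mulr_gt0 // oppr_gt0.
have := H s s0 sr; case: sg {H} => H.
  have := eP s; rewrite -ball_normE /= sub0r normrN gtr0_norm // => /(_ se).
  rewrite addr0 h0 subr0 dE ler_norml => /andP[_].
  clear -H sl2 ps s0 Q0; nra.
have := eP (- s); rewrite -ball_normE /= sub0r !normrN gtr0_norm // => /(_ se).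
rewrite addr0 h0 subr0 dE ler_norml => /andP[+ _].
clear -H sl2 ps s0 Q0; nra.
Qed.

End Matching.

Section Machine.
Context {R : realType} {n : nat} {M : ptopologicalType} (S : smooth_manifold R n M) (P : patches S).
Local Notation V := 'rV[R]_n.
Implicit Types (d : 'I_(pcard P)) (z : TsM S) (u v : M -> R).

Definition TT (K : TsM S -> R) (E t : R) u (y : M) : R :=
  inf [set u z.1 + hact K z t | z in [set z | K z <= E /\ (hflow K t z).1 = y]].

Record mach (K : TsM S -> R) (E0 k0 E1 b C k tau D : R) : Prop := Mach {
  mach_k : 0 < k;
  mach_k0 : 0 <= k0;
  mach_est : est P K K (E1 + 1) b C k tau D;
  mach_zero : forall x, K (zero_cov S x) <= E0;
  mach_E : E0 <= E1;
  mach_int : forall t z u, 0 < t -> t <= tau -> Lip P k0 u -> K z <= E1 + 1 ->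
    u z.1 + hact K z t <= u (hflow K (- t) (zero_cov S (hflow K t z).1)).1 +
    hact K (hflow K (- t) (zero_cov S (hflow K t z).1)) t -> K z <= E1 }.

Lemma EE1 (E1 : R) : E1 <= E1 + 1. Proof. by rewrite lerDl. Qed.

Lemma mach_ex K E0 k0 : tonelli_in P K -> 0 <= k0 -> (forall x, K (zero_cov S x) <= E0) ->
  exists E1, forall E1', E1 <= E1' -> exists b C k tau D, mach K E0 k0 E1' b C k tau D.
Proof.
move=> KT k00 K0; have [E1 E10 H] := min_interior KT k00 K0; have [_ reg _] := KT.
exists E1 => E1' E11.
have [b [C [k [tau [D [k0' es]]]]]] := est_ex (E1' + 1) (tonelli_good KT) reg.
exists b, C, k, tau, D; split=> //; first exact: le_trans E10 E11.
move=> t z u t0 tt Lu KE H'; apply: (le_trans _ E11).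
exact: (H _ _ _ _ _ _ (le_trans E11 (EE1 E1')) es _ _ u t0).
Qed.

Variable K : TsM S -> R.
Hypothesis KT : tonelli_in P K.
Let gp := tonelli_good KT.
Variables (E0 k0 E1 b C k tau D : R).
Hypothesis mc : mach K E0 k0 E1 b C k tau D.

Definition ismin t u y z : Prop :=
  [/\ K z <= E1, (hflow K t z).1 = y & TT K (E1 + 1) t u y = u z.1 + hact K z t].

Lemma TT_min_ex t u y : 0 < t -> t <= tau -> Lip P k0 u -> exists z,
  [/\ K z <= E1, (hflow K t z).1 = y & forall z', K z' <= E1 + 1 -> (hflow K t z').1 = y ->
     u z.1 + hact K z t <= u z'.1 + hact K z' t].
Proof.
move=> t0 tt Lu; have es := mach_est mc; have [b0 C0 tau0 D0] := est_pos es.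
have k00 := mach_k0 mc; have [K2 _ _] := KT.
have [d iy] := pcover1 P y; have [dy yr] := iy.
have nt : `|- t| <= tau by rewrite normrN gtr0_norm.
pose W (q : V) := tprm (idx d) (pchart d y, q).
have Wc q : pcoord d (W q) = (pchart d y, q).
  by rewrite /W tprmK //; exact: cod_chart.
have W1 q : (W q).1 = y by rewrite /W tprmE /= chartK.
have iW q : inr d 1 (W q).1 by rewrite W1.
have iW3 q : inr d 3 (W q).1 by apply: inr_le le13 _.
have WK q : K (W q) = ploc K d (pchart d y, q) by rewrite tlocE.
pose B := [set q : V | K (W q) <= E1 + 1].
pose f q := u (hflow K (- t) (W q)).1 + hact K (hflow K (- t) (W q)) t.
have yr4 : `|pchart d y - ctr d| <= 4 * rad d.
  by have [] : inr d 4 y by apply: inr_le iy; rewrite (ler_nat R 1 4).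
have Bb q : B q -> `|q| <= b.
  by rewrite /B /= WK => h; exact: (est_proper es yr4 h).
have cB : compact B.
  apply: (@subclosed_compact _ B [set q | `|q - 0| <= b]); last by move=> q /Bb; rewrite /= subr0.
    rewrite (_ : B = [set q | ploc K d (pchart d y, q) <= E1 + 1]).
      apply: (@closed_comp _ _ (fun q => ploc K d (pchart d y, q)) [set x | x <= E1 + 1]).
        move=> q _; apply: (@continuous_comp _ _ _ (fun q : V => (pchart d y, q)) (ploc K d)).
          apply: (@lipT_continuous _ _ _ 1) => q1 q2; rewrite mul1r.
          by apply: norm_pair_le; rewrite /= ?subrr ?normr0.
        by apply: differentiable_continuous; apply: tloc_diff => //; exact: cod_chart.
      exact: closed_le.
    by apply/seteqP; split=> q; rewrite /B /= WK.
  exact: compact_ball.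
pose L := k0 * (1 + C * tau) + (n%:R * (b * (1 + C * tau)) + n%:R * (b * 1) + D * tau * (2 * b)).
have cf : {within B, continuous f}.
  apply: (@lip_within _ _ _ f B L) => q q' Bq Bq'.
  have i2 q1 : B q1 -> inr d 2 (hflow K (- t) (W q1)).1.
    move=> Bq1; have := stay_inr es (iW q1) le13 Bq1 nt.
    by rewrite (_ : 1 + 1 = 2 :> R) // -[2]natr1.
  have cdE : cdiff d (W q) (W q') = (0, q' - q).
    by rewrite /cdiff !Wc; congr pair; exact: subrr.
  have ncd : `|cdiff d (W q) (W q')| = `|q' - q| by rewrite cdE norm_pair0l.
  have lp := est_lip es (iW3 q) (iW3 q') Bq Bq' nt.
  have Ct : C * `|- t| <= C * tau by apply: ler_wpM2l => //; exact: ltW.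
  have xt : `|(cdiff d (hflow K (- t) (W q)) (hflow K (- t) (W q'))).1| <= (1 + C * tau) * `|q' - q|.
    apply: le_trans (norm_pair1 _) _.
    rewrite -(subrK (cdiff d (W q) (W q')) (cdiff _ (hflow _ _ _) _)) (le_trans (ler_normD _ _)) //.
    rewrite ncd mulrDl mul1r addrC lerD2l (le_trans lp) // ncd.
    exact: ler_wpM2r.
  have th := est_act es (iW3 q) (iW3 q') Bq Bq' nt.
  have H1 : `|u (hflow K (- t) (W q')).1 - u (hflow K (- t) (W q)).1| <=
      k0 * (1 + C * tau) * `|q' - q|.
    apply: le_trans (Lu d _ _ (i2 _ Bq) (i2 _ Bq')) _.
    by rewrite -mulrA; apply: ler_wpM2l.
  have H2 : `|hact K (W q') (- t) - hact K (W q) (- t)| <=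
      (n%:R * (b * (1 + C * tau)) + n%:R * (b * 1) + D * tau * (2 * b)) * `|q' - q|.
    move: th; rewrite /theta ncd.
    set p1 := pairing (coord _ (hflow _ _ _)).2 _; set p2 := pairing (coord _ (W q)).2 _.
    have p1b : `|p1| <= n%:R * (b * (1 + C * tau)) * `|q' - q|.
      apply: le_trans (pairing_norm _ _) _; rewrite -!mulrA; apply: ler_wpM2l => //.
      by have [_ _ [_ h]] := stay_pbox KT es (iW3 q) Bq nt; apply: ler_pM.
    have p2b : `|p2| <= n%:R * (b * 1) * `|q' - q|.
      by rewrite /p2 cdE /= pairing0r normr0 !mulr_ge0.
    have qq : `|q' - q| <= 2 * b.
      by rewrite mulrDl mul1r (le_trans (ler_normB _ _)) // lerD // Bb.
    move: (hact _ _ _) (hact _ _ _) => h2 h1 th.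
    have -> : h1 - h2 = (h1 - h2 - p1 + p2) + p1 - p2 by ring.
    apply: le_trans (ler_normB _ _) _.
    apply: le_trans (lerD (ler_normD _ _) (lexx _)) _.
    rewrite (_ : _ * `|q' - q| = D * tau * (2 * b) * `|q' - q|
      + n%:R * (b * (1 + C * tau)) * `|q' - q| + n%:R * (b * 1) * `|q' - q|); last by ring.
    apply: lerD p2b.
    apply: lerD p1b; apply: le_trans th _.
    rewrite expr2 (mulrA (D * `|- t|)); apply: ler_wpM2r => //; apply: ler_pM => //.
      by rewrite mulr_ge0 // ltW.
    by apply: ler_wpM2l => //; exact: ltW.
  have fE q1 : f q1 = u (hflow K (- t) (W q1)).1 - hact K (W q1) (- t).
    by rewrite /f (hact_back KT) (hflowKN gp).
  rewrite !fE /L mulrDl; move: H1 H2; move: (u _) (u _) (hact _ _ _) (hact _ _ _) => u1 u2 h1 h2 H1 H2.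
  rewrite (_ : u2 - h2 - (u1 - h1) = (u2 - u1) - (h2 - h1)); last by ring.
  by apply: le_trans (ler_normB _ _) _; exact: lerD.
have B0 : B !=set0.
  exists 0; rewrite /B /= WK; have := mach_zero mc y.
  rewrite -(tloc_coord K (dy : dom (idx d) (zero_cov S y).1)) zero_cov_coord => h.
  by apply: le_trans h (le_trans (mach_E mc) (EE1 E1)).
have [q Bq qmin] := compact_EVT_min B0 cB cf.
rewrite inE in Bq; set z := hflow K (- t) (W q).
have zK : K z <= E1 + 1 by rewrite (hflow_energy gp).
have zy : (hflow K t z).1 = y by rewrite (hflowKN gp).
have zmin z' : K z' <= E1 + 1 -> (hflow K t z').1 = y -> u z.1 + hact K z t <= u z'.1 + hact K z' t.
  move=> Kz' z'y; set w := hflow K t z'.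
  have wE : W (pcoord d w).2 = w.
    have dw : dom (idx d) w.1 by rewrite z'y.
    by rewrite /W -z'y -[RHS](coordK dw).
  have Bq' : B (pcoord d w).2 by rewrite /B /= wE (hflow_energy gp).
  have := qmin (pcoord d w).2; rewrite inE => /(_ Bq').
  by rewrite /f wE (hflowNK gp).
exists z; split=> //; apply: (mach_int mc t0 tt Lu zK).
rewrite zy; apply: zmin; last by rewrite (hflowKN gp).
by rewrite (hflow_energy gp); exact: le_trans (mach_zero mc y) (le_trans (mach_E mc) (EE1 E1)).
Qed.

Lemma TT_eq t u y z : K z <= E1 + 1 -> (hflow K t z).1 = y ->
  (forall z', K z' <= E1 + 1 -> (hflow K t z').1 = y ->
     u z.1 + hact K z t <= u z'.1 + hact K z' t) ->
  TT K (E1 + 1) t u y = u z.1 + hact K z t.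
Proof.
move=> Kz zy zmin; apply/eqP; rewrite eq_le; apply/andP; split.
  apply: inf_lbound; last by exists z.
  by exists (u z.1 + hact K z t) => _ [z' [Kz' z'y] <-]; exact: zmin.
apply: lb_le_inf; first by exists (u z.1 + hact K z t), z.
by move=> _ [z' [Kz' z'y] <-]; exact: zmin.
Qed.

Lemma ismin_ex t u y : 0 < t -> t <= tau -> Lip P k0 u -> exists z, ismin t u y z.
Proof.
move=> t0 tt Lu; have [z [Kz zy zmin]] := TT_min_ex y t0 tt Lu.
by exists z; split=> //; apply: TT_eq => //; exact: le_trans Kz (EE1 E1).
Qed.

Lemma TT_le t u z : 0 < t -> t <= tau -> Lip P k0 u -> K z <= E1 + 1 ->
  TT K (E1 + 1) t u (hflow K t z).1 <= u z.1 + hact K z t.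
Proof.
move=> t0 tt Lu Kz; have [w [Kw wy wmin]] := TT_min_ex (hflow K t z).1 t0 tt Lu.
by rewrite (TT_eq (le_trans Kw (EE1 E1)) wy wmin); exact: wmin.
Qed.

Lemma ismin_start d (m : R) t u y z : 0 < t -> t <= tau -> inr d m y -> m <= 2 -> ismin t u y z ->
  inr d (m + 1) z.1.
Proof.
move=> t0 tt iy m2 [Kz zy _].
have -> : z = hflow K (- t) (hflow K t z) by rewrite (hflowNK gp).
apply: (stay_inr (mach_est mc)).
- by rewrite zy.
- exact: le_trans m2 le23.
- by rewrite (hflow_energy gp); exact: le_trans Kz (EE1 E1).
- by rewrite normrN gtr0_norm.
Qed.

Lemma EK1 x : x <= E1 -> x <= E1 + 1 - 1.
Proof. by rewrite addrK. Qed.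

Lemma TT_semiconcave t : 0 < t -> t <= tau -> exists rho Q, [/\ 0 < rho, 0 < Q &
  forall u d y z, Lip P k0 u -> inr d 2 y -> ismin t u y z ->
  forall y', dom (idx d) y' -> `|pchart d y' - pchart d y| <= rho ->
  TT K (E1 + 1) t u y' <= TT K (E1 + 1) t u y
    + pairing (pcoord d (hflow K t z)).2 (pchart d y' - pchart d y)
    + Q * `|pchart d y' - pchart d y| ^+ 2].
Proof.
move=> t0 tt; have t0' : 0 < `|t| by rewrite gtr0_norm.
have tt' : `|t| <= tau by rewrite gtr0_norm.
have [rho [Q [rho0 Q0 H]]] := push gp (mach_est mc) (mach_k mc) t0' tt'.
exists rho, Q; split=> // u d y z Lu iy zm y' dy' yr; have [Kz zy TTz] := zm.
have iz : inr d 3 z.1.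
  by have := ismin_start t0 tt iy (lexx _) zm; rewrite natr1.
have [|z' [z'1 Kz' dz' z'y]] := H d z iz (EK1 Kz) (pchart d y').
  by rewrite zy.
rewrite zy => /(le_trans (ler_norm _)); rewrite lerBlDl lerBlDl => h.
have zy' : (hflow K t z').1 = y' by rewrite -(chartK dy') -z'y chartK.
have := TT_le t0 tt Lu Kz'; rewrite zy' z'1 TTz => h'; apply: le_trans h' _.
by rewrite -!addrA lerD2l.
Qed.

Lemma TT_start t : 0 < t -> t <= tau -> exists rho Q, [/\ 0 < rho, 0 < Q &
  forall u d y z, Lip P k0 u -> inr d 2 y -> ismin t u y z ->
  forall x', dom (idx d) x' -> `|pchart d x' - pchart d z.1| <= rho ->
  u z.1 + pairing (pcoord d z).2 (pchart d x' - pchart d z.1)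
    - Q * `|pchart d x' - pchart d z.1| ^+ 2 <= u x'].
Proof.
move=> t0 tt; have t0' : 0 < `|- t| by rewrite normrN gtr0_norm.
have tt' : `|- t| <= tau by rewrite normrN gtr0_norm.
have [rho [Q [rho0 Q0 H]]] := push gp (mach_est mc) (mach_k mc) t0' tt'.
exists rho, Q; split=> // u d y z Lu iy zm x' dx' xr; have [Kz zy TTz] := zm.
pose w := hflow K t z.
have wz : hflow K (- t) w = z by rewrite (hflowNK gp).
have iw : inr d 3 w.1 by rewrite zy; apply: inr_le le23 iy.
have Kw : K w <= E1 by rewrite (hflow_energy gp).
have [|w' [w'1 Kw' dw' w'x]] := H d w iw (EK1 Kw) (pchart d x').
  by rewrite wz.
rewrite wz => h.
have wx' : (hflow K (- t) w').1 = x' by rewrite -(chartK dx') -w'x chartK.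
pose z' := hflow K (- t) w'.
have Kz' : K z' <= E1 + 1 by rewrite (hflow_energy gp).
have := TT_le t0 tt Lu Kz'; rewrite (hflowKN gp) w'1 zy TTz.
rewrite /z' wx' (hact_back KT t z) -/w (hact_back KT t) (hflowKN gp).
move: h; rewrite ler_norml => /andP[].
set a1 := hact K w' (- t); set a2 := hact K w (- t); set pp := pairing _ _; set qq := Q * _.
move=> h1 _ h2; rewrite -(lerD2r (- a1)) (le_trans _ h2) //.
rewrite (_ : u z.1 + pp - qq - a1 = (u z.1 + pp - a1) + - qq); last by ring.
by rewrite (_ : u z.1 - a2 = (u z.1 + pp - a1) + (a1 - a2 - pp)); [rewrite lerD2l|ring].
Qed.

(* At a junction, the starting covector of the second minimizing orbit is a subdifferential and
   the final covector of the first one is a superdifferential of the same function. *)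
Lemma unbroken r s u y z w : 0 < r -> r <= tau -> 0 < s -> s <= tau -> Lip P k0 u ->
  Lip P k0 (TT K (E1 + 1) s u) -> ismin r (TT K (E1 + 1) s u) y z -> ismin s u z.1 w ->
  hflow K s w = z.
Proof.
move=> r0 rt s0 st Lu Lv zm wm; have [d iy] := pcover1 P y.
have [rho1 [Q1 [rho10 Q10 H1]]] := TT_start r0 rt.
have [rho2 [Q2 [rho20 Q20 H2]]] := TT_semiconcave s0 st.
have iz : inr d 2 z.1.
  by have := ismin_start r0 rt iy le12 zm; rewrite (_ : 1 + 1 = 2 :> R) // -[2]natr1.
have {}H1 := H1 _ d y z Lv (inr_le le12 iy) zm.
have {}H2 := H2 u d _ w Lu iz wm.
have [Kw wz _] := wm; have [dz _] := iz.
have dw : dom (idx d) (hflow K s w).1 by rewrite wz.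
apply: (coord_inj dw dz); apply: injective_projections => /=; first by rewrite wz.
rewrite -[LHS]/((pcoord d (hflow K s w)).2) -[RHS]/((pcoord d z).2).
set q := (pcoord d (hflow K s w)).2 in H2 *; set p := (pcoord d z).2 in H1 *.
have [rr rr0 rP] := chart_ball dz.
apply/esym; pose rho := Num.min rr (Num.min rho1 rho2).
apply: (@quad_match _ _ _ _ rho (Q1 + Q2)); first by rewrite !lt_min rr0 rho10.
  by rewrite addr_ge0 // ltW.
move=> v; rewrite !le_min => /andP[v1 /andP[v2 v3]].
have cv : cod (idx d) (pchart d z.1 + v) by apply: rP; rewrite addrC addKr.
pose x' := param (idx d) (pchart d z.1 + v).
have dx' : dom (idx d) x' by exact: dom_param.
have xv : pchart d x' - pchart d z.1 = v by rewrite /x' paramK // addrC addKr.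
have := H1 x' dx'; rewrite xv => /(_ v2) h1.
have := H2 x' dx'; rewrite xv => /(_ v3) h2.
have := le_trans h1 h2; rewrite -!addrA lerD2l lerBlDr => h.
by apply: le_trans h _; rewrite -addrA lerD2l mulrDl addrC.
Qed.

Lemma TT_add r s u : 0 < r -> 0 < s -> r + s <= tau -> Lip P k0 u ->
  Lip P k0 (TT K (E1 + 1) s u) ->
  TT K (E1 + 1) r (TT K (E1 + 1) s u) = TT K (E1 + 1) (r + s) u.
Proof.
move=> r0 s0 rst Lu Lv.
have rt : r <= tau by apply: le_trans rst; rewrite lerDl ltW.
have st : s <= tau by apply: le_trans rst; rewrite lerDr ltW.
have rs0 : 0 < r + s by exact: addr_gt0.
apply/funext => y; apply/eqP; rewrite eq_le; apply/andP; split.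
  have [z [Kz zy ->]] := ismin_ex y rs0 rst Lu; have Kz' := le_trans Kz (EE1 E1).
  have Kz2 : K (hflow K s z) <= E1 + 1 by rewrite (hflow_energy gp).
  rewrite addrC in zy *; rewrite (hactD gp) addrA.
  have := TT_le r0 rt Lv Kz2; rewrite -(hflowD gp) zy => h; apply: le_trans h _.
  by rewrite lerD2r; exact: TT_le.
have [z zm] := ismin_ex y r0 rt Lv; have [w wm] := ismin_ex z.1 s0 st Lu.
have E' := unbroken r0 rt s0 st Lu Lv zm wm.
have [Kz zy ->] := zm; have [Kw _ ->] := wm.
rewrite -E' -addrA -(hactD gp).
have Kw' := le_trans Kw (EE1 E1).
by have := TT_le rs0 rst Lu Kw'; rewrite [r + s]addrC (hflowD gp) E' zy.
Qed.

Lemma TT_mono t u v e : 0 < t -> t <= tau -> Lip P k0 u -> Lip P k0 v ->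
  (forall x, u x <= v x + e) -> forall y, TT K (E1 + 1) t u y <= TT K (E1 + 1) t v y + e.
Proof.
move=> t0 tt Lu Lv uv y; have [z [Kz zy ->]] := ismin_ex y t0 tt Lv.
have := TT_le t0 tt Lu (le_trans Kz (EE1 E1)); rewrite zy => h; apply: le_trans h _.
by rewrite addrAC lerD2r.
Qed.

Lemma TT_Lip t u : 0 < t -> t <= tau -> Lip P k0 u ->
  (forall y z, ismin t u y z -> K z <= E0) ->
  (forall d y q, `|y - ctr d| <= 4 * rad d -> ploc K d (y, q) <= E0 -> n%:R * `|q| <= k0) ->
  Lip P k0 (TT K (E1 + 1) t u).
Proof.
move=> t0 tt Lu zE qE d x x' ix ix'.
have [rho [Q [rho0 Q0 H]]] := TT_semiconcave t0 tt.
have r0 := rad_gt0 d.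
pose f := TT K (E1 + 1) t u \o param (idx d).
have [dx xr] := ix; have [dx' xr'] := ix'.
have fE x1 : dom (idx d) x1 -> f (pchart d x1) = TT K (E1 + 1) t u x1.
  by move=> dx1; rewrite /f /= chartK.
rewrite -(fE _ dx) -(fE _ dx').
apply: (@lip_of_quad _ _ f (ctr d) (2 * rad d) rho Q) => // y y' yr yr' yy'.
have in4 w : `|w - ctr d| <= 2 * rad d -> `|w - ctr d| <= 4 * rad d.
  by move=> h; apply: le_trans h _; apply: ler_wpM2r; [exact: ltW|rewrite (ler_nat R 2 4)].
have cy : cod (idx d) y by apply: pcod; exact: in4.
have cy' : cod (idx d) y' by apply: pcod; exact: in4.
have dy := dom_param cy; have dy' := dom_param cy'.
have iy : inr d 2 (param (idx d) y) by split=> //; rewrite paramK.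
have [z zm] := ismin_ex (param (idx d) y) t0 tt Lu; have [Kz zy _] := zm.
have := H u d _ z Lu iy zm _ dy'; rewrite !paramK // => /(_ yy').
rewrite -addrA -lerBlDl => h; apply: le_trans h _; rewrite lerD2r.
apply: le_trans (ler_norm _) _; apply: le_trans (pairing_norm _ _) _; rewrite mulrA.
apply: ler_wpM2r => //; apply: (qE d y); first exact: in4.
have dz : dom (idx d) (hflow K t z).1 by rewrite zy.
rewrite (_ : (y, _) = pcoord d (hflow K t z)); last first.
  by rewrite [RHS]surjective_pairing /= zy paramK.
rewrite tloc_coord //.
by rewrite (hflow_energy gp); exact: zE zm.
Qed.

End Machine.

Section QuasiAdditive.
Context {R : realType}.

Lemma quasi_additive (a : nat -> R) (B : R) : 0 <= B -> a 0%N = 0 ->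
  (forall N N', `|a (N + N')%N - a N - a N'| <= B) -> exists l : R, forall N, `|a N - l * N%:R| <= B.
Proof.
move=> B0 a0 aB.
have lo N m : m%:R * (a N - B) <= a (m * N)%N.
  elim: m => [|m IH]; first by rewrite mul0r mul0n a0.
  have := aB N (m * N)%N; rewrite -mulSn ler_norml => /andP[h _].
  rewrite -natr1 mulrDl mul1r; move: h IH; move: (a (m.+1 * N)%N) (a (m * N)%N) (a N) (_%:R * _).
  move=> x1 x2 x3 x4; lra.
have up N m : a (m * N)%N <= m%:R * (a N + B).
  elim: m => [|m IH]; first by rewrite mul0r mul0n a0.
  have := aB N (m * N)%N; rewrite -mulSn ler_norml => /andP[_ h].
  rewrite -natr1 mulrDl mul1r; move: h IH; move: (a (m.+1 * N)%N) (a (m * N)%N) (a N) (_%:R * _).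
  move=> x1 x2 x3 x4; lra.
pose A := [set (a N.+1 - B) / N.+1%:R | N in [set: nat]].
have ubA N' : ubound A ((a N'.+1 + B) / N'.+1%:R).
  move=> _ [N _ <-]; rewrite ler_pdivrMr ?ltr0n // mulrAC ler_pdivlMr ?ltr0n //.
  rewrite mulrC [leRHS]mulrC; apply: le_trans (lo N.+1 N'.+1) _.
  by rewrite mulnC; exact: up.
have hA : has_sup A.
  split; first by exists ((a 1%N - B) / 1%:R), 0%N.
  by exists ((a 1%N + B) / 1%:R); exact: ubA.
exists (sup A) => -[|N]; first by rewrite mulr0 subr0 a0 normr0.
have N0 : (0 : R) < N.+1%:R by rewrite ltr0n.
have h1 : (a N.+1 - B) <= sup A * N.+1%:R.
  by rewrite -ler_pdivrMr //; apply: sup_upper_bound => //; exists N.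
have h2 : sup A * N.+1%:R <= a N.+1 + B.
  rewrite -ler_pdivlMr //; apply: ge_sup; [by case: hA|exact: ubA].
by rewrite ler_norml; apply/andP; split; move: h1 h2; move: (a _) (sup A * _) => x1 x2; lra.
Qed.

End QuasiAdditive.

Section Osc.
Context {R : realType} {n : nat} {M : ptopologicalType} (S : smooth_manifold R n M) (P : patches S).
Implicit Types (d : 'I_(pcard P)).

Lemma near_inr d x : dom (idx d) x -> `|pchart d x - ctr d| < rad d -> \forall x' \near x, inr d 1 x'.
Proof.
move=> dx xr; have e0 : 0 < rad d - `|pchart d x - ctr d| by rewrite subr_gt0.
apply: filterS (near_chart dx e0) => x' [dx' x'r]; split=> //; rewrite mul1r.
apply: le_trans (ler_distD (pchart d x) _ _) _; rewrite -lerBrDr; exact: ltW.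
Qed.

Lemma Lip_local (k : R) d x x' (u : M -> R) : 0 <= k -> Lip P k u -> inr d 2 x -> inr d 2 x' ->
  `|u x' - u x| <= k * (4 * rad d).
Proof.
move=> k0 Lu ix ix'; apply: le_trans (Lu d _ _ ix ix') _; apply: ler_wpM2l => //.
have [_ h1] := ix; have [_ h2] := ix'.
apply: le_trans (ler_distD (ctr d) _ _) _; rewrite (distrC (ctr d)).
have -> : 4 * rad d = 2 * rad d + 2 * rad d by ring.
exact: lerD.
Qed.

Lemma Lip_osc (k : R) : 0 <= k -> connected [set: M] ->
  exists2 B : R, 0 <= B & forall u, Lip P k u -> forall x y, `|u x - u y| <= B.
Proof.
move=> k0 cM; pose x0 : M := point.
pose Z := [set y | exists B : R, forall u, Lip P k u -> `|u y - u x0| <= B].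
have step d y y' : inr d 1 y -> inr d 1 y' -> Z y -> Z y'.
  move=> iy iy' [B HB]; exists (k * (4 * rad d) + B) => u Lu.
  apply: le_trans (ler_distD (u y) _ _) _; apply: lerD; last exact: HB.
  by apply: Lip_local => //; apply: inr_le le12 _.
have ZT : Z = setT.
  apply: cM.
  - by exists x0; exists 0 => u _; rewrite subrr normr0.
  - exists Z; last by rewrite setTI.
    rewrite openE => y Zy; rewrite /interior /=; have [d dy yr] := pcover P y.
    have iy : inr d 1 y by split=> //; rewrite mul1r ltW.
    by apply: filterS (near_inr dy yr) => y' iy'; exact: (step _ _ _ iy iy' Zy).
  - exists Z; last by rewrite setTI.
    rewrite closedE => y Hy; have [//|nZ] := pselect (Z y); exfalso; apply: Hy.
    have [d dy yr] := pcover P y; have iy : inr d 1 y by split=> //; rewrite mul1r ltW.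
    by apply: filterS (near_inr dy yr) => y' iy' Zy'; apply: nZ; exact: (step _ _ _ iy' iy Zy').
have [||B B0 HB] := @fin_bound R (pcard P) (fun d B => forall x u, inr d 1 x -> Lip P k u ->
    `|u x - u x0| <= B).
- move=> d; have [[x ix]|nx] := pselect (exists x, inr d 1 x); last first.
    by exists 0 => // x u ix; exfalso; apply: nx; exists x.
  have : Z x by rewrite ZT.
  move=> [B HB]; exists (k * (4 * rad d) + `|B|) => [|x' u ix' Lu].
    by rewrite addr_ge0 // !mulr_ge0 // ltW // rad_gt0.
  apply: le_trans (ler_distD (u x) _ _) _; apply: lerD.
    by apply: Lip_local => //; apply: inr_le le12 _.
  by apply: le_trans (HB u Lu) (ler_norm _).
- by move=> d B B' BB' H x u ix Lu; apply: le_trans BB'; exact: H.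
exists (B + B) => [|u Lu x y]; first exact: addr_ge0.
have [d ix] := pcover1 P x; have [d' iy] := pcover1 P y.
apply: le_trans (ler_distD (u x0) _ _) _; apply: lerD; first exact: (HB _ _ _ ix Lu).
by rewrite distrC; exact: (HB _ _ _ iy Lu).
Qed.

End Osc.

Section Dominated.
Context {R : realType} {n : nat} {M : ptopologicalType} (S : smooth_manifold R n M) (P : patches S).
Local Notation V := 'rV[R]_n.
Implicit Types (d : 'I_(pcard P)) (z : TsM S) (u v : M -> R).

Definition dominated (K : TsM S -> R) (E c h : R) v : Prop := forall z r, 0 < r -> r <= h ->
  K z <= E -> v (hflow K r z).1 <= v z.1 + hact K z r + c * r.

(* Differentiate the domination inequality along the orbit of [z], forwards for a subdifferential
   and backwards for a superdifferential. *)
Lemma dominated_sub K E c h v (E' b C k tau D : R) (sg : bool) d z rho Q :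
  tonelli_in P K -> est P K K E' b C k tau D -> 0 < h -> dominated K E c h v ->
  inr d 3 z.1 -> K z <= E -> K z <= E' -> 0 < rho -> 0 <= Q ->
  (forall x', dom (idx d) x' -> `|pchart d x' - pchart d z.1| <= rho ->
     let D := pchart d x' - pchart d z.1 in
     let a := v z.1 + pairing (pcoord d z).2 D in
     if sg then a - Q * `|D| ^+ 2 <= v x' else v x' <= a + Q * `|D| ^+ 2) ->
  K z <= c.
Proof.
move=> KT es h0 vd iz KE KE' rho0 Q0 H.
have gp := tonelli_good KT; have [b0 C0 tau0 D0] := est_pos es; have [dz _] := iz.
have [K2 _ _] := KT.
set p := (pcoord d z).2 in H *.
pose g s := hact K z s + c * s - pairing p (pchart d (hflow K s z).1 - pchart d z.1).
rewrite -subr_ge0; apply: (@derive_sign _ g _ (Num.min h (Num.min tau (rho / C))) (Q * C ^+ 2) sg).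
- by rewrite !lt_min h0 tau0 divr_gt0.
- by rewrite mulr_ge0 // sqr_ge0.
- have dz' : dom (idx d) (hflow K 0 z).1 by rewrite (hflow0 gp).
  have d1 := is_derive_hact gp z 0; have d2 := chart_deriv KT dz'.
  rewrite (hflow0 gp) in d1 d2.
  have d3 : is_derive (0 : R) 1 (fun s => pairing p (pchart d (hflow K s z).1 - pchart d z.1))
      (pairing p (gradQ (ploc K d) (pcoord d z))).
    under eq_fun do rewrite pairingC; rewrite pairingC; apply: is_derive_pairingl.
    rewrite -[X in is_derive _ _ _ X]subr0; apply: is_deriveB => //; exact: is_derive_cst.
  have d4 : is_derive (0 : R) 1 (fun s : R => c * s) c.
    by under eq_fun do rewrite mulrC; exact: is_derive_mulr.
  have -> : c - K z = lagr K z + c - pairing p (gradQ (ploc K d) (pcoord d z)).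
    rewrite (lagr_chart K2 dz) /ham_lagr tloc_coord // -/p.
    by move: (pairing _ _) (K z) => x1 x2; ring.
  by apply: is_deriveB => //; exact: is_deriveD.
- by rewrite /g (hact0 gp) mulr0 (hflow0 gp) subrr pairing0r addr0 subr0.
- move=> s s0; rewrite !le_min => /andP[sh /andP[st]]; rewrite ler_pdivlMr // => sr.
  have stay (s' : R) : `|s'| = s -> dom (idx d) (hflow K s' z).1 /\
      `|pchart d (hflow K s' z).1 - pchart d z.1| <= C * s.
    by move=> E1; have [] := est_stay es iz KE' (t := s') ; rewrite E1.
  have quad (s' : R) : `|s'| = s -> Q * `|pchart d (hflow K s' z).1 - pchart d z.1| ^+ 2 <=
      Q * C ^+ 2 * s ^+ 2.
    move=> E1; have [_ h1] := stay s' E1; rewrite -mulrA -exprMn; apply: ler_wpM2l => //.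
    by rewrite ler_pXn2r ?nnegrE // mulr_ge0 // ltW.
  case: sg H => H.
    have E1 : `|s| = s by rewrite gtr0_norm.
    have [h1 h2] := stay s E1; have := quad s E1.
    have := H _ h1; rewrite /= (le_trans h2) ?[C * _]mulrC // => /(_ isT).
    have := vd z s s0 sh KE; rewrite /g.
    move: (v _) (v _) (hact K _ _) (c * s) (pairing _ _) (Q * _) (Q * _ * _) => x1 x2 x3 x4 x5 x6 x7.
    lra.
  have E1 : `|- s| = s by rewrite normrN gtr0_norm.
  have [h1 h2] := stay (- s) E1; have := quad (- s) E1.
  have := H _ h1; rewrite /= (le_trans h2) ?[C * _]mulrC // => /(_ isT).
  have KE2 : K (hflow K (- s) z) <= E by rewrite (hflow_energy gp).
  have := vd _ s s0 sh KE2; rewrite (hflowKN gp) /g.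
  have -> : hact K z (- s) = - hact K (hflow K (- s) z) s.
    by rewrite (hact_back KT s) (hflowKN gp) opprK.
  rewrite mulrN.
  move: (v _) (v _) (hact K _ _) (c * s) (pairing _ _) (Q * _) (Q * _ * _) => x1 x2 x3 x4 x5 x6 x7.
  lra.
Qed.

End Dominated.

Section WeakKAM.
Context {R : realType} {n : nat} {M : ptopologicalType} (S : smooth_manifold R n M) (P : patches S).
Local Notation V := 'rV[R]_n.
Implicit Types (d : 'I_(pcard P)) (z : TsM S) (u v : M -> R).
Hypothesis M_connected : connected [set: M].
Variable K : TsM S -> R.
Hypothesis KT : tonelli_in P K.
Let gp := tonelli_good KT.
Variables (E0 k0 E1 b C k tau D : R).
Hypothesis mc : mach P K E0 k0 E1 b C k tau D.
Hypothesis qE : forall d y (q : V), `|y - ctr d| <= 4 * rad d -> ploc K d (y, q) <= E0 ->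
  n%:R * `|q| <= k0.
Local Notation T := (TT K (E1 + 1)).
Let h : R := tau / 2.

Lemma tau_gt0 : 0 < tau. Proof. by have [] := est_pos (mach_est mc). Qed.
Lemma h_gt0 : 0 < h. Proof. by rewrite divr_gt0 // tau_gt0. Qed.
Lemma hh : h + h = tau. Proof. by rewrite /h -splitr. Qed.
Lemma h_tau : h <= tau. Proof. by rewrite -hh lerDl ltW // h_gt0. Qed.

Fixpoint F (N : nat) : M -> R := if N is N'.+1 then T h (F N') else fun=> 0.

Lemma Lip0 : Lip P k0 (F 0).
Proof. by move=> d x x' _ _ /=; rewrite subrr normr0 mulr_ge0 // (mach_k0 mc). Qed.

Lemma ismin_zero r y z : 0 < r -> r <= tau -> ismin K E1 r (F 0) y z -> z = zero_cov S z.1.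
Proof.
move=> r0 rt zm; have [d iy] := pcover1 P y.
have [rho [Q [rho0 Q0 H]]] := TT_start KT mc r0 rt.
have {}H := H _ d y z Lip0 (inr_le le12 iy) zm.
have iz : inr d 2 z.1.
  by have := ismin_start KT mc r0 rt iy le12 zm; rewrite (_ : 1 + 1 = 2 :> R) // -[2]natr1.
have [dz _] := iz.
have dz0 : dom (idx d) (zero_cov S z.1).1 by [].
apply: (coord_inj dz dz0); rewrite zero_cov_coord.
apply: injective_projections => //=; rewrite -[LHS]/((pcoord d z).2).
have [rr rr0 rP] := chart_ball dz.
apply: (@quad_match _ _ _ _ (Num.min rr rho) Q); [by rewrite lt_min rr0|exact: ltW|].
move=> v; rewrite le_min => /andP[v1 v2].
have cv : cod (idx d) (pchart d z.1 + v) by apply: rP; rewrite addrC addKr.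
have := H _ (dom_param cv); rewrite paramK // addrC addKr => /(_ v2) /=.
by rewrite add0r pairing0l add0r lerBlDr add0r.
Qed.

Lemma F_orbit N : Lip P k0 (F N) /\ forall r y z, 0 < r -> r <= tau -> ismin K E1 r (F N) y z ->
  exists x, z = hflow K (N%:R * h) (zero_cov S x) /\ F N z.1 = hact K (zero_cov S x) (N%:R * h).
Proof.
elim: N => [|N [LN IH]].
  split=> [|r y z r0 rt zm]; first exact: Lip0.
  exists z.1; rewrite mul0r (hflow0 gp) (hact0 gp); split=> //; exact: ismin_zero zm.
have LN1 : Lip P k0 (F N.+1).
  apply: (TT_Lip KT mc h_gt0 h_tau LN _ qE) => y z /(IH _ _ _ h_gt0 h_tau)[x [-> _]].
  by rewrite (hflow_energy gp); exact: mach_zero mc x.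
split=> // r y z r0 rt zm; have [w wm] := ismin_ex KT mc z.1 h_gt0 h_tau LN.
have E' := unbroken KT mc r0 rt h_gt0 h_tau LN LN1 zm wm.
have [x [wx Fw]] := IH _ _ _ h_gt0 h_tau wm; have [_ _ Tw] := wm.
exists x; rewrite -natr1 mulrDl mul1r (hflowD gp) -wx E'; split=> //=.
by rewrite Tw (hactD gp) -wx Fw.
Qed.

Lemma F_Lip N : Lip P k0 (F N). Proof. by have [] := F_orbit N. Qed.

Lemma TF_Lip N r : 0 < r -> r <= tau -> Lip P k0 (T r (F N)).
Proof.
move=> r0 rt; have [LN H] := F_orbit N; apply: (TT_Lip KT mc r0 rt LN _ qE) => y z zm.
have [x [-> _]] := H _ _ _ r0 rt zm.
by rewrite (hflow_energy gp); exact: mach_zero mc x.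
Qed.

Lemma F_hact N y : exists x, (hflow K (N%:R * h) (zero_cov S x)).1 = y /\
  F N y = hact K (zero_cov S x) (N%:R * h).
Proof.
case: N => [|N]; first by exists y; rewrite mul0r (hflow0 gp) (hact0 gp).
have [LN H] := F_orbit N; have [z zm] := ismin_ex KT mc y h_gt0 h_tau LN.
have [x [zx Fz]] := H _ _ _ h_gt0 h_tau zm; have [_ zy Tz] := zm.
exists x; rewrite -natr1 mulrDl mul1r (hflowD gp) -zx zy; split=> //=.
by rewrite Tz (hactD gp) -zx Fz.
Qed.

Lemma F_shift N N' e : (forall x, F N x <= F N' x + e) -> forall m x, F (m + N) x <= F (m + N') x + e.
Proof.
move=> NN; elim=> [|m IH] x; first exact: NN.
rewrite !addSn /=.
by apply: (TT_mono KT mc h_gt0 h_tau (F_Lip _) (F_Lip _)).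
Qed.

Lemma lagr_ge z : - K (zero_cov S z.1) <= lagr K z.
Proof.
have [d [dz zr]] := pcover1 P z.1; have [K2 _ _] := KT.
have r4 : `|pchart d z.1 - ctr d| <= 4 * rad d.
  apply: le_trans zr _; apply: ler_wpM2r; [by rewrite ltW // rad_gt0|by rewrite (ler_nat R 1 4)].
rewrite (lagr_chart K2 dz) /ham_lagr.
have := fiber_convex KT (pcoord d z).2 0 r4.
have zE : (pchart d z.1, (pcoord d z).2) = pcoord d z by [].
rewrite zE -zero_cov_coord !tloc_coord // sub0r pairingNr pairingC.
by move: (K _) (K _) (pairing _ _) => x1 x2 x3; lra.
Qed.

Lemma hact_ge z t : 0 <= t -> - E0 * t <= hact K z t.
Proof.
move=> t0; have [s _] := @MVT_sym _ (hact K z) (fun s => lagr K (hflow K s z)) t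
  (fun s _ => is_derive_hact gp z s).
rewrite (hact0 gp) subr0 => ->; apply: ler_wpM2r => //; apply: le_trans (lagr_ge _).
by rewrite lerN2; exact: mach_zero mc _.
Qed.

Lemma critical_ex : exists c B : R, [/\ 0 <= B, c <= E0 & forall N x, `|F N x + c * (N%:R * h)| <= B].
Proof.
have [B B0 osc] := Lip_osc P (mach_k0 mc) M_connected.
pose a N := F N point.
have Fa N x : `|F N x - a N| <= B by exact: osc (F_Lip N) _ _.
have [//|N N'|l Hl] := @quasi_additive _ a B B0.
  rewrite ler_norml; apply/andP; split.
    have h1 x : F 0 x <= F N' x + (B - a N').
      by have := Fa N' x; rewrite ler_norml /= => /andP[+ _]; move: (F N' x) (a N') => x1 x2; lra.
    have := F_shift h1 N point; rewrite addn0.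
    by rewrite /a; move: (F _ _) (F _ _) (F _ _) => x1 x2 x3; lra.
  have h1 x : F N' x <= F 0 x + (a N' + B).
    by have := Fa N' x; rewrite ler_norml /= => /andP[_]; move: (F N' x) (a N') => x1 x2; lra.
  have := F_shift h1 N point; rewrite addn0.
  by rewrite /a; move: (F _ _) (F _ _) (F _ _) => x1 x2 x3; lra.
have h0 := h_gt0; pose c := - l / h.
have ch : c * h = - l by rewrite /c divfK // gt_eqF.
have HF N x : `|F N x + c * (N%:R * h)| <= B + B.
  rewrite mulrCA ch mulrC mulNr.
  have -> : F N x - l * N%:R = (F N x - a N) + (a N - l * N%:R) by ring.
  by apply: le_trans (ler_normD _ _) _; exact: lerD.
exists c, (B + B); split=> //; first exact: addr_ge0.
apply/ler_addgt0Pr => e e0; pose N := (Num.truncn ((B + B) / (e * h))).+1.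
have N0 : (0 : R) < N%:R by rewrite ltr0n.
have eh : 0 < e * h by exact: mulr_gt0.
have NB : B + B <= N%:R * (e * h) by rewrite -ler_pdivrMr // ltW // truncnS_gt.
have Nh : 0 < N%:R * h by exact: mulr_gt0.
have [x [_ Fx]] := F_hact N point.
have h1 : - E0 * (N%:R * h) <= F N point by rewrite Fx; apply: hact_ge; exact: ltW.
have := HF N point; rewrite ler_norml => /andP[_ h2].
rewrite -(ler_pM2r Nh) mulrDl.
have -> : e * (N%:R * h) = N%:R * (e * h) by ring.
move: h1 h2 NB; rewrite mulNr; move: (F N _) (c * _) (E0 * _) (N%:R * (e * h)) => x1 x2 x3 x4.
move: (B + B) => x5; lra.
Qed.

Section Critical.
Variables (c B : R).
Hypothesis cE : c <= E0.
Hypothesis HB : forall N x, `|F N x + c * (N%:R * h)| <= B.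

Definition crit (y : M) : R := inf [set a | exists N r, [/\ 0 < r, r <= h &
  a = T r (F N) y + c * (N%:R * h + r)]].

Lemma h_le r : r <= h -> r <= tau. Proof. by move=> /le_trans; apply; exact: h_tau. Qed.

Lemma crit_lb N r y : 0 < r -> r <= h ->
  - B - `|c - E0| * h <= T r (F N) y + c * (N%:R * h + r).
Proof.
move=> r0 rh; have [z [Kz zy ->]] := ismin_ex KT mc y r0 (h_le rh) (F_Lip N).
have := hact_ge z (ltW r0); have := HB N z.1; rewrite ler_norml => /andP[h1 _] h2.
have h3 : - (`|c - E0| * h) <= (c - E0) * r.
  rewrite lerNl -mulNr; apply: le_trans (ler_norm _) _.
  rewrite normrM normrN (gtr0_norm r0); exact: ler_wpM2l.
rewrite mulrDr; move: h1 h2 h3; rewrite mulrBl mulNr.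
move: (F N _) (hact K _ _) (c * (_ * _)) (c * r) (E0 * r) (`|_| * h) => x1 x2 x3 x4 x5 x6; lra.
Qed.

Lemma crit_le N r y : 0 < r -> r <= h -> crit y <= T r (F N) y + c * (N%:R * h + r).
Proof.
move=> r0 rh; apply: inf_lbound; last by exists N, r.
by exists (- B - `|c - E0| * h) => _ [N' [r' [r0' rh' ->]]]; exact: crit_lb.
Qed.

Lemma crit_ge a y : (forall N r, 0 < r -> r <= h -> a <= T r (F N) y + c * (N%:R * h + r)) ->
  a <= crit y.
Proof.
move=> H; apply: lb_le_inf; first by exists (T h (F 0) y + c * (0%:R * h + h)), 0%N, h; rewrite h_gt0.
by move=> _ [N [r [r0 rh ->]]]; exact: H.
Qed.

Lemma crit_Lip : Lip P k0 crit.
Proof.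
suff H d x x' : inr d 2 x -> inr d 2 x' ->
    crit x' - k0 * `|pchart d x' - pchart d x| <= crit x.
  move=> d x x' ix ix'; have h1 := H d x x' ix ix'; have h2 := H d x' x ix' ix.
  rewrite distrC in h2; rewrite ler_norml; move: h1 h2.
  by move: (crit x) (crit x') (_ * _) => x1 x2 x3 *; apply/andP; split; lra.
move=> ix ix'; apply: crit_ge => N r r0 rh; have := crit_le N x' r0 rh.
have := TF_Lip N r0 (h_le rh) ix ix' => /(le_trans (ler_norm _)).
by move: (TT _ _ _ _ x) (TT _ _ _ _ x') (crit x') (_ * `|_|) (c * _) => x1 x2 x3 x4 x5; lra.
Qed.

Lemma crit_dominated : dominated K (E1 + 1) c h crit.
Proof.
move=> z s s0 sh KE; rewrite -addrA -lerBlDr; apply: crit_ge => N r r0 rh.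
rewrite lerBlDr.
have rt := h_le rh; have st := h_le sh.
have rst : s + r <= tau by rewrite -hh lerD.
have := TT_le KT mc s0 st (TF_Lip N r0 rt) KE.
rewrite (TT_add KT mc s0 r0 rst (F_Lip N) (TF_Lip N r0 rt)) => H.
suff : crit (hflow K s z).1 <= T (s + r) (F N) (hflow K s z).1 + c * (N%:R * h + (s + r)).
  move: H; rewrite !mulrDr.
  move: (crit _) (TT _ _ _ _ _) (TT _ _ _ _ _) (hact K _ _) (c * (_ * _)) (c * s) (c * r).
  by move=> x1 x2 x3 x4 x5 x6 x7; lra.
have [srh|srh] := leP (s + r) h; first by apply: crit_le => //; exact: addr_gt0.
pose r' := s + r - h.
have r'0 : 0 < r' by rewrite subr_gt0.
have r'h : r' <= h by rewrite /r' lerBlDr hh.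
have E' : T (s + r) (F N) = T r' (F N.+1).
  have r'ht : r' + h <= tau by rewrite /r' subrK.
  by rewrite /= (TT_add KT mc r'0 h_gt0 r'ht (F_Lip N) (F_Lip N.+1)) /r' subrK.
rewrite E'; have -> : N%:R * h + (s + r) = N.+1%:R * h + r' by rewrite /r' -natr1; ring.
exact: crit_le.
Qed.

Lemma dominated_min v r y z : dominated K (E1 + 1) c h v -> Lip P k0 v -> 0 < r -> r <= tau ->
  ismin K E1 r v y z -> K z <= c.
Proof.
move=> vd Lv r0 rt zm; have [d iy] := pcover1 P y.
have [rho [Q [rho0 Q0 H]]] := TT_start KT mc r0 rt.
have {}H := H _ d y z Lv (inr_le le12 iy) zm.
have iz : inr d 2 z.1.
  by have := ismin_start KT mc r0 rt iy le12 zm; rewrite (_ : 1 + 1 = 2 :> R) // -[2]natr1.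
have [Kz _ _] := zm; have Kz' := le_trans Kz (EE1 E1).
apply: (dominated_sub (sg := true) KT (mach_est mc) h_gt0 vd _ Kz' Kz' rho0 (ltW Q0) H).
by apply: inr_le iz; rewrite (ler_nat R 2 3).
Qed.

Lemma dominated_Lip v r : dominated K (E1 + 1) c h v -> Lip P k0 v -> 0 < r -> r <= tau ->
  Lip P k0 (T r v).
Proof.
move=> vd Lv r0 rt; apply: (TT_Lip KT mc r0 rt Lv _ qE) => y z zm.
exact: le_trans (dominated_min vd Lv r0 rt zm) cE.
Qed.

Lemma TT_dominated v : dominated K (E1 + 1) c h v -> Lip P k0 v -> dominated K (E1 + 1) c h (T h v).
Proof.
move=> vd Lv z r r0 rh KE; have rt := h_le rh.
have LV := dominated_Lip vd Lv h_gt0 h_tau; have Lr := dominated_Lip vd Lv r0 rt.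
have rht : r + h <= tau by rewrite -hh lerD2r.
have hrt : h + r <= tau by rewrite addrC.
have := TT_le KT mc r0 rt LV KE.
rewrite (TT_add KT mc r0 h_gt0 rht Lv LV) (addrC r h) -(TT_add KT mc h_gt0 r0 hrt Lv Lr) => H.
apply: le_trans (_ : _ <= T h (T r v) (hflow K r z).1 + c * r) _; last by rewrite lerD2r.
apply: (TT_mono KT mc h_gt0 h_tau Lv Lr) => x.
have [w [Kw <- ->]] := ismin_ex KT mc x r0 rt Lv.
exact: vd (le_trans Kw (EE1 E1)).
Qed.

Lemma critical_sub : exists v, [/\ Lip P k0 v, dominated K (E1 + 1) c h v &
  exists rho Q, [/\ 0 < rho, 0 < Q & forall d y, inr d 2 y -> exists q : V,
    forall y', dom (idx d) y' -> `|pchart d y' - pchart d y| <= rho ->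
    v y' <= v y + pairing q (pchart d y' - pchart d y)
      + Q * `|pchart d y' - pchart d y| ^+ 2]].
Proof.
have [rho [Q [rho0 Q0 H]]] := TT_semiconcave KT mc h_gt0 h_tau.
exists (T h crit); split.
- exact: dominated_Lip crit_dominated crit_Lip h_gt0 h_tau.
- exact: TT_dominated crit_dominated crit_Lip.
exists rho, Q; split=> // d y iy.
have [z zm] := ismin_ex KT mc y h_gt0 h_tau crit_Lip.
by exists (pcoord d (hflow K h z)).2 => y'; exact: (H _ _ _ _ crit_Lip iy zm).
Qed.

End Critical.
End WeakKAM.

Section Reversal.
Context {R : realType} {n : nat} {M : ptopologicalType} (S : smooth_manifold R n M) (P : patches S).
Local Notation V := 'rV[R]_n.
Implicit Types (d : 'I_(pcard P)) (z : TsM S) (K : TsM S -> R) (w : V * V).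

Lemma open_codT (i : chart_index S) : open (cod i `*` [set: V]).
Proof.
rewrite openE => w [cw _]; have : nbhs w (cod i `*` [set: V] : set (V * V)); last by [].
exists (cod i, setT) => [|w' [h1 h2]] //=; split; last exact: filterT.
by apply: open_nbhs_nbhs; split => //; exact: open_cod.
Qed.

Lemma Ck_id (W : normedModType R) k (O : set W) : Ck k O (fun x : W => x).
Proof.
case: k => [|k] /=; first by move=> x _; exact: cvg_id.
split=> [x _|v]; first exact: ex_diff.
by rewrite (_ : (fun x => _) = fun=> v); [exact: Ck_cst|apply/funext => x; rewrite diff_val].
Qed.

Definition flip w : V * V := (w.1, - w.2).

Lemma flip_is_linear : linear flip.
Proof.
by move=> a [y q] [y' q']; rewrite /flip; congr pair => //=; rewrite opprD scalerN.
Qed.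

Lemma norm_flip w : `|flip w| = `|w|.
Proof. by rewrite !norm_pairE /= normrN. Qed.

Lemma flipB w w' : flip w - flip w' = flip (w - w').
Proof. by congr pair; rewrite /= opprB addrC opprK. Qed.

Lemma flip_continuous : continuous flip.
Proof. by apply: (@lipT_continuous _ _ _ 1) => w w'; rewrite mul1r flipB norm_flip. Qed.

Lemma flip_diff w : differentiable flip w.
Proof. exact: (@linear_differentiable _ _ _ (lin_of flip_is_linear) w flip_continuous). Qed.

Lemma dr_flip w v : dr flip w v = flip v.
Proof. exact: (@dr_lin _ _ _ (lin_of flip_is_linear) w v flip_continuous). Qed.

(* The Hamiltonian of the reversed orbits [(x (- t), - p (- t))]. *)
Definition reversed K z : R := K (z.1, - z.2).

Lemma tloc_reversed K i : tloc (reversed K) i = tloc K i \o flip.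
Proof. by apply/funext => w; rewrite /= !tlocE !tprmE /reversed /= mulNmx. Qed.

Lemma reversed_C2 K : TsM_C2 K -> TsM_C2 (reversed K).
Proof.
move=> K2 i; have := tloc_C2 i K2; move=> C2.
have -> : TsM_loc (reversed K) i = tloc K i \o flip by rewrite -tloc_reversed tloc.unlock.
apply: (Ck_comp (@open_codT i) _ C2) => [w [cw _] //|].
exact: (@Ck_lin _ _ _ _ 2 _ (fun w => w) (lin_of flip_is_linear) (@open_codT i) flip_continuous (@Ck_id _ 2 _)).
Qed.

Lemma grad_reversed K i w : TsM_C2 K -> cod i w.1 ->
  gradY (tloc (reversed K) i) w = gradY (tloc K i) (flip w) /\
  gradQ (tloc (reversed K) i) w = - gradQ (tloc K i) (flip w).
Proof.
move=> K2 cw; have H v : dr (tloc (reversed K) i) w v = dr (tloc K i) (flip w) (flip v).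
  by rewrite tloc_reversed (dr_comp _ (flip_diff w)) ?dr_flip //; exact: tloc_diff.
split; apply: pairing_ext => v.
  by have := H (v, 0); rewrite !dr_grad /= oppr0 !pairing0r !addr0.
by have := H (0, v); rewrite !dr_grad /= pairing0r !add0r pairing0r add0r pairingNr pairingNl.
Qed.

Lemma reversed_tonelli K : tonelli_in P K -> tonelli_in P (reversed K).
Proof.
move=> [K2 reg sup]; split; first exact: reversed_C2.
  move=> b b0; have [C [k [C0 k0 rg]]] := reg b b0; exists C, k; split=> // d.
  have fl w : pbox d b w -> pbox d b (flip w) by move=> [h1 h2]; split=> //=; rewrite normrN.
  have gr w : pbox d b w -> gradY (tloc (reversed K) (idx d)) w = gradY (ploc K d) (flip w) /\
      gradQ (tloc (reversed K) (idx d)) w = - gradQ (ploc K d) (flip w).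
    by move=> /pbox_cod cw; exact: grad_reversed.
  have [H1 H2 H3 H4 H5] := rg d; split.
  - move=> w hw; split=> [|v]; last exact: diff_grad.
    by apply: tloc_diff; [exact: reversed_C2|exact: pbox_cod hw].
  - move=> w w' hw hw'; have [-> _] := gr _ hw; have [-> _] := gr _ hw'.
    by rewrite -(norm_flip (w' - w)) -flipB; apply: H2; exact: fl.
  - move=> w w' hw hw'; have [_ ->] := gr _ hw; have [_ ->] := gr _ hw'.
    by rewrite -(norm_flip (w' - w)) -flipB -opprD normrN; apply: H3; exact: fl.
  - by move=> w hw; have [-> ->] := gr _ hw; rewrite normrN; apply: H4; exact: fl.
  - move=> w w' hw hw' E; have [_ ->] := gr _ hw; have [_ ->] := gr _ hw'.
    rewrite -opprD pairingNl -pairingNr opprD -[_ - - _]/((flip w' - flip w).2).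
    rewrite -(normrN (w'.2 - w.2)) opprD -[- w'.2 - _]/((flip w' - flip w).2).
    by apply: H5; [exact: fl|exact: fl|].
move=> A; have [B HB] := sup A; exists B => d y q yr.
by rewrite tloc_reversed /= -(normrN q); exact: HB.
Qed.

End Reversal.

Section RegularizeAux.
Context {R : realType}.

Lemma reg_aux1 (x X y a b : R) : y <= a + b -> x <= X + y -> a <= 2^-1 * x -> x <= 2 * X + 2 * b.
Proof. lra. Qed.

Lemma reg_aux2 (x1 x2 x3 x4 x5 x6 : R) :
  x2 - x3 <= x1 -> x4 <= x5 + x6 -> x6 <= x2 -> - x5 <= x1 - (x4 - x3).
Proof. lra. Qed.

Lemma reg_aux3 (u u' h h' p q a b th : R) : u + p - b <= u' -> - a <= th - b ->
  h' - h = th + q - p -> q - a <= u' + h' - (u + h).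
Proof. lra. Qed.

Lemma reg_aux4 (w w' q a b : R) : w' <= w + q + a -> q - b <= w' - w -> 0 <= a -> 0 <= b ->
  `|- w' - - w + q| <= a + b.
Proof. by move=> h1 h2 h3 h4; rewrite ler_norml; apply/andP; split; lra. Qed.

End RegularizeAux.

Section Regularize.
Context {R : realType} {n : nat} {M : ptopologicalType} (S : smooth_manifold R n M) (P : patches S).
Local Notation V := 'rV[R]_n.
Implicit Types (d : 'I_(pcard P)) (z : TsM S) (u v : M -> R).

(* [u] is of class C^{1,1}, with differential in [{K <= c}]. *)
Definition C11_sub (K : TsM S -> R) (c : R) u : Prop := exists rho Q, [/\ 0 < rho, 0 < Q &
  forall d y, inr d 1 y -> exists q : V, K (tprm (idx d) (pchart d y, q)) <= c /\
    forall y', inr d 1 y' -> `|pchart d y' - pchart d y| <= rho ->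
    `|u y' - u y - pairing q (pchart d y' - pchart d y)| <=
    Q * `|pchart d y' - pchart d y| ^+ 2].

Variable K : TsM S -> R.
Hypothesis KT : tonelli_in P K.
Variables (E0 k0 E1 b C k tau D b' C' k' tau' D' c h : R).
Let K' := reversed K.
Let KT' : tonelli_in P K' := reversed_tonelli KT.
Hypothesis mc : mach P K E0 k0 E1 b C k tau D.
Hypothesis mc' : mach P K' E0 k0 E1 b' C' k' tau' D'.
Hypothesis h0 : 0 < h.
Variable v : M -> R.
Hypothesis vL : Lip P k0 v.
Hypothesis vd : dominated K (E1 + 1) c h v.
Variables (rho Q : R).
Hypothesis (rho0 : 0 < rho) (Q0 : 0 < Q).
Hypothesis vQ : forall d y, inr d 2 y -> exists q : V,
  forall y', dom (idx d) y' -> `|pchart d y' - pchart d y| <= rho ->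
  v y' <= v y + pairing q (pchart d y' - pchart d y)
    + Q * `|pchart d y' - pchart d y| ^+ 2.

Let u0 (x : M) : R := - v x.

Lemma u0L : Lip P k0 u0.
Proof. by move=> d x x' ix ix'; rewrite /u0 opprK addrC distrC; have := vL ix ix'; rewrite distrC. Qed.

Lemma rev_energy s y z : 0 < s -> s <= tau' -> ismin K' E1 s u0 y z -> K' z <= c.
Proof.
move=> s0 st zm; have [d iy] := pcover1 P y.
have [rs [Qs [rs0 Qs0 H]]] := TT_start KT' mc' s0 st.
have {}H := H _ d y z u0L (inr_le le12 iy) zm.
have iz : inr d 2 z.1.
  by have := ismin_start KT' mc' s0 st iy le12 zm; rewrite (_ : 1 + 1 = 2 :> R) // -[2]natr1.
have [Kz _ _] := zm; have Kz' := le_trans Kz (EE1 E1).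
have iz3 : inr d 3 z.1 by apply: inr_le iz; rewrite (ler_nat R 2 3).
apply: (dominated_sub (z := (z.1, - z.2)) (sg := false) KT (mach_est mc) h0 vd iz3 Kz' Kz' rs0 (ltW Qs0)).
move=> x' dx' xr /=; have := H x' dx' xr; rewrite /u0 mulNmx pairingNl.
by move: (v _) (v _) (pairing _ _) (Qs * _) => x1 x2 x3 x4; lra.
Qed.

Lemma start_quad d (x : M) (r rs Qs : R) (p : V) : dom (idx d) x -> 0 < r -> 2 * r <= rho ->
  (forall y, `|y - pchart d x| <= r -> `|y - ctr d| <= 2 * rad d) -> 0 < rs -> 0 < Qs ->
  (forall x', dom (idx d) x' -> `|pchart d x' - pchart d x| <= rs ->
    u0 x + pairing p (pchart d x' - pchart d x)
      - Qs * `|pchart d x' - pchart d x| ^+ 2 <= u0 x') ->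
  forall x', dom (idx d) x' -> `|pchart d x' - pchart d x| <= r ->
    u0 x + pairing p (pchart d x' - pchart d x)
      - Q * (n%:R * `|pchart d x' - pchart d x| ^+ 2) <= u0 x'.
Proof.
move=> dx r0 rr sub rs0 Qs0 H x' dx' xr.
have in4 y : `|y - pchart d x| <= r -> cod (idx d) y.
  move=> /sub h1; apply: pcod; apply: le_trans h1 _.
  by apply: ler_wpM2r; [rewrite ltW // rad_gt0|rewrite (ler_nat R 2 4)].
pose f := u0 \o param (idx d).
have fE x1 : dom (idx d) x1 -> f (pchart d x1) = u0 x1 by move=> dx1; rewrite /f /= chartK.
have := @semiconvex_subdiff _ _ f (pchart d x) r Q (pchart d x) p.
rewrite subrr normr0 => H1.
have : f (pchart d x) + pairing p (pchart d x' - pchart d x) -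
    Q * pairing (pchart d x' - pchart d x) (pchart d x' - pchart d x) <=
    f (pchart d x').
  apply: H1 => //; last 2 first.
  - exact: ltW.
  - move=> e e0; exists (Num.min r (Num.min rs (e / Qs))); first by rewrite !lt_min r0 rs0 divr_gt0.
    move=> y; rewrite !le_min => /andP[y1 /andP[y2]]; rewrite ler_pdivlMr // => y3.
    have cy := in4 y y1; have := H _ (dom_param cy); rewrite paramK // => /(_ y2).
    rewrite /f /= chartK //; apply: le_trans; rewrite lerD2l lerN2 expr2 mulrA.
    by apply: ler_wpM2r => //; rewrite mulrC.
  - move=> y yr; have cy := in4 y yr.
    have iy : inr d 2 (param (idx d) y) by split; [exact: dom_param|rewrite paramK //; exact: sub].
    have [q Hq] := vQ iy; exists (- q) => y' y'r; have cy' := in4 y' y'r.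
    have := Hq _ (dom_param cy'); rewrite !paramK // /f /= /u0.
    have yy : `|y' - y| <= rho.
      apply: le_trans rr; apply: le_trans (ler_distD (pchart d x) _ _) _.
      by rewrite mulrDl mul1r lerD // distrC.
    move=> /(_ yy); rewrite pairingNl.
    have := ler_wpM2l (ltW Q0) (sqr_norm_pairing (y' - y)).
    move: (v _) (v _) (pairing q _) (Q * _) (Q * _) => x1 x2 x3 x4 x5; lra.
rewrite !fE //; apply: le_trans; rewrite lerD2l lerN2; apply: ler_wpM2l; first exact: ltW.
exact: pairing_le_sqr.
Qed.

Lemma regularize : exists u, C11_sub K c u.
Proof.
have es := mach_est mc'; have [b0' C0' tau0' D0'] := est_pos es; have k0' := mach_k mc'.
have gp' := tonelli_good KT'.
pose r := Num.min (C' * tau' / 2) (rho / 2).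
have r0 : 0 < r by rewrite lt_min !divr_gt0 // mulr_gt0.
have r1 : r <= C' * tau' / 2 by rewrite ge_min lexx.
have r2 : 2 * r <= rho.
  by rewrite mulrC -ler_pdivlMr // ge_min lexx orbT.
pose A := n%:R * Q + tau' * D'.
have A0 : 0 <= A by rewrite addr_ge0 // mulr_ge0 // ltW.
have AC : 0 < 32 * (A * C' ^+ 2) + 1 by rewrite ltr_wpDl // mulr_ge0 // mulr_ge0 // sqr_ge0.
pose s := Num.min (tau' / 2) (Num.min (r / (4 * C')) (k' / (32 * (A * C' ^+ 2) + 1))).
have C4 : 0 < 4 * C' by rewrite mulr_gt0.
have s0 : 0 < s by rewrite !lt_min !divr_gt0.
have s1 : s <= tau' / 2 by rewrite !ge_min lexx.
have s2 : s * (4 * C') <= r by rewrite -ler_pdivlMr // !ge_min lexx orbT.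
have s3 : s * (32 * (A * C' ^+ 2) + 1) <= k' by rewrite -ler_pdivlMr // !ge_min lexx !orbT.
have st : s <= tau'.
  by apply: le_trans s1 _; rewrite ler_pdivrMr // ler_peMr ?ler1n // ltW.
have Cs : C' * s <= r / 4 by rewrite ler_pdivlMr // (mulrC C') -mulrA (mulrC C').
have [rs [Qs [rs0 Qs0 Hs]]] := TT_start KT' mc' s0 st.
have [re [Qe [re0 Qe0 He]]] := TT_semiconcave KT' mc' s0 st.
have nt : `|s| <= tau' by rewrite gtr0_norm.
have nt' : `|- s| <= tau' by rewrite normrN.
have start d y z : inr d 1 y -> ismin K' E1 s u0 y z ->
    [/\ inr d 3 z.1, K' z <= E1 + 1, `|pchart d z.1 - pchart d y| <= r / 4 &
    forall x', dom (idx d) x' -> `|pchart d x' - pchart d z.1| <= r ->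
    u0 z.1 + pairing (pcoord d z).2 (pchart d x' - pchart d z.1)
      - Q * (n%:R * `|pchart d x' - pchart d z.1| ^+ 2) <= u0 x'].
  move=> iy zm; have [Kz zy _] := zm; have Kz' := le_trans Kz (EE1 E1).
  have iz : inr d 2 z.1.
    by have := ismin_start KT' mc' s0 st iy le12 zm; rewrite (_ : 1 + 1 = 2 :> R) // -[2]natr1.
  have iz3 : inr d 3 z.1 by apply: inr_le iz; rewrite (ler_nat R 2 3).
  have [dz _] := iz; have [dy yr] := iy.
  have zyr : `|pchart d z.1 - pchart d y| <= C' * s.
    have iw : inr d 3 (hflow K' s z).1 by rewrite zy; exact: inr_le le13 iy.
    have Kw : K' (hflow K' s z) <= E1 + 1 by rewrite (hflow_energy gp').
    by have [_] := est_stay es iw Kw nt'; rewrite (hflowNK gp') zy normrN gtr0_norm.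
  split=> //; first exact: le_trans Cs.
  have Crad : r <= rad d / 2.
    by apply: le_trans r1 _; rewrite ler_pM2r ?invr_gt0 // (est_rad es).
  apply: (start_quad dz r0 r2 _ rs0 Qs0); last exact: (Hs _ d y z u0L (inr_le le12 iy) zm).
  move=> w wr; apply: le_trans (ler_distD (pchart d z.1) _ _) _.
  have h1 := ler_distD (pchart d y) (pchart d z.1) (ctr d).
  apply: le_trans (lerD wr h1) _.
  move: yr zyr Crad Cs; rewrite mul1r.
  by move: (`|_ - ctr d|) (C' * s) (rad d) => x1 x2 x3; lra.
exists (fun x => - TT K' (E1 + 1) s u0 x), (Num.min re (r / 2)), (Qe + 8 * A); split.
- by rewrite lt_min re0 divr_gt0.
- by rewrite ltr_pwDl // mulr_ge0.
move=> d y iy; have [z zm] := ismin_ex KT' mc' y s0 st u0L; have [Kz zy Tz] := zm.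
have [iz KE zyr Hz] := start d y z iy zm; have [dz _] := iz; have [dy _] := iy.
set p := (pcoord d z).2 in Hz.
set q := (pcoord d (hflow K' s z)).2.
exists (- q); split.
  have -> : tprm (idx d) (pchart d y, - q) =
      ((hflow K' s z).1, - (hflow K' s z).2) :> TsM S.
    rewrite -[RHS](coordK (i := idx d)) /=; last by rewrite zy.
    by rewrite /coord /= zy mulNmx /q /coord /= zy.
  rewrite -[K _]/(K' (hflow K' s z)) (hflow_energy gp'); exact: rev_energy s0 st zm.
move=> y' iy'; rewrite le_min => /andP[yy1 yy2]; have [dy' _] := iy'.
set X := pchart d y' - pchart d y in yy1 yy2 *.
have [z' zm'] := ismin_ex KT' mc' y' s0 st u0L; have [Kz' zy' Tz'] := zm'.
have [iz' KE' zyr' _] := start d y' z' iy' zm'; have [dz' _] := iz'.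
have up := He u0 d y z u0L (inr_le le12 iy) zm y' dy' yy1.
rewrite -/q -/X in up.
have z0r : `|pchart d z'.1 - pchart d z.1| <= r.
  apply: le_trans (ler_distD (pchart d y') _ _) _.
  have h1 := ler_distD (pchart d y) (pchart d y') (pchart d z.1).
  apply: le_trans (lerD zyr' h1) _; rewrite (distrC (pchart d y)).
  rewrite -[r in _ <= r](_ : r / 4 + (r / 2 + r / 4) = r); last by field.
  by rewrite lerD2l lerD // distrC.
have lo0 := Hz _ dz' z0r.
have thl := est_low es iz iz' KE KE' nt k0'.
have lip := est_lip es iz iz' KE KE' nt.
set xi := pchart d z'.1 - pchart d z.1 in z0r lo0.
set pi := (cdiff d z z').2 in thl.
have xiE : (cdiff d z z').1 = xi by [].
have XE : (cdiff d (hflow K' s z) (hflow K' s z')).1 = X by rewrite /cdiff /= zy zy'.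
rewrite xiE in thl.
have thE : hact K' z' s - hact K' z s = theta K' d s z z' + pairing q X - pairing p xi.
  by rewrite /theta XE xiE -/q -/p; ring.
have thl' : s * (k' / 4 * `|pi| ^+ 2 - D' * `|xi| ^+ 2) <= theta K' d s z z'.
  by rewrite -(ler_pM2l s0) mulrA -expr2.
have xib : `|xi| <= 2 * `|X| + 2 * (C' * s) * `|pi|.
  have nc : `|cdiff d z z'| <= `|xi| + `|pi|.
    by apply: norm_pair_le; rewrite ?xiE ?lerDl ?lerDr.
  have XxE : (cdiff d (hflow K' s z) (hflow K' s z') - cdiff d z z').1 = X - xi by rewrite -XE.
  have := le_trans (norm_pair1 _) lip; rewrite (gtr0_norm s0) XxE => h1.
  have Cs0 : 0 <= C' * s by rewrite mulr_ge0 // ltW.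
  have h2 := le_trans h1 (ler_wpM2l Cs0 nc).
  have h3 : `|xi| <= `|X| + `|X - xi|.
    by rewrite -{1}(subKr X xi) (le_trans (ler_normB _ _)).
  have h4 : C' * s <= 2^-1.
    apply: le_trans (est_half es); apply: ler_wpM2l => //; exact: ltW.
  have h5 : C' * s * `|xi| <= 2^-1 * `|xi| by apply: ler_wpM2r.
  by rewrite mulrDr in h2; rewrite -(mulrA 2); exact: reg_aux1 h2 h3 h5.
have fin : - (8 * A * `|X| ^+ 2) <= theta K' d s z z' - Q * (n%:R * `|xi| ^+ 2).
  have h1 : `|xi| ^+ 2 <= 8 * `|X| ^+ 2 + 8 * (C' * s) ^+ 2 * `|pi| ^+ 2.
    have : `|xi| ^+ 2 <= (2 * `|X| + 2 * (C' * s) * `|pi|) ^+ 2.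
      by rewrite ler_pXn2r ?nnegrE // (le_trans _ xib).
    move=> h1; apply: le_trans h1 _; rewrite -subr_ge0.
    rewrite (_ : _ - _ = (2 * `|X| - 2 * (C' * s) * `|pi|) ^+ 2); [exact: sqr_ge0|ring].
  have h2 : (n%:R * Q + s * D') * `|xi| ^+ 2 <= A * (8 * `|X| ^+ 2 + 8 * (C' * s) ^+ 2 * `|pi| ^+ 2).
    apply: ler_pM => //; first by rewrite addr_ge0 // mulr_ge0 // ltW.
    by rewrite lerD2l; apply: ler_wpM2r => //; exact: ltW.
  have h3 : s * (32 * (A * C' ^+ 2)) <= k'.
    by apply: le_trans s3; rewrite mulrDr mulr1 lerDl ltW.
  have h4 : A * (8 * (C' * s) ^+ 2 * `|pi| ^+ 2) <= s * (k' / 4 * `|pi| ^+ 2).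
    rewrite (_ : A * _ = s / 4 * (s * (32 * (A * C' ^+ 2))) * `|pi| ^+ 2); last by field.
    rewrite (_ : s * (k' / 4 * _) = s / 4 * k' * `|pi| ^+ 2); last by field.
    apply: ler_wpM2r; first exact: sqr_ge0.
    by apply: ler_wpM2l => //; rewrite divr_ge0 // ltW.
  have e1 : Q * (n%:R * `|xi| ^+ 2) = (n%:R * Q + s * D') * `|xi| ^+ 2 - s * (D' * `|xi| ^+ 2) by ring.
  have e2 : A * (8 * `|X| ^+ 2 + 8 * (C' * s) ^+ 2 * `|pi| ^+ 2) =
     8 * A * `|X| ^+ 2 + A * (8 * (C' * s) ^+ 2 * `|pi| ^+ 2) by ring.
  rewrite e2 in h2; rewrite e1; rewrite mulrBr in thl'; exact: reg_aux2 thl' h2 h4.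
have lo : pairing q X - 8 * A * `|X| ^+ 2 <= TT K' (E1 + 1) s u0 y' - TT K' (E1 + 1) s u0 y.
  by rewrite Tz Tz'; exact: reg_aux3 lo0 fin thE.
have qX := sqr_ge0 `|X|.
have h1 : 0 <= Qe * `|X| ^+ 2 by rewrite mulr_ge0 // ltW.
have h2 : 0 <= 8 * A * `|X| ^+ 2 by rewrite !mulr_ge0.
by rewrite pairingNl (opprK (pairing q X)) mulrDl; exact: reg_aux4 up lo h1 h2.
Qed.

End Regularize.

Section Shift.
Context {R : realType} {n : nat} {M : ptopologicalType} (S : smooth_manifold R n M).
Local Notation V := 'rV[R]_n.
Implicit Types (i : chart_index S) (z : TsM S) (K : TsM S -> R) (w : V * V).

Lemma Ck_precomp (U W X : normedModType R) k (O : set W) (f : W -> X) (L : {linear U -> W}) :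
  continuous L -> open O -> Ck k O f -> Ck k (L @^-1` O) (f \o L).
Proof.
move=> cL oO; have oO' : open (L @^-1` O) by apply: open_comp => // x _; exact: cL.
elim: k f => [|k IH] f /=.
  by move=> cf x Ox; apply: continuous_comp; [exact: cL|exact: cf].
move=> [df Cf]; have dL x : differentiable L x by exact: linear_differentiable.
split=> [x Ox|v]; first by apply: differentiable_comp => //; exact: df.
apply: (@Ck_ext _ _ _ _ _ ((fun x => 'd f x (L v)) \o L)) => // [x Ox|]; last exact: IH.
by rewrite (diff_comp (dL x) (df _ Ox)) /= diff_lin.
Qed.

Lemma fst_is_linear : linear (fst : V * V -> V). Proof. by []. Qed.
Lemma snd_is_linear : linear (snd : V * V -> V). Proof. by []. Qed.

Lemma fst_continuous : continuous (fst : V * V -> V).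
Proof. by apply: (@lipT_continuous _ _ _ 1) => w w'; rewrite mul1r; exact: (norm_pair1 (w - w')). Qed.

Lemma snd_continuous : continuous (snd : V * V -> V).
Proof. by apply: (@lipT_continuous _ _ _ 1) => w w'; rewrite mul1r; exact: (norm_pair2 (w - w')). Qed.

Variable eta : M -> V.
Hypothesis etaC : closed_form S eta.

Definition cshift z : TsM S := (z.1, eta z.1 + z.2).
Definition shifted K z : R := K (cshift z).
Definition shift_loc i w : V * V := (w.1, form_loc eta i w.1 + w.2).

Lemma form_locE i y : form_loc eta i y = eta (param i y) *m (Jac i (chart_at S (param i y)) (param i y))^T.
Proof. by rewrite /form_loc JacE. Qed.

Lemma shift_tprm i w : cod i w.1 -> cshift (tprm i w) = tprm i (shift_loc i w).
Proof.
move=> cw; rewrite !tprmE /cshift /shift_loc /= form_locE mulmxDl; congr pair; congr (_ + _).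
rewrite -mulmxA -trmx_mul trans_inv ?trmx1 ?mulmx1 //; last exact: dom_param.
exact: dom_chart_at.
Qed.

Lemma tloc_shifted K i w : cod i w.1 -> tloc (shifted K) i w = tloc K i (shift_loc i w).
Proof. by move=> cw; rewrite !tlocE /shifted shift_tprm. Qed.

Lemma form_Ck i k : Ck k (cod i) (form_loc eta i).
Proof. by have [H _] := etaC i; exact: H. Qed.

Lemma form_diff i y : cod i y -> differentiable (form_loc eta i) y.
Proof. by move=> cy; have [H _] := @form_Ck i 1; exact: H. Qed.

Lemma shift_loc_Ck i k : Ck k (cod i `*` [set: V]) (shift_loc i).
Proof.
have oO := @open_codT _ _ _ S i.
have E : (cod i `*` [set: V]) = (lin_of fst_is_linear @^-1` cod i).
  by apply/seteqP; split=> [w [] //|w h]; split.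
apply: Ck_pair => //.
  by apply: (@Ck_lin _ _ _ _ k _ (fun w => w) (lin_of fst_is_linear)) => //; [exact: fst_continuous|exact: Ck_id].
apply: Ck_add => //.
  rewrite E; apply: (@Ck_precomp _ _ _ k (cod i) (form_loc eta i) (lin_of fst_is_linear)) => //.
  - exact: fst_continuous.
  - exact: open_cod.
  - exact: form_Ck.
by apply: (@Ck_lin _ _ _ _ k _ (fun w => w) (lin_of snd_is_linear)) => //; [exact: snd_continuous|exact: Ck_id].
Qed.

Lemma shifted_C2 K : TsM_C2 K -> TsM_C2 (shifted K).
Proof.
move=> K2 i; have C2 := tloc_C2 i K2; have oO := @open_codT _ _ _ S i.
suff : Ck 2 (cod i `*` setT) (tloc (shifted K) i) by rewrite tloc.unlock.
apply: (Ck_ext (f := tloc K i \o shift_loc i) oO); first by move=> w [cw _]; rewrite tloc_shifted.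
by apply: (Ck_comp oO _ C2) => [w [cw _]|]; [split|exact: shift_loc_Ck].
Qed.

Lemma dr_shift_loc i w v : cod i w.1 ->
  dr (shift_loc i) w v = (v.1, dr (form_loc eta i) w.1 v.1 + v.2).
Proof.
move=> cw; have [ds _] := @shift_loc_Ck i 1; have {ds} ds := ds w (conj cw I).
have dl : is_derive (0 : R) 1 (fun s : R => w + s *: v) v by exact: is_derive_line.
have w0 : w + (0 : R) *: v = w by rewrite scale0r addr0.
have := @is_derive_dr _ _ _ (shift_loc i) (fun s : R => w + s *: v) 0 v.
rewrite w0 => /(_ ds dl) [_ <-].
apply: derive_val; apply/is_derive_pairP; split => /=; first exact: is_derive_line.
apply: is_deriveD; last exact: is_derive_line.
have dl1 : is_derive (0 : R) 1 (fun s : R => w.1 + s *: v.1) v.1 by exact: is_derive_line.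
have w10 : w.1 + (0 : R) *: v.1 = w.1 by rewrite scale0r addr0.
have := @is_derive_dr _ _ _ (form_loc eta i) (fun s : R => w.1 + s *: v.1) 0 v.1.
by rewrite w10; apply => //; exact: form_diff.
Qed.

Lemma dr_shifted K i w v : TsM_C2 K -> cod i w.1 ->
  dr (tloc (shifted K) i) w v = dr (tloc K i) (shift_loc i w) (dr (shift_loc i) w v).
Proof.
move=> K2 cw; have [ds _] := @shift_loc_Ck i 1; have {ds} ds := ds w (conj cw I).
have dK : differentiable (tloc K i) (shift_loc i w) by exact: tloc_diff.
rewrite -(dr_comp _ ds dK).
have [|_ ->] := @dr_open_eq _ _ _ _ (tloc K i \o shift_loc i) (tloc (shifted K) i) w v
  (@open_codT _ _ _ S i) _ (conj cw I) (differentiable_comp ds dK) => //.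
by move=> w' [cw' _] /=; rewrite tloc_shifted.
Qed.

Lemma gradQ_shifted K i w : TsM_C2 K -> cod i w.1 ->
  gradQ (tloc (shifted K) i) w = gradQ (tloc K i) (shift_loc i w).
Proof.
move=> K2 cw; apply: pairing_ext => v; have := dr_shifted (0, v) K2 cw.
have d0 : dr (form_loc eta i) w.1 0 = 0 by rewrite drE linear0.
by rewrite dr_shift_loc //= d0 add0r !dr_grad /= !pairing0r !add0r.
Qed.

Lemma gradY_shifted K i w e : TsM_C2 K -> cod i w.1 ->
  pairing (gradY (tloc (shifted K) i) w) e = pairing (gradY (tloc K i) (shift_loc i w)) e +
  pairing (gradQ (tloc K i) (shift_loc i w)) (dr (form_loc eta i) w.1 e).
Proof.
move=> K2 cw; have := dr_shifted (e, 0) K2 cw.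
by rewrite dr_shift_loc //= !dr_grad /= pairing0r !addr0.
Qed.

Lemma closed_sym i (y v w : V) : cod i y ->
  pairing (dr (form_loc eta i) y v) w = pairing (dr (form_loc eta i) y w) v.
Proof. by move=> cy; rewrite !drE; have [_ H] := etaC i; exact: H. Qed.

Lemma shift_coord i z : dom i z.1 -> coord i (cshift z) = shift_loc i (coord i z).
Proof.
move=> dz; have cz : cod i (coord i z).1 by exact: cod_chart.
by rewrite -{1}(coordK dz) shift_tprm // tprmK.
Qed.

Lemma poisson_shifted K G z : TsM_C2 K -> TsM_C2 G ->
  poisson (shifted K) (shifted G) z = poisson K G (cshift z).
Proof.
move=> K2 G2; set i := chart_at S z.1.
have dz : dom i z.1 by exact: dom_chart_at.
have cz : cod i (coord i z).1 by exact: cod_chart.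
rewrite (poisson_chart (shifted_C2 K2) (shifted_C2 G2) dz).
rewrite (@poisson_chart _ _ _ _ K G i (cshift z) K2 G2 dz) shift_coord //.
rewrite /bracket_loc !gradQ_shifted // !gradY_shifted //.
set w := coord i z; set gK := gradQ (tloc K i) _; set gG := gradQ (tloc G i) _.
have -> : pairing gK (dr (form_loc eta i) w.1 gG) = pairing gG (dr (form_loc eta i) w.1 gK).
  by rewrite pairingC closed_sym // pairingC.
by ring.
Qed.

End Shift.

Section TonelliLocal.
Context {R : realType} {n : nat} {M : ptopologicalType} (S : smooth_manifold R n M) (P : patches S).
Local Notation V := 'rV[R]_n.
Implicit Types (d : 'I_(pcard P)) (i : chart_index S) (z : TsM S) (K : TsM S -> R).

Definition fiber_pos K : Prop := forall x (p w : V), w != 0 ->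
  0 < 'D_w ('D_w (fun q => K (x, q))) p.

Lemma derive_affine (f : V -> R) (L : V -> V) (a q e : V) : (forall x y, L (x + y) = L x + L y) ->
  (forall c x, L (c *: x) = c *: L x) ->
  'D_e (fun q => f (a + L q)) q = 'D_(L e) f (a + L q).
Proof.
move=> LD LZ; rewrite /derive; apply: (congr1 (fun g => lim (g @ (0 : R)^'))); apply/funext => h /=.
by rewrite LD LZ addrCA.
Qed.

Lemma derive2_affine (f : V -> R) (L : V -> V) (a q e : V) : (forall x y, L (x + y) = L x + L y) ->
  (forall c x, L (c *: x) = c *: L x) ->
  'D_e ('D_e (fun q => f (a + L q))) q = 'D_(L e) ('D_(L e) f) (a + L q).
Proof.
move=> LD LZ; rewrite -(derive_affine _ _ _ _ LD LZ); congr ('D_e _ q).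
by apply/funext => q'; rewrite derive_affine.
Qed.

Lemma fiber_pos_shifted K (eta : M -> V) : fiber_pos K -> fiber_pos (shifted eta K).
Proof.
move=> Kp x p w w0.
by have := @derive2_affine (fun q => K (x, q)) id (eta x) p w (fun _ _ => erefl) (fun _ _ => erefl)
  => ->; exact: Kp.
Qed.

Lemma derive_fiber (f : V * V -> R) (y q e : V) :
  'D_e (fun q => f (y, q)) q = 'D_(0, e) f (y, q).
Proof.
rewrite /derive; apply: (congr1 (fun g => lim (g @ (0 : R)^'))); apply/funext => h /=; congr (_ *: (f _ - _)).
by congr pair => /=; rewrite scaler0 add0r.
Qed.

Definition hessQ (f : V * V -> R) (w : V * V) (e : V) : R :=
  dr (fun w => dr f w (0, e)) w (0, e).

Lemma hessQ_pos K i (w : V * V) e : TsM_C2 K -> fiber_pos K -> cod i w.1 -> e != 0 ->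
  0 < hessQ (tloc K i) w e.
Proof.
move=> K2 Kp cw e0; case: w cw => y q /= cy.
have [dK CK] := tloc_C2 i K2; have [dK2 _] := CK (0, e); rewrite dr_fun in dK2.
have Oy q' : (cod i `*` [set: V]) (y, q') by [].
have E1 q' : 'D_e (fun q => tloc K i (y, q)) q' = dr (tloc K i) (y, q') (0, e).
  by rewrite derive_fiber drE deriveE //; exact: dK.
have E2 : 'D_e (fun q => dr (tloc K i) (y, q) (0, e)) q = hessQ (tloc K i) (y, q) e.
  rewrite (@derive_fiber (fun w => dr (tloc K i) w (0, e))) /hessQ [RHS]drE deriveE //.
  exact: dK2.
rewrite -E2; pose x := param i y; pose A := (Jac (chart_at S x) i x)^T.
have -> : (fun q => dr (tloc K i) (y, q) (0, e)) = 'D_e (fun q => K (x, 0 + q *m A)).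
  apply/funext => q'; rewrite -E1; congr ('D_e _ q'); apply/funext => q''.
  by rewrite tlocE tprmE add0r.
rewrite (@derive2_affine (fun q => K (x, q)) (fun q => q *m A)); last 2 first.
- by move=> u v; rewrite mulmxDl.
- by move=> c u; rewrite scalemxAl.
apply: Kp; apply: contraNneq e0 => eA.
have dx := dom_param cy.
rewrite -(mulmx1 e) -trmx1 -(trans_inv dx (dom_chart_at S x)) trmx_mul mulmxA.
by rewrite -/A eA mul0mx.
Qed.

Lemma hessQ_expand (f : V * V -> R) (O : set (V * V)) w e : open O -> Ck 2 O f -> O w ->
  hessQ f w e = \sum_j \sum_k e 0 j * (e 0 k * dr (fun w => dr f w (0, delta_mx 0 j)) w (0, delta_mx 0 k)).
Proof.
move=> oO [df Cf] Ow; pose a (v : V) : V * V := (0, v).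
have aD (v : V) : a v = \sum_k v 0 k *: a (delta_mx 0 k).
  rewrite {1}(row_sum_delta v); apply: injective_projections; rewrite /= raddf_sum /=.
    by rewrite big1 // => k _; exact: scaler0.
  by [].
have dre g (w' : V * V) v : dr g w' (a v) = \sum_k v 0 k * dr g w' (a (delta_mx 0 k)) :> R.
  by rewrite aD dr_sum; apply: eq_bigr => k _; rewrite drZ.
rewrite /hessQ -/(a e).
have dj j : differentiable (fun w => dr f w (a (delta_mx 0 j))) w.
  by rewrite -dr_fun; have [H _] := Cf (a (delta_mx 0 j)); exact: H.
have E : (fun w => dr f w (a e)) = \sum_j (e 0 j *: (fun w => dr f w (a (delta_mx 0 j)))).
  by apply/funext => w'; rewrite dre fct_sumE; apply: eq_bigr.
have dsum (m : nat) (g : 'I_m -> (V * V -> R)) v : (forall j, differentiable (g j) w) ->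
    differentiable (\sum_j g j) w /\ dr (\sum_j g j) w v = \sum_j dr (g j) w v.
  elim: m g => [|m IH] g dg.
    rewrite !big_ord0; split; first exact: differentiable_cst.
    by rewrite drE diff_cst.
  have [h1 h2] := IH (fun j => g (widen_ord (leqnSn m) j)) (fun j => dg _).
  rewrite !big_ord_recr /=; split; first exact: differentiableD.
  by rewrite drE diffD //= -!drE h2.
rewrite E; have [|_ ->] := dsum _ (fun j => e 0 j *: (fun w => dr f w (a (delta_mx 0 j)))) (a e).
  by move=> j; exact: differentiableZ.
apply: eq_bigr => j _; rewrite drE diffZ //= -drE dre scaler_sumr.
by [].
Qed.

Lemma hessQ_lower K b : TsM_C2 K -> fiber_pos K -> exists2 k : R, 0 < k &
  forall d w e, pbox d b w -> k * `|e| ^+ 2 <= hessQ (ploc K d) w e.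
Proof.
move=> K2 Kp.
have [||B B0 HB] := @fin_bound R (pcard P) (fun d B => forall w e, pbox d b w -> `|e| = 1 ->
    1 <= B * hessQ (ploc K d) w e).
- move=> d; pose f := ploc K d; pose O := cod (idx d) `*` [set: V].
  have oO : open O := @open_codT _ _ _ S (idx d); have C2 := tloc_C2 (idx d) K2.
  pose X := [set we : (V * V) * V | pbox d b we.1 /\ `|we.2| = 1].
  have cX : compact X.
    have -> : X = pbox d b `*` [set e : V | `|e| = 1].
      by apply/seteqP; split.
    apply: compact_setX; first exact: compact_box.
    apply: (@subclosed_compact _ _ [set e : V | `|e - 0| <= 1]); last by move=> e /=; rewrite subr0 => ->.
      by apply: (@closed_comp _ _ (fun e : V => `|e|) [set x | x = 1]) => [e _|]; [exact: norm_continuous|exact: closed_eq].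
    exact: compact_ball.
  pose g (we : (V * V) * V) : R := \sum_j \sum_k we.2 0 j * (we.2 0 k *
    dr (fun w => dr f w (0, delta_mx 0 j)) we.1 (0, delta_mx 0 k)).
  have gE w e : pbox d b w -> g (w, e) = hessQ f w e.
    by move=> pw; rewrite (hessQ_expand e oO C2) //; split => //; exact: pbox_cod pw.
  have cg we : X we -> {for we, continuous g}.
    move=> [pw _]; pose O' := [set we : (V * V) * V | O we.1].
    have oO' : open O'.
      by apply: (@open_comp _ _ (fun we : (V * V) * V => we.1) O) => // we' _; exact: cvg_fst.
    suff : Ck 0 O' g by apply; split=> //; exact: pbox_cod pw.
    have ck j : Ck 0 O' (fun we : (V * V) * V => we.2 0 j).
      move=> we' _; apply: (@lipT_continuous _ _ _ 1) => z1 z2 /=; rewrite mul1r.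
      have := norm_coord (z1.2 - z2.2) j; rewrite !mxE => h; apply: le_trans h _.
      by rewrite [leRHS]/Num.norm /= le_max lexx orbT.
    apply: Ck_sum => // j; apply: Ck_sum => // k; apply: Ck_mul => //; apply: Ck_mul => //.
    move=> we' Owe'; have [_ CK] := C2; have [_ CK2] := CK (0, delta_mx 0 j).
    have := CK2 (0, delta_mx 0 k) we'.1 Owe'; rewrite !dr_fun => cc.
    have c1 : {for we', continuous (fun we : (V * V) * V => we.1)} by exact: cvg_fst.
    exact: (continuous_comp c1 cc).
  have [X0|/set0P/negP/negPn/eqP X0] := pselect (X !=set0); last first.
    exists 0 => // w e pw e1; exfalso.
    by have : X (w, e) by []; rewrite X0.
  have cg' : {within X, continuous g} by apply: continuous_in_subspaceT => we; rewrite inE; exact: cg.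
  have [[w0 e0] Xm gmin] := compact_EVT_min X0 cX cg'; rewrite inE in Xm; have [pw0 e01] := Xm.
  have g0 : 0 < g (w0, e0).
    rewrite gE //; apply: hessQ_pos => //; first exact: pbox_cod pw0.
    by rewrite -normr_gt0 e01.
  exists (g (w0, e0))^-1; first by rewrite invr_ge0 ltW.
  move=> w e pw e1; rewrite mulrC ler_pdivlMr // mul1r -/f -gE //.
  by apply: (gmin (w, e)); rewrite inE.
- move=> d B B' BB' H w e pw e1; apply: le_trans (H w e pw e1) _; apply: ler_wpM2r => //.
  apply: ltW; apply: hessQ_pos => //; first exact: pbox_cod pw.
  by rewrite -normr_gt0 e1.
have B1 : 0 < B + 1 by rewrite ltr_wpDl.
exists (B + 1)^-1; first by rewrite invr_gt0.
move=> d w e pw; have [->|e0] := eqVneq e 0.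
  rewrite normr0 expr0n mulr0 /hessQ drE.
  by rewrite (_ : (0, 0) = 0 :> V * V) // linear0.
have ne : 0 < `|e| by rewrite normr_gt0.
pose e1 := `|e|^-1 *: e.
have e1n : `|e1| = 1 by rewrite normrZ normfV normr_id mulVf // gt_eqF.
have eE : (0, e) = `|e| *: (0, e1) :> V * V.
  by congr pair; rewrite /= ?scaler0 // scalerA divff ?scale1r // gt_eqF.
have hE : hessQ (ploc K d) w e = `|e| ^+ 2 * hessQ (ploc K d) w e1.
  rewrite /hessQ eE drZ expr2 -mulrA; congr (_ * _).
  have -> : (fun w => dr (ploc K d) w (`|e| *: (0, e1))) =
      `|e| *: (fun w => dr (ploc K d) w (0, e1)).
    by apply/funext => w'; rewrite drZ.
  rewrite drE diffZ //= -?drE //.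
  have [_ CK] := tloc_C2 (idx d) K2; have [dK2 _] := CK (0, e1).
  by rewrite -dr_fun; apply: dK2; split=> //; exact: pbox_cod pw.
rewrite hE [leRHS]mulrC; apply: ler_wpM2r; first exact: sqr_ge0.
have hp : 0 < hessQ (ploc K d) w e1.
  by apply: hessQ_pos => //; [exact: pbox_cod pw|rewrite -normr_gt0 e1n].
rewrite -[_^-1]mul1r ler_pdivrMr // mulrC; apply: le_trans (HB d w e1 pw e1n) _.
by apply: ler_wpM2r; [exact: ltW|rewrite lerDl].
Qed.

Lemma reg_fun_pos K : TsM_C2 K -> fiber_pos K -> reg_fun P K (fun k => 0 < k).
Proof.
move=> K2 Kp b b0; have [C C0 rg] := reg_const P K2 b0.
have [k k0 Hk] := hessQ_lower b K2 Kp; exists C, k; split=> // d.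
have [H1 H2 H3 H4 _] := rg d; split=> // z z' hz hz' E.
set f := ploc K d; set dl := z'.2 - z.2.
have zE (s : R) : z + s *: (z' - z) = z + s *: (0, dl).
  congr (_ + _ *: _); apply: injective_projections => //=; by rewrite E subrr.
have zin (s : R) : 0 <= s <= 1 -> pbox d b (z + s *: (0, dl)).
  by move=> s01; rewrite -zE; exact: box_segment.
have [dK CK] := tloc_C2 (idx d) K2; have [dK2 _] := CK (0, dl); rewrite dr_fun in dK2.
have [s s01 sE] := @MVT01 _ (fun s => dr f (z + s *: (0, dl)) (0, dl))
  (fun s => hessQ f (z + s *: (0, dl)) dl)
  (fun s s01 => is_derive_dr (f := fun w => dr f w (0, dl)) (c := fun s => z + s *: (0, dl))
     (dK2 _ (conj (pbox_cod (zin s s01)) I)) (is_derive_line _ _ _)).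
have := Hk d _ dl (zin s s01); rewrite -sE !dr_grad /= !pairing0r !add0r scale1r scale0r addr0.
have <- : z' = z + (0, dl) by rewrite -[(0, dl)]scale1r -zE scale1r addrC subrK.
by rewrite pairingBl.
Qed.

Lemma norm_mulmx (v : V) (A : 'M[R]_n) : `|v *m A| <= n%:R * (`|v| * `|A|).
Proof.
apply: norm_rV_le => [|k]; first by rewrite !mulr_ge0.
rewrite mxE (le_trans (ler_norm_sum _ _ _)) //.
rewrite (_ : n%:R * _ = \sum_(i < n) `|v| * `|A|); last first.
  by rewrite sumr_const card_ord mulr_natl.
apply: ler_sum => i _; rewrite normrM; apply: ler_pM => //; first exact: norm_coord.
have := le_bigmax 0 (fun i : 'I_n * 'I_n => `|A i.1 i.2|) (i, k).
by rewrite -mx_normrE.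
Qed.

Lemma quad_continuous (A : 'M[R]_n) : continuous (fun v : V => pairing (v *m A) v).
Proof.
suff : Ck 0 setT (fun v : V => pairing (v *m A) v) by move=> H x; exact: H.
have oT : open [set: V] by exact: openT.
have -> : (fun v : V => pairing (v *m A) v) = (fun v => \sum_k (\sum_j v 0 j * A j k) * v 0 k).
  by apply/funext => z; rewrite pairingE; apply: eq_bigr => k _; rewrite !mxE.
have ck k : Ck 0 setT (fun z : V => z 0 k).
  move=> z _; apply: (@lipT_continuous _ _ _ 1) => z1 z2 /=.
  by rewrite mul1r; have := norm_coord (z1 - z2) k; rewrite !mxE.
apply: Ck_sum => // k; apply: Ck_mul => //; apply: Ck_sum => // j; apply: Ck_mul => //.
exact: Ck_cst.
Qed.

Lemma metric_bounded (A : 'M[R]_n) : (forall v : V, v != 0 -> 0 < pairing (v *m A) v) ->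
  exists B : R, forall v : V, pairing (v *m A) v <= 1 -> `|v| <= B.
Proof.
move=> Ap; pose X := [set v : V | `|v| = 1].
have cX : compact X.
  apply: (@subclosed_compact _ _ [set e : V | `|e - 0| <= 1]); last by move=> e /=; rewrite subr0 => ->.
    by apply: (@closed_comp _ _ (fun e : V => `|e|) [set x | x = 1]) => [e _|]; [exact: norm_continuous|exact: closed_eq].
  exact: compact_ball.
have [X0|/set0P/negP/negPn/eqP X0] := pselect (X !=set0); last first.
  exists 0 => v _; have [->|v0] := eqVneq v 0; first by rewrite normr0.
  exfalso; have : X (`|v|^-1 *: v) by rewrite /X /= normrZ normfV normr_id mulVf // normr_eq0.
  by rewrite X0.
have cg : {within X, continuous (fun v : V => pairing (v *m A) v)}.
  by apply: continuous_in_subspaceT => v _; exact: quad_continuous.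
have [e0 Xe emin] := compact_EVT_min X0 cX cg; rewrite inE /X /= in Xe.
set m := pairing (e0 *m A) e0 in emin.
have m0 : 0 < m by apply: Ap; rewrite -normr_gt0 Xe.
exists (1 + m^-1) => v v1; have [->|v0] := eqVneq v 0.
  by rewrite normr0 addr_ge0 // invr_ge0 ltW.
have nv : 0 < `|v| by rewrite normr_gt0.
have : m <= pairing ((`|v|^-1 *: v) *m A) (`|v|^-1 *: v).
  by apply: emin; rewrite inE /X /= normrZ normfV normr_id mulVf // normr_eq0.
rewrite -scalemxAl pairingZl pairingZr mulrA -invfM -expr2 mulrC ler_pdivlMr ?exprn_gt0 // => h.
have h1 : `|v| ^+ 2 <= m^-1.
  by rewrite -(ler_pM2l m0) mulfV ?gt_eqF // (le_trans h).
have [vle|vgt] := lerP `|v| 1; first by rewrite (le_trans vle) // lerDl invr_ge0 ltW.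
apply: le_trans (_ : `|v| ^+ 2 <= _); first by rewrite expr2 ler_peMr // ltW.
by apply: le_trans h1 _; rewrite lerDr.
Qed.

Lemma conorm_lower (g : M -> 'M[R]_n) : riemannian_metric S g -> exists2 c0 : R, 0 < c0 &
  forall d (y q : V), `|y - ctr d| <= 4 * rad d ->
  c0 * `|q| <= conorm g (param (idx d) y) (tprm (idx d) (y, q)).2.
Proof.
move=> [gs gp gC].
pose G d y := let x := param (idx d) y in
  let J := trans (idx d) (chart_at S x) x in J *m g x *m J^T.
have [||B B0 HB] := @fin_bound R (pcard P) (fun d B => forall y, `|y - ctr d| <= 4 * rad d -> `|G d y| <= B).
- move=> d; have [|B B0 HB] := @compact_bound _ _ [set y : V | `|y - ctr d| <= 4 * rad d]
    (fun y => `|G d y|) (@compact_ball _ _ _ _).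
    move=> y yr; apply: continuous_comp; last exact: norm_continuous.
    by have := gC (idx d) 0%N y (pcod yr).
  by exists B => // y yr; have := HB y yr; rewrite normr_id.
- by move=> d B B' BB' H y yr; apply: le_trans BB'; exact: H.
pose t := (n%:R * (n%:R * B) + 1)^-1.
have t1 : 0 < n%:R * (n%:R * B) + 1 by rewrite ltr_wpDl // !mulr_ge0.
have t0 : 0 < t by rewrite invr_gt0.
exists t => // d y q yr; have cy := pcod yr; have dx := dom_param cy.
set x := param (idx d) y; set J := Jac (idx d) (chart_at S x) x.
have [w0 w01 w0q] := pairing_dual q.
pose v := (t *: w0) *m J.
have qv : pairing (tprm (idx d) (y, q)).2 v = t * `|q|.
  rewrite tprmE /= -/x /v pairing_mulmx -mulmxA -trmx_mul trans_inv ?trmx1 ?mulmx1 //.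
    by rewrite pairingZr pairingC w0q.
  exact: dom_chart_at.
rewrite -qv /conorm; apply: ub_le_sup; last first.
  exists v => //=; rewrite /v -[X in pairing X _]mulmxA pairing_mulmx.
  have -> : (t *: w0) *m (J *m g x) *m J^T = (t *: w0) *m G d y.
    by rewrite /G -/x JacE -/J !mulmxA.
  apply: le_trans (ler_norm _) _; apply: le_trans (pairing_norm _ _) _.
  have tw : `|t *: w0| <= t by rewrite normrZ (gtr0_norm t0) ler_piMr // ltW.
  have h1 : `|t *: w0 *m G d y| <= n%:R * (t * B).
    apply: le_trans (norm_mulmx _ _) _; apply: ler_wpM2l => //; apply: ler_pM => //; exact: HB.
  have h2 : `|t *: w0 *m G d y| * `|t *: w0| <= n%:R * (t * B) * t by apply: ler_pM.
  apply: le_trans (ler_wpM2l (ler0n _ n) h2) _.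
  have h3 : n%:R * (n%:R * B) * t <= 1.
    by rewrite /t ler_pdivrMr // mul1r lerDl.
  have h4 : t <= 1 by rewrite invf_le1 // lerDr !mulr_ge0.
  rewrite (_ : n%:R * _ = n%:R * (n%:R * B) * t * t); last by ring.
  apply: mulr_ile1 => //; last exact: ltW.
  by rewrite !mulr_ge0 // ltW.
have [Bv HBv] := metric_bounded (gp x).
exists (n%:R * (`|(tprm (idx d) (y, q)).2| * Bv)) => _ [v' v'1 <-].
apply: le_trans (ler_norm _) _; apply: le_trans (pairing_norm _ _) _.
by apply: ler_wpM2l => //; apply: ler_wpM2l => //; exact: HBv.
Qed.

Lemma tonelli_in_shifted K (eta : M -> V) : tonelli K -> closed_form S eta ->
  tonelli_in P (shifted eta K).
Proof.
move=> [K2 Kp [g gr sup]] etaC; split.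
- exact: shifted_C2.
- by apply: reg_fun_pos; [exact: shifted_C2|exact: fiber_pos_shifted].
- move=> A; have [c0 c00 Hc] := conorm_lower gr.
  have [||B0 B00 HB0] := @fin_bound R (pcard P) (fun d B => forall y, `|y - ctr d| <= 4 * rad d ->
    `|form_loc eta (idx d) y| <= B).
  + move=> d; have [|B B0 HB] := @compact_bound _ _ [set y : V | `|y - ctr d| <= 4 * rad d]
      (fun y => `|form_loc eta (idx d) y|) (@compact_ball _ _ _ _).
      move=> y yr; apply: continuous_comp; last exact: norm_continuous.
      by have := @form_Ck _ _ _ S eta etaC (idx d) 0%N y (pcod yr).
    by exists B => // y yr; have := HB y yr; rewrite normr_id.
  + by move=> d B B' BB' H y yr; apply: le_trans BB'; exact: H.
  pose A' := `|A| / c0; have A'0 : 0 <= A' by rewrite divr_ge0 // ltW.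
  have [B HB] := sup A'.
  exists (`|A| * B0 + B) => d y q yr; have cy := pcod yr.
  have cy' : cod (idx d) (y, q).1 by [].
  rewrite (tloc_shifted _ _ cy') /shift_loc /= tlocE.
  set q' := form_loc eta (idx d) y + q.
  have := HB (tprm (idx d) (y, q')).1 (tprm (idx d) (y, q')).2.
  rewrite -surjective_pairing; apply: le_trans.
  have h1 := Hc d y q' yr.
  have -> : (tprm (idx d) (y, q')).1 = param (idx d) y by rewrite tprmE.
  have h2 : `|A| * `|q'| <= A' * conorm g (param (idx d) y) (tprm (idx d) (y, q')).2.
    apply: le_trans (ler_wpM2l A'0 h1); rewrite /A' mulrA divfK // gt_eqF //.
  have h3 : `|q| <= `|q'| + B0.
    have -> : q = q' - form_loc eta (idx d) y by rewrite /q' addrC addKr.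
    by apply: le_trans (ler_normB _ _) _; rewrite lerD2l; exact: HB0.
  have h4 : A * `|q| <= `|A| * (`|q'| + B0).
    apply: le_trans (ler_wpM2r (normr_ge0 _) (ler_norm A)) _; exact: ler_wpM2l.
  move: h2 h4; rewrite mulrDr.
  by move: (A * _) (`|A| * `|q'|) (`|A| * B0) (A' * _) => x1 x2 x3 x4; lra.
Qed.

End TonelliLocal.

Section LipAt.
Context {R : realType}.
Implicit Types (U V W : normedModType R).

(* One constant serves as the Lipschitz constant and gives the radius: the condition is then
   monotone in it. *)
Definition lip_with V W (f : V -> W) (y : V) (B : R) : Prop := forall y1 y2,
  `|y1 - y| <= (B + 1)^-1 -> `|y2 - y| <= (B + 1)^-1 -> `|f y2 - f y1| <= B * `|y2 - y1|.
Definition lip_at V W (f : V -> W) (y : V) : Prop := exists2 B : R, 0 <= B & lip_with f y B.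

Lemma inv1_le (B B' : R) : 0 <= B -> B <= B' -> (B' + 1)^-1 <= (B + 1)^-1.
Proof. by move=> B0 BB; rewrite lef_pV2 ?posrE ?lerD2r // ltr_wpDl // (le_trans B0). Qed.

Lemma lip_with_mono V W (f : V -> W) y (B B' : R) : 0 <= B -> B <= B' -> lip_with f y B -> lip_with f y B'.
Proof.
move=> B0 BB H y1 y2 h1 h2; apply: le_trans (H _ _ _ _) _; try exact: le_trans (inv1_le B0 BB).
by apply: ler_wpM2r.
Qed.

Lemma lip_at_intro V W (f : V -> W) y (L r : R) : 0 < r ->
  (forall y1 y2, `|y1 - y| <= r -> `|y2 - y| <= r -> `|f y2 - f y1| <= L * `|y2 - y1|) -> lip_at f y.
Proof.
move=> r0 H; exists (`|L| + r^-1) => [|y1 y2 h1 h2]; first by rewrite addr_ge0 // invr_ge0 ltW.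
have rr : (`|L| + r^-1 + 1)^-1 <= r.
  rewrite -[leRHS]invrK lef_pV2 ?posrE ?invr_gt0 //; last by rewrite ltr_wpDl // addr_ge0 // invr_ge0 ltW.
  by rewrite -addrA addrCA lerDl addr_ge0.
apply: le_trans (H _ _ (le_trans h1 rr) (le_trans h2 rr)) _; apply: ler_wpM2r => //.
by rewrite (le_trans (ler_norm L)) // lerDl invr_ge0 ltW.
Qed.

Lemma lip_at_elim V W (f : V -> W) y : lip_at f y -> exists B r : R, [/\ 0 <= B, 0 < r &
  forall y1 y2, `|y1 - y| <= r -> `|y2 - y| <= r -> `|f y2 - f y1| <= B * `|y2 - y1|].
Proof.
by move=> [B B0 H]; exists B, (B + 1)^-1; split=> //; rewrite invr_gt0 ltr_wpDl.
Qed.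

Lemma lip_at_cont V W (f : V -> W) y : lip_at f y -> {for y, continuous f}.
Proof.
move=> /lip_at_elim[B [r [B0 r0 H]]]; apply: (@lip_continuous _ _ _ B).
apply/nbhs_ballP; exists r => //= z; rewrite -ball_normE /= distrC => /ltW zr.
by apply: H => //; rewrite subrr normr0 ltW.
Qed.

Lemma lip_at_near V W (O : set V) (f g : V -> W) y : open O -> O y -> (forall z, O z -> f z = g z) ->
  lip_at f y -> lip_at g y.
Proof.
move=> oO Oy fg /lip_at_elim[B [r [B0 r0 H]]].
have /nbhs_ballP[r' /= r'0 rO] : nbhs y O by apply: open_nbhs_nbhs; split.
have m0 : 0 < Num.min r (r' / 2) by rewrite lt_min r0 divr_gt0.
have sub z : `|z - y| <= Num.min r (r' / 2) -> `|z - y| <= r /\ O z.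
  rewrite le_min => /andP[h1 h2]; split=> //; apply: rO; rewrite -ball_normE /= distrC.
  by apply: le_lt_trans h2 _; rewrite ltr_pdivrMr // mulr_natr mulr2n ltrDl.
apply: (lip_at_intro (L := B) m0) => y1 y2 /sub[h1 o1] /sub[h2 o2].
by rewrite -!fg //; exact: H.
Qed.

Lemma lip_at_comp U V W (f : U -> V) (g : V -> W) y : lip_at f y -> lip_at g (f y) -> lip_at (g \o f) y.
Proof.
move=> /lip_at_elim[B [r [B0 r0 H]]] /lip_at_elim[B' [r' [B'0 r'0 H']]].
have B1 : 0 < B + 1 by rewrite ltr_wpDl.
have m0 : 0 < Num.min r (r' / (B + 1)) by rewrite lt_min r0 divr_gt0.
have sub z : `|z - y| <= Num.min r (r' / (B + 1)) -> `|z - y| <= r /\ `|f z - f y| <= r'.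
  rewrite le_min => /andP[h1]; rewrite ler_pdivlMr // => h2; split=> //.
  have := H y z; rewrite subrr normr0 (ltW r0) => /(_ isT h1) h3.
  apply: le_trans h3 (le_trans _ h2); rewrite mulrC; apply: ler_wpM2l => //; by rewrite lerDl.
apply: (lip_at_intro (L := B' * B) m0) => y1 y2 /sub[h1 o1] /sub[h2 o2] /=.
apply: le_trans (H' _ _ o1 o2) _; rewrite -mulrA; apply: ler_wpM2l => //; exact: H.
Qed.

Context {n : nat}.
Local Notation Y := 'rV[R]_n.

Lemma lip_at_pairing V (f g : V -> Y) y : lip_at f y -> lip_at g y ->
  lip_at (fun z => pairing (f z) (g z)) y.
Proof.
move=> [B B0 H] [B' B'0 H'].
pose b := B + B'.
have b0 : 0 <= b by exact: addr_ge0.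
have {}H : lip_with f y b by apply: lip_with_mono H => //; rewrite lerDl.
have {}H' : lip_with g y b by apply: lip_with_mono H' => //; rewrite lerDr.
have r0 : 0 < (b + 1)^-1 by rewrite invr_gt0 ltr_wpDl.
have bd (h : V -> Y) z : lip_with h y b -> `|z - y| <= (b + 1)^-1 -> `|h z| <= `|h y| + 1.
  move=> Hh hz; have := Hh y z; rewrite subrr normr0 (ltW r0) => /(_ isT hz) h1.
  rewrite -[h z](subrK (h y)) addrC; apply: le_trans (ler_normD _ _) _; rewrite lerD2l.
  apply: le_trans h1 _; apply: le_trans (ler_wpM2l b0 hz) _.
  by rewrite ler_pdivrMr ?mul1r ?lerDl // ltr_wpDl.
apply: (lip_at_intro (L := n%:R * (b * (`|g y| + 1)) + n%:R * ((`|f y| + 1) * b)) r0) => y1 y2 h1 h2.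
have -> : pairing (f y2) (g y2) - pairing (f y1) (g y1) =
    pairing (f y2 - f y1) (g y2) + pairing (f y1) (g y2 - g y1).
  by rewrite pairingBl pairingBr addrA subrK.
apply: le_trans (ler_normD _ _) _; rewrite mulrDl; apply: lerD; apply: le_trans (pairing_norm _ _) _;
  rewrite -mulrA; apply: ler_wpM2l => //.
  rewrite mulrAC; apply: ler_pM => //; [exact: H|exact: bd].
by rewrite -mulrA; apply: ler_pM => //; [exact: bd|exact: H'].
Qed.

Lemma lip_at_row V (f : V -> Y) y : (forall k, lip_at (fun z => f z 0 k) y) -> lip_at f y.
Proof.
move=> H; have [B B0 HB] := @fin_bound R n (fun k B => 0 <= B /\ lip_with (fun z => f z 0 k) y B)
  (fun k => let: ex_intro2 B B0 HB := H k in ex_intro2 _ _ B B0 (conj B0 HB))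
  (fun k B B' BB' h => conj (le_trans h.1 BB') (lip_with_mono h.1 BB' h.2)).
exists B => // y1 y2 h1 h2; apply: norm_rV_le => [|k]; first by rewrite mulr_ge0.
by rewrite !mxE; apply: (HB k).2.
Qed.

Lemma lip_at_Ck1 (O : set Y) (f : Y -> Y) y : open O -> Ck 1 O f -> O y -> lip_at f y.
Proof.
move=> oO Cf Oy; apply: lip_at_row => k.
have ck : linear (fun z : Y => z 0 k : R) by move=> a z w; rewrite !mxE.
have cc : continuous (fun z : Y => z 0 k).
  apply: (@lipT_continuous _ _ _ 1) => z1 z2; rewrite mul1r.
  by have := norm_coord (z1 - z2) k; rewrite !mxE.
have /nbhs_ballP[r /= r0 rO] : nbhs y O by apply: open_nbhs_nbhs; split.
pose g := fun z : Y => f z 0 k.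
have Cg : Ck 1 O g by exact: (Ck_lin (L := lin_of ck) oO cc Cf).
have oO' : open ((fst : Y * Y -> Y) @^-1` O).
  by apply: open_comp => // w _; exact: fst_continuous.
have Cg' := @Ck_precomp R _ _ _ 1 O g (lin_of (@fst_is_linear R n)) (@fst_continuous R n) oO Cg.
have bO : box y (r / 2) 0 `<=` (fst : Y * Y -> Y) @^-1` O.
  move=> w [w1 _]; apply: rO; rewrite -ball_normE /= distrC; apply: le_lt_trans w1 _.
  by rewrite ltr_pdivrMr // mulr_natr mulr2n ltrDl.
have [B B0 HB] := Ck1_box_lip Cg' bO.
have r2 : 0 < r / 2 by rewrite divr_gt0.
apply: (lip_at_intro (L := B) r2) => y1 y2 h1 h2.
have bx z : `|z - y| <= r / 2 -> box y (r / 2) 0 (z, 0) by move=> h; split=> //=; rewrite normr0.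
apply: le_trans (HB (y1, 0) (y2, 0) (bx _ h1) (bx _ h2)) _; apply: ler_wpM2l => //.
by apply: norm_pair_le => /=; rewrite ?subr0 ?normr0.
Qed.

Lemma diff_pairing (f : Y -> R) y v : 'd f y v = pairing (grad f y) v.
Proof.
rewrite [v in LHS]row_sum_delta linear_sum pairingE; apply: eq_bigr => k _.
by rewrite linearZ /= mxE mulrC.
Qed.

Lemma pairing_is_linear (p : Y) : linear (pairing p).
Proof. by move=> a v w; rewrite pairingDr pairingZr. Qed.

Lemma pairing_continuous (p : Y) : continuous (pairing p).
Proof.
apply: (@lipT_continuous _ _ _ (n%:R * `|p|)) => v w.
by rewrite -pairingBr -mulrA; exact: pairing_norm.
Qed.

Lemma diff_of_quad V W (f : V -> W) y (L : {linear V -> W}) (r Q : R) : continuous L -> 0 < r -> 0 <= Q ->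
  (forall y', `|y' - y| <= r -> `|f y' - f y - L (y' - y)| <= Q * `|y' - y| ^+ 2) ->
  differentiable f y /\ 'd f y = L :> (V -> W).
Proof.
move=> cL r0 Q0 H; apply: diff_intro => // e e0.
apply/nbhs_ballP; exists (Num.min r (e / (Q + 1))) => /=.
  by rewrite lt_min r0 divr_gt0 // ltr_wpDl.
move=> h; rewrite -ball_normE /= sub0r normrN lt_min => /andP[h1 h2].
have := H (h + y); rewrite addrK => /(_ (ltW h1)) h3; apply: le_trans h3 _.
rewrite expr2 mulrA; apply: ler_wpM2r => //.
have Q1 : 0 < Q + 1 by rewrite ltr_wpDl.
move: h2; rewrite ltr_pdivlMr // mulrC => /ltW; apply: le_trans.
by apply: ler_wpM2r => //; rewrite lerDl.
Qed.

Lemma grad_intro (f : Y -> R) y (q : Y) (r Q : R) : 0 < r -> 0 <= Q ->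
  (forall y', `|y' - y| <= r -> `|f y' - f y - pairing q (y' - y)| <= Q * `|y' - y| ^+ 2) ->
  differentiable f y /\ grad f y = q.
Proof.
move=> r0 Q0 H.
have [df E] := diff_of_quad (L := lin_of (pairing_is_linear q)) (@pairing_continuous q) r0 Q0 H.
by split=> //; apply: pairing_ext => v; rewrite -diff_pairing E.
Qed.

Lemma quad_lip (f : Y -> R) (g : Y -> Y) (a : Y) (r Q : R) : 0 < r -> 0 <= Q ->
  (forall y1 y2, `|y1 - a| < r -> `|y2 - a| < r ->
    `|f y2 - f y1 - pairing (g y1) (y2 - y1)| <= Q * `|y2 - y1| ^+ 2) ->
  forall y1 y2, `|y1 - a| < r / 4 -> `|y2 - a| < r / 4 -> `|g y2 - g y1| <= 6 * Q * `|y2 - y1|.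
Proof.
move=> r0 Q0 H y1 y2 h1 h2; have [->|ny] := eqVneq y2 y1; first by rewrite !subrr !normr0 mulr0.
have s0 : 0 < `|y2 - y1| by rewrite normr_gt0 subr_eq0.
have [w w1 wE] := pairing_dual (g y2 - g y1).
pose y3 := y2 + `|y2 - y1| *: w.
have d12 : `|y2 - y1| < r / 2.
  by have := ler_distD a y2 y1; rewrite (distrC a); move: h1 h2; lra.
have d32 : `|y3 - y2| <= `|y2 - y1|.
  by rewrite /y3 addrAC subrr add0r normrZ normr_id ler_piMr.
have d31 : `|y3 - y1| <= 2 * `|y2 - y1|.
  by apply: le_trans (ler_distD y2 _ _) _; rewrite mulr_natl mulr2n; apply: lerD.
have h3 : `|y3 - a| < r by have := ler_distD y2 y3 a; move: h2 d12 d32; lra.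
have lt4 x : x < r / 4 -> x < r by move=> hx; lra.
have q1 := H y2 y3 (lt4 _ h2) h3; have q2 := H y1 y3 (lt4 _ h1) h3.
have q3 := H y1 y2 (lt4 _ h1) (lt4 _ h2).
have e32 : y3 - y2 = `|y2 - y1| *: w by rewrite /y3 addrAC subrr add0r.
have e31 : y3 - y1 = (y3 - y2) + (y2 - y1) by rewrite addrA subrK.
rewrite e31 pairingDr -e31 e32 pairingZr in q2; rewrite e32 pairingZr -e32 in q1.
have s32 : Q * `|y3 - y2| ^+ 2 <= Q * `|y2 - y1| ^+ 2 by apply: ler_wpM2l => //; apply: lerXn2r; rewrite ?nnegrE.
have s31 : Q * `|y3 - y1| ^+ 2 <= 4 * (Q * `|y2 - y1| ^+ 2).
  rewrite [leRHS]mulrCA; apply: ler_wpM2l => //; rewrite (_ : 4 * _ = (2 * `|y2 - y1|) ^+ 2); last by ring.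
  by apply: lerXn2r; rewrite ?nnegrE ?mulr_ge0.
have E : pairing (g y2) w - pairing (g y1) w = `|g y2 - g y1| by rewrite -pairingBl pairingC wE.
rewrite -(ler_pM2r s0) -E mulrBl -[leRHS]mulrA -expr2 -mulrA.
move: q1 q2 q3 s32 s31 => /ler_normlP[q1 _] /ler_normlP[_ q2] /ler_normlP[q3 _].
move: q1 q2 q3.
move: (f y1) (f y2) (f y3) (Q * `|y3 - y2| ^+ 2) (Q * `|y3 - y1| ^+ 2) (Q * _ ^+ 2) => f1 f2 f3 a1 a2 a3.
by rewrite !(mulrC _ `|y2 - y1|); move: (_ * pairing (g y2) w) (_ * pairing (g y1) w) (pairing (g y1) (y2 - y1)) => b1 b2 b3; lra.
Qed.

Lemma C11_local (O : set Y) (f : Y -> R) : open O -> (forall y, O y -> differentiable f y) ->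
  (forall y, O y -> lip_at (grad f) y) ->
  Ck 1 O f /\ forall y, O y -> exists k : R, exists2 U : set Y, nbhs y U & k.-lipschitz_U (grad f).
Proof.
move=> oO df lf; split; first split=> // v y Oy /=.
  have -> : (fun x => 'd f x v) = (fun x => pairing (grad f x) v) by apply/funext => x; exact: diff_pairing.
  apply: lip_at_cont; apply: lip_at_pairing; first exact: lf.
  by apply: (lip_at_intro (L := 0) ltr01) => y1 y2 _ _; rewrite subrr normr0 mul0r.
move=> y Oy; have /lip_at_elim[B [r [B0 r0 H]]] := lf y Oy.
exists B, [set z | `|z - y| <= r].
  by apply/nbhs_ballP; exists r => //= z; rewrite -ball_normE /= distrC => /ltW.
by move=> [y1 y2] /= [h1 h2]; exact: H.
Qed.

End LipAt.

HB.lock Definition dfn (R : realType) (n : nat) (M : ptopologicalType) (S : smooth_manifold R n M)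
  (u : M -> R) (x : M) : 'rV[R]_n := dfun S u x.

Section C11Patches.
Context {R : realType} {n : nat} {M : ptopologicalType} (S : smooth_manifold R n M) (P : patches S).
Local Notation V := 'rV[R]_n.
Implicit Types (d : 'I_(pcard P)) (z : TsM S) (u v : M -> R) (i j : chart_index S).

Definition dgraph u x : TsM S := (x, dfn S u x).

Lemma chart_change u i j y : overlap j i y -> differentiable (u \o param i) (chart i (param j y)) ->
  differentiable (u \o param j) y /\
  grad (u \o param j) y = \row_k pairing (grad (u \o param i) (chart i (param j y)))
    (dr (chart i \o param j) y (delta_mx 0 k)).
Proof.
move=> oy du; have dp := transition_diff oy.
have dc : differentiable ((u \o param i) \o (chart i \o param j)) y by exact: differentiable_comp.
have eqO (z : V) : overlap j i z -> ((u \o param i) \o (chart i \o param j)) z = (u \o param j) z.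
  by move=> /overlapP[cz dz] /=; rewrite chartK.
have [dj E] := diff_open_eq (@open_overlap _ _ _ S j i) eqO oy dc; split=> //.
apply/rowP => k; rewrite !mxE E.
by rewrite (diff_comp dp du) /= diff_pairing drE.
Qed.

Lemma dfun_chart u i x : dom i x -> differentiable (u \o param i) (chart i x) ->
  coord i (dgraph u x) = (chart i x, grad (u \o param i) (chart i x)).
Proof.
move=> dx du; rewrite /coord /dgraph /=; congr pair; set j := chart_at S x.
have dj : dom j x by exact: dom_chart_at.
have oy : overlap j i (chart j x) by exact: overlap_chart.
have [|_ E] := @chart_change u i j (chart j x) oy; first by rewrite chartK.
have -> : dfn S u x = grad (u \o param j) (chart j x) by rewrite dfn.unlock.
rewrite E chartK //.
have -> : (\row_k pairing (grad (u \o param i) (chart i x)) (dr (chart i \o param j) (chart j x) (delta_mx 0 k)))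
   = grad (u \o param i) (chart i x) *m (Jac j i x)^T.
  by apply/rowP => k; rewrite mxE -transE pairing_mulmx pairing_delta.
by rewrite -mulmxA -trmx_mul trans_inv // trmx1 mulmx1.
Qed.

Definition quads (m rho Q : R) u (g : 'I_(pcard P) -> M -> V) : Prop := forall d y y', inr d m y -> inr d m y' ->
  `|pchart d y' - pchart d y| <= rho ->
  `|u y' - u y - pairing (g d y) (pchart d y' - pchart d y)| <=
    Q * `|pchart d y' - pchart d y| ^+ 2.

Lemma C11_of_quads (rho Q : R) u g : 0 < rho -> 0 <= Q -> quads 1 rho Q u g ->
  C11_fun S u /\ forall d x, dom (idx d) x -> `|pchart d x - ctr d| < rad d ->
    pcoord d (dgraph u x) = (pchart d x, g d x).
Proof.
move=> rho0 Q0 H.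
have loc d x : dom (idx d) x -> `|pchart d x - ctr d| < rad d ->
  [/\ differentiable (u \o param (idx d)) (pchart d x),
      grad (u \o param (idx d)) (pchart d x) = g d x &
      lip_at (grad (u \o param (idx d))) (pchart d x)].
  move=> dx xr; pose f := u \o param (idx d); pose a := pchart d x.
  pose r := Num.min (rho / 2) (rad d - `|a - ctr d|).
  have r0 : 0 < r by rewrite lt_min divr_gt0 // subr_gt0.
  have inb y : `|y - a| < r -> inr d 1 (param (idx d) y) /\ pchart d (param (idx d) y) = y.
    rewrite lt_min => /andP[_ h2]; have yr : `|y - ctr d| <= rad d.
      by have := ler_distD a y (ctr d); move: h2; lra.
    have cy : cod (idx d) y by apply: pcod; have := rad_gt0 d; move: yr; lra.
    by rewrite /inr paramK // mul1r; split=> //; split=> //; exact: dom_param.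
  have q2 y1 y2 : `|y1 - a| < r -> `|y2 - a| < r ->
      `|f y2 - f y1 - pairing (g d (param (idx d) y1)) (y2 - y1)| <= Q * `|y2 - y1| ^+ 2.
    move=> h1 h2; have [i1 e1] := inb _ h1; have [i2 e2] := inb _ h2.
    have := H d _ _ i1 i2; rewrite e1 e2; apply.
    move: h1 h2; rewrite !lt_min => /andP[h1 _] /andP[h2 _].
    by have := ler_distD a y2 y1; rewrite (distrC a); move: h1 h2; lra.
  have gE y : `|y - a| < r -> differentiable f y /\ grad f y = g d (param (idx d) y).
    move=> h; pose s := (r - `|y - a|) / 2.
    have s0 : 0 < s by rewrite divr_gt0 // subr_gt0.
    apply: (grad_intro s0 Q0) => y' h'; apply: q2 => //.
    by have := ler_distD y y' a; move: h h'; rewrite /s; lra.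
  have aa : `|a - a| < r by rewrite subrr normr0.
  have [df ge] := gE a aa; split=> //; first by rewrite ge /a chartK.
  have r8 : 0 < r / 8 by rewrite divr_gt0.
  apply: (lip_at_intro (L := 6 * Q) r8) => y1 y2 h1 h2.
  have r48 : r / 8 < r / 4 by move: r0; lra.
  have r4 : r / 4 <= r by move: r0; lra.
  have l1 := le_lt_trans h1 r48; have l2 := le_lt_trans h2 r48.
  rewrite (gE _ (lt_le_trans l1 r4)).2 (gE _ (lt_le_trans l2 r4)).2.
  exact: (quad_lip (f := f) (g := fun y => g d (param (idx d) y)) r0 Q0 q2 l1 l2).
split; last by move=> d x dx xr; have [df gE _] := loc d x dx xr; rewrite dfun_chart // gE.
move=> j; apply: C11_local; first exact: open_cod.
  move=> y cy; have [d dx xr] := pcover P (param j y).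
  have oy : overlap j (idx d) y by apply/overlapP.
  by have [df _ _] := loc d _ dx xr; have [] := chart_change oy df.
move=> y cy; have [d dx xr] := pcover P (param j y).
have oy : overlap j (idx d) y by apply/overlapP.
have tC := @transition_Ck _ _ _ S j (idx d) 2.
have oO := @open_overlap _ _ _ S j (idx d).
have l1 : lip_at (pchart d \o param j) y by apply: lip_at_Ck1 oO _ oy; exact: Ck_pred.
have [r r0 near_r] : exists2 r : R, 0 < r & forall z : V, `|z - y| < r -> overlap j (idx d) z /\
    `|pchart d (param j z) - ctr d| < rad d.
  have c1 : {for y, continuous (fun z : V => `|pchart d (param j z) - ctr d|)}.
    apply: continuous_comp; last exact: norm_continuous.
    by apply: continuousB; [exact: lip_at_cont|exact: cst_continuous].
  have N1 : \forall z \near y, `|pchart d (param j z) - ctr d| < rad d.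
    by apply: (c1 [set t | t < rad d]); apply: open_nbhs_nbhs; split=> //; exact: open_lt.
  have N2 : nbhs y (overlap j (idx d)) by apply: open_nbhs_nbhs; split.
  have /nbhs_ballP[r /= r0 rN] : nbhs y ([set z : V | `|pchart d (param j z) - ctr d| < rad d] `&` overlap j (idx d)).
    exact: filterI.
  exists r => // z zr.
  by have [] : _ /\ _ := rN z _; rewrite -?ball_normE /= 1?distrC.
apply: lip_at_row => k.
pose G (z : V) := pairing (grad (u \o param (idx d)) (pchart d (param j z)))
    (dr (pchart d \o param j) z (delta_mx 0 k)).
have oB : open (ball y r) by exact: ball_open.
apply: (lip_at_near (f := G) oB); first by rewrite -ball_normE /= subrr normr0.
  move=> z; rewrite -ball_normE /= distrC => /near_r[oz zr].
  have dz : dom (idx d) (param j z) by case/overlapP: oz.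
  by have [df _ _] := loc d _ dz zr; have [_ ->] := chart_change oz df; rewrite mxE.
apply: lip_at_pairing.
  apply: (@lip_at_comp _ _ _ _ (pchart d \o param j)) => //.
  by have [_ _] := loc d _ dx xr.
apply: lip_at_Ck1 oO _ oy; have [_ /(_ (delta_mx 0 k))] := tC.
by rewrite dr_fun.
Qed.

Lemma C11_sub_fun (K : TsM S -> R) c u : C11_sub P K c u ->
  C11_fun S u /\ forall x, K (dgraph u x) <= c.
Proof.
move=> [rho [Q [rho0 Q0 H]]].
have /choice[g gP] (dy : 'I_(pcard P) * M) : exists q : V, inr dy.1 1 dy.2 ->
    K (tprm (idx dy.1) (chart (idx dy.1) dy.2, q)) <= c /\
    forall y', inr dy.1 1 y' -> `|chart (idx dy.1) y' - chart (idx dy.1) dy.2| <= rho ->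
    `|u y' - u dy.2 - pairing q (chart (idx dy.1) y' - chart (idx dy.1) dy.2)| <=
    Q * `|chart (idx dy.1) y' - chart (idx dy.1) dy.2| ^+ 2.
  have [h|h] := pselect (inr dy.1 1 dy.2); last by exists 0 => /h.
  by have [q hq] := H _ _ h; exists q.
have [] := @C11_of_quads rho Q u (fun d y => g (d, y)) rho0 (ltW Q0).
  by move=> d y y' hy hy' yy; have [_ /(_ y' hy' yy)] := gP (d, y) hy.
move=> uC uE; split=> // x; have [d dx xr] := pcover P x.
have h1 : inr d 1 x by split=> //; rewrite mul1r ltW.
have [+ _] := gP (d, x) h1.
by rewrite /= -(uE _ _ dx xr) coordK.
Qed.

Lemma C11_diff u i y : C11_fun S u -> cod i y -> differentiable (u \o param i) y.
Proof. by move=> /(_ i)[[+ _] _]; apply. Qed.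

Lemma C11_lip u i y : C11_fun S u -> cod i y -> lip_at (grad (u \o param i)) y.
Proof.
move=> /(_ i)[_ +] cy => /(_ y cy)[k [U /nbhs_ballP[r /= r0 rU] kU]].
have r2 : 0 < r / 2 by rewrite divr_gt0.
apply: (lip_at_intro (L := k) r2) => y1 y2 h1 h2; apply: (kU (y2, y1)).
have r2r : r / 2 < r by rewrite ltr_pdivrMr // mulr_natr mulr2n ltrDl.
by split=> /=; apply: rU; rewrite -ball_normE /= distrC; apply: le_lt_trans r2r.
Qed.

Lemma lip_uniform (f : V -> V) (a : V) (r : R) : (forall y, `|y - a| <= r -> lip_at f y) ->
  exists N : nat, forall y y', `|y - a| <= r -> `|y' - y| <= N.+1%:R^-1 ->
    `|f y' - f y| <= N%:R * `|y' - y|.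
Proof.
move=> H; have /compact_near_coveringP cK := @compact_ball R n a r.
pose Q N y := forall y' : V, `|y' - y| <= N.+1%:R^-1 -> `|f y' - f y| <= N%:R * `|y' - y|.
have : \forall N \near \oo, [set y | `|y - a| <= r] `<=` Q N.
  apply: cK => y /H/lip_at_elim[B [s [B0 s0 HB]]].
  exists ([set z | `|z - y| <= s / 2], [set N : nat | B <= N%:R /\ N.+1%:R^-1 <= s / 2]) => /=.
    split; first by apply/nbhs_ballP; exists (s / 2) => /=; rewrite ?divr_gt0 // => z; rewrite -ball_normE /= distrC => /ltW.
    have N1 : \forall N \near \oo, B <= (N%:R : R) by exact: nbhs_infty_ger.
    have N2 : \forall N \near \oo, (s / 2)^-1 <= (N%:R : R) by exact: nbhs_infty_ger.
    apply: filterS2 N1 N2 => N h1 h2; split=> //.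
    rewrite -[leRHS]invrK lef_pV2 ?posrE ?invr_gt0 ?divr_gt0 // (le_trans h2) //.
    by rewrite ler_nat.
  move=> [z N] /= [zs [BN Ns]] y' hy'.
  have s2 : s / 2 <= s by move: s0; lra.
  apply: le_trans (HB _ _ (le_trans zs s2) _) _; last by apply: ler_wpM2r.
  by have := ler_distD z y' y; move: zs (le_trans hy' Ns); lra.
move=> [N0 _ /(_ N0 (leqnn _)) h]; exists N0 => y y' hy; exact: h.
Qed.

Lemma C11_quads u (m : R) : m <= 4 -> C11_fun S u -> exists rho Q, [/\ 0 < rho, 0 < Q,
  quads m rho Q u (fun d x => (pcoord d (dgraph u x)).2) &
  forall d y y', inr d m y -> inr d m y' -> `|pchart d y' - pchart d y| <= rho ->
    `|cdiff d (dgraph u y) (dgraph u y')| <= Q * `|pchart d y' - pchart d y|].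
Proof.
move=> m4 uC.
have rm d : m * rad d <= 4 * rad d by rewrite ler_wpM2r // ltW // rad_gt0.
pose Pr d (B : R) := 0 <= B /\ forall y y', `|y - ctr d| <= m * rad d ->
    `|y' - y| <= (B + 1)^-1 ->
    `|grad (u \o param (idx d)) y' - grad (u \o param (idx d)) y| <= B * `|y' - y|.
have [B B0 HB] : exists2 B, 0 <= B & forall d, Pr d B.
  apply: (@fin_bound R (pcard P) Pr) => [d|d B B' BB [B0 HB]].
    have [y hy|N HN] := @lip_uniform (grad (u \o param (idx d))) (ctr d) (m * rad d).
      by apply: C11_lip => //; apply: pcod; exact: le_trans (rm d).
    by exists N%:R => //; split=> // y y' hy; have := HN y y' hy; rewrite -natr1.
  split=> [|y y' hy hyy]; first exact: le_trans BB.
  apply: le_trans (HB _ _ hy (le_trans hyy (inv1_le B0 BB))) _; exact: ler_wpM2r.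
have r0 : 0 < (B + 1)^-1 by rewrite invr_gt0 ltr_wpDl.
have gE d x : inr d m x -> pcoord d (dgraph u x) =
    (pchart d x, grad (u \o param (idx d)) (pchart d x)).
  by move=> [dx xr]; apply: dfun_chart => //; apply: C11_diff => //; exact: cod_chart.
exists (B + 1)^-1, (n%:R * B + B + 1); split=> //.
- by rewrite ltr_wpDl // addr_ge0 // mulr_ge0.
- move=> d x x' hx hx' xx; rewrite gE //=.
  set y := pchart d x in xx *; set y' := pchart d x' in xx *.
  pose f := u \o param (idx d).
  have yr : `|y - ctr d| <= m * rad d by case: hx.
  have yr' : `|y' - ctr d| <= m * rad d by case: hx'.
  pose c (s : R) := y + s *: (y' - y).
  have cin s : 0 <= s <= 1 -> `|c s - ctr d| <= m * rad d.
    by move=> s01; exact: (ball_convex s01 yr yr').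
  pose h (s : R) := f (c s) - s * pairing (grad f y) (y' - y).
  have dh (s : R) : 0 <= s <= 1 -> is_derive s 1 h (pairing (grad f (c s) - grad f y) (y' - y)).
    move=> s01; have dc : is_derive s 1 c (y' - y) by exact: is_derive_line.
    have df : differentiable f (c s) by apply: C11_diff => //; apply: pcod; exact: le_trans (cin _ s01) (rm d).
    have := is_derive_dr df dc; rewrite drE diff_pairing pairingBl => d1.
    exact: (is_deriveB d1 (is_derive_mulr _ _)).
  have [s /andP[s0 s1] hE] := MVT01 dh.
  have E : f y' - f y - pairing (grad f y) (y' - y) = h 1 - h 0.
    by rewrite /h /c scale1r scale0r addr0 mul1r mul0r subr0 (addrC y) subrK addrAC.
  have uE w : inr d m w -> f (pchart d w) = u w by move=> [dw _]; rewrite /f /= chartK.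
  rewrite -(uE _ hx) -(uE _ hx') -/y -/y' E hE; apply: le_trans (pairing_norm _ _) _.
  have cs : `|c s - y| <= `|y' - y|.
    by rewrite /c addrAC subrr add0r normrZ ger0_norm ?ler_piMl // ltW.
  have g1 := (HB d).2 y (c s) yr (le_trans cs xx).
  rewrite mulrA expr2 mulrA; apply: (@le_trans _ _ (n%:R * (B * `|y' - y|) * `|y' - y|)).
    apply: ler_wpM2r => //; apply: ler_wpM2l => //; apply: le_trans g1 _.
    exact: ler_wpM2l.
  rewrite mulrA; do 2 apply: ler_wpM2r => //; by rewrite -addrA lerDl addr_ge0.
- move=> d x x' hx hx' xx; pose f := u \o param (idx d).
  have -> : cdiff d (dgraph u x) (dgraph u x') = (pchart d x', grad f (pchart d x')) -
      (pchart d x, grad f (pchart d x)).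
    by congr (_ - _); exact: gE.
  apply: norm_pair_le => /=; first by rewrite ler_peMl // lerDr addr_ge0 // mulr_ge0.
  apply: le_trans ((HB d).2 _ _ _ xx) _; first by case: hx.
  by apply: ler_wpM2r => //; rewrite -addrA addrCA lerDl addr_ge0 // mulr_ge0.
Qed.

End C11Patches.

Lemma near_for (T U : topologicalType) (f : T -> U) x (B : set U) : {for x, continuous f} ->
  nbhs (f x) B -> \forall y \near x, B (f y).
Proof. by move=> cf /cf. Qed.

Lemma near_cod (R : realType) (n : nat) (M : ptopologicalType) (S : smooth_manifold R n M) (i : chart_index S)
    (w : 'rV[R]_n * 'rV[R]_n) : cod i w.1 -> nbhs w [set y | cod i y.1].
Proof. by move=> cw; apply: (near_for (@fst_continuous R n _)); apply: open_nbhs_nbhs; split=> //; exact: open_cod. Qed.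

Section Evolution.
Context {R : realType} {n : nat} {M : ptopologicalType} (S : smooth_manifold R n M) (P : patches S).
Local Notation V := 'rV[R]_n.
Implicit Types (d : 'I_(pcard P)) (z : TsM S) (u v : M -> R) (i j : chart_index S).
Local Notation dg := (dgraph S).

Definition subsol (K : TsM S -> R) (a : R) : set (M -> R) :=
  [set u | C11_fun S u /\ forall x, K (dg u x) <= a].

Lemma evolve_small (rho Q s : R) : 0 < rho -> 0 <= Q -> 0 < s -> exists2 e : R, 0 < e &
  forall e' : R, 0 <= e' -> e' <= e -> [/\ n%:R * (e' * Q) <= 2^-1, e' * Q <= 2^-1, 4 * e' <= rho &
    n%:R * (n%:R + 1) * e' < 2^-1 * s].
Proof.
move=> rho0 Q0 s0; have n0 : 0 <= (n%:R : R) by [].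
have Q1 : 0 < Q + 1 by rewrite ltr_wpDl.
have n1 : 0 < (n%:R : R) + 1 by rewrite ltr_wpDl.
exists (Num.min (rho / 4) (Num.min ((2 * (n%:R + 1) * (Q + 1))^-1) (s / (4 * (n%:R + 1) * (n%:R + 1))))).
  by rewrite !lt_min !divr_gt0 ?invr_gt0 ?mulr_gt0.
move=> e e0; rewrite !le_min => /and3P[h1 h2 h3].
have {}h1 : 4 * e <= rho by move: h1; lra.
have {}h2 : 2 * (n%:R + 1) * (Q + 1) * e <= 1.
  by move: h2; rewrite -[_^-1]mul1r ler_pdivlMr ?mulr_gt0 // mulrC.
have {}h3 : 4 * (n%:R + 1) * (n%:R + 1) * e <= s by move: h3; rewrite ler_pdivlMr ?mulr_gt0 // mulrC.
have eQ : 0 <= e * Q by exact: mulr_ge0.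
have p1 : 0 <= n%:R * (e * Q) by exact: mulr_ge0.
have p2 : 0 <= n%:R * e by exact: mulr_ge0.
have p3 : 0 <= n%:R * (n%:R * e) by exact: mulr_ge0.
have E2 : 2 * (n%:R + 1) * (Q + 1) * e = 2 * (n%:R * (e * Q)) + 2 * (n%:R * e) + 2 * (e * Q) + 2 * e by ring.
have E3 : 4 * (n%:R + 1) * (n%:R + 1) * e = 4 * (n%:R * (n%:R * e)) + 8 * (n%:R * e) + 4 * e by ring.
have E4 : n%:R * (n%:R + 1) * e = n%:R * (n%:R * e) + n%:R * e by ring.
rewrite E2 in h2; rewrite E3 in h3; rewrite E4; clear E2 E3 E4 n1 Q1.
move: (n%:R * (n%:R * e)) (n%:R * (e * Q)) (n%:R * e) (e * Q) p3 p1 p2 eQ h2 h3 => x1 x2 x3 x4 *.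
by split=> //; lra.
Qed.

Lemma near_aux (x1 x2 x3 x4 x5 r e : R) : x1 <= x4 + x2 -> x2 <= x3 + x5 -> x3 <= r / 2 ->
  x5 <= e -> x4 <= e -> 4 * e <= r -> x1 <= r.
Proof. by move=> *; lra. Qed.

Section Evolve.
Variables (K G : TsM S -> R) (a : R) (u : M -> R).
Hypothesis KG : good_pair P K G.
Hypothesis uS : subsol K a u.

Lemma evolve : exists2 t0 : R, 0 < t0 & forall t, `|t| <= t0 -> exists2 v, subsol K a v &
  forall x, hflow G t (dg u x) = dg v (hflow G t (dg u x)).1 /\
    v (hflow G t (dg u x)).1 = u x + hact G (dg u x) t.
Proof.
have [uC uK] := uS; have [K2 G2 KG0 _] := KG.
have rG : reg_fun P G (fun=> True).
  by move=> b b0; have [C C0 HC] := reg_const P G2 b0; exists C, (- (n%:R * C)).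
have [b [C [k [tau [D [_ es]]]]]] := est_ex a KG rG.
have [b0 C0 tau0 D0] := est_pos es.
have [rho [Q [rho0 Q0 uq ul]]] := @C11_quads _ _ _ _ P u 3 (ler_nat R 3 4) uC.
pose s := Num.min (rho / 2) (C * tau).
have s0 : 0 < s by rewrite lt_min divr_gt0 // mulr_gt0.
have [e e0 He] := evolve_small rho0 (ltW Q0) s0.
exists (Num.min tau (e / C)) => [|t]; first by rewrite lt_min tau0 divr_gt0.
rewrite le_min => /andP[tt te].
have [|e1 e2 e3 e4] := He (C * `|t|) (mulr_ge0 (ltW C0) (normr_ge0 t)).
  by move: te; rewrite ler_pdivlMr // mulrC.
have [X XE] : exists X : M -> M, forall x, X x = (hflow G t (dg u x)).1 by exists (fun x => (hflow G t (dg u x)).1).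
have stay d x : inr d 3 x -> dom (idx d) (X x) /\ `|pchart d (X x) - pchart d x| <= C * `|t|.
  by move=> h; rewrite XE; apply: (est_stay es).
have back d x : inr d 1 (X x) -> inr d 2 x /\ `|pchart d (X x) - pchart d x| <= C * `|t|.
  move=> h; have h3 : inr d 3 (hflow G t (dg u x)).1 by rewrite -XE; exact: inr_le le13 h.
  have KX : K (hflow G t (dg u x)) <= a by rewrite (hflow_energy KG).
  have tt' : `|- t| <= tau by rewrite normrN.
  have [] := est_stay es h3 KX tt'; rewrite (hflowNK KG) normrN -XE /= => dx xX.
  rewrite distrC; split=> //; split=> //.
  have := ler_distD (pchart d (X x)) (pchart d x) (ctr d).
  have := est_rad es d; case: h => _; have : C * `|t| <= C * tau by apply: ler_wpM2l => //; exact: ltW.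
  by move: xX; lra.
have close d x x' : inr d 3 x -> inr d 3 x' -> `|pchart d x' - pchart d x| <= rho ->
    `|cdiff d (dg u x) (dg u x')| <= Q * `|pchart d x' - pchart d x| /\
    `|(pchart d (X x') - pchart d (X x)) - (pchart d x' - pchart d x)| <=
    C * `|t| * Q * `|pchart d x' - pchart d x|.
  move=> hx hx' xx; have l1 := ul d x x' hx hx' xx; split=> //.
  have l2 := @est_lip _ _ _ _ _ _ _ _ _ _ _ _ _ es d (dg u x) (dg u x') t hx hx' (uK _) (uK _) tt.
  rewrite !XE; apply: (le_trans (norm_pair1 (cdiff d (hflow G t (dg u x)) (hflow G t (dg u x')) - cdiff d (dg u x) (dg u x')))).
  apply: le_trans l2 _; rewrite -[leRHS]mulrA; apply: ler_wpM2l => //.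
  by rewrite mulr_ge0 // ltW.
have near d x x' : inr d 2 x -> inr d 2 x' -> `|pchart d (X x) - pchart d x| <= C * `|t| ->
    `|pchart d (X x') - pchart d x'| <= C * `|t| ->
    `|pchart d (X x') - pchart d (X x)| <= rho / 2 ->
    `|pchart d x' - pchart d x| <= rho /\
    `|pchart d x' - pchart d x| <= 2 * `|pchart d (X x') - pchart d (X x)|.
  move=> hx hx' h h' XX; have xr : `|pchart d x' - pchart d x| <= rho.
    have t1 := ler_distD (pchart d (X x')) (pchart d x') (pchart d x).
    have t2 := ler_distD (pchart d (X x)) (pchart d (X x')) (pchart d x).
    rewrite (distrC (pchart d x') (pchart d (X x'))) in t1.
    exact: near_aux t1 t2 XX h h' e3.
  split=> //; have [_ c2] := close d x x' (inr_le le23 hx) (inr_le le23 hx') xr.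
  have l3 : C * `|t| * Q * `|pchart d x' - pchart d x| <= 2^-1 * `|pchart d x' - pchart d x|.
    exact: ler_wpM2r.
  have := ler_distD (pchart d (X x') - pchart d (X x)) (pchart d x' - pchart d x) 0.
  by rewrite !subr0 (distrC (pchart d x' - _)); move: c2 l3; lra.
have inj x x' : X x = X x' -> x = x'.
  move=> E; have [d h] := pcover1 P (X x).
  have [h1 l1] := back d x h; have := h; rewrite E => h'.
  have [h2 l2] := back d x' h'.
  have [|_] := near d x x' h1 h2 l1 l2; first by rewrite E subrr normr0 divr_ge0 // ltW.
  rewrite E subrr normr0 mulr0 normr_le0 subr_eq0 => /eqP cE.
  by rewrite -(chartK h1.1) -cE (chartK h2.1).
have surj y : exists x, X x = y.
  have [d h] := pcover1 P y; pose p0 := pchart d y.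
  pose f p := pchart d (X (param (idx d) p)).
  have sd : s <= rad d by rewrite (le_trans _ (est_rad es d)) // /s ge_min lexx orbT.
  have inb p : `|p - p0| <= s -> inr d 2 (param (idx d) p) /\ pchart d (param (idx d) p) = p.
    move=> hp; have pr : `|p - ctr d| <= 2 * rad d.
      by have := ler_distD p0 p (ctr d); case: h => _; rewrite /p0; move: hp sd; lra.
    have cp : cod (idx d) p by apply: pcod; have := rad_gt0 d; move: pr; lra.
    by rewrite /inr paramK //; split=> //; split=> //; exact: dom_param.
  have pp p p' : `|p - p0| <= s -> `|p' - p0| <= s ->
      `|(f p' - f p) - (p' - p)| <= C * `|t| * Q * `|p' - p|.
    move=> hp hp'; have [i1 E1] := inb p hp; have [i2 E2] := inb p' hp'.
    have := close d _ _ (inr_le le23 i1) (inr_le le23 i2); rewrite E1 E2 => -[] //.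
    have := ler_distD p0 p' p; rewrite (distrC p0).
    have : s <= rho / 2 by rewrite /s ge_min lexx.
    by move: hp hp'; lra.
  have aux : `|p0 - f p0| <= C * `|t|.
    have p00 : `|p0 - p0| <= s by rewrite subrr normr0 ltW.
    have [i1 E1] := inb p0 p00.
    by have [_] := stay d _ (inr_le le23 i1); rewrite E1 -/(f p0) distrC.
  have [||p p' hp hp'|p p' hp hp'||p [hp fp _]] := @mono_surj R n f p0 p0 s 2^-1 2 s0.
  - by [].
  - by [].
  - have := pairing_norm (p' - p) ((f p' - f p) - (p' - p)).
    move=> /ler_normlP[+ _]; rewrite pairingBr opprB => h1.
    have h2 := sqr_norm_pairing (p' - p).
    have h3 : n%:R * (`|p' - p| * `|f p' - f p - (p' - p)|) <= 2^-1 * `|p' - p| ^+ 2.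
      apply: (@le_trans _ _ (n%:R * (`|p' - p| * (C * `|t| * Q * `|p' - p|)))).
        by apply: ler_wpM2l => //; apply: ler_wpM2l => //; exact: pp.
      rewrite (_ : n%:R * _ = n%:R * (C * `|t| * Q) * `|p' - p| ^+ 2); last by ring.
      by apply: ler_wpM2r => //; exact: sqr_ge0.
    move: h1 h2 h3; move: (pairing _ (f p' - f p)) (pairing _ (p' - p)) (n%:R * _) (`|p' - p| ^+ 2).
    by move=> *; lra.
  - have h1 := pp _ _ hp hp'.
    have h2 : C * `|t| * Q * `|p' - p| <= 2^-1 * `|p' - p| by exact: ler_wpM2r.
    have := ler_distD (p' - p) (f p' - f p) 0; rewrite !subr0.
    by have := normr_ge0 (p' - p); move: h1 h2; lra.
  - apply: le_lt_trans e4; apply: ler_wpM2l; [by rewrite mulr_ge0 // addr_ge0|exact: aux].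
  - have [i1 E1] := inb p hp; exists (param (idx d) p).
    have [dX _] := stay d _ (inr_le le23 i1).
    by rewrite -(chartK dX) -(chartK h.1); congr (param _ _); exact: fp.
have /choice[Y YX] := surj.
have YK x : Y (X x) = x by apply: inj; rewrite YX.
pose v y := u (Y y) + hact G (dg u (Y y)) t.
pose g d y := (pcoord d (hflow G t (dg u (Y y)))).2.
have [|||vC vE] := @C11_of_quads _ _ _ _ P (rho / 2) (4 * (Q + D * tau * Q ^+ 2)) v g.
- by rewrite divr_gt0.
- by rewrite mulr_ge0 // addr_ge0 ?mulr_ge0 ?sqr_ge0 // ltW.
- move=> d y y' hy hy' yy; have hX : inr d 1 (X (Y y)) by rewrite YX.
  have hX' : inr d 1 (X (Y y')) by rewrite YX.
  set x := Y y in hX *; set x' := Y y' in hX' *.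
  have [h1 l1] := back d x hX; have [h2 l2] := back d x' hX'.
  have Ex : X x = y by exact: YX. have Ex' : X x' = y' by exact: YX.
  have [|r1 r2] := near d x x' h1 h2 l1 l2; first by rewrite Ex Ex'.
  rewrite Ex Ex' in r2.
  have [c1 _] := close d x x' (inr_le le23 h1) (inr_le le23 h2) r1.
  have uQ := uq d x x' (inr_le le23 h1) (inr_le le23 h2) r1.
  have th := @est_act _ _ _ _ _ _ _ _ _ _ _ _ _ es d (dg u x) (dg u x') t (inr_le le23 h1) (inr_le le23 h2) (uK _) (uK _) tt.
  have -> : v y' - v y - pairing (g d y) (pchart d y' - pchart d y) =
    (u x' - u x - pairing (pcoord d (dg u x)).2 (pchart d x' - pchart d x)) +
    theta G d t (dg u x) (dg u x').
    rewrite /theta /v -/x -/x' /g -/x.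
    rewrite (_ : (cdiff d (hflow G t (dg u x)) (hflow G t (dg u x'))).1 = pchart d y' - pchart d y); last by rewrite -Ex -Ex' !XE.
    rewrite (_ : (cdiff d (dg u x) (dg u x')).1 = pchart d x' - pchart d x) //.
    by move: (hact G (dg u x') t) (hact G (dg u x) t) (pairing (pcoord d (hflow G t (dg u x))).2 _)
      (pairing (pcoord d (dg u x)).2 _) => a1 a2 p1 p2; ring.
  apply: le_trans (ler_normD _ _) _.
  have s1 : `|pchart d x' - pchart d x| ^+ 2 <= 4 * `|pchart d y' - pchart d y| ^+ 2.
    rewrite (_ : 4 * _ = (2 * `|pchart d y' - pchart d y|) ^+ 2); last by ring.
    by apply: lerXn2r; rewrite ?nnegrE ?mulr_ge0.
  have s2 : `|cdiff d (dg u x) (dg u x')| ^+ 2 <= Q ^+ 2 * `|pchart d x' - pchart d x| ^+ 2.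
    by rewrite -exprMn; apply: lerXn2r; rewrite ?nnegrE ?mulr_ge0 // ltW.
  rewrite mulrDr [leRHS]mulrDl; apply: lerD.
    apply: le_trans uQ _; rewrite (mulrC 4) -[leRHS]mulrA; apply: ler_wpM2l => //; exact: ltW.
  apply: le_trans th _; apply: (@le_trans _ _ (D * tau * (Q ^+ 2 * (4 * `|pchart d y' - pchart d y| ^+ 2)))).
    apply: ler_pM; rewrite ?sqr_ge0 //; first by rewrite mulr_ge0 // ltW.
      by apply: ler_wpM2l => //; exact: ltW.
    apply: le_trans s2 _; apply: ler_wpM2l => //; exact: sqr_ge0.
  by rewrite le_eqVlt; apply/orP; left; apply/eqP; ring.
have vG y : dg v y = hflow G t (dg u (Y y)).
  have [d dy yr] := pcover P y.
  have E : (hflow G t (dg u (Y y))).1 = y by rewrite -XE YX.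
  apply: (@coord_inj _ _ _ S (idx d)) => //; first by rewrite E.
  by rewrite vE // /g /coord /= E.
exists v; first by split=> // y; rewrite vG (hflow_energy KG).
move=> x; rewrite vG; have -> : Y (hflow G t (dg u x)).1 = x by rewrite -XE YK.
by split=> //; rewrite /v; have -> : Y (hflow G t (dg u x)).1 = x by rewrite -XE YK.
Qed.

End Evolve.

Section Rigidity.
Variables (K : TsM S -> R) (a : R).

Definition rigid : set M := [set x | forall u v, subsol K a u -> subsol K a v -> dfn S u x = dfn S v x].

Lemma rigid_dgraph x u v : rigid x -> subsol K a u -> subsol K a v -> dg u x = dg v x.
Proof. by move=> h uS vS; rewrite /dgraph (h u v). Qed.

Lemma dgraph_coord u i x : C11_fun S u -> dom i x ->
  coord i (dg u x) = (chart i x, grad (u \o param i) (chart i x)).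
Proof. by move=> uC dx; apply: dfun_chart => //; apply: C11_diff => //; exact: cod_chart. Qed.

Lemma is_derive_along G u i z (t : R) : good_pair P K G -> C11_fun S u -> dom i (hflow G t z).1 ->
  is_derive t 1 (fun s => u (hflow G s z).1)
    (pairing (grad (u \o param i) (chart i (hflow G t z).1)) (gradQ (tloc G i) (coord i (hflow G t z)))).
Proof.
move=> KG uC dz; have [ct /(_ i dz)/is_derive_pairP[dy _]] := hflow_ham KG z t.
have df : differentiable (u \o param i) (chart i (hflow G t z).1) by apply: C11_diff => //; exact: cod_chart.
have := is_derive_dr df dy; rewrite drE diff_pairing.
apply: near_eq_is_derive; apply: filterS (near_curve_dom ct dz) => s ds /=.
by rewrite chartK.
Qed.

(* The evolved subsolutions differ from [u] by constants on a ball of rigid points. Differentiating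
   the constant at time 0 along the orbits leaves [- G] at the graph of [du]. *)
Lemma rigid_locally_const G u x0 : good_pair P K G -> subsol K a u -> (rigid^°) x0 ->
  \forall x \near x0, G (dg u x) = G (dg u x0).
Proof.
move=> KG uS x0A; have [uC _] := uS; have [_ G2 _ _] := KG.
set i := chart_at S x0; have d0 : dom i x0 by exact: dom_chart_at.
have [t0 t00 Hv] := evolve KG uS.
have /choice[v vP] (t : R) : exists w : M -> R, `|t| <= t0 -> subsol K a w /\ forall x,
    hflow G t (dg u x) = dg w (hflow G t (dg u x)).1 /\
    w (hflow G t (dg u x)).1 = u x + hact G (dg u x) t.
  have [/Hv[w w1 w2]|h] := pselect (`|t| <= t0); first by exists w.
  by exists u => /h.
have [r r0 rP] : exists2 r : R, 0 < r & forall y : V, `|y - chart i x0| <= r -> cod i y /\ rigid (param i y).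
  have cA : \forall y \near chart i x0, rigid (param i y).
    have cp := @param_continuous _ _ _ S i (chart i x0) (cod_chart d0).
    have N : nbhs (param i (chart i x0)) rigid by rewrite chartK.
    exact: (near_for cp N).
  have cC : \forall y \near chart i x0, cod i y.
    by apply: open_nbhs_nbhs; split; [exact: open_cod|exact: cod_chart].
  have /nbhs_ballP[r /= r0 rP] : nbhs (chart i x0) (cod i `&` [set y | rigid (param i y)]) by exact: filterI.
  exists (r / 2) => [|y yr]; first by rewrite divr_gt0.
  apply: rP; rewrite -ball_normE /= distrC; apply: le_lt_trans yr _.
  by rewrite ltr_pdivrMr // mulr_natr mulr2n ltrDl.
have const t x : `|t| <= t0 -> dom i x -> `|chart i x - chart i x0| <= r -> v t x - u x = v t x0 - u x0.
  move=> tt dx xr; have [vS _] := vP t tt; have [vC _] := vS.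
  pose c (s : R) := chart i x0 + s *: (chart i x - chart i x0).
  pose f (w : M -> R) (s : R) := (w \o param i) (c s).
  have cin (s : R) : 0 <= s <= 1 -> cod i (c s) /\ rigid (param i (c s)).
    move=> /andP[s0 s1]; apply: rP; rewrite /c addrAC subrr add0r normrZ ger0_norm //.
    by apply: le_trans xr; rewrite ler_piMl.
  have df w (s : R) : C11_fun S w -> 0 <= s <= 1 ->
      is_derive s 1 (f w) (pairing (grad (w \o param i) (c s)) (chart i x - chart i x0)).
    move=> wC s01; have [cc _] := cin s s01.
    have dc := is_derive_line (chart i x0) (chart i x - chart i x0) s.
    by have := is_derive_dr (C11_diff wC cc) dc; rewrite drE diff_pairing.
  have dh (s : R) : 0 <= s <= 1 -> is_derive s 1 (fun s => f (v t) s - f u s) (0 : R).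
    move=> s01; have [cc Ac] := cin s s01.
    have := is_deriveB (df _ s vC s01) (df _ s uC s01).
    suff -> : grad (v t \o param i) (c s) = grad (u \o param i) (c s) by rewrite subrr.
    have dp := dom_param cc.
    have e1 := dgraph_coord uC dp; have e2 := dgraph_coord vC dp.
    by move: e2; rewrite -(rigid_dgraph Ac uS vS) e1 (paramK cc) => /(congr1 snd) /= ->.
  have [s s01 E] := @MVT01 _ _ (fun=> 0) dh.
  have c1 : c 1 = chart i x by rewrite /c scale1r addrC subrK.
  have c0 : c 0 = chart i x0 by rewrite /c scale0r addr0.
  move: E; rewrite /f c1 c0 /= !chartK // => /eqP.
  by rewrite subr_eq0 => /eqP.
pose h x (t : R) := u x + hact G (dg u x) t - u (hflow G t (dg u x)).1.
have hv x : dom i x -> `|chart i x - chart i x0| < r -> \forall t \near (0 : R), h x t = v t x0 - u x0.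
  move=> dx xr; have z0 : hflow G 0 (dg u x) = dg u x := hflow0 KG _.
  have [ct _] := hflow_ham KG (dg u x) 0.
  have N1 : \forall x' \near (hflow G 0 (dg u x)).1, dom i x' /\ `|chart i x' - chart i x0| <= r.
    rewrite z0 /=; have e0 : 0 < r - `|chart i x - chart i x0| by rewrite subr_gt0.
    apply: filterS (near_chart dx e0) => x' [dx' x'r]; split=> //.
    have := ler_distD (chart i x) (chart i x') (chart i x0).
    by move: x'r; lra.
  have N2 : \forall t \near (0 : R), `|t| <= t0.
    apply/nbhs_ballP; exists t0 => //= t; rewrite -ball_normE /= sub0r normrN; exact: ltW.
  apply: filterS2 (near_for ct N1) N2 => t [dt tr] tt.
  by rewrite -(const t _ tt dt tr) /h; have [_ /(_ x)[_ ->]] := vP t tt.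
have hd x : dom i x -> is_derive (0 : R) 1 (h x) (- G (dg u x)).
  move=> dx; have z0 : hflow G 0 (dg u x) = dg u x := hflow0 KG _.
  have d1 := is_derive_hact KG (dg u x) 0.
  have d2 : is_derive (0 : R) 1 (fun s => u (hflow G s (dg u x)).1)
      (pairing (grad (u \o param i) (chart i x)) (gradQ (tloc G i) (coord i (dg u x)))).
    by have := @is_derive_along G u i (dg u x) 0 KG uC; rewrite z0; apply.
  have d3 := is_derive_cst (u x) (0 : R) (1 : R).
  have := is_deriveB (is_deriveD d3 d1) d2.
  rewrite z0 add0r (lagr_chart (i := i) G2) // /ham_lagr tloc_coord // dgraph_coord //=.
  by rewrite [X in is_derive _ _ _ X -> _]addrAC subrr add0r.
apply: filterS (near_chart d0 r0) => x [dx xr].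
have d2 : is_derive (0 : R) 1 (h x0) (- G (dg u x)).
  apply: near_eq_is_derive (hd x dx).
  have x00 : `|chart i x0 - chart i x0| < r by rewrite subrr normr0.
  by apply: filterS2 (hv x dx xr) (hv x0 d0 x00) => t -> ->.
have := hd x0 d0; move: d2 => [_ E1] [_ E2].
by apply: oppr_inj; exact: etrans (esym E1) E2.
Qed.

Lemma rigid_poisson0 G1 G2 u x0 : good_pair P K G1 -> good_pair P K G2 -> subsol K a u ->
  (rigid^°) x0 -> poisson G1 G2 (dg u x0) = 0.
Proof.
move=> KG1 KG2 uS x0A; have [_ C1 _ _] := KG1; have [_ C2 _ _] := KG2.
have [t0 t00 Hv] := evolve KG1 uS.
pose z := dg u x0; have z0 : hflow G1 0 z = z := hflow0 KG1 _.
have [ct dt] := hflow_ham KG1 z 0.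
set i := chart_at S x0; have di : dom i (hflow G1 0 z).1 by rewrite z0; exact: dom_chart_at.
have := is_derive_dr (tloc_diff_coord C2 di) (dt i di).
rewrite dr_grad /= pairingNr (pairingC (gradQ _ _)) z0 => d1.
have N1 : \forall x \near (hflow G1 0 z).1, (rigid^°) x by rewrite z0; apply: open_nbhs_nbhs; split=> //; exact: open_interior.
have N2 : \forall x \near (hflow G1 0 z).1, G2 (dg u x) = G2 (dg u x0).
  by rewrite z0; exact: rigid_locally_const KG2 uS x0A.
have N3 : \forall t \near (0 : R), `|t| <= t0.
  apply/nbhs_ballP; exists t0 => //= t; rewrite -ball_normE /= sub0r normrN; exact: ltW.
have d2 : is_derive (0 : R) 1 (fun t => tloc G2 i (coord i (hflow G1 t z))) 0.
  apply: near_eq_is_derive (is_derive_cst (G2 (dg u x0)) (0 : R) (1 : R)).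
  near=> t.
  have tt : `|t| <= t0 by near: t.
  have [v vS /(_ x0)[vE _]] := Hv t tt.
  have At : rigid (hflow G1 t z).1 by apply: interior_subset; near: t; exact: (near_for ct N1).
  rewrite tloc_coord; last by near: t; exact: near_curve_dom ct di.
  rewrite vE; have -> : dg v (hflow G1 t (dg u x0)).1 = dg u (hflow G1 t (dg u x0)).1.
    exact: rigid_dgraph At vS uS.
  by apply/esym; near: t; exact: (near_for ct N2).
move: d1 d2 => [_ E1] [_ E2].
rewrite (poisson_chart C1 C2 (i := i)); last exact: dom_chart_at.
rewrite /bracket_loc; apply/eqP; rewrite -oppr_eq0 opprB; apply/eqP.
exact: etrans (esym E1) E2.
Unshelve. all: by end_near. Qed.

Lemma closure_zero (W : normedModType R) (f : M -> W) (B : set M) x : {for x, continuous f} ->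
  (\forall x' \near x, B x' -> f x' = 0) -> closure B x -> f x = 0.
Proof.
move=> cf fB Bx; apply/eqP; apply: contrapT => /negP fx.
have N1 : \forall x' \near x, f x' != 0.
  have fx0 : 0 < `|f x| by rewrite normr_gt0.
  have /cvgrPdist_lt/(_ _ fx0) := cf; apply: filterS => x'; apply: contraTneq => ->.
  by rewrite subr0 ltxx.
have /Bx[x' [Bx' [n1 n2]]] : nbhs x ([set x' | f x' != 0] `&` [set x' | B x' -> f x' = 0]) by exact: filterI.
by move: n1; rewrite /= n2 // eqxx.
Qed.

Lemma grad_continuous u i x : C11_fun S u -> dom i x ->
  {for x, continuous (fun x' => grad (u \o param i) (chart i x'))}.
Proof.
move=> uC dx; have c1 := @chart_continuous _ _ _ S i x dx.
have c2 := lip_at_cont (C11_lip uC (cod_chart dx)).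
exact: (continuous_comp c1 c2).
Qed.

Lemma rigid_closed x : closure rigid x -> rigid x.
Proof.
move=> xA u v uS vS; have [uC _] := uS; have [vC _] := vS.
set i := chart_at S x; have dx : dom i x by exact: dom_chart_at.
pose f x' := grad (u \o param i) (chart i x') - grad (v \o param i) (chart i x').
have : f x = 0.
  apply: (closure_zero _ _ xA); first by apply: continuousB; exact: grad_continuous.
  apply: filterS (near_dom dx) => x' dx' Ax'; rewrite /f.
  have e1 := dgraph_coord uC dx'; have e2 := dgraph_coord vC dx'.
  have E : dg u x' = dg v x' := rigid_dgraph Ax' uS vS.
  by move: e2; rewrite -E e1 => /(congr1 snd) /= ->; rewrite subrr.
move=> /eqP; rewrite subr_eq0 => /eqP fE.
have E : dg u x = dg v x by apply: (@coord_inj _ _ _ S i (dg u x) (dg v x) dx dx); rewrite (dgraph_coord uC dx) (dgraph_coord vC dx) fE.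
exact: (congr1 snd E).
Qed.

Lemma bracket_continuous G1 G2 i (w : V * V) : TsM_C2 G1 -> TsM_C2 G2 -> cod i w.1 ->
  {for w, continuous (bracket_loc G1 G2 i)}.
Proof.
move=> C1 C2 cw; have oO := @open_codT _ _ _ S i.
suff : Ck 0 (cod i `*` setT) (bracket_loc G1 G2 i) by apply.
have gY G k : TsM_C2 G -> Ck 0 (cod i `*` setT) (fun w => 'd (tloc G i) w (delta_mx 0 k, 0)).
  by move=> /(tloc_C2 i)[_ CG]; apply: Ck_pred; exact: CG.
have gQ G k : TsM_C2 G -> Ck 0 (cod i `*` setT) (fun w => 'd (tloc G i) w (0, delta_mx 0 k)).
  by move=> /(tloc_C2 i)[_ CG]; apply: Ck_pred; exact: CG.
pose f G G' w := \sum_k 'd (tloc G i) w (delta_mx 0 k, 0) * 'd (tloc G' i) w (0, delta_mx 0 k).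
have fC G G' : TsM_C2 G -> TsM_C2 G' -> Ck 0 (cod i `*` setT) (f G G').
  by move=> h h'; apply: Ck_sum => // k; apply: Ck_mul => //; [exact: gY|exact: gQ].
apply: (Ck_ext (f := fun w => f G1 G2 w + (-1) * f G2 G1 w) oO).
  move=> w' _; rewrite /bracket_loc /f !pairingE mulN1r.
  by congr (_ - _); apply: eq_bigr => k _; rewrite gradYE gradQE.
by apply: Ck_add => //; [exact: fC|apply: Ck_scale => //; exact: fC].
Qed.

Lemma rigid_poisson0_closure G1 G2 u x : good_pair P K G1 -> good_pair P K G2 -> subsol K a u ->
  closure (rigid^°) x -> poisson G1 G2 (dg u x) = 0.
Proof.
move=> KG1 KG2 uS xA; have [uC _] := uS; have [_ C1 _ _] := KG1; have [_ C2 _ _] := KG2.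
set i := chart_at S x; have dx : dom i x by exact: dom_chart_at.
pose f x' := bracket_loc G1 G2 i (chart i x', grad (u \o param i) (chart i x')).
have fE x' : dom i x' -> f x' = poisson G1 G2 (dg u x').
  by move=> dx'; rewrite (poisson_chart C1 C2 (i := i)) // dgraph_coord.
rewrite -fE //; apply: (@closure_zero R^o f _ x _ _ xA).
  have c1 : {for x, continuous (fun x' => (chart i x', grad (u \o param i) (chart i x')))}.
    exact: (cvg_pair (@chart_continuous _ _ _ S i x dx) (grad_continuous uC dx)).
  have c2 := @bracket_continuous G1 G2 i (chart i x, grad (u \o param i) (chart i x)) C1 C2 (cod_chart dx).
  exact: (continuous_comp c1 c2).
by apply: filterS (near_dom dx) => x' dx' Ax'; rewrite fE //; exact: rigid_poisson0.
Qed.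

End Rigidity.
End Evolution.

Section Aubry.
Context {R : realType} {n : nat} {M : ptopologicalType} (S : smooth_manifold R n M) (P : patches S).
Local Notation V := 'rV[R]_n.
Variables (H F1 F2 : TsM S -> R) (eta : M -> V).
Hypotheses (HT : tonelli H) (F1C : TsM_C2 F1) (F1I : integral_of_motion H F1)
  (F2C : TsM_C2 F2) (F2I : integral_of_motion H F2) (etaC : closed_form S eta).
Hypothesis crit0 : critical_subsolution H eta !=set0.
Local Notation a := (mather_alpha H eta).
Local Notation K := (shifted eta H).

Lemma integral_good F : TsM_C2 F -> integral_of_motion H F -> good_pair P K (shifted eta F).
Proof.
move=> FC FI; have [H2 _ _] := HT.
have [K2 _ _ KE] := tonelli_good (tonelli_in_shifted P HT etaC).
split; [exact: K2|exact: (shifted_C2 etaC FC)| |exact: KE].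
by move=> z; rewrite (poisson_shifted etaC).
Qed.

Lemma critical_subsol u : critical_subsolution H eta u <-> subsol K a u.
Proof.
rewrite /critical_subsolution /subsol /= /shifted /cshift /dgraph /= dfn.unlock.
by split=> -[h1 h2]; split.
Qed.

Lemma aubryP z : aubry H eta z <-> rigid K a z.1 /\ forall u, subsol K a u -> z = cshift eta (dgraph S u z.1).
Proof.
split=> [Az|[Az zE] u /critical_subsol uS]; last first.
  by exists z.1 => //; rewrite [RHS](zE u uS) /cshift /dgraph /= dfn.unlock.
have E u : subsol K a u -> z = cshift eta (dgraph S u z.1).
  by move=> /critical_subsol/Az[x _ <-]; rewrite /cshift /dgraph /= dfn.unlock.
split=> // u v uS vS; apply: (addrI (eta z.1)).
by have := E u uS; rewrite {1}(E v vS) => /(congr1 snd).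
Qed.

Lemma aubry_ex x u : subsol K a u -> rigid K a x -> aubry H eta (cshift eta (dgraph S u x)).
Proof.
move=> uS Ax; apply/aubryP; split=> // v vS; congr pair; congr (_ + _); exact: Ax.
Qed.

Lemma proj_aubryE : proj_aubry H eta = rigid K a.
Proof.
apply/seteqP; split=> [x [z /aubryP[Az _] <-]//|x Ax].
have [u /critical_subsol uS] := crit0; exists (cshift eta (dgraph S u x)) => //; exact: aubry_ex.
Qed.

Lemma aubry_poisson : set_bij (aubry H eta) (proj_aubry H eta) (@TsM_proj R n M S) /\
  forall x : M, closure (interior (proj_aubry H eta)) x ->
    proj_aubry H eta x /\
    poisson F1 F2
      ('pinv_(fun y => (y, 0)) (aubry H eta) (@TsM_proj R n M S) x) = 0.
Proof.
have [u /critical_subsol uS] := crit0.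
have inj : {in aubry H eta &, injective (@TsM_proj R n M S)}.
  move=> z w; rewrite !inE => /aubryP[_ zE] /aubryP[_ wE] zw.
  by rewrite (zE u uS) (wE u uS); congr (cshift _ (dgraph _ _ _)).
split; first by split=> [z Az|//|//]; exists z.
move=> x xA; have Ax : rigid K a x.
  rewrite proj_aubryE in xA; apply: rigid_closed.
  exact: (closure_subset (@interior_subset _ _)) xA.
split; first by rewrite proj_aubryE.
have Az := aubry_ex uS Ax.
have -> : 'pinv_(fun y => (y, 0)) (aubry H eta) (@TsM_proj R n M S) x = cshift eta (dgraph S u x).
  have px : x = TsM_proj (cshift eta (dgraph S u x)) by [].
  by rewrite {1}px pinvKV ?inE //.
rewrite -(poisson_shifted etaC) //; rewrite proj_aubryE in xA.
by apply: (rigid_poisson0_closure (P := P) _ _ uS xA); exact: integral_good.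
Qed.

End Aubry.

Definition total (R : realType) (n : nat) (M : ptopologicalType) (S : smooth_manifold R n M)
  (p : chart_index S -> 'rV[R]_n * 'rV[R]_n -> M * 'rV[R]_n) : Type := (M * 'rV[R]_n)%type.

Section TotalTopology.
Context {R : realType} {n : nat} {M : ptopologicalType} (S : smooth_manifold R n M).
Local Notation V := 'rV[R]_n.
Variable p : chart_index S -> V * V -> M * V.

Definition total_open : set (set (total p)) :=
  [set W | forall i, open [set y | cod i y.1 /\ W (p i y)]].

HB.instance Definition _ := Pointed.copy (total p) (M * V)%type.

Let total_openT : total_open setT.
Proof.
move=> i; rewrite (_ : [set _ | _] = cod i `*` [set: V]); first exact: open_codT.
by apply/seteqP; split=> y [].
Qed.

Let total_openI : setI_closed total_open.
Proof.
move=> A B oA oB i; have := openI (oA i) (oB i); congr open.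
by apply/seteqP; split=> [y [[] ? ? []]|y [] ? []].
Qed.

Let total_open_bigU (I : Type) (f : I -> set (total p)) : (forall i, total_open (f i)) ->
  total_open (\bigcup_i f i).
Proof.
move=> of' i; have := @bigcup_open _ I setT (fun k => [set y | cod i y.1 /\ f k (p i y)]) (fun k _ => of' k i).
congr open; apply/seteqP; split=> [y [k _ []] ? ?|y [? [k _ ?]]]; last by exists k.
by split=> //; exists k.
Qed.

HB.instance Definition _ := isOpenTopological.Build (total p) total_openT total_openI total_open_bigU.

Lemma total_openE W : open W = total_open W. Proof. by []. Qed.

End TotalTopology.

Section Bundle.
Context {R : realType} {n : nat} {M : ptopologicalType} (S : smooth_manifold R n M).
Local Notation V := 'rV[R]_n.
Variable p : chart_index S -> V * V -> M * V.
Variable c : chart_index S -> M * V -> V * V.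
Hypothesis cE : forall i z, (c i z).1 = chart i z.1.
Hypothesis pE : forall i y, (p i y).1 = param i y.1.
Hypothesis pK : forall i z, dom i z.1 -> p i (c i z) = z.
Hypothesis cK : forall i y, cod i y.1 -> c i (p i y) = y.
Hypothesis change : forall i j y, overlap i j y.1 -> {for y, continuous (c j \o p i)}.
Local Notation X := (total p).
Implicit Types (i j : chart_index S).

Lemma total_param_continuous i y : cod i y.1 -> {for y, continuous (p i : V * V -> X)}.
Proof.
move=> cy W; rewrite nbhsE => -[U [oU Uy] UW].
have : open [set y | cod i y.1 /\ U (p i y)] by exact: oU.
by rewrite openE => /(_ y (conj cy Uy)); apply: filterS => y' [_ /UW].
Qed.

Lemma total_box_open i (Q : set (V * V)) : open Q -> open ([set z : X | dom i z.1 /\ Q (c i z)] : set X).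
Proof.
move=> oQ; rewrite total_openE => j; rewrite openE => y [cy [dy Qy]].
have oy : overlap j i y.1 by apply/overlapP; rewrite -pE.
have N1 : \forall y' \near y, Q ((c i \o p j) y').
  by apply: (near_for (change oy)); apply: open_nbhs_nbhs; split.
have N2 : \forall y' \near y, overlap j i y'.1.
  by apply: (near_for (@fst_continuous R n y)); apply: open_nbhs_nbhs; split=> //; exact: open_overlap.
apply: filterS2 N1 N2 => y' Qy' /overlapP[cy' dy']; split=> //; split=> //; by rewrite pE.
Qed.

Lemma total_coord_continuous i z : dom i z.1 -> {for z, continuous (c i : X -> V * V)}.
Proof.
move=> dz W; rewrite nbhsE => -[Q [oQ Qz] QW].
have : nbhs (z : X) ([set z : X | dom i z.1 /\ Q (c i z)] : set X).
  by apply: open_nbhs_nbhs; split=> //; exact: total_box_open.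
by apply: filterS => z' [_ /QW].
Qed.

Lemma total_proj_continuous : continuous (fst : X -> M).
Proof.
move=> z W; rewrite nbhsE => -[Q [oQ Qz] QW].
suff : nbhs (z : X) ([set z' : X | Q z'.1] : set X) by apply: filterS => z' /QW.
apply: open_nbhs_nbhs; split; last exact: Qz.
rewrite total_openE => i; rewrite openE => y [cy]; rewrite /= pE => Qy.
have N1 : \forall y' \near y.1, cod i y' /\ Q (param i y').
  apply: filterI; first by apply: open_nbhs_nbhs; split=> //; exact: open_cod.
  by apply: (near_for (@param_continuous _ _ _ S i y.1 cy)); apply: open_nbhs_nbhs; split.
apply: filterS (near_for (@fst_continuous R n y) N1) => y' [cy' Qy']; split=> //=.
by rewrite pE.
Qed.

Lemma total_near_dom i (z : X) : dom i z.1 -> \forall z' \near z, dom i z'.1.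
Proof. by move=> dz; exact: (near_for (@total_proj_continuous z) (near_dom dz)). Qed.

Lemma total_continuous_at (T : topologicalType) (f : X -> T) i z : dom i z.1 ->
  {for c i z, continuous (f \o p i)} -> {for z, continuous f}.
Proof.
move=> dz cf W Wz; have N1 : nbhs ((f \o p i) (c i z)) W by rewrite /= pK.
have N2 := near_for (@total_coord_continuous i z dz) (near_for cf N1).
by apply: filterS2 N2 (total_near_dom dz) => z' /= + dz'; rewrite pK.
Qed.

Lemma total_near_coord i (z : X) (r : R) : dom i z.1 -> 0 < r -> \forall z' \near z, `|c i z' - c i z| < r.
Proof.
move=> dz r0; have /cvgrPdist_lt/(_ r r0) := total_coord_continuous dz.
by apply: filterS => z'; rewrite distrC.
Qed.

Lemma total_hausdorff : hausdorff_space X.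
Proof.
move=> z w zw.
have E1 : z.1 = w.1.
  apply: (hausdorffM S) => A B NA NB.
  by have [x [Ax Bx]] := zw _ _ (total_proj_continuous NA) (total_proj_continuous NB); exists x.1.
have dz := dom_chart_at S z.1.
have dw := dz; rewrite [X in dom _ X]E1 in dw.
rewrite -(pK dz) -[RHS](pK dw); congr (p _ _); apply: (@norm_hausdorff _ (V * V)%type) => A B NA NB.
have [x [Ax Bx]] := zw _ _ (total_coord_continuous dz NA) (total_coord_continuous dw NB).
by exists (c (chart_at S z.1) x).
Qed.

Lemma total_compact_box i (y : V * V) (r1 r2 : R) : (forall y', `|y' - y.1| <= r1 -> cod i y') ->
  compact (p i @` [set y' | `|y'.1 - y.1| <= r1 /\ `|y'.2 - y.2| <= r2] : set X).
Proof.
move=> rc; apply: continuous_compact.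
  apply: continuous_in_subspaceT => y'; rewrite inE => -[h1 _].
  by apply: total_param_continuous; exact: rc.
have c1 := @compact_ball R n y.1 r1; have c2 := @compact_ball R n y.2 r2.
exact: (compact_setX c1 c2).
Qed.

Lemma total_locally_compact (z : X) (W : set X) : nbhs z W -> exists C, [/\ compact C, nbhs z C & C `<=` W].
Proof.
move=> NW; set i := chart_at S z.1; have dz : dom i z.1 by exact: dom_chart_at.
have cz : cod i (c i z).1 by rewrite cE; exact: cod_chart.
have N1 : nbhs (p i (c i z) : X) W by rewrite pK.
have N2 : nbhs (c i z) [set y | W (p i y)] by exact: (near_for (@total_param_continuous i _ cz) N1).
have N3 : nbhs (c i z) [set y | cod i y.1].
  exact: near_cod.
have /nbhs_ballP[r /= r0 rW] : nbhs (c i z) ([set y | W (p i y)] `&` [set y | cod i y.1]) by exact: filterI.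
have r2 : 0 < r / 2 by rewrite divr_gt0.
have r2r : r / 2 < r by rewrite ltr_pdivrMr // mulr_natr mulr2n ltrDl.
have sub y : `|y.1 - (c i z).1| <= r / 2 -> `|y.2 - (c i z).2| <= r / 2 -> W (p i y) /\ cod i y.1.
  move=> h1 h2; apply: rW; rewrite -ball_normE /= distrC; apply: le_lt_trans r2r.
  exact: norm_pair_le.
exists (p i @` [set y' | `|y'.1 - (c i z).1| <= r / 2 /\ `|y'.2 - (c i z).2| <= r / 2]); split.
- apply: total_compact_box => y' h; have [] // := sub (y', (c i z).2) h _.
  by rewrite subrr normr0 ltW.
- apply: filterS2 (total_near_dom dz) (total_near_coord dz r2) => z' dz' zz'.
  exists (c i z'); last exact: pK.
  split; apply: le_trans (ltW zz'); [exact: (norm_pair1 (c i z' - c i z))|exact: (norm_pair2 (c i z' - c i z))].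
- by move=> _ [y [h1 h2] <-]; have [] := sub y h1 h2.
Qed.

End Bundle.

Lemma near_eq_continuous (T U : topologicalType) (f g : T -> U) x : (\forall y \near x, f y = g y) ->
  {for x, continuous f} -> {for x, continuous g}.
Proof.
move=> fg cf W; rewrite -(nbhs_singleton fg) => /(near_for cf) N.
by apply: filterS2 fg N => y /= ->.
Qed.

Section Coordinates.
Context {R : realType} {n : nat} {M : ptopologicalType} (S : smooth_manifold R n M).
Local Notation V := 'rV[R]_n.
Implicit Types (i j : chart_index S) (y : V * V).

Lemma coord_cont k : continuous (fun v : V => v 0 k).
Proof.
apply: (@lipT_continuous _ _ _ 1) => v w; rewrite mul1r.
by have := norm_coord (v - w) k; rewrite !mxE.
Qed.

Lemma row_continuous (T : topologicalType) (f : T -> V) x : (forall k, {for x, continuous (fun t => f t 0 k)}) ->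
  {for x, continuous f}.
Proof.
move=> cf; apply/cvgrPdist_le => e e0.
have : \forall t \near x, forall k, `|f x 0 k - f t 0 k| <= e.
  by apply: filter_forall => k; have /cvgrPdist_le := cf k; apply.
by apply: filterS => t ft; apply: norm_rV_le => [|k]; [exact: ltW|rewrite !mxE].
Qed.

Lemma sum_mul_continuous (T : topologicalType) m (f g : 'I_m -> T -> R) x :
  (forall k, {for x, continuous (f k)}) -> (forall k, {for x, continuous (g k)}) ->
  {for x, continuous (fun t => \sum_k f k t * g k t)}.
Proof.
move=> cf cg; rewrite (_ : (fun t => _) = \sum_k (fun t => f k t * g k t)); last first.
  by apply/funext => t; rewrite fct_sumE.
elim/big_ind : _ => [|h h' ch ch'|k _]; first exact: cst_continuous.
  exact: continuousD.
exact: continuousM.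
Qed.

Lemma comp_for (T U W : topologicalType) (f : T -> U) (g : U -> W) x : {for x, continuous f} ->
  {for f x, continuous g} -> {for x, continuous (fun t => g (f t))}.
Proof. by move=> cf cg; exact: (continuous_comp cf cg). Qed.

Lemma transition_dr_continuous i j (y v : V) : overlap i j y ->
  {for y, continuous (fun w : V => dr (chart j \o param i) w v)}.
Proof.
by move=> oy; have [_ /(_ v)] := @transition_Ck _ _ _ S i j 1; rewrite dr_fun; apply.
Qed.

Lemma chart_fst_continuous i j y : overlap i j y.1 ->
  {for y, continuous (fun w : V * V => chart j (param i w.1))}.
Proof.
move=> /overlapP[cy dy]; apply: (comp_for (f := fun w : V * V => param i w.1)); last exact: chart_continuous.
by apply: comp_for; [exact: fst_continuous|exact: param_continuous].
Qed.

Lemma near_overlap i j y : overlap i j y.1 -> \forall w \near y, overlap i j w.1.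
Proof.
move=> oy; apply: (near_for (@fst_continuous R n y)).
by apply: open_nbhs_nbhs; split=> //; exact: open_overlap.
Qed.

Lemma snd_coord_continuous k y : {for y, continuous (fun w : V * V => w.2 0 k)}.
Proof. exact: (comp_for (@snd_continuous R n y) (@coord_cont k _)). Qed.

Lemma TM_coord_change_continuous i j y : overlap i j y.1 ->
  {for y, continuous ((@TM_coord _ _ _ S j : M * V -> V * V) \o (@TM_param _ _ _ S i : V * V -> M * V))}.
Proof.
move=> oy.
pose f (w : V * V) := (chart j (param i w.1),
  \row_k (\sum_m w.2 0 m * dr (chart j \o param i) w.1 (delta_mx 0 m) 0 k) : V).
apply: (near_eq_continuous (f := f)).
  apply: filterS (near_overlap oy) => w /overlapP[cw dw] /=; congr pair.
  rewrite /TM_param /= !JacE -mulmxA trans_comp //; [|exact: dom_param|exact: dom_chart_at].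
  apply/rowP => k; rewrite !mxE; apply: eq_bigr => m _; congr (_ * _).
  by rewrite -{1}(paramK cw) -transE -rowE mxE.
suff c2 : {for y, continuous (fun w => (f w).2)} by exact: (cvg_pair (chart_fst_continuous oy) c2).
apply: row_continuous => k.
rewrite (_ : (fun t => _) = (fun w : V * V => \sum_m w.2 0 m * dr (chart j \o param i) w.1 (delta_mx 0 m) 0 k)); last first.
  by apply/funext => w; rewrite mxE.
apply: sum_mul_continuous => m; first exact: snd_coord_continuous.
apply: (comp_for (f := fun w : V * V => dr (chart j \o param i) w.1 (delta_mx 0 m)) (g := fun v : V => v 0 k)); last exact: coord_cont.
by have := continuous_comp (@fst_continuous R n y) (transition_dr_continuous (v := delta_mx 0 m) oy).
Qed.

Lemma coord_change_continuous i j y : overlap i j y.1 ->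
  {for y, continuous ((@TsM_coord _ _ _ S j : M * V -> V * V) \o (@tprm _ _ _ S i : V * V -> M * V))}.
Proof.
move=> oy.
pose f (w : V * V) := (chart j (param i w.1),
  \row_k (\sum_m w.2 0 m * dr (chart i \o param j) (chart j (param i w.1)) (delta_mx 0 k) 0 m) : V).
apply: (near_eq_continuous (f := f)).
  apply: filterS (near_overlap oy) => w /overlapP[cw dw] /=.
  rewrite tprmE /coord /=; congr pair.
  rewrite -mulmxA -trmx_mul trans_comp //; [|exact: dom_chart_at|exact: dom_param].
  apply/rowP => k; rewrite !mxE; apply: eq_bigr => m _; congr (_ * _).
  by rewrite -transE -rowE !mxE.
suff c2 : {for y, continuous (fun w => (f w).2)} by exact: (cvg_pair (chart_fst_continuous oy) c2).
apply: row_continuous => k.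
rewrite (_ : (fun t => _) = (fun w : V * V => \sum_m w.2 0 m * dr (chart i \o param j) (chart j (param i w.1)) (delta_mx 0 k) 0 m)); last first.
  by apply/funext => w; rewrite mxE.
apply: sum_mul_continuous => m; first exact: snd_coord_continuous.
apply: (comp_for (f := fun w : V * V => dr (chart i \o param j) (chart j (param i w.1)) (delta_mx 0 k)) (g := fun v : V => v 0 m)); last exact: coord_cont.
apply: (comp_for (g := fun w : V => dr (chart i \o param j) w (delta_mx 0 k))); first exact: chart_fst_continuous.
apply: transition_dr_continuous; case/overlapP: oy => cy dy.
by apply: overlap_chart => //; exact: dom_param.
Qed.

End Coordinates.

Section Cotangent.
Context {R : realType} {n : nat} {M : ptopologicalType} (S : smooth_manifold R n M).
Local Notation V := 'rV[R]_n.
Implicit Types (i j : chart_index S) (z : TsM S) (K : TsM S -> R).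

Definition TsMt : ptopologicalType := total (S := S) (@tprm R n M S).
Definition TMt : ptopologicalType := total (S := S) (@TM_param R n M S).

Lemma tprm1 i (y : V * V) : (tprm i y).1 = param i y.1. Proof. by rewrite tprmE. Qed.

Lemma TsMt_hausdorff : hausdorff_space TsMt.
Proof.
exact: (@total_hausdorff R n M S (@tprm R n M S) (@TsM_coord R n M S) tprm1
  (@coordK _ _ _ S) (@coord_change_continuous _ _ _ S)).
Qed.

Lemma TsMt_locally_compact (z : TsMt) (W : set TsMt) : nbhs z W ->
  exists C, [/\ compact C, nbhs z C & C `<=` W].
Proof.
exact: (@total_locally_compact R n M S (@tprm R n M S) (@TsM_coord R n M S) (fun _ _ => erefl) tprm1
  (@coordK _ _ _ S) (@coord_change_continuous _ _ _ S)).
Qed.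

Lemma TsMt_continuous_at (T : topologicalType) (f : TsMt -> T) i z : dom i z.1 ->
  {for coord i z, continuous (f \o tprm i)} -> {for (z : TsMt), continuous f}.
Proof.
exact: (@total_continuous_at R n M S (@tprm R n M S) (@TsM_coord R n M S) tprm1
  (@coordK _ _ _ S) (@coord_change_continuous _ _ _ S)).
Qed.

Lemma TMt_continuous_at (T : topologicalType) (f : TMt -> T) i (z : TM S) : dom i z.1 ->
  {for TM_coord i z, continuous (f \o @TM_param _ _ _ S i)} -> {for (z : TMt), continuous f}.
Proof.
exact: (@total_continuous_at R n M S (@TM_param R n M S) (@TM_coord R n M S) (fun _ _ => erefl)
  (@TM_coordK _ _ _ S) (@TM_coord_change_continuous _ _ _ S)).
Qed.

Lemma tprm_continuous i (y : V * V) : cod i y.1 -> {for y, continuous (tprm i : V * V -> TsMt)}.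
Proof. exact: total_param_continuous. Qed.

Lemma TM_param_continuous i (y : V * V) : cod i y.1 -> {for y, continuous (TM_param i : V * V -> TMt)}.
Proof. exact: total_param_continuous. Qed.

Lemma TsM_coord_continuous i z : dom i z.1 -> {for (z : TsMt), continuous (coord i : TsMt -> V * V)}.
Proof.
exact: (@total_coord_continuous R n M S (@tprm R n M S) (@TsM_coord R n M S) tprm1
  (@coord_change_continuous _ _ _ S)).
Qed.

Lemma TsM_proj_continuous : continuous (fst : TsMt -> M).
Proof. exact: (@total_proj_continuous R n M S (@tprm R n M S) tprm1). Qed.

Lemma TsM_fun_continuous K : TsM_C2 K -> continuous (K : TsMt -> R).
Proof.
move=> K2 z; have dz := dom_chart_at S z.1.
apply: (TsMt_continuous_at (i := chart_at S z.1) dz).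
have -> : (K : TsMt -> R) \o tprm (chart_at S z.1) = tloc K (chart_at S z.1) by apply/funext => y; rewrite tlocE.
have C0 := Ck_pred (Ck_pred (tloc_C2 (chart_at S z.1) K2)).
by apply: C0; split=> //; exact: cod_chart.
Qed.

Lemma lagr_continuous K : TsM_C2 K -> continuous (lagr K : TsMt -> R).
Proof.
move=> K2 z; set i := chart_at S z.1; have dz : dom i z.1 by exact: dom_chart_at.
apply: (TsMt_continuous_at (i := i) dz).
have cz : cod i (coord i z).1 by exact: cod_chart.
apply: near_eq_continuous (ham_lagr_continuous K2 cz).
have N : nbhs (coord i z) [set w | cod i w.1].
  exact: near_cod.
apply: filterS N => w cw /=.
by rewrite (lagr_chart (i := i) K2) ?tprmK // tprm1; exact: dom_param.
Qed.

End Cotangent.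

Section FlowContinuity.
Context {R : realType} {n : nat} {M : ptopologicalType} (S : smooth_manifold R n M) (P : patches S).
Local Notation V := 'rV[R]_n.
Implicit Types (d : 'I_(pcard P)) (z : TsM S).
Variable K : TsM S -> R.
Hypothesis KK : good_pair P K K.

Let K2 : TsM_C2 K. Proof. by case: KK. Qed.

Lemma hflow_near_continuous E : exists2 tau : R, 0 < tau & forall s z (W : set (TsMt S)), `|s| < tau -> K z < E ->
  nbhs (hflow K s z : TsMt S) W -> \forall t \near s & z' \near (z : TsMt S), W (hflow K t z').
Proof.
have rG : reg_fun P K (fun=> True).
  by move=> b b0; have [C C0 HC] := reg_const P K2 b0; exists C, (- (n%:R * C)).
have [b [C [k [tau [D [_ es]]]]]] := est_ex E KK rG.
have [b0 C0 tau0 D0] := est_pos es; exists tau => // s z W st KE NW.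
have [d hz] := pcover1 P z.1; have [dz zr] := hz.
have m12 : (1 : R) < 2 by rewrite (ltr_nat R 1 2).
have hz3 := inr_le le13 hz.
have [ds _] := est_stay es hz3 (ltW KE) (ltW st).
have cs : cod (idx d) (pcoord d (hflow K s z)).1 by exact: cod_chart.
have N0 : nbhs (tprm (idx d) (pcoord d (hflow K s z)) : TsMt S) W by rewrite coordK.
have /nbhs_ballP[r /= r0 rW] := near_for (tprm_continuous cs) N0.
have ctau : C * tau <= 2^-1 := est_half es.
have r3 : 0 < r / 3 by rewrite divr_gt0.
have r6 : 0 < r / 6 by rewrite divr_gt0.
have N1 : \forall t \near s, `|t| < tau.
  apply/nbhs_ballP; exists (tau - `|s|) => /=; first by rewrite subr_gt0.
  move=> t; rewrite -ball_normE /= distrC => h.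
  by have := ler_distD s t 0; rewrite !subr0; move: h; lra.
have N2 : \forall t \near s, `|pcoord d (hflow K t z) - pcoord d (hflow K s z)| < r / 3.
  have [_ /(_ (idx d) ds) dd] := hflow_ham KK z s.
  have /cvgrPdist_lt/(_ _ r3) := is_derive_continuous dd.
  by apply: filterS => t; rewrite distrC.
have N3 : \forall z' \near (z : TsMt S), K z' < E.
  have NE : nbhs (K z) [set e | e < E] by apply: open_nbhs_nbhs; split=> //; exact: open_lt.
  exact: (@near_for (TsMt S) R K z _ (@TsM_fun_continuous _ _ _ S K K2 z) NE).
have N4 : \forall z' \near (z : TsMt S), inr d 2 (fst (z' : M * V)).
  apply: (near_for (@TsM_proj_continuous _ _ _ S z)).
  have rd : 0 < rad d by exact: rad_gt0.
  apply: filterS (near_chart dz rd) => x' [dx' xx']; split=> //.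
  have := ler_distD (pchart d z.1) (pchart d x') (ctr d).
  by move: zr xx'; rewrite mul1r; lra.
have N5 : \forall z' \near (z : TsMt S), `|pcoord d z' - pcoord d z| < r / 6.
  have /cvgrPdist_lt/(_ _ r6) := @TsM_coord_continuous _ _ _ S (idx d) z dz.
  by apply: filterS => z'; rewrite distrC.
exists ([set t | `|t| < tau /\ `|pcoord d (hflow K t z) - pcoord d (hflow K s z)| < r / 3],
  [set z' : TsMt S | K z' < E /\ inr d 2 (fst (z' : M * V)) /\ `|pcoord d z' - pcoord d z| < r / 6]).
  by split; [exact: filterI|apply: filterI => //; exact: filterI].
move=> [t z'] /= [[tt tr] [KE' [hz' zz']]].
have hz3' := inr_le le23 hz'.
have [dt _] := est_stay es hz3' (ltW KE') (ltW tt).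
rewrite -(coordK dt); apply: rW; rewrite -ball_normE /= distrC.
have := est_lip es hz3 hz3' (ltW KE) (ltW KE') (ltW tt).
rewrite /cdiff => el.
have e1 : C * `|t| * `|pcoord d z' - pcoord d z| <= `|pcoord d z' - pcoord d z|.
  apply: ler_piMl => //; apply: (@le_trans _ _ (C * tau)); last by apply: le_trans ctau _; rewrite invf_le1 // ler1n.
  by apply: ler_wpM2l; exact: ltW.
have t1 := ler_distD (pcoord d (hflow K t z)) (pcoord d (hflow K t z')) (pcoord d (hflow K s z)).
have t2 := ler_distD (pcoord d z' - pcoord d z) (pcoord d (hflow K t z') - pcoord d (hflow K t z)) 0.
rewrite !subr0 in t2.
move: t1 t2 el e1 zz' tr; move: (`|_ - _|) (`|_ - _|) (`|_ - _|) (`|_ - _|) (`|_ - _|) (C * _ * _) => *; lra.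
Qed.

Lemma hflow_continuous t : continuous (hflow K t : TsMt S -> TsMt S).
Proof.
move=> z; have [tau tau0 H] := hflow_near_continuous (K z + 1).
have small s w : `|s| < tau -> K w = K z -> {for (w : TsMt S), continuous (hflow K s : TsMt S -> TsMt S)}.
  move=> st Kw W NW; have KE : K w < K z + 1 by rewrite Kw ltrDl.
  have [[A B] /= [NA NB] AB] := H s w W st KE NW.
  by apply: filterS NB => w' Bw'; apply: (AB (s, w')); split=> //; exact: nbhs_singleton NA.
have iter m s : `|s| < tau -> {for (z : TsMt S), continuous (hflow K (m%:R * s) : TsMt S -> TsMt S)}.
  move=> st; elim: m => [|m IH].
    by rewrite mul0r; apply: (near_eq_continuous (f := id)) => //; apply: filterE => w; rewrite (hflow0 KK).
  apply: (near_eq_continuous (f := fun w : TsMt S => hflow K s (hflow K (m%:R * s) w) : TsMt S)).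
    by apply: filterE => w; rewrite -(hflowD KK) -natr1 mulrDl mul1r.
  apply: (comp_for (f := hflow K (m%:R * s) : TsMt S -> TsMt S)) => //.
  by apply: small => //; rewrite (hflow_energy KK).
pose m := (Num.truncn (`|t| / tau)).+1.
have m0 : 0 < (m%:R : R) by rewrite ltr0n.
have -> : t = m%:R * (t / m%:R) by rewrite mulrC divfK // gt_eqF.
apply: iter; rewrite normrM normfV (ger0_norm (ltW m0)) ltr_pdivrMr // mulrC -ltr_pdivrMr //.
exact: truncnS_gt.
Qed.

Lemma compact_energy E : exists2 Z : set (TsMt S), compact Z & forall z, K z <= E -> Z z.
Proof.
have [_ _ _ /(_ E)[b Hb]] := KK.
pose B d : set (TsMt S) := tprm (idx d) @` [set y | `|y.1 - ctr d| <= rad d /\ `|y.2 - 0| <= b].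
exists (\big[setU/set0]_(d < pcard P) B d).
  elim/big_ind : _ => [|A A' cA cA'|d _]; [exact: compact0|exact: compactU|].
  apply: (@total_compact_box _ _ _ S (@tprm R n M S) (idx d) (ctr d, 0)) => y /= yr.
  by apply: pcod; apply: le_trans yr _; rewrite ler_peMl // ?ler1n // ltW // rad_gt0.
move=> z KE; have [d [dz zr]] := pcover1 P z.1; rewrite mul1r in zr; rewrite (bigD1 d) //=; left.
exists (pcoord d z); last exact: coordK.
split=> //=; rewrite subr0; apply: (Hb d (pchart d z.1)).
  by apply: le_trans zr _; rewrite ler_peMl // ?ler1n // ltW // rad_gt0.
by rewrite (_ : (_, _) = pcoord d z) // tloc_coord.
Qed.

End FlowContinuity.

Section LocalLegendre.
Context {R : realType} {n : nat} {M : ptopologicalType} (S : smooth_manifold R n M).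
Local Notation V := 'rV[R]_n.
Implicit Types (i j : chart_index S) (w : V * V) (x : M).

Definition add_patch (P : patches S) i (y0 : V) : cod i y0 ->
  exists2 P' : patches S, True & exists d : 'I_(pcard P'), idx d = i /\ ctr d = y0.
Proof.
move=> cy; have [r r0 rP] : exists2 r : R, 0 < r & forall y, `|y - y0| <= r -> cod i y.
  by have := chart_ball (dom_param cy); rewrite paramK.
pose f (T : Type) (a : T) (g : 'I_(pcard P) -> T) (d : 'I_(pcard P).+1) := oapp g a (unlift ord0 d).
unshelve eexists (@Patches _ _ _ S (pcard P).+1 (f _ i (@idx _ _ _ _ P)) (f _ y0 (@ctr _ _ _ _ P))
  (f _ (r / 4) (@rad _ _ _ _ P)) _ _ _) => //.
- by move=> d; rewrite /f; case: unlift => [d'|] /=; [exact: rad_gt0|rewrite divr_gt0].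
- by move=> x; have [d dx xr] := pcover P x; exists (lift ord0 d); rewrite /f liftK.
- move=> d y; rewrite /f; case: unlift => [d'|] /=; first exact: pcod.
  by rewrite mulrC divfK ?pnatr_eq0 //; exact: rP.
- by exists ord0; rewrite /= /f unlift_none.
Qed.

Variable P : patches S.
Variable H : TsM S -> R.
Hypothesis HT : forall P' : patches S, tonelli_in P' H.

Let H2 : TsM_C2 H. Proof. by case: (HT P). Qed.

Lemma local_tonelli i (y0 : V) : cod i y0 -> exists r : R, [/\ 0 < r, forall y, `|y - y0| <= r -> cod i y,
  forall b, 0 <= b -> exists C k, [/\ 0 <= C, 0 < k &
    reg_on (box y0 r b) C k (tloc H i) (gradY (tloc H i)) (gradQ (tloc H i))] &
  forall A, exists B, forall y q, `|y - y0| <= r -> A * `|q| - B <= tloc H i (y, q)].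
Proof.
move=> cy; have [P' _ [d [<- <-]]] := add_patch P cy; have [_ reg sup] := HT P'.
exists (4 * rad d); split.
- by rewrite mulr_gt0 // rad_gt0.
- exact: pcod.
- by move=> b /reg[C [k [C0 k0 rg]]]; exists C, k; split=> //; exact: rg.
- by move=> A; have [B HB] := sup A; exists B => y q; exact: HB.
Qed.

Lemma fiber_mono i (y q q' : V) : cod i y ->
  gradQ (tloc H i) (y, q) = gradQ (tloc H i) (y, q') -> q = q'.
Proof.
move=> cy E; have [r [r0 _ reg _]] := local_tonelli cy.
pose b := Num.max `|q| `|q'|.
have b0 : 0 <= b by rewrite le_max normr_ge0.
have [C [k [C0 k0 [_ _ _ _ mono]]]] := reg b b0.
have h1 : box y r b (y, q) by split=> /=; [rewrite subrr normr0 ltW|rewrite le_max lexx].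
have h2 : box y r b (y, q') by split=> /=; [rewrite subrr normr0 ltW|rewrite le_max lexx orbT].
have := mono _ _ h1 h2 erefl; rewrite E subrr pairing0l /= pmulr_rle0 // => h.
have : `|q' - q| ^+ 2 = 0 by apply/eqP; rewrite eq_le h sqr_ge0.
by move=> /eqP; rewrite sqrf_eq0 normr_eq0 subr_eq0 => /eqP.
Qed.

Lemma fiber_fenchel i (y q r : V) : cod i y ->
  tloc H i (y, q) + pairing (gradQ (tloc H i) (y, q)) (r - q) <= tloc H i (y, r).
Proof.
move=> cy; have [P' _ [d [<- ed]]] := add_patch P cy.
by apply: (fiber_convex (HT P')); rewrite ed subrr normr0 mulr_ge0 // ltW // rad_gt0.
Qed.

Lemma leg_ex i (y v : V) : cod i y -> exists q, gradQ (tloc H i) (y, q) = v.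
Proof.
move=> cy; have [r [r0 rc reg sup]] := local_tonelli cy.
have [B HB] := sup (n%:R * `|v| + 1).
pose f (q : V) := tloc H i (y, q) - pairing q v.
have fB q : `|q| - B <= f q.
  have yy : `|y - y| <= r by rewrite subrr normr0 ltW.
  have h1 := HB y q yy; have := pairing_norm q v => /ler_normlP[_ h2]; rewrite /f.
  by move: h1 h2; rewrite mulrDl mul1r -mulrA (mulrC `|v|); lra.
pose b := `|B + f 0| + 1.
have b0 : 0 <= b by rewrite addr_ge0.
pose A := [set q : V | `|q - 0| <= b].
have dH q : differentiable (tloc H i) (y, q) by apply: tloc_diff.
have cf : continuous f.
  have c1 q : {for q, continuous (fun q : V => (y, q))}.
    by apply: (@lipT_continuous _ _ _ 1) => q1 q2; rewrite mul1r -(norm_pair0l (q1 - q2)) (_ : (0, _) = (y, q1) - (y, q2)) //; congr pair; rewrite /= subrr.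
  move=> q; have c2 : {for q, continuous (fun q => tloc H i (y, q))}.
    exact: (continuous_comp (c1 q) (differentiable_continuous (dH q))).
  have c3 : {for q, continuous (fun q => pairing q v)}.
    rewrite (_ : (fun q => pairing q v) = pairing v); last by apply/funext => q'; rewrite pairingC.
    exact: pairing_continuous.
  exact: (continuousB c2 c3).
have A0 : A !=set0 by exists 0; rewrite /A /= subrr normr0.
have [q] := compact_EVT_min A0 (@compact_ball R n 0 b) (continuous_subspaceT cf).
rewrite inE => Aq qmin; exists q.
have A00 : 0 \in A by rewrite inE /A /= subrr normr0.
have qb : `|q| < b.
  have := qmin 0 A00; have := fB q; have := ler_norm (B + f 0).
  by rewrite /b; move: (f q) (f 0) `|B + f 0| => a1 a2 a3; lra.
apply: pairing_ext => e; pose g (s : R) := f (q + s *: e).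
have dg (s : R) : is_derive s 1 g (pairing (gradQ (tloc H i) (y, q + s *: e)) e - pairing e v).
  have dl := is_derive_line q e s.
  have dc : is_derive s 1 (fun s : R => (y, q + s *: e)) ((0 : V), e).
    by apply/is_derive_pairP; split=> //=; exact: is_derive_cst.
  have d1 := is_derive_dr (dH (q + s *: e)) dc.
  rewrite dr_grad /= pairing0r add0r in d1.
  exact: (is_deriveB d1 (is_derive_pairingl v dl)).
pose dlt := (b - `|q|) / (`|e| + 1).
have e1 : 0 < `|e| + 1 by rewrite ltr_wpDl.
have dlt0 : 0 < dlt by rewrite divr_gt0 // subr_gt0.
have [_ E] : is_derive (0 : R) 1 g 0.
  apply: (@derive1_at_min R g (- dlt) dlt 0).
  - by apply: (@le_trans _ _ 0); [rewrite oppr_le0|]; exact: ltW.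
  - by move=> s _; case: (dg s).
  - by rewrite in_itv /= oppr_lt0 dlt0.
  - move=> s; rewrite in_itv /= => /andP[s1 s2]; rewrite /g scale0r addr0; apply: qmin.
    rewrite inE /A /= subr0; apply: le_trans (ler_normD _ _) _; rewrite normrZ.
    have sd : `|s| <= dlt by rewrite ler_norml !ltW.
    have h1 : `|s| * `|e| <= dlt * (`|e| + 1) by apply: ler_pM => //; rewrite lerDl.
    by move: h1; rewrite /dlt divfK ?gt_eqF //; lra.
have [_ E2] := dg 0; move: E2; rewrite E scale0r addr0 => /esym/eqP.
by rewrite subr_eq0 (pairingC e) => /eqP.
Qed.

Definition legq i (w : V * V) : V := get [set q | gradQ (tloc H i) (w.1, q) = w.2].

Lemma legqP i w : cod i w.1 -> gradQ (tloc H i) (w.1, legq i w) = w.2.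
Proof.
by move=> cw; apply: (@getPex _ [set q | gradQ (tloc H i) (w.1, q) = w.2]); exact: leg_ex.
Qed.

Lemma legq_eq i w q : cod i w.1 -> gradQ (tloc H i) (w.1, q) = w.2 -> legq i w = q.
Proof. by move=> cw E; apply: (fiber_mono cw); rewrite legqP. Qed.

Definition Lloc i w : R := pairing (legq i w) w.2 - tloc H i (w.1, legq i w).

Lemma Lloc_ge i w q : cod i w.1 -> pairing q w.2 - tloc H i (w.1, q) <= Lloc i w.
Proof.
move=> cw; have := fiber_fenchel (legq i w) q cw.
rewrite legqP // pairingBr !(pairingC w.2) /Lloc.
by move: (pairing q w.2) (pairing (legq i w) w.2) (tloc H i (w.1, q)) (tloc H i (w.1, legq i w)) => *; lra.
Qed.

Lemma legq_lip i w0 : cod i w0.1 -> exists r b L : R, [/\ 0 < r, 0 <= L,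
  forall w, `|w - w0| <= r -> cod i w.1 /\ `|legq i w - legq i w0| <= L * `|w - w0| &
  exists C k, reg_on (box w0.1 r b) C k (tloc H i) (gradY (tloc H i)) (gradQ (tloc H i)) /\
    forall w, `|w - w0| <= r -> `|legq i w| <= b].
Proof.
move=> cw; have [r [r0 rc reg sup]] := local_tonelli cw.
have [B HB] := sup (n%:R * (`|w0.2| + 1) + 1).
have [C0 C00 HC0] : exists2 C0 : R, 0 <= C0 & forall y : V, `|y - w0.1| <= r -> `|tloc H i (y, 0)| <= C0.
  have sub : box w0.1 r 0 `<=` cod i `*` setT by move=> z [z1 _]; split=> //; exact: rc.
  have [B' B'0 HB'] := box_bound (Ck_pred (Ck_pred (tloc_C2 i H2))) sub.
  by exists B' => // y yr; apply: HB'; split=> //=; rewrite normr0.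
pose r1 := Num.min r 1; have r10 : 0 < r1 by rewrite lt_min r0 ltr01.
have r1r : r1 <= r by rewrite ge_min lexx.
have w1 w : `|w - w0| <= r1 -> [/\ `|w.1 - w0.1| <= r, `|w.2 - w0.2| <= 1, `|w.1 - w0.1| <= `|w - w0| & `|w.2 - w0.2| <= `|w - w0|].
  rewrite le_min => /andP[h1 h2]; have n1 := norm_pair1 (w - w0); have n2 := norm_pair2 (w - w0).
  by split=> //; [exact: le_trans n1 h1|exact: le_trans n2 h2].
pose b := `|B + C0|.
have qb w : `|w - w0| <= r1 -> `|legq i w| <= b.
  move=> /w1[h1 h2 _ _]; have cw' := rc _ h1.
  have f1 := Lloc_ge 0 cw'; have f2 := HB w.1 (legq i w) h1; have f3 := HC0 _ h1.
  move: f1; rewrite /Lloc pairing0l sub0r => f1.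
  have := pairing_norm (legq i w) w.2 => /ler_normlP[_ f4].
  have w2 : `|w.2| <= `|w0.2| + 1 by have := ler_distD w0.2 w.2 0; rewrite !subr0; move: h2; lra.
  have f5 : n%:R * (`|legq i w| * `|w.2|) <= n%:R * (`|w0.2| + 1) * `|legq i w|.
    by rewrite -mulrA; apply: ler_wpM2l => //; rewrite mulrC; apply: ler_wpM2r.
  move: f3 => /ler_normlP[_ f3]; have := ler_norm (B + C0); rewrite /b.
  move: f2; rewrite mulrDl mul1r; move: f1 f3 f4 f5.
  move: `|legq i w| `|B + C0| (pairing (legq i w) w.2) (tloc H i (w.1, legq i w)) (tloc H i (w.1, 0))
    (n%:R * (`|legq i w| * `|w.2|)) (n%:R * (`|w0.2| + 1) * `|legq i w|) => *; lra.
have [C [k [C0' k0 rg]]] := reg b (normr_ge0 _).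
have [_ _ lq _ mono] := rg.
exists r1, b, (n%:R * (C + 1) / k); split=> //.
- by rewrite divr_ge0 ?mulr_ge0 ?addr_ge0 // ltW.
- move=> w ww; have [h1 h2 h3 h4] := w1 _ ww; have cw' := rc _ h1; split=> //.
  have ww0 : `|w0 - w0| <= r1 by rewrite subrr normr0 ltW.
  have b1 : box w0.1 r b (w0.1, legq i w0) by split=> /=; [rewrite subrr normr0 ltW|exact: qb].
  have b2 : box w0.1 r b (w0.1, legq i w) by split=> /=; [rewrite subrr normr0 ltW|exact: qb].
  have b3 : box w0.1 r b (w.1, legq i w) by split=> //=; exact: qb.
  have := mono _ _ b1 b2 erefl; rewrite /= pairingC => m1.
  have := norm_le_pairing (ltW k0) m1 => m2.
  rewrite mulrAC ler_pdivlMr // mulrC; apply: le_trans m2 _; rewrite -mulrA; apply: ler_wpM2l => //.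
  rewrite -(legqP cw) in h4 *; have E : gradQ (tloc H i) (w0.1, legq i w) - gradQ (tloc H i) (w0.1, legq i w0) =
    (gradQ (tloc H i) (w0.1, legq i w) - gradQ (tloc H i) (w.1, legq i w)) + (w.2 - gradQ (tloc H i) (w0.1, legq i w0)).
    by rewrite (legqP cw') addrA subrK.
  rewrite E; apply: le_trans (ler_normD _ _) _; rewrite mulrDl mul1r; apply: lerD => //.
  apply: le_trans (lq _ _ b3 b2) _; apply: ler_wpM2l => //.
  apply: norm_pair_le => /=; first by rewrite distrC; exact: norm_pair1 (w - w0).
  by rewrite subrr normr0.
- exists C, k; split=> //; have [g1 g2 g3 g4 g5] := rg.
  have sub z : box w0.1 r1 b z -> box w0.1 r b z by move=> [z1 z2]; split=> //; exact: le_trans z1 r1r.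
  by split; [move=> z /sub/g1|move=> z z' /sub h /sub h'; exact: g2|move=> z z' /sub h /sub h'; exact: g3|move=> z /sub/g4|move=> z z' /sub h /sub h'; exact: g5].
Qed.

Lemma legq_continuous i w : cod i w.1 -> {for w, continuous (legq i)}.
Proof.
move=> /legq_lip[r [b [L [r0 L0 H1 _]]]]; apply: (@lip_continuous _ _ _ L).
apply/nbhs_ballP; exists r => //= w'; rewrite -ball_normE /= distrC => /ltW h.
by have [] := H1 _ h.
Qed.

Definition dL (q gy : V) (w : V * V) : R := pairing q w.2 - pairing gy w.1.

Lemma dL_is_linear q gy : linear (dL q gy).
Proof. by move=> a w w'; rewrite /dL /= !pairingDr !pairingZr /GRing.scale /=; ring. Qed.

Lemma dL_continuous q gy : continuous (dL q gy).
Proof.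
move=> w.
have c1 : {for w, continuous (fun w : V * V => pairing q w.2)}.
  by have := continuous_comp (@snd_continuous R n w) (@pairing_continuous R n q w.2).
have c2 : {for w, continuous (fun w : V * V => pairing gy w.1)}.
  by have := continuous_comp (@fst_continuous R n w) (@pairing_continuous R n gy w.1).
exact: (continuousB c1 c2).
Qed.

(* The envelope theorem: only the explicit dependence of [q.v - H(y, q)] contributes. *)
Lemma Lloc_diff i w0 : cod i w0.1 -> differentiable (Lloc i) w0 /\
  forall w, 'd (Lloc i) w0 w = pairing (legq i w0) w.2 - pairing (gradY (tloc H i) (w0.1, legq i w0)) w.1.
Proof.
move=> cw; have [r [b [L [r0 L0 H1 [C [k [rg qb]]]]]]] := legq_lip cw.
set q0 := legq i w0; set gy := gradY _ _.
have ww0 : `|w0 - w0| <= r by rewrite subrr normr0 ltW.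
have b1 : box w0.1 r b (w0.1, q0) by split=> /=; [rewrite subrr normr0 ltW|exact: qb].
have C0 : 0 <= C by have [_ _ _ /(_ _ b1)[h _] _] := rg; exact: le_trans h.
pose T := 2 * n%:R * C.
have T0 : 0 <= T by rewrite !mulr_ge0.
have [||df E] := @diff_of_quad R _ _ (Lloc i) w0 (lin_of (dL_is_linear q0 gy)) r (n%:R * L + T + n%:R * (C * L)) (@dL_continuous q0 gy) r0.
- by rewrite !addr_ge0 ?mulr_ge0.
- move=> w ww; have [cw' ql] := H1 w ww; set q := legq i w in ql *.
  have n1 : `|w.1 - w0.1| <= `|w - w0| := norm_pair1 (w - w0).
  have n2 : `|w.2 - w0.2| <= `|w - w0| := norm_pair2 (w - w0).
  have h1 := le_trans n1 ww.
  have b2 : box w0.1 r b (w0.1, q) by split=> /=; [rewrite subrr normr0 ltW|exact: qb].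
  have b3 : box w0.1 r b (w.1, q) by split=> //=; exact: qb.
  have b4 : box w0.1 r b (w.1, q0) by split=> //=; exact: qb.
  have nn (a a' e : V) : `|(a, e) - (a', e)| <= `|a - a'|.
    by apply: norm_pair_le => //=; rewrite subrr normr0.
  have s0 : 0 <= `|w - w0| ^+ 2 by exact: sqr_ge0.
  have t1 := taylor_bound rg b1 b4; have t2 := taylor_bound rg b2 b3.
  rewrite /= !subrr !pairing0r !subr0 -/gy in t1 t2.
  have u (a a' e : V) : `|a - a'| <= `|w - w0| -> T * `|(a, e) - (a', e)| ^+ 2 <= T * `|w - w0| ^+ 2.
    move=> aa; apply: ler_wpM2l => //; apply: lerXn2r; rewrite ?nnegrE //; exact: le_trans (nn _ _ _) aa.
  have {}t1 := le_trans t1 (u _ _ _ n1); have {}t2 := le_trans t2 (u _ _ _ n1).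
  have lo := Lloc_ge q0 cw'; have up := Lloc_ge q cw.
  rewrite /Lloc -/q0 in up; rewrite /Lloc -/q in lo.
  have gg : `|pairing (gradY (tloc H i) (w0.1, q) - gy) (w.1 - w0.1)| <= n%:R * (C * L) * `|w - w0| ^+ 2.
    apply: le_trans (pairing_norm _ _) _; rewrite -mulrA; apply: ler_wpM2l => //.
    rewrite expr2 mulrA; apply: ler_pM => //; have [_ ly _ _ _] := rg.
    apply: le_trans (ly _ _ b1 b2) _; rewrite -mulrA; apply: ler_wpM2l => //; apply: le_trans ql.
    by apply: norm_pair_le => //=; rewrite subrr normr0.
  have qq : `|pairing (q - q0) (w.2 - w0.2)| <= n%:R * L * `|w - w0| ^+ 2.
    apply: le_trans (pairing_norm _ _) _; rewrite -mulrA; apply: ler_wpM2l => //.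
    by rewrite expr2 mulrA; apply: ler_pM.
  rewrite /lin_of /= /dL /= /Lloc -/q -/q0.
  rewrite !mulrDl; move: t1 t2 lo up gg qq; rewrite !pairingBl !pairingBr.
  move=> /ler_normlP[t1 t1'] /ler_normlP[t2 t2'] lo up /ler_normlP[g1 g1'] /ler_normlP[q1 q1'].
  move: (n%:R * (C * L) * _) (n%:R * L * _) (T * _) (mulr_ge0 (mulr_ge0 (ler0n R n) (mulr_ge0 C0 L0)) s0) (mulr_ge0 (mulr_ge0 (ler0n R n) L0) s0) (mulr_ge0 T0 s0) t1 t1' t2 t2' lo up g1 g1' q1 q1' => e1 e2 e3 p1 p2 p3.
  move: (pairing gy w.1) (pairing gy w0.1) (pairing q w.2) (pairing q w0.2) (pairing q0 w.2) (pairing q0 w0.2).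
  move: (tloc H i (w.1, q)) (tloc H i (w0.1, q)) (tloc H i (w.1, q0)) (tloc H i (w0.1, q0)).
  move: (pairing _ w.1) (pairing _ w0.1) => a1 a2 a3 a4 a5 a6 a7 a8 a9 a10 a11 a12 t1 t1' t2 t2' lo up g1 g1' q1 q1'.
  apply/ler_normlP; split; lra.
by split=> // w; rewrite E.
Qed.

End LocalLegendre.

Section EulerLagrange.
Context {R : realType} {n : nat} {M : ptopologicalType} (S : smooth_manifold R n M) (P : patches S).
Local Notation V := 'rV[R]_n.
Implicit Types (i j : chart_index S) (x : M) (z : TsM S) (w : TM S) (y : V * V).
Variable H : TsM S -> R.
Hypothesis HT : forall P' : patches S, tonelli_in P' H.
Local Notation ca := (chart_at S).
Local Notation gQ i := (gradQ (tloc H i)).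
Local Notation L := (lagrangian H).

Let H2 : TsM_C2 H. Proof. by case: (HT P). Qed.

Definition leg z : TM S := (z.1, gQ (ca z.1) (coord (ca z.1) z)).
Definition legi w : TsM S := tprm (ca w.1) (chart (ca w.1) w.1, legq H (ca w.1) (TM_coord (ca w.1) w)).

Lemma TM_coord_inj i w w' : dom i w.1 -> dom i w'.1 -> TM_coord i w = TM_coord i w' -> w = w'.
Proof. by move=> dw dw' E; rewrite -(TM_coordK dw) E TM_coordK. Qed.

Lemma leg_coord i z : dom i z.1 -> TM_coord i (leg z) = (chart i z.1, gQ i (coord i z)).
Proof.
move=> dz; rewrite /TM_coord /= JacE; congr pair; apply/esym.
by apply: gradQ_change => //; [exact: dom_chart_at|apply: tloc_diff_coord => //; exact: dom_chart_at|exact: tloc_diff_coord].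
Qed.

Lemma legi1 w : (legi w).1 = w.1.
Proof. by rewrite /legi tprm1 /= chartK //; exact: dom_chart_at. Qed.

Lemma legK w : leg (legi w) = w.
Proof.
have dw := dom_chart_at S w.1.
have dw' : dom (ca w.1) (legi w).1 by rewrite legi1.
have cw : cod (ca w.1) (TM_coord (ca w.1) w).1 by exact: cod_chart.
apply: (TM_coord_inj (i := ca w.1) (w := leg (legi w)) (w' := w) dw' dw).
rewrite (leg_coord dw') legi1 /legi tprmK; last exact: cod_chart.
by rewrite (legqP P HT cw).
Qed.

Lemma leg_inj z z' : leg z = leg z' -> z = z'.
Proof.
move=> E; have E1 : z.1 = z'.1 by exact: (congr1 fst E).
have dz := dom_chart_at S z.1.
have dz' : dom (ca z.1) z'.1 by rewrite -E1.
apply: (coord_inj dz dz'); have := leg_coord dz; rewrite E leg_coord // => -[E2 E3].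
rewrite /coord -[X in _ = X]/((coord (ca z.1) z').1, (coord (ca z.1) z').2).
rewrite -[X in X = _]/((coord (ca z.1) z).1, (coord (ca z.1) z).2).
have cz : cod (ca z.1) (chart (ca z.1) z.1) by exact: cod_chart.
congr pair; first by rewrite /= E1.
apply: (fiber_mono P HT cz); rewrite -[X in gQ _ (X, _)]/((coord (ca z.1) z).1) -surjective_pairing -E3.
by congr (gQ _ _); rewrite [LHS]surjective_pairing /= E1.
Qed.

Lemma legiK z : legi (leg z) = z.
Proof. by apply: leg_inj; rewrite legK. Qed.

Lemma legi_coord i w : dom i w.1 -> coord i (legi w) = (chart i w.1, legq H i (TM_coord i w)).
Proof.
move=> dw; have dw' : dom i (legi w).1 by rewrite legi1.
have E : chart i (legi w).1 = chart i w.1 by rewrite legi1.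
rewrite [LHS]surjective_pairing {1}/coord /= E; congr pair; apply/esym/(legq_eq P HT).
  exact: cod_chart.
by have := leg_coord dw'; rewrite legK => ->.
Qed.

Lemma pairing_cov i z w : dom i z.1 -> w.1 = z.1 ->
  pairing (coord i z).2 (TM_coord i w).2 = pairing z.2 w.2.
Proof.
move=> dz E; rewrite /coord /TM_coord /= JacE E pairing_mulmx -mulmxA -trmx_mul trans_inv //.
  by rewrite trmx1 mulmx1.
exact: dom_chart_at.
Qed.

Lemma lagrangian_sup i w : dom i w.1 ->
  L w = Lloc H i (TM_coord i w) /\ forall p, pairing p w.2 - H (w.1, p) <= L w.
Proof.
move=> dw; have cw : cod i (TM_coord i w).1 by exact: cod_chart.
pose A := [set pairing p w.2 - H (w.1, p) | p in setT].
have E (z : TsM S) : z.1 = w.1 -> pairing z.2 w.2 - H z =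
    pairing (coord i z).2 (TM_coord i w).2 - tloc H i ((TM_coord i w).1, (coord i z).2).
  move=> zw; have dz : dom i z.1 by rewrite zw.
  rewrite pairing_cov //; congr (_ - _); rewrite -(tloc_coord H dz); congr (tloc _ _ _).
  by rewrite [LHS]surjective_pairing /= zw.
have ubA : ubound A (Lloc H i (TM_coord i w)).
  move=> _ [p _ <-]; rewrite (E (w.1, p)) //; exact: (Lloc_ge P HT).
have inA : A (Lloc H i (TM_coord i w)).
  have l1 := legi1 w; have dl : dom i (legi w).1 by rewrite l1.
  exists (legi w).2 => //; have -> : (w.1, (legi w).2) = legi w by rewrite -l1 -surjective_pairing.
  by rewrite (E (legi w)) // legi_coord.
have sA : has_sup A by split; [exists (Lloc H i (TM_coord i w))|exists (Lloc H i (TM_coord i w))].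
have supE : L w = Lloc H i (TM_coord i w).
  apply/eqP; rewrite eq_le; apply/andP; split; first by apply: ge_sup => //; exact: sA.1.
  by apply: ub_le_sup => //; exact: sA.2.
by split=> // p; rewrite supE; apply: ubA; exists p.
Qed.

Lemma lagrangian_leg z : L (leg z) = lagr H z.
Proof.
have dz := dom_chart_at S z.1.
have [-> _] := @lagrangian_sup (ca z.1) (leg z) dz.
rewrite (lagr_chart (i := ca z.1) H2 dz) /Lloc leg_coord //=.
have -> : legq H (ca z.1) (chart (ca z.1) z.1, gQ (ca z.1) (coord (ca z.1) z)) = (coord (ca z.1) z).2.
  by apply: (legq_eq P HT); [exact: cod_chart|congr (gQ _ _); rewrite [RHS]surjective_pairing].
by [].
Qed.

Lemma lagrangian_derive i y : cod i y.1 -> forall e : V,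
  'D_(0, e) (L \o TM_param i) y = pairing (legq H i y) e /\
  'D_(e, 0) (L \o TM_param i) y = - pairing (gradY (tloc H i) (y.1, legq H i y)) e.
Proof.
move=> cy e; have [dL0 E0] := Lloc_diff P HT cy.
have [dL1 E1] : differentiable (L \o TM_param i) y /\ 'd (L \o TM_param i) y = 'd (Lloc H i) y :> (V * V -> R).
  apply: (diff_near_eq (f := Lloc H i)) => //.
  have N : nbhs y [set w | cod i w.1].
    exact: near_cod.
  apply: filterS N => w cw /=.
  have dw : dom i (TM_param i w).1 by exact: dom_param.
  by have [-> _] := lagrangian_sup dw; rewrite TM_paramK.
by rewrite !deriveE // E1 !E0 /= pairing0r subr0 pairing0r sub0r.
Qed.

Lemma TM_coord_leg_near i (zeta : R -> TsM S) (t : R) : {for t, continuous (fun s => (zeta s).1 : M)} ->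
  dom i (zeta t).1 -> \forall s \near t, TM_coord i (leg (zeta s)) =
    ((coord i (zeta s)).1, gQ i (coord i (zeta s))) /\ dom i (zeta s).1.
Proof.
by move=> ct dt; apply: filterS (near_curve_dom ct dt) => s ds; rewrite leg_coord.
Qed.

Lemma leg_legq i z : dom i z.1 -> legq H i (TM_coord i (leg z)) = (coord i z).2.
Proof.
move=> dz; apply: (legq_eq P HT); first exact: cod_chart.
by rewrite leg_coord //; congr (gQ _ _); rewrite [RHS]surjective_pairing.
Qed.

Lemma ham_EL (zeta : R -> TsM S) : (forall t, ham_at H zeta t) -> EL_curve L (fun t => leg (zeta t)).
Proof.
move=> hz; split=> [t|i t dt0]; first by have [] := hz t.
have dt : dom i (zeta t).1 := dt0.
have [ct /(_ i dt) dz] := hz t; have /is_derive_pairP[/= dy dq] := dz.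
have N := TM_coord_leg_near ct dt.
have cE := leg_coord dt; split.
  by have E2 := congr1 snd cE; rewrite /= in E2; rewrite E2.
move=> e; have cy : cod i (TM_coord i (leg (zeta t))).1 by exact: cod_chart.
have E1 : pairing (- gradY (tloc H i) (coord i (zeta t))) e = 'D_(e, 0) (L \o TM_param i) (TM_coord i (leg (zeta t))).
  rewrite (lagrangian_derive cy e).2 pairingNl; congr (- pairing (gradY _ _) e).
  by rewrite (leg_legq dt); exact: surjective_pairing.
apply: (is_derive_eq _ E1); apply: near_eq_is_derive (is_derive_pairingl e dq).
apply: filterS N => s [_ ds]; have cs : cod i (TM_coord i (leg (zeta s))).1 by exact: cod_chart.
apply: (etrans _ (esym (lagrangian_derive cs e).1)); congr (pairing _ e); apply/esym; exact: (leg_legq ds).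
Qed.

Lemma EL_ham (gamma : R -> TM S) : EL_curve L gamma -> forall t, ham_at H (fun t => legi (gamma t)) t.
Proof.
move=> [cg EL] t.
have E1 : (fun s => (legi (gamma s)).1 : M) = (fun s => (gamma s).1) by apply/funext => s; rewrite legi1.
split; first by rewrite /prop_for /continuous_at E1 legi1; exact: cg.
move=> i; rewrite legi1 => dt; have [dy dq] := EL i t dt.
have ct : {for t, continuous (fun s => (gamma s).1 : M)} by exact: cg.
have N : \forall s \near t, dom i (gamma s).1 by exact: (near_for ct (near_dom dt)).
have cy : cod i (TM_coord i (gamma t)).1 by exact: cod_chart.
have dp : is_derive t 1 (fun s => ((TM_coord i (gamma s)).1, legq H i (TM_coord i (gamma s))))
    ((TM_coord i (gamma t)).2, - gradY (tloc H i) ((TM_coord i (gamma t)).1, legq H i (TM_coord i (gamma t)))).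
  apply/is_derive_pairP; split=> //=.
  apply/is_derive_rVP => k.
  have := is_derive_eq (dq (delta_mx 0 k)) (lagrangian_derive cy (delta_mx 0 k)).2.
  rewrite -pairingNl pairing_delta; apply: near_eq_is_derive; apply: filterS N => s ds.
  have cs : cod i (TM_coord i (gamma s)).1 by exact: cod_chart.
  exact: etrans (lagrangian_derive cs (delta_mx 0 k)).1 (pairing_delta _ _).
have E : hfield H i (coord i (legi (gamma t))) = ((TM_coord i (gamma t)).2,
    - gradY (tloc H i) ((TM_coord i (gamma t)).1, legq H i (TM_coord i (gamma t)))).
  by rewrite /hfield /ham_field (legi_coord dt); congr pair; exact: (legqP P HT cy).
apply: (is_derive_eq _ (esym E)); apply: near_eq_is_derive dp; apply: filterS N => s ds.
by rewrite legi_coord.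
Qed.

Lemma leg_continuous : continuous (leg : TsMt S -> TMt S).
Proof.
move=> z; set i := ca z.1; have dz : dom i z.1 by exact: dom_chart_at.
apply: (TsMt_continuous_at (i := i) dz).
have cz : cod i (coord i z).1 by exact: cod_chart.
have N : nbhs (coord i z) [set w | cod i w.1].
  exact: near_cod.
apply: (near_eq_continuous (f := fun y : V * V => TM_param i (y.1, gQ i y) : TMt S)).
  apply: filterS N => y cy /=.
  have dy : dom i (tprm i y).1 by rewrite tprm1; exact: dom_param.
  have := leg_coord dy; rewrite tprmK // tprm1 paramK // => <-.
  by rewrite TM_coordK.
apply: (comp_for (f := fun y : V * V => (y.1, gQ i y))); last exact: TM_param_continuous.
suff c2 : {for coord i z, continuous (gQ i)} by exact: (cvg_pair (@fst_continuous R n _) c2).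
apply: row_continuous => k.
have -> : (fun t => gQ i t 0 k) = (fun t => 'd (tloc H i) t (0, delta_mx 0 k)).
  by apply/funext => t; rewrite gradQE.
have C0 : Ck 0 (cod i `*` setT) (fun t => 'd (tloc H i) t (0, delta_mx 0 k)).
  by apply: Ck_pred; have [_ CG] := tloc_C2 i H2; exact: CG.
by apply: C0; split.
Qed.

Lemma legi_continuous : continuous (legi : TMt S -> TsMt S).
Proof.
move=> w; set i := ca w.1; have dw : dom i w.1 by exact: dom_chart_at.
apply: (TMt_continuous_at (i := i) dw).
have cw : cod i (TM_coord i w).1 by exact: cod_chart.
have N : nbhs (TM_coord i w) [set y | cod i y.1].
  exact: near_cod.
apply: (near_eq_continuous (f := fun y : V * V => tprm i (y.1, legq H i y) : TsMt S)).
  apply: filterS N => y cy /=.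
  have dy : dom i (TM_param i y).1 by exact: dom_param.
  have := legi_coord dy; rewrite TM_paramK // [chart _ _]paramK // => <-.
  by rewrite coordK // legi1.
apply: (comp_for (f := fun y : V * V => (y.1, legq H i y))); last exact: tprm_continuous.
exact: (cvg_pair (@fst_continuous R n _) (legq_continuous P HT cw)).
Qed.

End EulerLagrange.

Section ContentMeasure.
Context {R : realType} {X : ptopologicalType}.
Hypothesis X_hausdorff : hausdorff_space X.
Hypothesis X_locally_compact : forall (x : X) (W : set X), nbhs x W ->
  exists C, [/\ compact C, nbhs x C & C `<=` W].
Variable nu : set X -> R.
Hypothesis nu_ge0 : forall A, 0 <= nu A.
Hypothesis nuU : forall A B, A `&` B = set0 -> nu (A `|` B) = nu A + nu B.
Hypothesis nuT : nu setT = 1.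
Implicit Types (A B C U W : set X).

Lemma nu_le A B : A `<=` B -> nu A <= nu B.
Proof.
move=> AB; rewrite -(setDUK AB) nuU; first by rewrite lerDl.
by rewrite setDE setICA setICr setI0.
Qed.

Lemma nu0 : nu set0 = 0.
Proof. by have := @nuU set0 set0 (setI0 _); rewrite setU0 => /eqP; rewrite -subr_eq subrr => /eqP. Qed.

Lemma nu_leU A B : nu (A `|` B) <= nu A + nu B.
Proof.
have -> : A `|` B = A `|` (B `\` A) by rewrite setDE setUIr setUCr setIT.
rewrite nuU; first by rewrite lerD2l; apply: nu_le; exact: subDsetl.
by rewrite setDE setICA setICr setI0.
Qed.

Lemma nu_le_sum N (F : nat -> set X) : nu (\big[setU/set0]_(i < N) F i) <= \sum_(i < N) nu (F i).
Proof.
elim: N => [|N IH]; first by rewrite !big_ord0 nu0.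
by rewrite !big_ord_recr /=; apply: le_trans (nu_leU _ _) _; rewrite lerD2r.
Qed.

Definition inner U : R := sup [set nu C | C in [set C | compact C /\ C `<=` U]].

Let inner_set U : has_sup [set nu C | C in [set C | compact C /\ C `<=` U]].
Proof.
split; first by exists (nu set0); exists set0 => //; split=> //; exact: compact0.
by exists 1 => _ [C _ <-]; rewrite -nuT; exact: nu_le.
Qed.

Lemma inner_ge U C : compact C -> C `<=` U -> nu C <= inner U.
Proof. by move=> cC CU; apply: ub_le_sup; [have [] := inner_set U|exists C]. Qed.

Lemma inner_le U (a : R) : (forall C, compact C -> C `<=` U -> nu C <= a) -> inner U <= a.
Proof.
move=> H; apply: ge_sup; first by have [] := inner_set U.
by move=> _ [C [cC CU] <-]; exact: H.
Qed.

Lemma inner_mono U W : U `<=` W -> inner U <= inner W.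
Proof. by move=> UW; apply: inner_le => C cC CU; apply: inner_ge => //; exact: subset_trans UW. Qed.

Lemma inner_ge0 U : 0 <= inner U.
Proof. by rewrite -nu0; apply: inner_ge; [exact: compact0|exact: sub0set]. Qed.

Lemma inner_nu U : inner U <= nu U.
Proof. by apply: inner_le => C _; exact: nu_le. Qed.

Lemma inner_approx U (e : R) : 0 < e -> exists2 C, compact C /\ C `<=` U & inner U - e < nu C.
Proof. by move=> e0; have [_ [C CU <-] h] := sup_adherent e0 (inner_set U); exists C. Qed.

Lemma compact_sum C (U : nat -> set X) : compact C -> (forall i, open (U i)) -> C `<=` \bigcup_i U i ->
  exists N, nu C <= \sum_(i < N) inner (U i).
Proof.
move=> cC oU CU.
have /choice[f fP] (x : X) : exists p : nat * set X, C x -> [/\ compact p.2, nbhs x p.2 & p.2 `<=` U p.1].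
  have [/CU[i _ Uix]|h] := pselect (C x); last by exists (0%N, set0) => /h.
  have [D [cD xD DU]] := X_locally_compact (open_nbhs_nbhs (conj (oU i) Uix)).
  by exists (i, D).
have cC' : cover_compact C by rewrite -compact_cover.
have /(_ X C (fun x => ((f x).2)^°)) [||D DC CD] := cC'.
- by move=> x _; exact: open_interior.
- by move=> x Cx; exists x => //; have [] := fP x Cx.
pose s := finmap.enum_fset D.
pose N := (\max_(x <- s) (f x).1).+1.
pose E i := \big[setU/set0]_(x <- s | (f x).1 == i) (f x).2.
have Cs x : x \in s -> C x by move=> xs; have /set_mem := DC x xs.
have EP i : compact (E i) /\ E i `<=` U i.
  have -> : E i = \big[setU/set0]_(x <- s | ((f x).1 == i) && (x \in s)) (f x).2 by rewrite /E big_seq_cond; apply: eq_bigl => x; rewrite andbC.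
  elim/big_ind : _ => [|A B [cA AU] [cB BU]|x /andP[/eqP <- /Cs/fP[]]//].
    by split; [exact: compact0|exact: sub0set].
  by split; [exact: compactU|rewrite subUset].
exists N; apply: (@le_trans _ _ (nu (\big[setU/set0]_(i < N) E i))); last first.
  apply: le_trans (nu_le_sum _ _) _; apply: ler_sum => i _; have [cE EU] := EP i; exact: inner_ge.
apply: nu_le => y /CD[x Dx /interior_subset fx].
have xN : ((f x).1 < N)%N by rewrite ltnS; apply: (leq_bigmax_seq (F := fun x => (f x).1)).
rewrite (bigD1 (Ordinal xN)) //=; left; rewrite /E (big_rem x) //= eqxx; by left.
Qed.

Definition outerR A : R := inf [set inner U | U in [set U | open U /\ A `<=` U]].

Let outer_set A : has_inf [set inner U | U in [set U | open U /\ A `<=` U]].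
Proof.
split; first by exists (inner setT); exists setT => //; split=> //; exact: openT.
by exists 0 => _ [U _ <-]; exact: inner_ge0.
Qed.

Lemma outerR_le A U : open U -> A `<=` U -> outerR A <= inner U.
Proof. by move=> oU AU; apply: ge_inf; [have [] := outer_set A|exists U]. Qed.

Lemma outerR_ge A (a : R) : (forall U, open U -> A `<=` U -> a <= inner U) -> a <= outerR A.
Proof.
move=> H; apply: lb_le_inf; first by have [] := outer_set A.
by move=> _ [U [oU AU] <-]; exact: H.
Qed.

Lemma outerR_ge0 A : 0 <= outerR A.
Proof. by apply: outerR_ge => U _ _; exact: inner_ge0. Qed.

Lemma outerR_approx A (e : R) : 0 < e -> exists U, [/\ open U, A `<=` U & inner U < outerR A + e].
Proof. by move=> e0; have [_ [U [oU AU] <-] h] := inf_adherent e0 (outer_set A); exists U. Qed.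

Lemma outerR_open U : open U -> outerR U = inner U.
Proof.
move=> oU; apply/eqP; rewrite eq_le outerR_le //=; apply: outerR_ge => W _; exact: inner_mono.
Qed.

Definition outer A : \bar R := (outerR A)%:E.

Let outer0 : outer set0 = 0%E.
Proof.
rewrite /outer outerR_open; last exact: open0.
congr EFin; apply/eqP; rewrite eq_le inner_ge0 andbT; apply: inner_le => C _.
by rewrite subset0 => ->; rewrite nu0.
Qed.

Let outer_ge0 A : (0 <= outer A)%E. Proof. by rewrite lee_fin outerR_ge0. Qed.

Let outer_mono : {homo outer : A B / A `<=` B >-> (A <= B)%E}.
Proof.
move=> A B AB; rewrite lee_fin; apply: outerR_ge => U oU BU; apply: outerR_le => //.
exact: subset_trans BU.
Qed.

Lemma sum_half (e : R) N : \sum_(i < N) e / 2 ^+ i.+1 = e - e / 2 ^+ N.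
Proof.
elim: N => [|N IH]; first by rewrite big_ord0 expr0 divr1 subrr.
rewrite big_ord_recr /= IH exprS; have h : (2 : R) ^+ N != 0 by rewrite expf_neq0.
by field; rewrite h.
Qed.

Let outer_sigma : sigma_subadditive outer.
Proof.
move=> F; apply/lee_addgt0Pr => e e0.
have e2 i : 0 < e / 2 ^+ i.+1 by rewrite divr_gt0 // exprn_gt0.
have /choice[U UP] i := outerR_approx (F i) (e2 i).
have oU : open (\bigcup_i U i) by apply: bigcup_open => i _; have [] := UP i.
have FU : \bigcup_i F i `<=` \bigcup_i U i.
  by move=> x [i _ Fx]; exists i => //; have [_ + _] := UP i; apply.
apply: (@le_trans _ _ (inner (\bigcup_i U i))%:E); first by rewrite lee_fin; exact: outerR_le.
have S0 N : (\sum_(i < N) outer (F i) <= \sum_(i <oo) outer (F i))%E.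
  by rewrite -(big_mkord xpredT (outer \o F)); apply: nneseries_lim_ge => i _ _; exact: outer_ge0.
have Sx : (0 <= \sum_(i <oo) outer (F i))%E by exact: nneseries_ge0.
case E : (\sum_(i <oo) outer (F i))%E Sx S0 => [s| |] // _ S0; last by rewrite addye // leey.
rewrite -EFinD lee_fin; apply: inner_le => C cC CU.
have [N CN] := compact_sum cC (fun i => let: And3 h _ _ := UP i in h) CU.
apply: le_trans CN _; apply: (@le_trans _ _ (\sum_(i < N) (outerR (F i) + e / 2 ^+ i.+1))).
  by apply: ler_sum => i _; have [_ _ /ltW] := UP i.
rewrite big_split /= sum_half; apply: lerD.
  by have := S0 N; rewrite /outer sumEFin lee_fin.
by rewrite gerBl divr_ge0 ?exprn_ge0 // ltW.
Qed.

HB.instance Definition _ := isOuterMeasure.Build R X outer outer0 outer_ge0 outer_mono outer_sigma.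

Lemma outer_open_caratheodory U : open U -> outer.-caratheodory U.
Proof.
move=> oU; apply: le_caratheodory_measurable => A; rewrite /= -EFinD lee_fin.
apply: outerR_ge => W oW AW; apply/ler_addgt0Pr => e e0.
have e2 : 0 < e / 2 by rewrite divr_gt0.
have [C [cC CWU] hC] := inner_approx (W `&` U) e2.
have clC : closed C by exact: compact_closed.
have [D [cD DWC] hD] := inner_approx (W `&` ~` C) e2.
have h1 : outerR (A `&` U) <= inner (W `&` U) by apply: outerR_le; [exact: openI|exact: setSI].
have h2 : outerR (A `&` ~` U) <= inner (W `&` ~` C).
  apply: outerR_le; first by apply: openI => //; exact: closed_openC.
  by move=> x [Ax Ux]; split; [exact: AW|move=> /CWU[]].
have h3 : nu C + nu D <= inner W.
  rewrite -nuU; last by rewrite -subset0 => x [Cx /DWC[_]]; exact.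
  apply: inner_ge; first exact: compactU.
  by move=> x [/CWU[]|/DWC[]].
by move: h1 h2 h3 hC hD; lra.
Qed.

Local Notation Borel := (g_sigma_algebraType (@open X)).

Lemma borel_caratheodory : (measurable : set (set Borel)) `<=` outer.-caratheodory.
Proof.
apply: smallest_sub; last by move=> U oU; exact: outer_open_caratheodory.
split; first exact: caratheodory_measurable_set0.
- by move=> A mA; rewrite setTD; exact: caratheodory_measurable_setC.
- exact: caratheodory_measurable_bigcup.
Qed.

Definition content_measure : set Borel -> \bar R := outer.

Let cm0 : content_measure set0 = 0%E. Proof. exact: outer0. Qed.
Let cm_ge0 A : (0 <= content_measure A)%E. Proof. exact: outer_ge0. Qed.
Let cm_sigma : semi_sigma_additive content_measure.
Proof.
move=> F mF tF mUF.
apply: (@caratheodory_measure_sigma_additive R X outer F) => //.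
  by move=> i; exact: borel_caratheodory.
exact: borel_caratheodory.
Qed.

HB.instance Definition _ := isMeasure.Build _ Borel R content_measure cm0 cm_ge0 cm_sigma.

Variable Z : set X.
Hypothesis cZ : compact Z.
Hypothesis nuZ : nu Z = 1.

Let cmT : content_measure setT = 1%E.
Proof.
rewrite /content_measure /outer outerR_open; last exact: openT.
congr EFin; apply/eqP; rewrite eq_le -{1}nuT inner_nu -nuZ; exact: inner_ge.
Qed.

HB.instance Definition _ := Measure_isProbability.Build _ _ _ content_measure cmT.

Lemma content_measure_ex : exists mu : probability Borel R,
  (forall U, open U -> mu U = (inner U)%:E) /\
  forall phi : X -> X, continuous phi -> (forall U, open U -> inner (phi @^-1` U) <= inner U) ->
    forall A, (mu (phi @^-1` A) <= mu A)%E.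
Proof.
exists content_measure; split=> [U oU|phi cphi H A].
  by rewrite /= /content_measure /outer outerR_open.
rewrite /= /content_measure /outer lee_fin; apply: outerR_ge => U oU AU.
apply: le_trans (H U oU); apply: outerR_le; first by move/continuousP: cphi; apply.
exact: preimage_subset.
Qed.

End ContentMeasure.

Section UltraLimit.
Context {R : realType}.
Variable (U : set_system nat).
Hypothesis UU : UltraFilter U.
Hypothesis Uoo : \oo `<=` U.

Lemma ultra_cvg (u : nat -> R) (b : R) : (forall N, `|u N| <= b) -> exists l : R, u N @[N --> U] --> l.
Proof.
move=> ub; have UF : ProperFilter U := ultra_proper.
have [l [_ lu]] : [set` `[- b, b]] `&` cluster (u N @[N --> U]) !=set0.
  apply: (@segment_compact R (- b) b (u N @[N --> U])).
  by rewrite /fmap /=; apply: (@filterE _ U) => N; rewrite /= in_itv /= -ler_norml; exact: ub.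
exists l => B NB; have [//|UB] := in_ultra_setVsetC (u @^-1` B) UU.
by have [x [Bx nBx]] := lu (~` B) B UB NB.
Qed.

Definition ulim (u : nat -> R) : R := lim (u N @[N --> U]).

Lemma ulimP (u : nat -> R) (b : R) : (forall N, `|u N| <= b) -> u N @[N --> U] --> ulim u.
Proof.
move=> ub; have UF : ProperFilter U := ultra_proper.
have [l ul] := ultra_cvg ub; suff -> : ulim u = l by [].
by apply: cvg_lim.
Qed.

Lemma ulim_le (u v : nat -> R) (b e : R) : (forall N, `|u N| <= b) -> (forall N, `|v N| <= b) ->
  (\forall N \near \oo, u N <= v N + e) -> ulim u <= ulim v + e.
Proof.
move=> ub vb uv; have UF : ProperFilter U := ultra_proper.
have c1 := ulimP ub; have c2 : v N + e @[N --> U] --> ulim v + e.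
  by apply: cvgD; [exact: ulimP vb|exact: cvg_cst].
by apply: (ler_cvg_to c1 c2); exact: Uoo.
Qed.

Lemma ulimD (u v : nat -> R) (b : R) : (forall N, `|u N| <= b) -> (forall N, `|v N| <= b) ->
  ulim (fun N => u N + v N) = ulim u + ulim v.
Proof.
move=> ub vb; have UF : ProperFilter U := ultra_proper.
by apply: cvg_lim => //; apply: cvgD; [exact: ulimP ub|exact: ulimP vb].
Qed.

Lemma ulim_near (u : nat -> R) (l b : R) : (forall N, `|u N| <= b) -> (\forall N \near \oo, u N = l) -> ulim u = l.
Proof.
move=> ub ul; have b0 : 0 <= b by exact: le_trans (ub 0%N).
have bb (w : nat -> R) : (forall N, `|w N| <= b) -> forall N, `|w N| <= b + `|l|.
  by move=> wb N; apply: le_trans (wb N) _; rewrite lerDl.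
have lb N : `|l| <= b + `|l| by rewrite lerDr.
have cl : ulim (fun=> l) = l by have UF : ProperFilter U := ultra_proper; apply: cvg_lim => //; exact: cvg_cst.
have h1 : ulim u <= ulim (fun=> l) + 0.
  by apply: (ulim_le (b := b + `|l|)); [exact: bb|exact: lb|apply: filterS ul => N ->; rewrite addr0].
have h2 : ulim (fun=> l) <= ulim u + 0.
  by apply: (ulim_le (b := b + `|l|)); [exact: lb|exact: bb|apply: filterS ul => N ->; rewrite addr0].
by apply/eqP; rewrite eq_le; move: h1 h2; rewrite cl !addr0 => -> ->.
Qed.

End UltraLimit.

Section Sampling.
Context {R : realType}.

Lemma sum_shift (g : nat -> R) (J l : nat) : (forall j, 0 <= g j <= 1) ->
  \sum_(j < J) g (j + l)%N <= \sum_(j < J) g j + l%:R /\ \sum_(j < J) g j <= \sum_(j < J) g (j + l)%N + l%:R.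
Proof.
move=> g01.
have s0 m (F : nat -> R) : (forall j, 0 <= F j <= 1) -> 0 <= \sum_(j < m) F j <= m%:R.
  move=> F01; apply/andP; split; first by apply: sumr_ge0 => j _; have /andP[] := F01 j.
  rewrite -[m in leRHS]card_ord -sum1_card natr_sum; apply: ler_sum => j _; have /andP[] := F01 j; by [].
have E1 : \sum_(j < l + J) g j = \sum_(j < l) g j + \sum_(j < J) g (j + l)%N.
  rewrite big_split_ord /=; congr (_ + _); apply: eq_bigr => j _; by rewrite addnC.
have E2 : \sum_(j < l + J) g j = \sum_(j < J) g j + \sum_(j < l) g (J + j)%N.
  by rewrite addnC big_split_ord.
have /andP[a1 a2] := s0 l g g01; have /andP[b1 b2] := s0 l (fun j => g (J + j)%N) (fun j => g01 _).
by split; move: E1 E2 a1 a2 b1 b2; move: (\sum_(j < l + J) _) => x; lra.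
Qed.

Variable h : R.
Hypothesis h0 : 0 < h.

Definition step (N : nat) : R := h / 2 ^+ N.

Lemma step_gt0 N : 0 < step N. Proof. by rewrite divr_gt0 // exprn_gt0. Qed.

Lemma step_cvg (e : R) : 0 < e -> \forall N \near \oo, step N < e.
Proof.
move=> e0; have : \forall N \near \oo, h / e <= (N%:R : R) by exact: nbhs_infty_ger.
apply: filterS => N; rewrite ler_pdivrMr // => hN; rewrite /step ltr_pdivrMr ?exprn_gt0 //.
apply: le_lt_trans hN _; rewrite mulrC ltr_pM2l // -natrX ltr_nat; exact: ltn_expl.
Qed.

Lemma dyadic_approx (t e : R) : 0 <= t -> 0 < e -> exists a b, `|a%:R * step b - t| < e.
Proof.
move=> t0 e0; have [b _ Hb] := step_cvg e0; have sb : step b < e by exact: Hb (leqnn b).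
have s0 := step_gt0 b; pose a := Num.truncn (t / step b); exists a, b.
have := truncn_itv (divr_ge0 t0 (ltW s0)); rewrite -/a => /andP[a1 a2].
rewrite ler_pdivlMr // in a1; rewrite ltr_pdivrMr // -natr1 mulrDl mul1r in a2.
by rewrite ltr_norml; apply/andP; split; move: a1 a2 sb; lra.
Qed.

End Sampling.

Section OccupationMeasure.
Context {R : realType} {n : nat} {M : ptopologicalType} (S : smooth_manifold R n M) (P : patches S).
Variable K : TsM S -> R.
Hypothesis KK : good_pair P K K.
Local Notation X := (TsMt S).
Variables (h : R) (z : nat -> TsM S) (E0 : R).
Hypothesis h0 : 0 < h.
Hypothesis zE : forall N, K (z N) <= E0.
Variable (U : set_system nat).
Hypothesis UU : UltraFilter U.
Hypothesis Uoo : \oo `<=` U.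

Let K2 : TsM_C2 K. Proof. by case: KK. Qed.

Definition sample (N j : nat) : TsM S := hflow K (j%:R * step h N) (z N).
Definition ave (N : nat) (g : TsM S -> R) : R := (\sum_(j < N * 2 ^ N) g (sample N j)) / (N * 2 ^ N)%:R.
Definition freq (A : set X) (N : nat) : R := ave N \1_A.
Definition occ (A : set X) : R := ulim U (freq A).

Lemma ave_le N g g' : (forall j, g (sample N j) <= g' (sample N j)) -> ave N g <= ave N g'.
Proof. by move=> gg; apply: ler_wpM2r; [rewrite invr_ge0|apply: ler_sum => j _]. Qed.

Lemma aveD N g g' : ave N (fun x => g x + g' x) = ave N g + ave N g'.
Proof. by rewrite /ave big_split mulrDl. Qed.

Lemma ave_cst N (a : R) : (0 < N)%N -> ave N (fun=> a) = a.
Proof.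
move=> N0; rewrite /ave sumr_const card_ord -[a *+ _]mulr_natr mulfK // pnatr_eq0 -lt0n.
by rewrite muln_gt0 N0 expn_gt0.
Qed.

Lemma freq01 A N : 0 <= freq A N <= 1.
Proof.
apply/andP; split; first by rewrite divr_ge0 // sumr_ge0 // => j _; rewrite indicE.
have [->|N0] := posnP N; first by rewrite /freq /ave mul0n invr0 mulr0.
rewrite -(ave_cst 1 N0); apply: ave_le => j; rewrite indicE; by case: (_ \in _).
Qed.

Lemma freq_norm A N : `|freq A N| <= 1.
Proof. by have /andP[f0 f1] := freq01 A N; rewrite ger0_norm. Qed.

Lemma occ_ge0 A : 0 <= occ A.
Proof.
have c0 : ulim U (fun=> (0 : R)) = 0 by apply: (ulim_near UU Uoo (b := 1)) => [N|]; [rewrite normr0|exact: nearW].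
rewrite -c0 -[leRHS]addr0; apply: (ulim_le UU Uoo (b := 1)) => [N|N|]; [by rewrite normr0|exact: freq_norm|].
by apply: nearW => N; rewrite addr0; have /andP[] := freq01 A N.
Qed.

Lemma occU A B : A `&` B = set0 -> occ (A `|` B) = occ A + occ B.
Proof.
move=> AB; rewrite /occ -(ulimD UU (freq_norm A) (freq_norm B)); congr ulim; apply/funext => N.
rewrite /freq -aveD; congr (ave N _); apply/funext => x.
rewrite !indicE in_setU; case: (boolP (x \in A)) => //= xA; last by rewrite add0r.
have -> : (x \in B) = false by apply/negbTE/negP => /set_mem xB; move/set_mem: xA => xA; have : (A `&` B) x by []; rewrite AB.
by rewrite addr0.
Qed.

Lemma occ_all A : (forall N j, A (sample N j)) -> occ A = 1.
Proof.
move=> HA; apply: (ulim_near UU Uoo (freq_norm A)).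
exists 1%N => // N /= N0; rewrite -[RHS](ave_cst 1 N0) /freq /ave; congr (_ / _).
by apply: eq_bigr => j _; rewrite indicE mem_set.
Qed.

Lemma sampleD N j l b : (b <= N)%N ->
  hflow K (l%:R * step h b) (sample N j) = sample N (j + l * 2 ^ (N - b))%N.
Proof.
move=> bN; rewrite /sample -(hflowD KK) natrD mulrDl; congr (hflow K (_ + _) _).
rewrite /step natrM natrX -{2}(subnKC bN) exprD; have h1 : (2 : R) ^+ (N - b) != 0 by rewrite expf_neq0.
have h2 : (2 : R) ^+ b != 0 by rewrite expf_neq0.
by field; rewrite h1 h2.
Qed.

Lemma occ_shift A (a b : nat) : occ (hflow K (a%:R * step h b) @^-1` A) = occ A.
Proof.
set B := _ @^-1` A.
have H (e : R) : 0 < e -> \forall N \near \oo, freq B N <= freq A N + e /\ freq A N <= freq B N + e.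
  move=> e0; have N1 : \forall N \near \oo, a%:R / e <= (N%:R : R) by exact: nbhs_infty_ger.
  have N2 : \forall N \near \oo, (maxn 1 b <= N)%N by exact: nbhs_infty_ge.
  apply: filterS2 N1 N2 => N h1; rewrite geq_max => /andP[N0 bN].
  pose l := (a * 2 ^ (N - b))%N; pose J := (N * 2 ^ N)%N.
  have J0 : 0 < (J%:R : R) by rewrite ltr0n muln_gt0 N0 expn_gt0.
  pose g j := \1_A (sample N j) : R.
  have g01 j : 0 <= g j <= 1 by rewrite /g indicE; case: (_ \in _); rewrite ?lexx ?ler01.
  have [s1 s2] := @sum_shift R g J l g01.
  have fA : freq A N = (\sum_(j < J) g j) / J%:R by [].
  have fB : freq B N = (\sum_(j < J) g (j + l)%N) / J%:R.
    rewrite /freq /ave; congr (_ / _); apply: eq_bigr => j _.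
    by rewrite /g -sampleD.
  have lJ : l%:R <= e * J%:R.
    have aN : a%:R <= e * N%:R by rewrite -ler_pdivrMl // mulrC.
    rewrite /l /J !natrM mulrA; apply: ler_pM => //.
    by rewrite ler_nat leq_exp2l // leq_subr.
  rewrite fA fB !ler_pdivrMr // !mulrDl !divfK ?gt_eqF //.
  by split; [apply: le_trans s1 _|apply: le_trans s2 _]; rewrite lerD2l.
apply/eqP; rewrite eq_le; apply/andP; split; apply/ler_addgt0Pr => e e0.
  apply: (ulim_le UU Uoo (freq_norm B) (freq_norm A)); by apply: filterS (H e e0) => N [].
by apply: (ulim_le UU Uoo (freq_norm A) (freq_norm B)); apply: filterS (H e e0) => N [].
Qed.

Lemma occ_flow A (r : R) a b : r = a%:R * step h b \/ r = - (a%:R * step h b) -> occ (hflow K r @^-1` A) = occ A.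
Proof.
move=> [->|->]; first exact: occ_shift.
rewrite -[LHS](occ_shift _ a b); congr occ; apply/seteqP.
by split=> x /=; rewrite (hflowNK KK).
Qed.

Lemma tube (C W : set X) : compact C -> open W -> C `<=` W ->
  exists2 e : R, 0 < e & forall s x, `|s| < e -> C x -> W (hflow K s x).
Proof.
move=> cC oW CW; have /compact_near_coveringP cv := cC.
have : \forall s \near (0 : R), C `<=` (fun x : X => W (hflow K s x)).
  apply: (cv R (nbhs (0 : R)) (fun s (x : X) => W (hflow K s x))) => x Cx; have [tau tau0 H] := hflow_near_continuous KK (K x + 1).
  have NW : nbhs (hflow K 0 x : X) W by rewrite (hflow0 KK); apply: open_nbhs_nbhs; split=> //; exact: CW.
  have Kx : K x < K x + 1 by rewrite ltrDl.
  have t00 : `|0 : R| < tau by rewrite normr0.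
  have [[A B] /= [NA NB] AB] := H 0 x W t00 Kx NW.
  by exists (B, A) => //= -[x' s] /= [Bx As]; exact: (AB (s, x')).
move=> /nbhs_ballP[e /= e0 H]; exists e => // s x se Cx.
by apply: (H s) => //; rewrite -ball_normE /= sub0r normrN.
Qed.

Lemma occ_inner (t : R) (W : set X) : open W -> inner occ (hflow K t @^-1` W) <= inner occ W.
Proof.
move=> oW; have occT : occ setT = 1 by exact: occ_all.
apply: (inner_le occ_ge0 occU) => // C cC CW.
have cD : compact (hflow K t @` C : set X).
  by apply: continuous_compact => //; apply: continuous_subspaceT; exact: (hflow_continuous KK).
have DW : (hflow K t @` C : set X) `<=` W by move=> _ [x Cx <-]; exact: CW.
have [e e0 He] := tube cD oW DW.
have [r [a [b [rE re]]]] : exists r a b, (r = a%:R * step h b \/ r = - (a%:R * step h b)) /\ `|r - t| < e.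
  have [t0|t0] := lerP 0 t.
    by have [a [b H]] := dyadic_approx h0 t0 e0; exists (a%:R * step h b), a, b; split=> //; left.
  have t0' : 0 <= - t by rewrite oppr_ge0 ltW.
  have [a [b H]] := dyadic_approx h0 t0' e0; exists (- (a%:R * step h b)), a, b; split; first by right.
  by rewrite -normrN opprD !opprK -[t in X in X < _]opprK.
have DrW : hflow K r @` C `<=` W.
  move=> _ [x Cx <-]; have -> : r = t + (r - t) by rewrite addrC subrK.
  by rewrite (hflowD KK); apply: He => //; exists x.
have cDr : compact (hflow K r @` C : set X).
  by apply: continuous_compact => //; apply: continuous_subspaceT; exact: (hflow_continuous KK).
apply: (@le_trans _ _ (occ (hflow K r @` C))); last exact: (inner_ge occ_ge0 occU).
rewrite -(occ_flow (hflow K r @` C) rE); apply: (nu_le occ_ge0 occU) => x Cx; by exists x.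
Qed.

Lemma occ_measure_ex : exists mu : probability (g_sigma_algebraType (@open X)) R,
  (forall W, open W -> (mu W <= (occ W)%:E)%E) /\
  forall t A, mu (hflow K t @^-1` A) = mu A.
Proof.
have occT : occ setT = 1 by exact: occ_all.
have [Z cZ ZE] := compact_energy KK E0.
have occZ : occ Z = 1 by apply: occ_all => N j; apply: ZE; rewrite (hflow_energy KK).
have [mu [muW muI]] := content_measure_ex (@TsMt_hausdorff _ _ _ S) (@TsMt_locally_compact _ _ _ S)
  occ_ge0 occU occT cZ occZ.
exists mu; split=> [W oW|t A]; first by rewrite muW // lee_fin; exact: (inner_nu occ_ge0 occU).
have le t' A' : (mu (hflow K t' @^-1` A') <= mu A')%E.
  by apply: muI; [exact: (hflow_continuous KK)|move=> W; exact: occ_inner].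
apply/eqP; rewrite eq_le le /=; have := le (- t) (hflow K t @^-1` A).
rewrite (_ : hflow K (- t) @^-1` _ = A) //; apply/seteqP.
by split=> x /=; rewrite (hflowKN KK).
Qed.

End OccupationMeasure.

Section Integrals.
Context {d : measure_display} {T : measurableType d} {R : realType}.
Variable mu : probability T R.
Implicit Types f g w : T -> R.

Lemma integral_mono f g : measurable_fun setT f -> measurable_fun setT g -> (forall x, f x <= g x) ->
  (\int[mu]_x (f x)%:E <= \int[mu]_x (g x)%:E)%E.
Proof.
move=> mf mg fg; rewrite [leLHS]integralE [leRHS]integralE.
have mf' : measurable_fun setT (EFin \o f) by exact/measurable_EFinP.
have mg' : measurable_fun setT (EFin \o g) by exact/measurable_EFinP.
apply: leeB; apply: ge0_le_integral => //.
- exact: measurable_funepos.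
- exact: measurable_funepos.
- by move=> x _; rewrite /= !funeposE /= -!EFin_max lee_fin; apply: le_max2.
- exact: measurable_funeneg.
- exact: measurable_funeneg.
- by move=> x _; rewrite /= !funenegE /= -!EFin_max lee_fin; apply: le_max2 => //; rewrite lerN2.
Qed.

Lemma bounded_integrable f b : measurable_fun setT f -> (forall x, `|f x| <= b) ->
  mu.-integrable setT (EFin \o f).
Proof.
move=> mf fb; apply: measurable_bounded_integrable => //; first by rewrite -ge0_fin_numE // fin_num_measure.
by exists b; split; [exact: num_real|move=> M bM x _; exact: le_trans (fb x) (ltW bM)].
Qed.

Lemma drift_bound (phi : T -> T) (A : set T) f w (s c D b : R) : measurable_fun setT phi ->
  (forall B, measurable B -> mu (phi @^-1` B) = mu B) -> measurable A ->
  measurable_fun setT f -> measurable_fun setT w -> (forall x, `|w x| <= b) -> 0 < s ->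
  (forall x, w (phi x) - w x <= s * (f x + c + D * \1_A x)) ->
  ((- c - D * fine (mu A))%:E <= \int[mu]_x (f x)%:E)%E.
Proof.
move=> mphi inv mA mf mw wb s0 H.
have wi := bounded_integrable mw wb.
have mwp : measurable_fun setT (fun x => w (phi x)) by exact: measurableT_comp.
have wpi : mu.-integrable setT (EFin \o (fun x => w (phi x))) by apply: (bounded_integrable mwp) => x.
have mI : measurable_fun setT (\1_A : T -> R) by exact: measurable_indic.
have Ii : mu.-integrable setT (EFin \o (\1_A : T -> R)).
  by apply: (bounded_integrable (b := 1) mI) => x; rewrite indicE; case: (_ \in _); rewrite ?normr0 ?normr1.
have Ew : (\int[mu]_x (w (phi x))%:E = \int[mu]_x (w x)%:E)%E.
  have := @integral_pushforward _ _ T T R phi mphi mu setT (EFin \o w).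
  rewrite preimage_setT => <- //; last by exact/measurable_EFinP.
  by apply: eq_measure_integral => B mB _; exact: inv.
have wf : (\int[mu]_x (w x)%:E)%E \is a fin_num by exact: integrable_fin_num wi.
pose r1 x := s^-1 * (w (phi x) - w x); pose r2 x := c + D * \1_A x.
have m1 : measurable_fun setT r1 by apply: measurable_funM => //; exact: measurable_funB.
have m2 : measurable_fun setT r2 by apply: measurable_funD => //; exact: measurable_funM.
have I0 : mu.-integrable setT (EFin \o (fun x => w (phi x) - w x)).
  by apply: eq_integrable (integrableB measurableT wpi wi) => // x _ /=; rewrite EFinB.
have I1 : mu.-integrable setT (EFin \o r1) by exact: eq_integrable (integrableZl measurableT s^-1 I0).
have I3 : mu.-integrable setT (EFin \o (fun x => D * \1_A x)) by exact: eq_integrable (integrableZl measurableT D Ii).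
have I4 : mu.-integrable setT (EFin \o (fun=> c)) by apply: (bounded_integrable (b := `|c|)) => //.
have J1 : (\int[mu]_x (r1 x)%:E)%E = 0%E.
  rewrite (_ : (fun x => _) = (fun x => s^-1%:E * (EFin \o (fun x => (w (phi x) - w x)%R)) x)%E) //.
  rewrite integralZl //; rewrite (_ : (fun x => _) = (fun x => (w (phi x))%:E - (w x)%:E)%E).
    by rewrite integralB_EFin // Ew subee // mule0.
  by apply/funext => x /=; rewrite EFinB.
have J2 : (\int[mu]_x (r2 x)%:E)%E = (c + D * fine (mu A))%:E.
  rewrite (_ : (fun x => _) = (fun x => (EFin \o (fun=> c)) x + (EFin \o (fun x => (D * \1_A x)%R)) x)%E) //.
  rewrite integralD_EFin //= integral_cst // [X in (_ * X)%E](_ : _ = 1%E); last exact: probability_setT.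
  rewrite mule1.
  rewrite (_ : (fun x => (D * _)%:E) = (fun x => D%:E * (EFin \o (\1_A : T -> R)) x)%E) //.
  by rewrite integralZl // integral_indic // setIT EFinD EFinM fineK // fin_num_measure.
have -> : (- c - D * fine (mu A))%:E = (\int[mu]_x (r1 x - r2 x)%:E)%E.
  rewrite (_ : (fun x => _) = (fun x => (r1 x)%:E - (r2 x)%:E)%E) //.
  rewrite integralB_EFin //; last first.
    by apply: eq_integrable (integrableD measurableT I4 I3) => // x _.
  by rewrite J1 J2 sub0e -EFinN opprD.
apply: integral_mono => //; first exact: measurable_funB.
move=> x; rewrite /r1 /r2 lerBlDr addrA ler_pdivrMl //; exact: H.
Qed.

Lemma layer_bound f (m : nat) (e : R) (a : nat -> R) : 0 < e -> measurable_fun setT f -> (forall x, 0 <= f x) ->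
  mu [set x | (m%:R * e < f x)%R] = 0%E ->
  (forall k : nat, (mu [set x | (k%:R * e < f x)%R] <= (a k)%:E)%E) ->
  (\int[mu]_x (f x)%:E <= (e * \sum_(k < m) a k)%:E)%E.
Proof.
move=> e0 mf f0 fm fa; pose U k := [set x | k%:R * e < f x].
have mU k : measurable (U k).
  have -> : U k = setT `&` f @^-1` `]k%:R * e, +oo[.
    by rewrite setTI; apply/seteqP; split=> x /=; rewrite /U /= in_itv /= andbT.
  exact: mf.
have mI k : measurable_fun setT (EFin \o (\1_(U k) : T -> R)) by exact/measurable_EFinP/measurable_indic.
have mI' : measurable_fun setT (fun x => \sum_(k < m) (EFin \o (\1_(U k) : T -> R)) x)%E by apply: emeasurable_sum.
apply: (@le_trans _ _ (\int[mu]_x (e%:E * \sum_(k < m) (\1_(U k) x)%:E))%E); last first.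
  rewrite ge0_integralZl_EFin //; last 2 first.
  - by move=> x _; apply: sume_ge0 => k _; rewrite lee_fin indicE.
  - exact: ltW.
  rewrite EFinM; apply: lee_wpmul2l; first by rewrite lee_fin ltW.
  rewrite -sumEFin ge0_integral_sum //; last exact: mI.
  by apply: lee_sum => k _; rewrite integral_indic // setIT; exact: fa.
apply: ae_ge0_le_integral => //.
- by move=> x _; rewrite lee_fin.
- exact/measurable_EFinP.
- by move=> x _; rewrite mule_ge0 ?lee_fin ?(ltW e0) //; apply: sume_ge0 => k _; rewrite lee_fin indicE.
- by apply: emeasurable_funM.
exists (U m); split=> // x /= Hx; apply: contrapT => xU; apply: Hx => _.
have xm : f x <= m%:R * e by rewrite leNgt; apply/negP.
rewrite sumEFin -EFinM lee_fin.
suff H (l : nat) : (f x <= l%:R * e) -> f x <= e * \sum_(k < l) \1_(U k) x by exact: H.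
elim: l => [|l IH]; first by rewrite mul0r big_ord0 mulr0.
rewrite big_ord_recr /= mulrDr => fl; have [xl|xl] := lerP (f x) (l%:R * e).
  by apply: le_trans (IH xl) _; rewrite lerDl mulr_ge0 ?indicE // ltW.
have U1 k : (k <= l)%N -> \1_(U k) x = 1 :> R.
  move=> kl; rewrite indicE mem_set //=; apply: le_lt_trans xl; apply: ler_wpM2r; [exact: ltW|by rewrite ler_nat].
rewrite (eq_bigr (fun=> 1)) => [|k _]; last by rewrite U1 // ltnW.
by rewrite U1 // sumr_const card_ord -mulrDr natr1 mulrC.
Qed.

End Integrals.

Section Borel.
Context {R : realType}.

Lemma borel_measurable_fun (X : ptopologicalType) (f : X -> R) : continuous f ->
  measurable_fun setT (f : g_sigma_algebraType (@open X) -> R).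
Proof.
move=> /continuousP cf; apply: (measurability _ (RGenOpens.measurableE R)).
move=> _ [_ [a [b ->] <-]]; rewrite setTI; apply: sub_sigma_algebra.
exact/cf/interval_open.
Qed.

Lemma g_sigma_measurable (X Y : pointedType) (G1 : set (set X)) (G2 : set (set Y)) (f : X -> Y) :
  (forall B, G2 B -> G1 (f @^-1` B)) ->
  measurable_fun setT (f : g_sigma_algebraType G1 -> g_sigma_algebraType G2).
Proof.
move=> fG; apply: (@measurability _ _ (g_sigma_algebraType G1) (g_sigma_algebraType G2) setT f G2 erefl).
move=> _ [B GB <-]; rewrite setTI; apply: sub_sigma_algebra; exact: fG.
Qed.

Lemma continuous_g_sigma (X Y : ptopologicalType) (f : X -> Y) : continuous f ->
  measurable_fun setT (f : g_sigma_algebraType (@open X) -> g_sigma_algebraType (@open Y)).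
Proof. by move=> /continuousP cf; apply: g_sigma_measurable => B oB; exact: cf. Qed.

Lemma staircase_le (e x : R) m : 0 < e -> 0 <= x -> e * \sum_(k < m) ((k%:R * e < x)%R : nat)%:R <= x + e.
Proof.
move=> e0 x0; elim: m => [|m IH]; first by rewrite big_ord0 mulr0 addr_ge0 // ltW.
rewrite big_ord_recr /=; have [xm|mx] := lerP x (m%:R * e); first by rewrite addr0.
apply: (@le_trans _ _ (e * (m%:R + 1))); last by rewrite mulrDr mulr1 lerD2r mulrC ltW.
rewrite ler_pM2l // lerD2r -[m in leRHS]card_ord -sum1_card natr_sum.
by apply: ler_sum => k _; case: (_ < _).
Qed.

End Borel.

Section Action.
Context {R : realType} {n : nat} {M : ptopologicalType} (S : smooth_manifold R n M) (P : patches S).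
Variable K : TsM S -> R.
Hypothesis KT : forall P' : patches S, tonelli_in P' K.
Local Notation X := (TsMt S).
Local Notation BX := (g_sigma_algebraType (@open X)).

Let KK : good_pair P K K. Proof. exact: tonelli_good (KT P). Qed.
Let K2 : TsM_C2 K. Proof. by case: KK. Qed.

Lemma lagr_uniform (E e : R) : 0 < e -> exists2 sg : R, 0 < sg &
  forall z s, K z <= E -> `|s| <= sg -> `|lagr K (hflow K s z) - lagr K z| <= e.
Proof.
move=> e0; have [Z cZ ZE] := compact_energy KK E.
have /compact_near_coveringP cv := cZ; have e2 : 0 < e / 2 by rewrite divr_gt0.
have : \forall s \near (0 : R), Z `<=` (fun z : X => `|lagr K (hflow K s z) - lagr K z| <= e).
  apply: (cv R (nbhs (0 : R)) (fun s (z : X) => `|lagr K (hflow K s z) - lagr K z| <= e)) => z Zz.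
  have [tau tau0 H] := hflow_near_continuous KK (K z + 1).
  pose W := [set w : X | `|lagr K z - lagr K w| < e / 2].
  have NW : nbhs (z : X) W by apply: (near_for (B := ball (lagr K z) (e / 2)) (lagr_continuous K2 (x := z))); exact: nbhsx_ballx.
  have Kz : K z < K z + 1 by rewrite ltrDl.
  have t00 : `|0 : R| < tau by rewrite normr0.
  have NW0 : nbhs (hflow K 0 z : X) W by rewrite (hflow0 KK).
  have [[A B] /= [NA NB] AB] := H 0 z W t00 Kz NW0.
  exists (B `&` W, A); first by split=> //; exact: filterI.
  move=> -[z' s] /= [[Bz' Wz'] As]; have Ws : W (hflow K s z') := AB (s, z') (conj As Bz').
  rewrite distrC (splitr e); apply: le_trans (ler_distD (lagr K z) _ _) _.
  by apply: lerD; apply: ltW => //; rewrite distrC.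
move=> /nbhs_ballP[r /= r0 H]; exists (r / 2) => [|z s zE sr]; first by rewrite divr_gt0.
apply: H (ZE _ zE); rewrite -ball_normE /= sub0r normrN; apply: le_lt_trans sr _.
by rewrite ltr_pdivrMr // ltr_pMr // ltr1n.
Qed.

Lemma lagr_lower (E0 : R) : (forall x, K (zero_cov S x) <= E0) -> forall z, 0 <= lagr K z + E0.
Proof. by move=> KE z; have := lagr_ge (KT P) z; have := KE z.1; lra. Qed.

Lemma ave_lagr (z : nat -> TsM S) (E0 e sg h : R) N : 0 < h -> (0 < N)%N ->
  (forall z s, K z <= E0 -> `|s| <= sg -> `|lagr K (hflow K s z) - lagr K z| <= e) ->
  K (z N) <= E0 -> step h N <= sg ->
  ave K h z N (lagr K) <= hact K (z N) (N%:R * h) / (N%:R * h) + e.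
Proof.
move=> h0 N0 H zE ssg; set s := step h N in ssg *; have s0 : 0 < s by exact: step_gt0.
have C J : s * \sum_(j < J) lagr K (sample K h z N j) <= hact K (z N) (J%:R * s) + J%:R * s * e.
  elim: J => [|J IH]; first by rewrite big_ord0 !mul0r mulr0 (hact0 KK) addr0.
  have [r rs E] : exists2 r : R, `|r| <= `|s| & hact K (sample K h z N J) s - hact K (sample K h z N J) 0 =
      lagr K (hflow K r (sample K h z N J)) * s.
    by apply: (MVT_sym (f' := fun r => lagr K (hflow K r _))) => r _; exact: (is_derive_hact KK).
  have sE : K (sample K h z N J) <= E0 by rewrite (hflow_energy KK).
  rewrite (gtr0_norm s0) in rs; have := H _ r sE (le_trans rs ssg); rewrite ler_norml => /andP[l1 _].
  rewrite big_ord_recr /= -natr1 mulrDl mul1r (hactD KK) -/(sample K h z N J) [s * _]mulrDr.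
  rewrite (hact0 KK) subr0 in E; rewrite E mulrDl.
  have : s * (- e) <= s * (lagr K (hflow K r (sample K h z N J)) - lagr K (sample K h z N J)) by rewrite ler_pM2l.
  move: IH; move: (lagr K (sample K h z N J)) (lagr K (hflow K r (sample K h z N J))) (hact K (z N) (J%:R * s))
    (s * \sum_(j < J) _) => x1 x2 x3 x4; lra.
pose J := (N * 2 ^ N)%N; have := C J.
have N0' : (N%:R : R) != 0 by rewrite pnatr_eq0 -lt0n.
have Js : J%:R * s = N%:R * h.
  by rewrite /J /s /step natrM natrX; have h2 : (2 : R) ^+ N != 0 by [rewrite expf_neq0]; field.
have J0 : 0 < (J%:R : R) by rewrite ltr0n muln_gt0 N0 expn_gt0.
rewrite Js /ave -/J => CJ; have Nh : 0 < N%:R * h by rewrite -Js mulr_gt0.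
rewrite ler_pdivrMr // -(ler_pM2l s0); apply: le_trans CJ _; rewrite -Js.
move: (hact _ _ _) => x2; rewrite le_eqVlt; apply/orP; left; apply/eqP; field; by rewrite !gt_eqF.
Qed.

Lemma minimizing_measure (z : nat -> TsM S) (E0 c B h : R) : 0 < h -> (forall x, K (zero_cov S x) <= E0) ->
  (forall N, K (z N) <= E0) -> (forall N, hact K (z N) (N%:R * h) <= B - c * (N%:R * h)) ->
  exists2 mu : probability BX R, forall t (A : set BX), mu (hflow K t @^-1` A) = mu A &
    (\int[mu]_z (lagr K z)%:E <= (- c)%:E)%E.
Proof.
move=> h0 KE zE zB; have [U [UU Uoo]] := ultraFilterLemma (F := \oo).
have UF : ProperFilter U := ultra_proper.
have [mu [muW muI]] := occ_measure_ex KK h0 zE UU Uoo.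
exists mu => //; pose f z := lagr K z + E0.
have f0 z' : 0 <= f z' by exact: lagr_lower.
have cf : continuous (f : X -> R) by move=> x; apply: continuousD; [exact: lagr_continuous|exact: cst_continuous].
have mf : measurable_fun setT (f : BX -> R) := borel_measurable_fun cf.
have oU (a : R) : open ([set x | a < f x] : set X) by have /continuousP cf' := cf; exact/(cf' [set y | a < y])/open_gt.
have [Z cZ ZE] := compact_energy KK E0.
have [b fb] : exists b, forall z', K z' <= E0 -> f z' <= b.
  have cfZ : compact (f @` Z) by apply: continuous_compact => //; exact: continuous_subspaceT.
  have [b [_ Hb]] := compact_bounded cfZ; exists (b + 1) => z' /ZE Zz'.
  by apply: le_trans (ler_norm _) _; apply: Hb; [rewrite ltrDl|exists z'].
suff int_f (e : R) : 0 < e -> (\int[mu]_z (f z)%:E <= (E0 - c + e)%:E)%E.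
  have fi : mu.-integrable setT (EFin \o (f : BX -> R)).
    apply/integrableP; split; first exact/measurable_EFinP.
    apply: (le_lt_trans _ (ltry (E0 - c + 1))); have -> : (fun x : BX => `|(EFin \o (f : BX -> R)) x|)%E = (fun x => (f x)%:E).
      by apply/funext => x; rewrite /= ger0_norm.
    exact: int_f.
  have cI : mu.-integrable setT (EFin \o (fun=> E0)) by apply: (@bounded_integrable _ _ _ mu (fun=> E0) `|E0|).
  have -> : (\int[mu]_z (lagr K z)%:E = \int[mu]_z ((f z)%:E - E0%:E))%E.
    by apply: eq_integral => x _; rewrite -EFinB addrK.
  rewrite (integralB_EFin measurableT fi cI) integral_cst // [X in (_ * X)%E](_ : _ = 1%E); last exact: probability_setT.
  rewrite mule1.
  apply/lee_addgt0Pr => e e0; rewrite leeBlDr // -!EFinD; apply: le_trans (int_f e e0) _.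
  by rewrite lee_fin; lra.

move=> e0; pose e1 := e / 3; have e10 : 0 < e1 by rewrite divr_gt0.
pose m := (Num.truncn (b / e1)).+1; pose V k := [set x : X | k%:R * e1 < f x].
have bm : b <= m%:R * e1.
  rewrite -ler_pdivrMr //; apply: ltW; have := truncnS_gt (b / e1); by [].
have Vm : occ K h z U (V m) = 0.
  apply: (ulim_near UU Uoo (b := 1)) => [N|]; first exact: freq_norm.
  apply: nearW => N; rewrite /freq /ave big1 ?mul0r // => j _; rewrite indicE memNset //= /V /=.
  apply/negP; rewrite -leNgt; apply: le_trans bm; apply: fb; by rewrite (hflow_energy KK).
apply: le_trans (layer_bound (m := m) (a := fun k => occ K h z U (V k)) e10 mf f0 _ _) _.
- by apply/eqP; rewrite eq_le measure_ge0 andbT; have := muW _ (oU (m%:R * e1)); by rewrite Vm.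
- by move=> k; exact: muW (oU _).
rewrite lee_fin; have cs l : \sum_(k < l) freq K h z (V k) N @[N --> U] --> \sum_(k < l) occ K h z U (V k).
  elim: l => [|l IH]; first by rewrite big_ord0; under eq_fun do rewrite big_ord0; exact: cvg_cst.
  rewrite big_ord_recr /=; under eq_fun do rewrite big_ord_recr /=.
  apply: cvgD IH _; apply: (ulimP UU (b := 1)) => N; exact: freq_norm.
have c1 : e1 * \sum_(k < m) freq K h z (V k) N @[N --> U] --> e1 * \sum_(k < m) occ K h z U (V k).
  by apply: cvgM (cs m); exact: cvg_cst.
apply: (ler_cvg_to c1 (cvg_cst (E0 - c + e))); apply: Uoo.
have [sg sg0 Hsg] := lagr_uniform E0 e10; have eh : 0 < e1 * h by rewrite mulr_gt0.
have N1 : \forall N \near \oo, B / (e1 * h) <= (N%:R : R) by exact: nbhs_infty_ger.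
have N2 : \forall N \near \oo, (0 < N)%N by exact: nbhs_infty_gt.
near=> N; have N0 : (0 < N)%N by near: N.
have sN : step h N <= sg by apply: ltW; near: N; exact: step_cvg.
have BN : B <= N%:R * (e1 * h) by rewrite -ler_pdivrMr //; near: N.
have A1 := ave_lagr h0 N0 Hsg (zE N) sN.
have Nh : 0 < N%:R * h by rewrite mulr_gt0 // ltr0n.
have A2 : hact K (z N) (N%:R * h) / (N%:R * h) <= e1 - c.
  rewrite ler_pdivrMr //; apply: le_trans (zB N) _; rewrite mulrBl lerD2r; by apply: le_trans BN _; rewrite mulrCA.
apply: (@le_trans _ _ (ave K h z N (fun x => lagr K x + (E0 + e1)))); last first.
  rewrite aveD (ave_cst _ _ _ _ N0); have : e = e1 + e1 + e1 by rewrite /e1; lra.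
  by move: A1 A2; move: (ave _ _ _ _ _) (hact _ _ _ / _) => x1 x2; lra.
have -> : e1 * \sum_(k < m) freq K h z (V k) N = ave K h z N (fun x => e1 * \sum_(k < m) ((k%:R * e1 < f x)%R : nat)%:R).
  rewrite /freq /ave -mulr_suml exchange_big mulrA mulr_sumr; congr (_ / _).
  apply: eq_bigr => j _; congr (_ * _); apply: eq_bigr => k _; rewrite indicE; congr (_%:R); congr nat_of_bool.
  by rewrite /V; apply/idP/idP => [/set_mem|H]; [|exact/mem_set].
apply: ave_le => j; apply: le_trans (staircase_le _ e10 (f0 _)) _; by rewrite /f addrA.
Unshelve. all: by end_near.
Qed.

Lemma TsM_proj_flow (u : M -> R) (c E e : R) : 0 < e -> subsol K c u -> exists2 s : R, 0 < s &
  forall z, K z <= E -> u (hflow K s z).1 - u z.1 <= s * (lagr K z + c + e).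
Proof.
move=> e0 [uC uc]; have [s s0 H] := lagr_uniform E e0; exists s => // z zE.
pose v r := pairing (dfn S u (hflow K r z).1) (leg K (hflow K r z)).2.
have [r rs E1] : exists2 r : R, `|r| <= `|s| & u (hflow K s z).1 - u (hflow K 0 z).1 = v r * s.
  apply: (MVT_sym (f := fun r => u (hflow K r z).1)) => r _; rewrite /v dfn.unlock.
  exact: (is_derive_along KK uC (dom_chart_at S (hflow K r z).1)).
rewrite (hflow0 KK) in E1; rewrite E1 mulrC ler_pM2l //.
rewrite (gtr0_norm s0) in rs; have := H z r zE rs; rewrite ler_norml => /andP[_ h1].
have := (lagrangian_sup P KT (w := leg K (hflow K r z)) (dom_chart_at S _)).2 (dfn S u (hflow K r z).1).
rewrite (lagrangian_leg P KT) -/(v r) => h2; have h3 := uc (hflow K r z).1.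
move: h1 h2 h3; rewrite /dgraph /=; move: (lagr K _) (lagr K _) (K _) (v r) => x1 x2 x3 x4; lra.
Qed.

Lemma subsol_bounded (u : M -> R) : compact [set: M] -> continuous u -> exists b, forall x, `|u x| <= b.
Proof.
move=> cM cu; have cuM : compact (u @` setT) by apply: continuous_compact => //; exact: continuous_subspaceT.
have [b [_ Hb]] := compact_bounded cuM; exists (b + 1) => x; apply: (Hb (b + 1)); by [rewrite ltrDl|exists x].
Qed.

Lemma action_lower (nu : probability BX R) (u : M -> R) (c E0 : R) : compact [set: M] ->
  (forall x, K (zero_cov S x) <= E0) -> subsol K c u -> continuous u ->
  (forall t (B : set BX), measurable B -> nu (hflow K t @^-1` B) = nu B) ->
  ((- c)%:E <= \int[nu]_z (lagr K z)%:E)%E.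
Proof.
move=> cM KE uS cu inv; have [b ub] := subsol_bounded cM cu.
have ml : measurable_fun setT (lagr K : BX -> R) by apply: borel_measurable_fun; exact: lagr_continuous.
have mK : measurable_fun setT (K : BX -> R) by apply: borel_measurable_fun; exact: TsM_fun_continuous.
pose A (k : nat) : set BX := [set z | k%:R < K z].
have mA k : measurable (A k).
  have -> : A k = setT `&` K @^-1` `]k%:R, +oo[.
    by rewrite setTI; apply/seteqP; split=> x /=; rewrite /A /= in_itv /= andbT.
  exact: mK.
have A0 : fine (nu (A k)) @[k --> \oo] --> 0.
  have cA : nu (A k) @[k --> \oo] --> nu (\bigcap_k A k).
    apply: nonincreasing_cvg_mu => //; [by rewrite -ge0_fin_numE // fin_num_measure|exact: bigcapT_measurable|].
    by move=> k l kl; apply/subsetPset => z; rewrite /A /=; apply: le_lt_trans; rewrite ler_nat.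
  have E : \bigcap_k A k = set0.
    rewrite -subset0 => z /(_ (Num.truncn (K z)).+1 I); rewrite /A /= ltNge ltW //; exact: truncnS_gt.
  by rewrite E measure0 in cA; exact: (fine_cvg cA).
suff H (e : R) k : 0 < e -> ((- (c + e) - (`|E0| + `|c|) * fine (nu (A k)))%:E <= \int[nu]_z (lagr K z)%:E)%E.
  case: (\int[nu]_z _)%E H => [l||] H; rewrite ?leey //; last by have := H 1 0%N ltr01; rewrite leeNy_eq.
  rewrite lee_fin; apply/ler_addgt0Pr => e e0.
  have c1 : (- (c + e) - (`|E0| + `|c|) * fine (nu (A k))) @[k --> \oo] --> - (c + e) - (`|E0| + `|c|) * 0.
    by apply: cvgB; [exact: cvg_cst|apply: cvgM A0; exact: cvg_cst].
  have : - (c + e) - (`|E0| + `|c|) * 0 <= l.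
    by apply: (ler_cvg_to c1 (cvg_cst l)); apply: nearW => k; rewrite -lee_fin; exact: H.
  by rewrite mulr0; lra.
move=> e0; have [s s0 Hs] := TsM_proj_flow k%:R e0 uS.
pose w (z : BX) : R := u z.1 * \1_(~` A k) z.
have cuf : continuous ((fun z => u z.1) : X -> R).
  by move=> z; exact: (comp_for (@TsM_proj_continuous _ _ _ S z) (cu z.1)).
have mu := borel_measurable_fun cuf.
have wb z : `|w z| <= b.
  by rewrite /w normrM indicE; case: (_ \in _); rewrite ?normr1 ?normr0 ?mulr1 ?mulr0 //; exact: le_trans (ub z.1).
apply: (@drift_bound _ BX _ nu (hflow K s : BX -> BX) (A k) (lagr K : BX -> R) w s (c + e) (`|E0| + `|c|) b) => //.
- exact: continuous_g_sigma (hflow_continuous KK (t := s)).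
- by move=> B; exact: inv.
- by apply: measurable_funM => //; apply: measurable_indic; exact: measurableC.
move=> z; rewrite /w !indicE !in_setC.
have Af : (hflow K s z \in A k) = (z \in A k) by apply/idP/idP => /set_mem h; apply/mem_set; move: h; rewrite /A /= (hflow_energy KK).
rewrite Af; case: (boolP (z \in A k)) => zA /=.
  rewrite !mulr0 subrr mulr1 pmulr_rge0 //; have := lagr_lower KE z; have := ler_norm E0; have := ler_norm (- c).
  by rewrite normrN; move: (lagr K z) (`|E0|) (`|c|) e0 => x1 x2 x3; lra.
rewrite !mulr1 mulr0 addr0 addrA; apply: Hs; rewrite leNgt; apply/negP => h; move/negP: zA; apply; exact/mem_set.
Qed.

End Action.

Lemma pushforward_ex (d d' : measure_display) (T : measurableType d) (T' : measurableType d') (R : realType)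
    (mu : probability T R) (f : T -> T') : measurable_fun setT f ->
  exists2 nu : probability T' R, forall A, nu A = mu (f @^-1` A) &
    forall g : T' -> R, measurable_fun setT g -> (\int[nu]_y (g y)%:E = \int[mu]_x (g (f x))%:E)%E.
Proof.
move=> mf; pose X : {mfun T >-> T'} := mfun_Sub (mem_set mf).
have XE : X = f :> (T -> T') by [].
exists (distribution mu X) => [A|g mg]; first by rewrite /distribution /pushforward XE.
have mg' : measurable_fun setT (EFin \o g) by exact/measurable_EFinP.
rewrite [LHS]integralE [RHS]integralE; congr (_ - _)%E.
  rewrite (@ge0_integral_distribution _ _ _ _ _ mu X (EFin \o g)^\+%E).
  - by apply: eq_integral => x _; rewrite /= !funeposE.
  - exact: measurable_funepos.
  - exact: funepos_ge0.
rewrite (@ge0_integral_distribution _ _ _ _ _ mu X (EFin \o g)^\-%E).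
- by apply: eq_integral => x _; rewrite /= !funenegE.
- exact: measurable_funeneg.
- exact: funeneg_ge0.
Qed.

Section MatherAlpha.
Context {R : realType} {n : nat} {M : ptopologicalType} (S : smooth_manifold R n M).
Local Notation V := 'rV[R]_n.

Lemma zero_closed : closed_form S (fun=> 0).
Proof.
have E i : form_loc (S := S) (fun=> 0) i = (fun=> 0) by apply/funext => y; rewrite /form_loc mul0mx.
move=> i; split=> [k|y _ v w]; rewrite E; first exact: Ck_cst.
have D : 'd (fun _ : V => 0 : V) y = 0 :> (V -> V) by exact: diff_cst.
by rewrite !D !pairing0l.
Qed.

Lemma tonelli_in_patches (H : TsM S -> R) P : tonelli H -> tonelli_in P H.
Proof.
move=> HT; have := @tonelli_in_shifted _ _ _ S P H _ HT zero_closed.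
by congr (tonelli_in P _); apply/funext => -[x p]; rewrite /shifted /cshift /= add0r.
Qed.

Lemma zero_cov_bound P (K : TsM S -> R) : tonelli_in P K -> exists E0, forall x, K (zero_cov S x) <= E0.
Proof.
move=> KT; have [B _ HB] := tloc_bound KT 0; exists B => x; have [d [dx xr]] := pcover1 P x.
rewrite -(@tloc_coord _ _ _ _ K (idx d) (zero_cov S x) dx) zero_cov_coord; apply: le_trans (ler_norm _) _; apply: HB.
split=> /=; last by rewrite normr0.
by apply: le_trans xr _; rewrite mul1r ler_peMl ?(ltW (rad_gt0 d)) // (ler_nat R 1 4).
Qed.

Variable P : patches S.
Variables (H : TsM S -> R) (eta : M -> V).
Hypothesis HT : tonelli H.
Hypothesis etaC : closed_form S eta.
Local Notation K := (shifted eta H).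
Local Notation L := (lagrangian H).
Local Notation ca := (chart_at S).

Let HTP P' : tonelli_in P' H. Proof. exact: tonelli_in_patches. Qed.
Let KT P' : tonelli_in P' K. Proof. exact: tonelli_in_shifted. Qed.
Let HH : good_pair P H H. Proof. exact: tonelli_good (HTP P). Qed.
Let KK : good_pair P K K. Proof. exact: tonelli_good (KT P). Qed.
Let H2 : TsM_C2 H. Proof. by case: HT. Qed.

Lemma ham_at_shifted (zeta : R -> TsM S) (t : R) : ham_at K zeta t -> ham_at H (fun s => cshift eta (zeta s)) t.
Proof.
move=> [ct dz]; split=> // i di; have {}dz := dz i di.
have cz : cod i (coord i (zeta t)).1 by exact: cod_chart.
have N := near_curve_dom ct di; set w := coord i (zeta t) in dz cz.
have /is_derive_pairP[d1 d2] := dz.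
have d : is_derive t 1 (fun s => shift_loc eta i (coord i (zeta s)))
    (gradQ (tloc K i) w, dr (form_loc eta i) w.1 (gradQ (tloc K i) w) + - gradY (tloc K i) w).
  apply/is_derive_pairP; split=> //=; apply: is_deriveD d2.
  exact: (is_derive_dr (form_diff etaC cz) d1).
apply: near_eq_is_derive (is_derive_eq d _); first by apply: filterS N => s ds; rewrite shift_coord.
rewrite [coord i (cshift _ _)]shift_coord // -/w /hfield /ham_field gradQ_shifted //; congr pair; apply: pairing_ext => e.
by rewrite pairingDl !pairingNl gradY_shifted // closed_sym // pairingC; ring.
Qed.

Lemma leg_shifted z : leg K z = leg H (cshift eta z).
Proof.
by rewrite /leg shift_coord ?gradQ_shifted //; [exact/cod_chart/dom_chart_at|exact: dom_chart_at].
Qed.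

Lemma lagrangian_shifted w : lagrangian K w = L w - pairing (eta w.1) w.2.
Proof.
rewrite -(legK P KT w); set z := legi K w; rewrite (lagrangian_leg P KT) leg_shifted (lagrangian_leg P HTP).
have dz := dom_chart_at S z.1.
have cz : cod (ca z.1) (coord (ca z.1) z).1 by exact: cod_chart.
rewrite /lagr /ham_lagr [(cshift eta z).1]/= shift_coord // gradQ_shifted // tloc_shifted //.
rewrite /= pairingDl shift_coord //.
have -> : form_loc eta (ca z.1) (coord (ca z.1) z).1 = eta z.1.
  by rewrite /form_loc /= chartK // JacE trans_id // trmx1 mulmx1.
by ring.
Qed.

Definition elflow (t : R) (w : TM S) : TM S := leg K (hflow K t (legi K w)).

Lemma elflow_EL : EL_flow L elflow.
Proof.
move=> w; split; first by rewrite /elflow (hflow0 KK) (legK P KT).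
rewrite /elflow; under eq_fun do rewrite leg_shifted.
by apply: (ham_EL P HTP) => t; apply: ham_at_shifted; exact: (hflow_ham KK).
Qed.

Lemma EL_flow_unique Phi t w : EL_flow L Phi -> Phi t w = elflow t w.
Proof.
move=> /(_ w)[P0 PE]; pose z := legi K w.
have tt : `|t| < `|t| + 1 by rewrite ltrDl.
have := hflowP HH (T := `|t| + 1) (zeta := fun s => legi H (Phi s w)) (fun s _ => EL_ham P HTP PE s) tt.
have := hflowP HH (T := `|t| + 1) (zeta := fun s => cshift eta (hflow K s z))
  (fun s _ => ham_at_shifted (hflow_ham KK z s)) tt.
rewrite (hflow0 KK) P0.
have -> : cshift eta z = legi H w by apply: (leg_inj P HTP); rewrite -leg_shifted (legK P HTP) (legK P KT).
by move=> -> E; rewrite /elflow leg_shifted E (legK P HTP).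
Qed.

Local Notation X := (TsMt S).
Local Notation BX := (g_sigma_algebraType (@open X)).

Lemma leg_measurable : measurable_fun setT (leg K : BX -> borelTM S).
Proof.
by apply: g_sigma_measurable => W oW; have /continuousP cl := @leg_continuous _ _ _ S P K KT; exact: (cl W oW).
Qed.

Lemma legi_measurable : measurable_fun setT (legi K : borelTM S -> BX).
Proof.
by apply: g_sigma_measurable => W oW; have /continuousP cl := @legi_continuous _ _ _ S P K KT; exact: (cl W oW).
Qed.

Lemma lagr_legi w : lagr K (legi K w) = L w - pairing (eta w.1) w.2.
Proof. by rewrite -lagrangian_shifted -[in RHS](legK P KT w) (lagrangian_leg P KT). Qed.

Lemma mather_alphaE (c : R) (mu : probability BX R) u : compact [set: M] -> subsol K c u ->
  (forall t (A : set BX), mu (hflow K t @^-1` A) = mu A) ->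
  (\int[mu]_z (lagr K z)%:E <= (- c)%:E)%E -> mather_alpha H eta = c.
Proof.
move=> cM uS muI mu_c; have [E0 KE] := zero_cov_bound (KT P).
have uC : C11_fun S u by case: uS.
have cu : continuous u.
  move=> x; have dx := dom_chart_at S x.
  apply: (near_eq_continuous (f := fun x' => (u \o param (ca x)) (chart (ca x) x'))).
    by apply: filterS (near_dom dx) => x' dx' /=; rewrite chartK.
  apply: (comp_for (chart_continuous dx)); apply: differentiable_continuous.
  by apply: (C11_diff uC); exact: cod_chart.
have lower nu : EL_invariant L nu -> ((- c)%:E <= action L eta nu)%E.
  move=> [Phi PL PI]; have [nu' nu'E nuI] := pushforward_ex nu legi_measurable.
  have ml : measurable_fun setT (lagr K : BX -> R) by apply: borel_measurable_fun; apply: lagr_continuous; case: KK.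
  have := action_lower P KT (nu := nu') cM KE uS cu; rewrite nuI //.
  rewrite (_ : (\int[nu]_x _)%E = action L eta nu); last by apply: eq_integral => w _; rewrite lagr_legi.
  apply => t B mB; rewrite !nu'E -(PI t (legi K @^-1` B)); last first.
    by rewrite -[X in measurable X]setTI; exact: legi_measurable.
  congr (nu _); apply/seteqP.
  by split=> w /=; rewrite (EL_flow_unique _ _ PL) /elflow (legiK P KT).
have [nu nuE nuI] := pushforward_ex mu leg_measurable.
have nu_EL : EL_invariant L nu.
  exists elflow; first exact: elflow_EL.
  move=> t B mB; rewrite !nuE -[RHS](muI t); congr (mu _); apply/seteqP.
  by split=> z /=; rewrite /elflow (legiK P KT).
have nu_c : action L eta nu = (- c)%:E.
  apply/eqP; rewrite eq_le lower // andbT; apply: le_trans mu_c.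
  have mg : measurable_fun setT (fun w : borelTM S => L w - pairing (eta w.1) w.2).
    have ml : measurable_fun setT (lagr K : BX -> R) by apply: borel_measurable_fun; apply: lagr_continuous; case: KK.
    rewrite (_ : (fun w => _) = (fun w => lagr K (legi K w))); last by apply/funext => w; rewrite lagr_legi.
    exact: (measurableT_comp ml legi_measurable).
  rewrite /action nuI //; rewrite le_eqVlt; apply/orP; left; apply/eqP.
  by apply: eq_integral => z _; rewrite -lagrangian_shifted (lagrangian_leg P KT).
rewrite /mather_alpha; set Q := [set a | _]; have : Q (get Q).
  by apply: getPex; exists c; exists nu => //; split=> // nu' nu'EL; rewrite nu_c; exact: lower.
move=> [mu' mu'I [mu'a mu'min]]; have h1 := lower _ mu'I; have := mu'min _ nu_EL.
by rewrite nu_c; move: h1; rewrite mu'a !lee_fin; lra.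
Qed.

End MatherAlpha.

Theorem proposition2p7 (R : realType) (n : nat) (M : ptopologicalType)
    (S : smooth_manifold R n M)
    (M_compact : compact [set: M])
    (M_connected : connected [set: M])
    (H F1 F2 : TsM S -> R)
    (H_tonelli : tonelli H)
    (F1_C2 : TsM_C2 F1) (F1_int : integral_of_motion H F1)
    (F2_C2 : TsM_C2 F2) (F2_int : integral_of_motion H F2)
    (c : H1 S) (eta : M -> 'rV[R]_n) (eta_c : H1_class c eta) :
  set_bij (aubry H eta) (proj_aubry H eta) (@TsM_proj R n M S) /\
  forall x : M, closure (interior (proj_aubry H eta)) x ->
    proj_aubry H eta x /\
    poisson F1 F2
      ('pinv_(fun y => (y, 0)) (aubry H eta) (@TsM_proj R n M S) x) = 0.
Proof.
have etaC : closed_form S eta by case: (H1_classP c) => eta0 _ cE; move: eta_c; rewrite cE => -[].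
have [P] := patches_ex S M_compact.
apply: aubry_poisson => //; set K := shifted eta H.
have KT P' : tonelli_in P' K by exact: tonelli_in_shifted.
have KP := KT P; have [E0 KE] := zero_cov_bound KP.
have [_ _ _ /(_ E0)[b Hb]] := tonelli_good KP.
pose k0 := n%:R * `|b|; have k00 : 0 <= k0 by rewrite mulr_ge0.
have qE d y (q : 'rV[R]_n) : `|y - ctr d| <= 4 * rad d -> tloc K (idx (p := P) d) (y, q) <= E0 -> n%:R * `|q| <= k0.
  by move=> yr yE; apply: ler_wpM2l => //; apply: le_trans (Hb _ _ _ yr yE) (ler_norm _).
have KE' x : reversed K (zero_cov S x) <= E0 by rewrite /reversed /= oppr0; exact: KE.
have [E1 mK] := mach_ex KP k00 KE; have [E2 mK'] := mach_ex (reversed_tonelli KP) k00 KE'.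
have m1 : E1 <= Num.max E1 E2 by rewrite le_max lexx.
have m2 : E2 <= Num.max E1 E2 by rewrite le_max lexx orbT.
have [b1 [C1 [k1 [tau1 [D1 mc]]]]] := mK _ m1; have [b2 [C2 [k2 [tau2 [D2 mc']]]]] := mK' _ m2.
have [a [B [B0 aE FB]]] := critical_ex M_connected KP mc qE.
have h0 := h_gt0 mc.
have [v [vL vd [rho [Q [rho0 Q0 vQ]]]]] := critical_sub KP mc qE aE FB.
have [u /C11_sub_fun uS] := regularize KP mc mc' h0 vL vd rho0 Q0 vQ.
have /choice[x xP] (N : nat) : exists x : M, hact K (zero_cov S x) (N%:R * (tau1 / 2)) <= B - a * (N%:R * (tau1 / 2)).
  have [x [_ xF]] := F_hact KP mc qE N point; exists x; rewrite -xF.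
  by have := FB N point; rewrite ler_norml => /andP[_]; lra.
have [mu muI mu_a] := minimizing_measure P KT h0 KE (fun N => KE (x N)) xP.
exists u; apply/critical_subsol; rewrite (mather_alphaE P H_tonelli etaC M_compact uS muI mu_a).
by split; case: uS.
Qed.
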